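(* Let $(W,S)$ be an irreducible Fuchsian Coxeter system, $(\Delta,\delta)$ a thick regular Fuchsian building of type $(W,S)$ with base chamber $o$, and $(X_n)_{n\ge0}$ an irreducible isotropic random walk on $\Delta$ with $X_0=o$, bounded range, and $p(x,y)>0$ whenever $\delta(x,y)\in S$. Let $\overline X_n=\delta(o,X_n)$ be the retracted walk on $W$, let $\overline\pi_n$ be the distribution of $\overline X_n$, and let $h_G=\frac{H(\mathbf Y)}{\mathbb E_\nu[\mathbf e_2-\mathbf e_1]}$, where $\mathbf e_k$, $\nu$ and $H(\mathbf Y)$ are as defined in the context. Then the asymptotic entropy $$\overline h=\lim_{n\to\infty}-\frac1n\mathbb E[\log\overline\pi_n(\overline X_n)]$$ exists and equals $h_G$. In particular, $\overline h$ is the rate of escape of the retracted walk with respect to the Green distance, i.e. $\overline h=\lim_{n\to\infty}\frac1n\ell_G(\overline X_n)$ almost surely, where $\ell_G(w)=-\log\frac{\overline G(e,w)}{\overline G(e,e)}$.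
   Context: Fuchsian Coxeter system: $S=\{s_1,\dots,s_N\}$, $N\ge3$, with integers $k_1,\dots,k_N\ge2$, $\sum_i 1/k_i<N-2$, such that $W$ is generated by $S$ subject to $s_i^2=e$ and $(s_is_{i+1})^{k_i}=e$ (indices cyclic), with no relation between other pairs. $\ell$ is word length, $d(u,v)=\ell(u^{-1}v)$, $\mathcal B_n(u)=\{v\mid d(u,v)\le n\}$. Building: a nonempty set $\Delta$ with $\delta:\Delta\times\Delta\to W$ such that: (B1) $\delta(x,y)=e$ iff $x=y$; (B2) if $\delta(x,y)=w$, $\delta(y,z)=s\in S$, then $\delta(x,z)\in\{w,ws\}$, and $\delta(x,z)=ws$ if $\ell(ws)=\ell(w)+1$; (B3) if $\delta(x,y)=w$, $s\in S$, there is $z$ with $\delta(y,z)=s$, $\delta(x,z)=ws$. Regular: $q_s=|\{y\mid\delta(x,y)=s\}|$ is finite and independent of $x$; thick: $q_s\ge2$ for all $s\in S$. Walks: isotropic means that $p(x,y)$ depends only on $\delta(x,y)$. Bounded range: $L_0$ is the minimal integer such that $p(x,y)>0$ implies $\ell(\delta(x,y))\le L_0$. $\overline X_n$ is a Markov chain on $W$ started at $e$ with $\overline p(u,v)=\sum_{y:\delta(o,y)=v}p(x,y)$ for any $x$ with $\delta(o,x)=u$; $\overline G(u,v)=\sum_{n\ge0}\overline p^{(n)}(u,v)$. Automatic structure and cones: a strongly automatic structure for $(W,S)$ is a finite directed graph $\mathfrak A$ with distinguished vertex $s_*$ and edge labels in $S$ such that no edge ends at $s_*$, every other vertex is reachable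 from $s_*$, the label word of every finite path from $s_*$ is a geodesic (reduced) word in $W$, and mapping a path from $s_*$ to the product of its labels is a bijection from finite paths starting at $s_*$ onto $W$. Let $\gamma_w$ be the path representing $w$. The cone $C(w)$ is the set of $u\in W$ such that $\gamma_w$ is a prefix of $\gamma_u$; the cone type $T(w)$ is the end vertex of $\gamma_w$, identified with the set $w^{-1}C(w)$, which depends only on this vertex. A cone type is recurrent if there is a nontrivial directed path in $\mathfrak A$ from it to itself; $\mathfrak A_R$ is the set of recurrent cone types. Fix such an $\mathfrak A$ (in the paper: obtained from the automaton of cone types of $(W,S)$ by a lexicographic choice), with the properties that any recurrent type can be reached from any other inside $\mathfrak A_R$, and that there is $K\in\mathbb N$ such that all elements of $W\setminus\mathcal B_K(e)$ have recurrent cone type. For $A\subseteq W$ and $L\geq 1$: $\partial_LA=\{u\in A\mid\exists v\in W\setminus A: d(u,v)\le L\}$ and $\mathrm{Int}_LA=A\setminus\partial_LA$. Constant $L_1$: let $\delta_{hyp}$ be a constant such that geodesic triangles in the Cayley graph of $(W,S)$ are $\delta_{hyp}$-thin, and let $\mathrm{div}:\mathbb N_0\to\mathbb R$ be an exponential divergence function: if $\gamma_1,\gamma_2$ are geodesics starting at $u$, $R+r$ is at most both their lengths and $d(\gamma_1(R),\gamma_2(R))\ge\mathrm{div}(0)$, then every path from $\gamma_1(R+r)$ to $\gamma_2(R+r)$ visiting only vertices outside $\mathcal B_{R+r}(u)$ has length at least $\mathrm{div}(r)$. Put $L_1=\max\{\mathrm{div}(0),L_0,\delta_{hyp}\}+1$.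 Coverings: for each $\mathbf T\in\mathfrak A_R$ fix a set $\mathrm{Cov}(\mathbf T)=\{u_1,u_2,\dots\}\subset W$ such that for all $w$ with $T(w)=\mathbf T$: $wu_i\in\mathrm{Int}_{3L_1}C(w)$; $C(wu_i)\subseteq\mathrm{Int}_{L_1}C(w)$; the cones $C(wu_i)$ are pairwise disjoint; $\{T(wu_i)\mid i\ge1\}=\mathfrak A_R$; $C(w)\setminus\bigcup_iC(wu_i)\subset\partial_{3L_1}C(w)\cup\mathcal B_L(w)$ for some constant $L=L(\mathbf T)$; $|\mathrm{Cov}(\mathbf T)\cap\mathcal B_n(e)|$ grows linearly in $n$. Put $\mathrm{Cov}(w)=w\,\mathrm{Cov}(T(w))$, $\mathrm{Cov}_0=\bigcup_{w\in\mathcal B_{K+1}(e)\setminus\mathcal B_K(e)}\mathrm{Cov}(w)$, $\mathrm{Cov}_{n+1}=\bigcup_{w\in\mathrm{Cov}_n}\mathrm{Cov}(w)$. Last entry times: for $k\ge0$, $\mathbf e_k=\inf\{m\mid\exists w\in\mathrm{Cov}_k:\overline X_m\in\mathrm{Int}_{3L_1}C(w),\ \forall n\ge m:\overline X_n\in\mathrm{Int}_{L_1}C(w)\}$ (almost surely finite), and $\mathcal R_k$ is the $w\in\mathrm{Cov}_k$ with $\overline X_{\mathbf e_k}\in C(w)$. For $k\ge1$ let $\mathbf W_k=(T(\mathcal R_k),\mathcal R_{k-1}^{-1}\mathcal R_k,\mathcal R_k^{-1}\overline X_{\mathbf e_k})$. On the set of its attainable values, $(\mathbf W_k)_{k\ge1}$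 is an irreducible positive recurrent time-homogeneous Markov chain; $\nu$ is its stationary probability measure. $\mathbb E_\nu$ is expectation when the law of $\mathbf W_1$ is replaced by $\nu$, i.e. $\mathbb E_\nu[\mathbf e_2-\mathbf e_1]=\sum_{\mathfrak w}\nu(\mathfrak w)\,\mathbb E[\mathbf e_{k+1}-\mathbf e_k\mid\mathbf W_k=\mathfrak w]$ with any $k\ge1$ such that $\mathbb P[\mathbf W_k=\mathfrak w]>0$ (the conditional expectation does not depend on $k$). Entropy $H(\mathbf Y)$: $\mathbf Y_0=\mathcal R_0$ and $\mathbf Y_k=(T(\mathcal R_{k-1}),T(\mathcal R_k),\mathcal R_{k-1}^{-1}\mathcal R_k)$ for $k\ge1$. $H(\mathbf Y)\in[0,\infty]$ is the constant such that $-\frac1n\log\mathbb P[\mathbf Y_0=\mathfrak y_0,\dots,\mathbf Y_n=\mathfrak y_n]\to H(\mathbf Y)$ for almost every realisation $(\mathfrak y_0,\mathfrak y_1,\dots)$ of the process (it exists by the Shannon–McMillan–Breiman theorem). *)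

(* Defs.v *)
From HB Require Import structures.
From mathcomp Require Import all_boot all_order all_algebra all_fingroup finmap.
From mathcomp Require Import all_classical all_reals all_analysis.
Set Implicit Arguments.
Unset Strict Implicit.
Unset Printing Implicit Defensive.
Import Order.TTheory GRing.Theory Num.Theory.
Import numFieldNormedType.Exports.

Local Open Scope classical_set_scope.
Local Open Scope card_scope.
Local Open Scope ring_scope.

(** * Fuchsian Coxeter systems *)

Definition fuchsian_relations (N : nat) (k : 'I_N -> nat) (G : groupType)
    (f : 'I_N -> G) : Prop :=
  (forall i, f i * f i = 1)%g /\
  (forall i, (f i * f (ordS i)) ^+ k i = 1)%g.

Section CoxeterSystem.
Context {N : nat} {W : groupType}.
Variable s : 'I_N -> W.

Definition wprod (l : seq 'I_N) : W := foldr (fun i w => s i * w)%g 1%g l.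

(* [W] is presented by the generators [s i] and the Fuchsian relations: the
   generators satisfy the relations, generate [W] (their inverses are not
   needed, being involutions), and [W] is universal with these properties. *)
Definition fuchsian_coxeter_system (k : 'I_N -> nat) : Prop :=
  [/\ (3 <= N)%N,
      (forall i, (2 <= k i)%N),
      \sum_(i < N) ((k i)%:R)^-1 < N%:R - 2 :> rat,
      fuchsian_relations k s &
      (forall w : W, exists l : seq 'I_N, wprod l = w) /\
      (forall (G : groupType) (f : 'I_N -> G), fuchsian_relations k f ->
         exists phi : {multiplicative W -> G}, forall i, phi (s i) = f i)].

(* [S] is not the union of two nonempty disjoint subsets commuting with each
   other. *)
Definition coxeter_irreducible : Prop :=
  forall A : pred 'I_N, (exists i, A i) -> (exists j, ~~ A j) ->
    exists i j, [/\ A i, ~~ A j & (s i * s j <> s j * s i)%g].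

Definition len (w : W) : nat :=
  xget 0%N [set n | (exists2 l, size l = n & wprod l = w) /\
                    (forall l, wprod l = w -> (n <= size l)%N)].

Definition dist (u v : W) : nat := len (u^-1 * v)%g.

Definition ball (n : nat) (u : W) : set W := [set v | (dist u v <= n)%N].

Definition reduced (l : seq 'I_N) : Prop := len (wprod l) = size l.

(* The path of the Cayley graph starting at [u] with label word [l] visits
   [path_at u l 0 = u, ..., path_at u l (size l)]; it is a geodesic iff [l] is
   reduced. *)
Definition path_at (u : W) (l : seq 'I_N) (j : nat) : W :=
  (u * wprod (take j l))%g.

Section RealScale.
Context {R : realType}.

(* The radius is real because [L_1] is built from real constants. *)
Definition bdry (L : R) (A : set W) : set W :=
  [set u | A u /\ exists2 v, ~ A v & (dist u v)%:R <= L].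

Definition intr (L : R) (A : set W) : set W := A `\` bdry L A.

(* Triangles with vertices in [W], sides [la : a -> b], [lb : b -> c] and
   [lc : c -> a].  It suffices to treat the side [la]: the other ones are
   obtained by rotating the triangle. *)
Definition thin_triangles (dhyp : R) : Prop :=
  forall (a : W) (la lb lc : seq 'I_N),
    reduced la -> reduced lb -> reduced lc ->
    (wprod la * wprod lb * wprod lc = 1)%g ->
    let b := (a * wprod la)%g in
    let c := (b * wprod lb)%g in
    forall i, (i <= size la)%N ->
      (exists2 j, (j <= size lb)%N &
         (dist (path_at a la i) (path_at b lb j))%:R <= dhyp) \/
      (exists2 j, (j <= size lc)%N &
         (dist (path_at a la i) (path_at c lc j))%:R <= dhyp).

(* The end points of a path joining two points of the sphere of radius
   [m + r] are in the closed ball; "outside the ball" is about the other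
   vertices of the path. *)
Definition divergence_function (div : nat -> R) : Prop :=
  forall (u : W) (l1 l2 : seq 'I_N) (m r : nat),
    reduced l1 -> reduced l2 ->
    (m + r <= size l1)%N -> (m + r <= size l2)%N ->
    div 0%N <= (dist (path_at u l1 m) (path_at u l2 m))%:R ->
    forall l : seq 'I_N,
      (path_at u l1 (m + r) * wprod l = path_at u l2 (m + r))%g ->
      (forall j, (0 < j < size l)%N ->
         ~ ball (m + r) u (path_at (path_at u l1 (m + r)) l j)) ->
      div r <= (size l)%:R.

Definition exponential_growth (div : nat -> R) : Prop :=
  exists a b : R, [/\ 0 < a, 1 < b &
    exists r0 : nat, forall r, (r0 <= r)%N -> a * b ^+ r <= div r].

Definition exponential_divergence (div : nat -> R) : Prop :=
  divergence_function div /\ exponential_growth div.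

Definition L1_const (div0 : R) (L0 : nat) (dhyp : R) : R :=
  Num.max div0 (Num.max L0%:R dhyp) + 1.

End RealScale.
End CoxeterSystem.

(** * Buildings *)

Section Building.
Context {N : nat} {W : groupType} {Delta : choiceType}.
Variables (s : 'I_N -> W) (delta : Delta -> Delta -> W).

Record is_building : Prop := IsBuilding {
  building_B1 : forall x y, delta x y = 1%g <-> x = y;
  building_B2 : forall x y z i, delta y z = s i ->
    (delta x z = delta x y \/ delta x z = delta x y * s i)%g /\
    (len s (delta x y * s i)%g = (len s (delta x y)).+1 ->
     delta x z = delta x y * s i)%g;
  building_B3 : forall x y i, exists z,
    delta y z = s i /\ (delta x z = delta x y * s i)%g }.

Definition is_regular (q : 'I_N -> nat) : Prop :=
  forall x i, [set y | delta x y = s i] #= `I_(q i).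

Definition thick (q : 'I_N -> nat) : Prop := forall i, (2 <= q i)%N.

End Building.

(** * Markov chains on discrete state spaces *)

Section MarkovChains.
Context {R : realType} {T : choiceType}.

Fixpoint nstep (q : T -> T -> \bar R) (n : nat) (x y : T) : \bar R :=
  if n is m.+1 then (\esum_(z in [set: T]) (q x z * nstep q m z y))%E
  else if x == y then 1%E else 0%E.

Definition green (q : T -> T -> \bar R) (x y : T) : \bar R :=
  (\sum_(0 <= n <oo) nstep q n x y)%E.

Definition is_stochastic (p : T -> T -> R) : Prop :=
  (forall x y, 0 <= p x y) /\
  (forall x, (\esum_(y in [set: T]) (p x y)%:E = 1)%E).

Definition is_irreducible (p : T -> T -> R) : Prop :=
  forall x y, exists n, (0 < nstep (fun a b => (p a b)%:E) n x y)%E.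

(* [X] is a Markov chain with transition matrix [p] started at [o]. *)
Definition is_markov_chain {d : measure_display} {Om : measurableType d}
    (P : probability Om R) (X : nat -> Om -> T) (p : T -> T -> R) (o : T)
    : Prop :=
  (forall n x, measurable [set om | X n om = x]) /\
  (forall (n : nat) (x : nat -> T),
     P [set om | forall i, (i <= n)%N -> X i om = x i] =
     (if x 0%N == o then \prod_(i < n) p (x i) (x i.+1) else 0)%:E).

End MarkovChains.

(** * Isotropic walks on a building and their retractions *)

Section Retraction.
Context {R : realType} {N : nat} {W : groupType} {Delta : choiceType}.
Variables (s : 'I_N -> W) (delta : Delta -> Delta -> W).
Variables (o : Delta) (p : Delta -> Delta -> R).

Definition isotropic : Prop :=
  forall x y x' y', delta x y = delta x' y' -> p x y = p x' y'.

Definition range_bound (L : nat) : Prop :=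
  forall x y, 0 < p x y -> (len s (delta x y) <= L)%N.

Definition is_range (L0 : nat) : Prop :=
  range_bound L0 /\ forall L, range_bound L -> (L0 <= L)%N.

(* The value does not depend on the chosen chamber at distance [u] of [o]. *)
Definition pbar (u v : W) : \bar R :=
  (\esum_(y in [set y | delta o y = v])
     (p (xget o [set x | delta o x = u]) y)%:E)%E.

(* Both Green functions are finite and positive for a transient irreducible
   walk, so that [fine] is harmless. *)
Definition ellG (w : W) : R :=
  - ln (fine (green pbar 1%g w) / fine (green pbar 1%g 1%g)).

Definition Xbar {Om : Type} (X : nat -> Om -> Delta) (n : nat) (om : Om) : W :=
  delta o (X n om).

Definition pibar {d : measure_display} {Om : measurableType d}
    (P : probability Om R) (X : nat -> Om -> Delta) (n : nat) (w : W) : R :=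
  fine (P [set om | Xbar X n om = w]).

End Retraction.

(** * Strongly automatic structures and cones *)

Section Automaton.
Context {N : nat} {W : groupType} {V : finType}.
Variables (s : 'I_N -> W) (star : V) (edge : V -> 'I_N -> V -> bool).

(* A path is given by its starting vertex and the sequence of the labels and
   the end vertices of its edges. *)
Fixpoint is_path (v : V) (g : seq ('I_N * V)) : bool :=
  if g is (i, v') :: g' then edge v i v' && is_path v' g' else true.

Definition labels (g : seq ('I_N * V)) : seq 'I_N := map fst g.

Definition endpoint (v : V) (g : seq ('I_N * V)) : V := last v (map snd g).

Record strongly_automatic : Prop := StronglyAutomatic {
  aut_star : forall v i, ~~ edge v i star;
  aut_reach : forall v, v != star ->
    exists2 g, is_path star g & endpoint star g = v;
  aut_geodesic : forall g, is_path star g -> reduced s (labels g);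
  aut_bij : forall w, exists! g, is_path star g /\ wprod s (labels g) = w }.

Definition gamma (w : W) : seq ('I_N * V) :=
  xget [::] [set g | is_path star g /\ wprod s (labels g) = w].

Definition cone (w : W) : set W := [set u | prefix (gamma w) (gamma u)].

Definition ctype (w : W) : V := endpoint star (gamma w).

Definition recurrent (t : V) : Prop :=
  exists g, [/\ g != [::], is_path t g & endpoint t g = t].

Definition recurrent_connected : Prop :=
  forall t t', recurrent t -> recurrent t' ->
    exists g, [/\ is_path t g, endpoint t g = t' &
                  forall v, v \in map snd g -> recurrent v].

Definition recurrent_outside (K : nat) : Prop :=
  forall w, ~ ball s K 1%g w -> recurrent (ctype w).

Definition linear_growth {R : realType} (f : nat -> nat) : Prop :=
  exists a b : R, [/\ 0 < a, 0 < b & exists n0 : nat,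
    forall n, (n0 <= n)%N -> a * n%:R <= (f n)%:R <= b * n%:R].

Record is_covering {R : realType} (L1 : R) (t : V) (C : set W) : Prop :=
  IsCovering {
  cov_int : forall w u, ctype w = t -> C u ->
    intr s (3 * L1) (cone w) (w * u)%g;
  cov_cone : forall w u, ctype w = t -> C u ->
    cone (w * u)%g `<=` intr s L1 (cone w);
  cov_disj : forall w u u', ctype w = t -> C u -> C u' -> u <> u' ->
    cone (w * u)%g `&` cone (w * u')%g = set0;
  cov_types : forall w, ctype w = t ->
    [set ctype (w * u)%g | u in C] = [set t' | recurrent t'];
  cov_rest : exists L : nat, forall w, ctype w = t ->
    cone w `\` \bigcup_(u in C) cone (w * u)%g `<=`
    bdry s (3 * L1) (cone w) `|` ball s L w;
  cov_growth :
    linear_growth (R := R) (fun n => #|` fset_set (C `&` ball s n 1%g)|%fset) }.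

Section Coverings.
Variables (K : nat) (Cov : V -> set W).

Definition cov_at (w : W) : set W := [set (w * u)%g | u in Cov (ctype w)].

Fixpoint covn (n : nat) : set W :=
  if n is m.+1 then \bigcup_(w in covn m) cov_at w
  else \bigcup_(w in ball s K.+1 1%g `\` ball s K 1%g) cov_at w.

End Coverings.
End Automaton.

(** * Last entry times *)

Section LastEntry.
Context {R : realType} {N : nat} {W : groupType} {V : finType}.
Variables (s : 'I_N -> W) (star : V) (edge : V -> 'I_N -> V -> bool).
Variables (L1 : R) (K : nat) (Cov : V -> set W).
Context {d : measure_display} {Om : measurableType d}.
Variables (P : probability Om R) (Xb : nat -> Om -> W).

Local Notation cone := (cone s star edge).
Local Notation ctype := (ctype s star edge).
Local Notation covn := (covn s star edge K Cov).

Definition entered (k : nat) (om : Om) : set nat :=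
  [set m | exists w, [/\ covn k w, intr s (3 * L1) (cone w) (Xb m om) &
    forall n, (m <= n)%N -> intr s L1 (cone w) (Xb n om)]].

(* The infimum of [entered k om], and 0 on the null event where this set is
   empty. *)
Definition etime (k : nat) (om : Om) : nat :=
  xget 0%N [set m | entered k om m /\
                    forall m', entered k om m' -> (m <= m')%N].

Definition Rpos (k : nat) (om : Om) : W :=
  xget 1%g [set w | covn k w /\ cone w (Xb (etime k om) om)].

(* [Wproc k] is only meaningful for [1 <= k]. *)
Definition Wproc (k : nat) (om : Om) : V * W * W :=
  (ctype (Rpos k om),
   ((Rpos k.-1 om)^-1 * Rpos k om)%g,
   ((Rpos k om)^-1 * Xb (etime k om) om)%g).

Definition attained_at (x : V * W * W) (k : nat) : Prop :=
  (1 <= k)%N /\ (0 < P [set om | Wproc k om = x])%E.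

Definition attainable (x : V * W * W) : Prop := exists k, attained_at x k.

(* Some time at which [x] is attained; conditional laws given [Wproc k = x]
   do not depend on the choice of this time. *)
Definition attain_time (x : V * W * W) : nat := xget 1%N (attained_at x).

Definition Wtrans (x y : V * W * W) : \bar R :=
  let k := attain_time x in
  (P [set om | Wproc k om = x /\ Wproc k.+1 om = y] /
   P [set om | Wproc k om = x])%E.

Record is_stationary_probability (nu : V * W * W -> R) : Prop :=
  IsStationaryProbability {
  stat_ge0 : forall x, 0 <= nu x;
  stat_supp : forall x, ~ attainable x -> nu x = 0;
  stat_mass : (\esum_(x in attainable) (nu x)%:E = 1)%E;
  stat_inv : forall y, attainable y ->
    (\esum_(x in attainable) ((nu x)%:E * Wtrans x y) = (nu y)%:E)%E }.

(* E[e_(k+1) - e_k | W_k = x] *)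
Definition mean_increment (x : V * W * W) : \bar R :=
  let k := attain_time x in
  ((\int[P]_(om in [set om | Wproc k om = x])
      ((etime k.+1 om)%:R - (etime k om)%:R)%:E) /
   P [set om | Wproc k om = x])%E.

Definition Enu_increment (nu : V * W * W -> R) : \bar R :=
  (\esum_(x in attainable) ((nu x)%:E * mean_increment x))%E.

Definition Yproc (k : nat) (om : Om) : W + (V * V * W) :=
  if k is j.+1 then
    inr (ctype (Rpos j om), ctype (Rpos j.+1 om),
         ((Rpos j om)^-1 * Rpos j.+1 om)%g)
  else inl (Rpos 0 om).

Definition Ycylinder (n : nat) (om : Om) : set Om :=
  [set om' | forall j, (j <= n)%N -> Yproc j om' = Yproc j om].

Definition is_entropy_Y (H : \bar R) : Prop :=
  {ae P, forall om,
    (fun n : nat => (- ln (fine (P (Ycylinder n om))) / n%:R)%:E) @ \oo --> H}.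

End LastEntry.

(* Main.v *)
Require Import Defs.
From HB Require Import structures.
From mathcomp Require Import all_boot all_order all_algebra all_fingroup finmap.
From mathcomp Require Import all_classical all_reals all_analysis.
From mathcomp Require Import measurable_realfun ring lra zify.
Set Implicit Arguments.
Unset Strict Implicit.
Unset Printing Implicit Defensive.
Import Order.TTheory GRing.Theory Num.Theory.
Import numFieldNormedType.Exports.

Local Open Scope classical_set_scope.
Local Open Scope ring_scope.

(* The step operator of the retracted walk is an average of projections along
   galleries, reversible for the sphere sizes [m] of the building.  Thickness makes
   [m] at least double along ascents, so that a Hardy inequality along the
   geodesics of the automaton gives a spectral gap; hence the Green function is
   finite, and the walk has a uniformly positive probability of staying forever
   in a cone once it is deep inside.  The trajectory after a last entry time,
   conditioned to stay in the cone, depends only on the cone type and on the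
   relative position, so that the visits of the cones to a fixed state are
   renewal times and the strong law of large numbers gives
   [e_k / k --> kappa], which is the expected increment under the stationary
   law.

   Up to factors that are subexponential along the process, the probability of
   [R_k = r] is the Green function [G(e, r)], so that [- ln G(e, R_k) / k -> H],
   and interpolation between last entry times gives
   [- ln G(e, X_n) / n -> H / kappa].  Finally the entropy of [X_n] is at least
   the mean of [- ln G(e, X_n)], because [p_n(e, x) <= G(e, x)], and exceeds it
   by at most the logarithm of the mass of [G] on a ball of radius [O(n)] (Gibbs'
   inequality), which is [O(n)] because of the spectral gap. *)

(** * Length and ascents *)

(** Symmetry with respect to [m] is used letter by letter: a product of letters need not be
    symmetric. Hence the energy compares two functions [f] and [g], and the norm of the step
    operator is read off by pairing [walk_op g] with a multiple of itself. Only the one-letter words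
    contribute to the loss in a step.

    Last entry times look at the whole future and are not stopping times. The way out is that, on
    one almost sure event, prescribing the path up to [e_k] and the cone entered there amounts to a
    condition on the past together with never leaving the interior of that cone; the second
    condition looks the same in all cones of one type. Cycles between renewals have finite mean
    because a regeneration occurs within a bounded delay, with probability at least [c], whatever
    the past: a linear number of regenerations leaves no room for long cycles.

    A Green function at the single point [R_k] carries the entropy of the whole process [Y] up to
    [k] because covering cones are nested, so that [R_k] determines its predecessors. Elements of
    arbitrary length are needed throughout; that [W] is infinite comes from its reflection
    representation. *)

Section Length.
Context {N : nat} {W : groupType} (s : 'I_N -> W).

Lemma wprod_cat (a b : seq 'I_N) : wprod s (a ++ b) = (wprod s a * wprod s b)%g.
Proof. by elim: a => [|i a IH] /=; rewrite ?mul1g // IH mulgA. Qed.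

Lemma wprod1 i : wprod s [:: i] = s i.
Proof. by rewrite /= mulg1. Qed.

Lemma wprod_rcons a i : wprod s (rcons a i) = (wprod s a * s i)%g.
Proof. by rewrite -cats1 wprod_cat wprod1. Qed.

(** What the metric arguments retain of the Coxeter relations. [gen_parity] is the trace of the sign
    homomorphism: it excludes edges inside a sphere of the Cayley graph, so that every edge is an
    ascent or a descent. *)
Class involutive_generators : Prop := InvolutiveGenerators {
  gen_inv : forall i, (s i * s i = 1)%g;
  gen_all : forall w : W, exists l : seq 'I_N, wprod s l = w;
  gen_parity : forall w i, len s (w * s i)%g <> len s w }.

Context {G : involutive_generators}.

Local Notation len := (len s).
Local Notation dist := (dist s).

Lemma gen_par (w : W) i : len (w * s i)%g <> len w.
Proof. exact: gen_parity. Qed.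

Lemma gen_invV i : ((s i)^-1 = s i)%g.
Proof. by apply: mulg1_eq; apply: gen_inv. Qed.

Lemma wprod_rev a : wprod s (rev a) = ((wprod s a)^-1)%g.
Proof.
elim: a => [|i a IH] /=; first by rewrite invg1.
by rewrite rev_cons wprod_rcons IH invgM gen_invV.
Qed.

Lemma len_spec w : (exists2 l, size l = len w & wprod s l = w) /\
  (forall l, wprod s l = w -> (len w <= size l)%N).
Proof.
rewrite /Defs.len; case: xgetP => [n -> //|].
have [l lw] := gen_all w.
have ex : exists n, `[< exists2 l, size l = n & wprod s l = w >].
  by exists (size l); apply/asboolP; exists l.
case: (ex_minnP ex) => n /asboolP nw nmin /(_ n) []; split=> // l' l'w.
by apply: nmin; apply/asboolP; exists l'.
Qed.

Lemma lenP w : exists2 l, size l = len w & wprod s l = w.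
Proof. by have [] := len_spec w. Qed.

Lemma len_wprod l : (len (wprod s l) <= size l)%N.
Proof. by have [_ ->] := len_spec (wprod s l). Qed.

Lemma len1 : len 1%g = 0%N.
Proof. by apply/eqP; rewrite -leqn0; apply: (len_wprod [::]). Qed.

Lemma len0_eq1 w : len w = 0%N -> w = 1%g.
Proof. by have [l <- <-] := lenP w; move=> /size0nil ->. Qed.

Lemma lenV w : len w^-1%g = len w.
Proof.
have le u : (len u^-1%g <= len u)%N.
  by have [l <- {1}<-] := lenP u; rewrite -wprod_rev -(size_rev l) len_wprod.
by apply/eqP; rewrite eqn_leq le -{1}(invgK w) le.
Qed.

Lemma lenM u v : (len (u * v)%g <= len u + len v)%N.
Proof.
have [a <- {1}<-] := lenP u; have [b <- {1}<-] := lenP v.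
by rewrite -wprod_cat -size_cat len_wprod.
Qed.

Lemma len_gen_le i : (len (s i) <= 1)%N.
Proof. by rewrite -wprod1 len_wprod. Qed.

Lemma len_gen i : len (s i) = 1%N.
Proof.
have := @gen_par 1%g i; rewrite mul1g len1.
by have := len_gen_le i; lia.
Qed.

Lemma mulgss w i : (w * s i * s i)%g = w.
Proof. by rewrite -mulgA gen_inv mulg1. Qed.

Lemma lenMs_le w i : (len (w * s i)%g <= (len w).+1)%N.
Proof. by rewrite -addn1 (leq_trans (lenM _ _)) // leq_add2l len_gen_le. Qed.

Lemma lenMs w i : len (w * s i)%g = (len w).+1 \/ len w = (len (w * s i)%g).+1.
Proof.
have h1 := lenMs_le w i; have h2 := lenMs_le (w * s i)%g i.
rewrite mulgss in h2; have := @gen_par w i; lia.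
Qed.

Definition ascent w i := (len w < len (w * s i)%g)%N.

Lemma ascentE w i : ascent w i -> len (w * s i)%g = (len w).+1.
Proof. by rewrite /ascent; case: (lenMs w i) => ->; lia. Qed.

Lemma descentE w i : ~~ ascent w i -> len w = (len (w * s i)%g).+1.
Proof. by rewrite /ascent; case: (lenMs w i) => ->; lia. Qed.

Lemma ascent_s w i : ascent (w * s i)%g i = ~~ ascent w i.
Proof. by rewrite /ascent mulgss; case: (lenMs w i) => ->; lia. Qed.

Lemma reduced_cat a b : reduced s (a ++ b) -> reduced s a /\ reduced s b.
Proof.
rewrite /reduced wprod_cat size_cat => h.
have := lenM (wprod s a) (wprod s b); have := len_wprod a; have := len_wprod b.
by rewrite h; lia.
Qed.

Lemma reduced_rev a : reduced s a -> reduced s (rev a).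
Proof. by rewrite /reduced wprod_rev lenV size_rev. Qed.

Lemma reducedP w : exists2 l, reduced s l & wprod s l = w.
Proof. by have [l sl lw] := lenP w; exists l; rewrite // /reduced lw. Qed.

Lemma distxx u : dist u u = 0%N.
Proof. by rewrite /Defs.dist mulVg len1. Qed.

Lemma distC u v : dist u v = dist v u.
Proof. by rewrite /Defs.dist -lenV invgM invgK. Qed.

Lemma dist_triangle v u w : (dist u w <= dist u v + dist v w)%N.
Proof.
by rewrite /Defs.dist (leq_trans _ (lenM _ _)) // mulgA mulgK.
Qed.

Lemma distM w u v : dist (w * u)%g (w * v)%g = dist u v.
Proof. by rewrite /Defs.dist invgM -mulgA mulKg. Qed.

Lemma dist1 u : dist 1%g u = len u.
Proof. by rewrite /Defs.dist invg1 mul1g. Qed.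

Lemma distMr u w : dist u (u * w)%g = len w.
Proof. by rewrite /Defs.dist mulKg. Qed.

Lemma dist0_eq u v : dist u v = 0%N -> u = v.
Proof. by move=> /len0_eq1 /mulg1_eq; rewrite invgK. Qed.

Lemma dist_gen u i : dist u (u * s i)%g = 1%N.
Proof. by rewrite distMr len_gen. Qed.

Fixpoint words (n : nat) : seq (seq 'I_N) :=
  if n is m.+1 then [::] :: [seq i :: l | i <- enum 'I_N, l <- words m] else [:: [::]].

Lemma size_words n : (size (words n) <= N.+1 ^ n)%N.
Proof.
elim: n => //= n IH; rewrite size_allpairs size_enum_ord expnS mulSn.
have : (0 < N.+1 ^ n)%N by rewrite expn_gt0.
by have := leq_mul (leqnn N) IH; lia.
Qed.

Lemma mem_words n l : (l \in words n) = (size l <= n)%N.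
Proof.
elim: n l => [|n IH] [|i l] //=; rewrite in_cons /=.
apply/allpairsP/idP => [[[j l'] /= [_ ]]|sl]; first by rewrite IH => h [_ ->].
by exists (i, l); rewrite /= IH mem_enum.
Qed.

(** Balls are duplicate-free lists, so that sums over them are finite big operators and union bounds
    have at most [N.+1 ^ n] terms. *)
Definition bseq (n : nat) : seq W := undup (map (wprod s) (words n)).

Lemma mem_bseq n w : (w \in bseq n) = (len w <= n)%N.
Proof.
rewrite mem_undup; apply/mapP/idP => [[l]|h].
  by rewrite mem_words => h ->; apply: leq_trans h; apply: len_wprod.
by have [l sl <-] := lenP w; exists l; rewrite // mem_words sl.
Qed.

Lemma bseq_uniq n : uniq (bseq n).
Proof. exact: undup_uniq. Qed.

Lemma size_bseq n : (size (bseq n) <= N.+1 ^ n)%N.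
Proof. by rewrite (leq_trans (size_undup _)) // size_map size_words. Qed.

Definition bseq_at (u : W) n : seq W := [seq (u * w)%g | w <- bseq n].

Lemma mem_bseq_at u n w : (w \in bseq_at u n) = (dist u w <= n)%N.
Proof.
apply/mapP/idP => [[v]|h]; first by rewrite mem_bseq => h ->; rewrite distMr.
by exists (u^-1 * w)%g; rewrite ?mem_bseq // mulVKg.
Qed.

Lemma bseq_at_uniq u n : uniq (bseq_at u n).
Proof. by rewrite map_inj_uniq ?bseq_uniq //; apply: mulgI. Qed.

Lemma size_bseq_at u n : (size (bseq_at u n) <= N.+1 ^ n)%N.
Proof. by rewrite size_map size_bseq. Qed.

Lemma countable_W : countable [set: W].
Proof.
apply: (@sub_countable _ _ _ (range (wprod s))); last first.
  exact: (card_le_trans (card_image_le _ _) (countableP _)).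
apply: subset_card_le => w _; have [l lw] := gen_all w; by exists l.
Qed.

(** Stands for a geodesic through [z]: the equation holds iff some geodesic from [a] to [b] contains
    [z], and no label word has to be carried along. *)
Definition btw (a z b : W) : Prop := (dist a z + dist z b = dist a b)%N.

Lemma btw_sym a z b : btw a z b -> btw b z a.
Proof. by rewrite /btw (distC b z) (distC z a) (distC b a) addnC. Qed.

Lemma btw_path_at u l j : reduced s l -> btw u (path_at s u l j) (u * wprod s l)%g.
Proof.
move=> rl; rewrite /btw /path_at distM !distMr.
have [] := @reduced_cat (take j l) (drop j l); rewrite ?cat_take_drop // => ra rb.
have -> : wprod s l = (wprod s (take j l) * wprod s (drop j l))%g.
  by rewrite -wprod_cat cat_take_drop.
by rewrite distMr -wprod_cat cat_take_drop ra rb rl -size_cat cat_take_drop.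
Qed.

End Length.

Existing Class strongly_automatic.

Section Interior.
Context {R : realType} {N : nat} {W : groupType} (s : 'I_N -> W).
Context {G : involutive_generators s}.

Lemma intrP (L : R) (A : set W) u :
  Defs.intr s L A u <-> A u /\ forall v, (dist s u v)%:R <= L -> A v.
Proof.
split=> [[Au nb]|[Au h]].
  split=> // v uv; apply: contrapT => Av; apply: nb; split=> //; by exists v.
by split=> // -[_ [v Av uv]]; apply: Av; apply: h.
Qed.

Lemma intr_sub (L : R) (A : set W) : Defs.intr s L A `<=` A.
Proof. by move=> u []. Qed.

Lemma intr_mono (L : R) (A B : set W) : A `<=` B -> Defs.intr s L A `<=` Defs.intr s L B.
Proof.
by move=> AB u /intrP[Au h]; apply/intrP; split=> [|v uv]; apply: AB => //; apply: h.
Qed.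

End Interior.

(** * Cones of the automatic structure *)

Section Cones.
Context {N : nat} {W : groupType} (s : 'I_N -> W) {G : involutive_generators s}.
Context {V : finType} (star : V) (edge : V -> 'I_N -> V -> bool).
Context {A : strongly_automatic s star edge}.

Local Notation len := (len s).
Local Notation dist := (dist s).
Local Notation gamma := (gamma s star edge).
Local Notation cone := (cone s star edge).
Local Notation ctype := (ctype s star edge).
Local Notation wlab g := (wprod s (labels g)).

Lemma is_path_cat v (a b : seq ('I_N * V)) :
  is_path edge v (a ++ b) = is_path edge v a && is_path edge (endpoint v a) b.
Proof.
rewrite /endpoint; elim: a v => [|[i w] a IH] v //=.
by rewrite IH /= andbA.
Qed.

Lemma endpoint_cat v (a b : seq ('I_N * V)) :
  endpoint v (a ++ b) = endpoint (endpoint v a) b.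
Proof. by rewrite /endpoint map_cat last_cat. Qed.

Lemma wlab_cat (a b : seq ('I_N * V)) : wlab (a ++ b) = (wlab a * wlab b)%g.
Proof. by rewrite /labels map_cat wprod_cat. Qed.

Lemma gammaP w : is_path edge star (gamma w) /\ wlab (gamma w) = w.
Proof.
rewrite /Defs.gamma; case: xgetP => [g _ []//|].
by have [g [gw _]] := aut_bij A w => /(_ g).
Qed.

Lemma gammaK w : wlab (gamma w) = w.
Proof. by have [] := gammaP w. Qed.

Lemma gamma_wlab g : is_path edge star g -> gamma (wlab g) = g.
Proof.
move=> pg; have [h [_ hu]] := aut_bij A (wlab g).
by have h1 := hu _ (gammaP (wlab g)); rewrite -h1; apply: hu.
Qed.

Lemma reduced_gamma w : reduced s (labels (gamma w)).
Proof. by apply: (aut_geodesic A); have [] := gammaP w. Qed.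

Lemma size_gamma w : size (gamma w) = len w.
Proof. by have := reduced_gamma w; rewrite /reduced gammaK size_map. Qed.

Lemma gamma_ext w g : is_path edge (ctype w) g -> gamma (w * wlab g)%g = gamma w ++ g.
Proof.
move=> pg; rewrite -{1}(gammaK w) -wlab_cat gamma_wlab // is_path_cat pg andbT.
by have [] := gammaP w.
Qed.

Lemma coneP w u : cone w u <->
  exists g, [/\ is_path edge (ctype w) g, u = (w * wlab g)%g & gamma u = gamma w ++ g].
Proof.
split=> [/prefixP[g gu]|[g [_ _ gu]]]; last by rewrite /Defs.cone /= gu prefix_prefix.
have [pu uE] := gammaP u; exists g; split=> //.
  by move: pu; rewrite gu is_path_cat => /andP[].
by rewrite -{1}uE gu wlab_cat gammaK.
Qed.

Lemma cone_ext w g : is_path edge (ctype w) g -> cone w (w * wlab g)%g.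
Proof. by move=> pg; apply/coneP; exists g; split=> //; apply: gamma_ext. Qed.

Lemma ctype_ext w g : is_path edge (ctype w) g ->
  ctype (w * wlab g)%g = endpoint (ctype w) g.
Proof. by move=> pg; rewrite /Defs.ctype gamma_ext // endpoint_cat. Qed.

Lemma cone_refl w : cone w w.
Proof. exact: prefix_refl. Qed.

Lemma cone_trans v u w : cone u v -> cone v w -> cone u w.
Proof. exact: prefix_trans. Qed.

Lemma cone_dist w u : cone w u -> len u = (len w + dist w u)%N.
Proof.
move=> /coneP[g [_ uE gu]].
have := reduced_gamma u; rewrite gu /labels map_cat => /reduced_cat[_].
rewrite /reduced -[map fst g]/(labels g) => rg.
by rewrite -!size_gamma gu size_cat uE distMr rg size_map.
Qed.

Lemma cone_len w u : cone w u -> (len w <= len u)%N.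
Proof. by move=> /cone_dist ->; apply: leq_addr. Qed.

Lemma cone_len_eq w u : cone w u -> (len u <= len w)%N -> u = w.
Proof.
move=> wu; have := cone_dist wu => -> h; apply: esym.
by apply: (@dist0_eq _ _ s); lia.
Qed.

(** An element of the cone is the end of a path prolonging [gamma w], and the possible prolongations
    depend only on the end vertex of [gamma w], that is, on the type. *)
Lemma cone_ctype w w' u : ctype w = ctype w' -> cone w (w * u)%g ->
  cone w' (w' * u)%g /\ ctype (w * u)%g = ctype (w' * u)%g.
Proof.
move=> ww' /coneP[g [pg /mulgI uE _]]; have pg' := pg; rewrite ww' in pg'.
by rewrite uE; split; [apply: cone_ext|rewrite !ctype_ext // ww'].
Qed.

(** Both [gamma w] and [gamma w'] are prefixes of the same path, so the shorter is a prefix of the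
    longer; two cones are therefore nested or disjoint. *)
Lemma cone_linear w w' u : cone w u -> cone w' u -> (len w <= len w')%N -> cone w w'.
Proof.
rewrite -!size_gamma /Defs.cone /= !prefixE => /eqP wu /eqP w'u h.
by rewrite -w'u take_takel // wu.
Qed.

Lemma cone_between w w' u : cone w u -> cone w' u -> ~ cone w w' -> cone w' w.
Proof.
move=> wu wu' h; case: (leqP (len w) (len w')) => [/(cone_linear wu wu')//|/ltnW].
exact: cone_linear wu' wu.
Qed.

Definition anc (n : nat) (u : W) : W := wlab (take n (gamma u)).

Lemma gamma_anc n u : gamma (anc n u) = take n (gamma u).
Proof.
rewrite gamma_wlab //; have [+ _] := gammaP u.
by rewrite -{1}(cat_take_drop n (gamma u)) is_path_cat => /andP[].
Qed.

Lemma cone_anc n u : cone (anc n u) u.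
Proof. by rewrite /Defs.cone /= gamma_anc; apply/prefixP; exists (drop n (gamma u)); rewrite cat_take_drop. Qed.

Lemma len_anc n u : (n <= len u)%N -> len (anc n u) = n.
Proof. by move=> h; rewrite -size_gamma gamma_anc size_takel // size_gamma. Qed.

Lemma len_btw_cone w u : cone w u -> btw s 1%g w u.
Proof. by move=> wu; rewrite /btw !dist1 -cone_dist. Qed.

Section Thin.
Context {R : realType} (dhyp : R).
Hypothesis thin : thin_triangles s dhyp.

(** The third side keeps its word [lc], so that it can be chosen as the automaton's own geodesic,
    whose points are ancestors; the other sides are only known through the points between their
    ends. *)
Lemma thin_word a z b c lc : btw s a z b -> reduced s lc ->
  wprod s lc = (c^-1 * a)%g ->
  (exists z', btw s b z' c /\ (dist z z')%:R <= dhyp) \/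
  (exists2 j, (j <= size lc)%N & (dist z (path_at s c lc j))%:R <= dhyp).
Proof.
move=> abz rlc lcE.
have [l1 r1 l1E] := reducedP (s:=s) (a^-1 * z)%g.
have [l2 r2 l2E] := reducedP (s:=s) (z^-1 * b)%g.
have [lb rb lbE] := reducedP (s:=s) (b^-1 * c)%g.
have e12 : wprod s (l1 ++ l2) = (a^-1 * b)%g.
  by rewrite wprod_cat l1E l2E mulgA -(mulgA _ z) mulgV mulg1.
have r12 : reduced s (l1 ++ l2).
  rewrite /reduced e12 size_cat; move: r1 r2; rewrite /reduced l1E l2E => <- <-.
  by move: abz; rewrite /btw /Defs.dist => ->.
have aE : (a * wprod s (l1 ++ l2))%g = b by rewrite e12 mulVKg.
have := @thin a (l1 ++ l2) lb lc r12 rb rlc; rewrite aE.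
have bE : (b * wprod s lb)%g = c by rewrite lbE mulVKg.
rewrite e12 lbE lcE => h; have {h} := h.
have -> : (a^-1 * b * (b^-1 * c) * (c^-1 * a) = 1)%g.
  by rewrite !mulgA mulgK mulgK mulVg.
move=> /(_ erefl (size l1)); rewrite size_cat leq_addr => /(_ isT).
have -> : path_at s a (l1 ++ l2) (size l1) = z.
  by rewrite /path_at take_size_cat // l1E mulVKg.
case=> [[j jl dj]|[j jl dj]]; [left|right]; last by exists j; rewrite // -(mulVKg b c).
exists (path_at s b lb j); split=> //.
have h := btw_path_at b j rb; rewrite bE in h; exact: h.
Qed.

Lemma thin_btw a z b c : btw s a z b ->
  exists z', (dist z z')%:R <= dhyp /\ (btw s b z' c \/ btw s c z' a).
Proof.
move=> abz; have [lc rlc lcE] := reducedP (s:=s) (c^-1 * a)%g.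
have [[z' [bz zz]]|[j jl zz]] := thin_word abz rlc lcE.
  by exists z'; split=> //; left.
exists (path_at s c lc j); split=> //; right.
have -> : a = (c * wprod s lc)%g by rewrite lcE mulVKg.
exact: btw_path_at.
Qed.

(** Thinness is applied to the triangle with corners the identity, [x] and [p], at the point [v1] of
    the first side. If the nearby point were on the automaton geodesic of [p], it would lie in
    [cone w1] and be an ancestor of [p], so that [p] would lie in [cone w1] too; hence it is on the
    side from [x] to [p]. *)
Lemma cone_separation v1 w1 x p : cone v1 x ->
  (forall y, (dist v1 y)%:R <= dhyp -> cone w1 y) -> ~ cone w1 p ->
  exists2 z, btw s x z p & (dist v1 z)%:R <= dhyp.
Proof.
move=> v1x w1b w1p.
have [|||[z [xz vz]]|[j jl]] := @thin_word 1%g v1 x p (rev (labels (gamma p))).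
- exact: len_btw_cone.
- by apply: reduced_rev; apply: reduced_gamma.
- by rewrite wprod_rev gammaK mulg1.
- by exists z.
(* Read backwards from [p], the [j]-th point is the prefix of length [size l - j], hence an ancestor
   of [p]. *)
set l := labels _ in jl *; rewrite /path_at take_rev wprod_rev.
set k := (size l - j)%N => /w1b w1k; case: w1p; apply: cone_trans w1k _.
have -> : (p * (wprod s (drop k l))^-1 = anc k p)%g.
  have {1}-> : p = (wprod s (take k l) * wprod s (drop k l))%g.
    by rewrite -wprod_cat cat_take_drop gammaK.
  by rewrite mulgK /anc /labels map_take.
exact: cone_anc.
Qed.

(** If some [v] within [L] of a point [y] of [cone x] were outside [cone r], a geodesic from [y] to
    [v] would pass within [dhyp] of [x]; then [v] would be within [dhyp + L], at most [3 * L], of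
    [x], against the depth of [x]. *)
Lemma cone_interior (L : R) r x : dhyp <= L -> Defs.intr s (3 * L) (cone r) x ->
  cone x `<=` Defs.intr s L (cone r).
Proof.
move=> dL /intrP[rx rxb] y xy.
have L0 : 0 <= L.
  apply: le_trans dL.
  have [z [h _]] := @thin_btw 1%g 1%g 1%g 1%g (ltac:(by rewrite /btw !distxx)).
  exact: le_trans h.
have rxd u : (dist x u)%:R <= dhyp -> cone r u.
  by move=> h; apply: rxb; lra.
apply/intrP; split; first exact: cone_trans xy.
move=> v yv; apply: contrapT => rv.
have [z yzv xz] := @cone_separation x r y v xy rxd rv.
apply: rv; apply: rxb.
have : (dist x v <= dist x z + dist z v)%N by apply: dist_triangle.
have : (dist z v <= dist y v)%N by rewrite -yzv leq_addl.
rewrite -!(ler_nat R) natrD; lra.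
Qed.

(** Use the triangles with corners [p j], [p j.+1] and [p l]: each moves the nearby point by at most
    [dhyp], either to the geodesic for the next index or to the short side between [p j] and
    [p j.+1], where the search stops. The loss is linear in the number of steps, which geometric
    decay of return probabilities can afford if the chain is sampled rarely enough. *)
Lemma geodesic_chain (p : nat -> W) (b : W) (B l : nat) (D : R) j0 :
  (forall j, (dist (p j) (p j.+1) <= B)%N) -> (j0 <= l)%N ->
  (exists2 z, btw s (p j0) z (p l) & (dist b z)%:R <= D) -> 0 <= dhyp ->
  exists2 j, (j0 <= j <= l)%N &
    (dist b (p j))%:R <= D + (j - j0)%:R * dhyp + dhyp + B%:R.
Proof.
move=> pB + + d0; move kE : (l - j0)%N => k; elim: k j0 D kE => [|k IH] j0 D kE j0l [z pz bz].
  have ? : j0 = l by lia.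
  subst l; exists j0; first by rewrite leqnn.
  have ? : z = p j0.
    apply: esym; apply: (@dist0_eq _ _ s).
    by move: pz; rewrite /btw distxx; lia.
  by subst z; rewrite subnn mul0r addr0; have := ler0n R B; lra.
have [z' [zz' [pz'|pz']]] := thin_btw (p j0.+1) pz.
  have [|||j jl h] := IH j0.+1 (D + dhyp); [lia|lia| |].
    exists z'; first exact: btw_sym.
    have : (dist b z' <= dist b z + dist z z')%N by apply: dist_triangle.
    by rewrite -(ler_nat R) natrD; lra.
  exists j; first lia.
  have -> : (j - j0 = (j - j0.+1).+1)%N by lia.
  by rewrite -natr1; move: h; lra.
exists j0; first lia.
have : (dist b (p j0) <= dist b z + (dist z z' + dist z' (p j0)))%N.
  by rewrite (leq_trans (dist_triangle z _ _)) // leq_add2l dist_triangle.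
have : (dist z' (p j0) <= B)%N.
  by rewrite (leq_trans _ (pB j0)) // (distC (p j0)) -pz' leq_addl.
by rewrite -!(ler_nat R) !natrD subnn mul0r; lra.
Qed.

End Thin.

(** The points within [L] of an interior point all lie in the cone, so the type transports them one
    at a time. *)
Lemma intr_ctype {R : realType} (L : R) w w' u : ctype w = ctype w' ->
  Defs.intr s L (cone w) (w * u)%g -> Defs.intr s L (cone w') (w' * u)%g.
Proof.
move=> ww' /intrP[wu h]; apply/intrP; split; first by have [] := cone_ctype ww' wu.
move=> v; rewrite -{1}(mulVKg w' v) distM -(distM _ w) => /h wv.
by have [] := cone_ctype ww' wv; rewrite mulVKg.
Qed.

Lemma recurrent_edge t : recurrent edge t ->
  exists i t', edge t i t' /\ recurrent edge t'.
Proof.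
move=> [[|[i t'] g] [//= _ /andP[e pg] gt]]; exists i, t'; split=> //.
exists (rcons g (i, t')); split; first by case: (g).
  by rewrite -cats1 is_path_cat pg /= -[endpoint t' g]/(endpoint t ((i, t') :: g)) gt e.
by rewrite -cats1 endpoint_cat.
Qed.

End Cones.

Lemma esumZl {R : realType} {T : choiceType} (A : set T) (c : R) (a : T -> \bar R) :
  0 <= c -> (forall x, 0 <= a x)%E ->
  (\esum_(x in A) (c%:E * a x) = c%:E * \esum_(x in A) a x)%E.
Proof.
have le (d : R) (b : T -> \bar R) : 0 <= d -> (forall x, 0 <= b x)%E ->
    (\esum_(x in A) (d%:E * b x) <= d%:E * \esum_(x in A) b x)%E.
  move=> d0 b0; apply: ge_ereal_sup => _ [F [fF FA] <-].
  rewrite -ge0_mule_fsumr //; apply: lee_wpmul2l => //.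
  by apply: ereal_sup_ubound; exists F.
move=> c0 a0; apply/eqP; rewrite eq_le le //=.
have [->|c_neq0] := eqVneq c 0.
  by rewrite mul0e; apply: esum_ge0 => x _; rewrite mule_ge0.
rewrite -lee_pdivlMl ?lt_neqAle ?c0 ?(eq_sym 0) ?c_neq0 //.
have := le c^-1 (fun x => c%:E * a x)%E; rewrite invr_ge0 => /(_ c0) h.
apply: le_trans (h _) => [|x]; last by rewrite mule_ge0.
apply: le_esum => x _; rewrite muleA -EFinM mulVf // mul1e.
exact: lexx.
Qed.

(** * The step operator of the retracted walk *)

Section Walk.
Context {R : realType} {N : nat} {W : groupType} (s : 'I_N -> W).
Context {G : involutive_generators s}.
Variables (q : 'I_N -> nat) (m : W -> R) (ws : seq (R * seq 'I_N)) (L0 : nat).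

Implicit Types (F H : W -> R) (u v w : W).

(* One step along a uniformly chosen gallery of type [i]: upwards with
   certainty, downwards with probability [1 / q i], folded otherwise. *)
Definition letter_op i F u : R :=
  if ascent s u i then F (u * s i)%g
  else (q i)%:R^-1 * F (u * s i)%g + (1 - (q i)%:R^-1) * F u.

Fixpoint word_op (l : seq 'I_N) F : W -> R :=
  if l is i :: l' then letter_op i (word_op l' F) else F.

Definition walk_op F u : R := \sum_(c <- ws) c.1 * word_op c.2 F u.

Lemma letter_opE i F u : letter_op i F u =
  if ascent s u i then F (u * s i)%g
  else (q i)%:R^-1 * F (u * s i)%g + (1 - (q i)%:R^-1) * F u.
Proof. by []. Qed.

Lemma walk_op_words F u : walk_op F u = \sum_(c <- ws) c.1 * word_op c.2 F u.
Proof. by []. Qed.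

(** A word of [ws] is drawn with its weight and a uniform gallery of that type is followed. For the
    building, [m] will be the size of spheres; [wd_m] is detailed balance for each letter. [wd_gen]
    records the positivity of the walk on neighbours, with a bound common to all letters. *)
Class walk_data : Prop := WalkData {
  wd_q : forall i, (2 <= q i)%N;
  wd_m0 : forall w, 0 < m w;
  wd_m : forall w i, ascent s w i -> m (w * s i)%g = (q i)%:R * m w;
  wd_ge0 : forall c, c \in ws -> 0 <= c.1;
  wd_sum : \sum_(c <- ws) c.1 = 1;
  wd_size : forall c, c \in ws -> (size c.2 <= L0)%N;
  wd_gen : exists2 b, 0 < b & forall i, exists2 b', b <= b' & (b', [:: i]) \in ws }.

Context {D : walk_data}.

Lemma q_ge2 i : (2 <= q i)%N.
Proof. exact: wd_q. Qed.

Lemma q_gt0 i : 0 < (q i)%:R :> R.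
Proof. by rewrite ltr0n; have := q_ge2 i; lia. Qed.

Lemma qV_ge0 i : 0 <= (q i)%:R^-1 :> R.
Proof. by rewrite invr_ge0 ltW // q_gt0. Qed.

Lemma qV_le1 i : (q i)%:R^-1 <= 1 :> R.
Proof. by rewrite invf_le1 ?q_gt0 // ler1n; have := q_ge2 i; lia. Qed.

Lemma letter_op_ge0 i F : (forall u, 0 <= F u) -> forall u, 0 <= letter_op i F u.
Proof.
move=> F0 u; rewrite /letter_op; case: ifP => // _.
by rewrite addr_ge0 // mulr_ge0 ?qV_ge0 // subr_ge0 qV_le1.
Qed.

Lemma word_op_ge0 l F : (forall u, 0 <= F u) -> forall u, 0 <= word_op l F u.
Proof. by elim: l => //= i l IH F0; apply: letter_op_ge0 => u; apply: IH. Qed.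

Lemma walk_op_ge0 F : (forall u, 0 <= F u) -> forall u, 0 <= walk_op F u.
Proof.
move=> F0 u; rewrite /walk_op big_seq sumr_ge0 // => c cw.
by rewrite mulr_ge0 ?(wd_ge0 cw) // word_op_ge0.
Qed.

Lemma letter_op_lin i a b F H u :
  letter_op i (fun v => a * F v + b * H v) u = a * letter_op i F u + b * letter_op i H u.
Proof. by rewrite /letter_op; case: ifP => // _; ring. Qed.

Lemma eq_letter_op i F H u : F (u * s i)%g = H (u * s i)%g -> F u = H u ->
  letter_op i F u = letter_op i H u.
Proof. by rewrite /letter_op => -> ->. Qed.

Lemma eq_word_op l F H u : (forall v, (dist s u v <= size l)%N -> F v = H v) ->
  word_op l F u = word_op l H u.
Proof.
elim: l u => [|i l IH] u FH /=; first by apply: FH; rewrite distxx.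
apply: eq_letter_op; apply: IH => v uv; apply: FH.
  rewrite (leq_trans (dist_triangle (u * s i)%g _ _)) // dist_gen /=; lia.
by rewrite /=; lia.
Qed.

Lemma word_op_lin l a b F H u :
  word_op l (fun v => a * F v + b * H v) u = a * word_op l F u + b * word_op l H u.
Proof.
elim: l u => [|i l IH] u //=; rewrite -letter_op_lin.
by apply: eq_letter_op; apply: IH.
Qed.

Lemma word_op_cst l a u : word_op l (fun=> a) u = a.
Proof.
elim: l u => [|i l IH] u //=; rewrite (@eq_letter_op i _ (fun=> a)) //.
by rewrite /letter_op; case: ifP => // _; ring.
Qed.

Lemma eq_walk_op F H u : (forall v, (dist s u v <= L0)%N -> F v = H v) ->
  walk_op F u = walk_op H u.
Proof.
move=> FH; rewrite /walk_op [LHS]big_seq [RHS]big_seq; apply: eq_bigr => c cw.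
congr (_ * _); apply: eq_word_op => v uv; apply: FH.
exact: leq_trans (wd_size cw).
Qed.

Lemma walk_op_lin a b F H u :
  walk_op (fun v => a * F v + b * H v) u = a * walk_op F u + b * walk_op H u.
Proof.
rewrite /walk_op !mulr_sumr -big_split; apply: eq_bigr => c _ /=.
by rewrite word_op_lin; ring.
Qed.

Lemma walk_op_cst a u : walk_op (fun=> a) u = a.
Proof.
rewrite /walk_op (eq_bigr (fun c : R * seq 'I_N => c.1 * a)) => [|c _]; last first.
  by rewrite word_op_cst.
by rewrite -mulr_suml wd_sum mul1r.
Qed.

Lemma walk_opZ a F u : walk_op (fun v => a * F v) u = a * walk_op F u.
Proof.
rewrite -[RHS]addr0 -(mul0r (walk_op F u)) -walk_op_lin.
by apply: eq_walk_op => v _; rewrite mul0r addr0.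
Qed.

Lemma walk_opD F H u : walk_op (fun v => F v + H v) u = walk_op F u + walk_op H u.
Proof.
rewrite -[walk_op F u]mul1r -[walk_op H u]mul1r -walk_op_lin.
by apply: eq_walk_op => v _; rewrite !mul1r.
Qed.

Lemma walk_op_sum (I : Type) (r : seq I) (F : I -> W -> R) u :
  walk_op (fun v => \sum_(j <- r) F j v) u = \sum_(j <- r) walk_op (F j) u.
Proof.
elim: r => [|j r IH].
  rewrite big_nil (@eq_walk_op _ (fun=> 0)) ?walk_op_cst // => v _.
  by rewrite big_nil.
rewrite big_cons -IH -walk_opD; apply: eq_walk_op => v _; by rewrite big_cons.
Qed.

Lemma le_walk_op F H u : (forall v, F v <= H v) -> walk_op F u <= walk_op H u.
Proof.
move=> FH; rewrite -subr_ge0.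
have -> : walk_op H u - walk_op F u = walk_op (fun v => H v - F v) u.
  rewrite -[walk_op H u]mul1r -mulN1r -walk_op_lin.
  by apply: eq_walk_op => v _; rewrite mul1r mulN1r.
by apply: walk_op_ge0 => v; rewrite subr_ge0.
Qed.

Definition dirac1 v u : R := (u == v)%:R.

Definition pstep u v : R := walk_op (dirac1 v) u.

Lemma pstepE u v : pstep u v = walk_op (dirac1 v) u. Proof. by []. Qed.

Lemma pstep_ge0 u v : 0 <= pstep u v.
Proof. by apply: walk_op_ge0 => w; rewrite ler0n. Qed.

Lemma walk_opE F u : walk_op F u = \sum_(v <- bseq_at s u L0) pstep u v * F v.
Proof.
rewrite (eq_bigr (fun v => walk_op (fun w => F v * dirac1 v w) u)); last first.
  by move=> v _; rewrite walk_opZ mulrC.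
rewrite -walk_op_sum; apply: eq_walk_op => v; rewrite -mem_bseq_at => uv.
rewrite (bigD1_seq v) //=; last by rewrite bseq_at_uniq.
rewrite /dirac1 eqxx mulr1 big1 ?addr0 // => w wv.
by rewrite (negbTE (_ : v != w)) ?mulr0 // eq_sym.
Qed.

Lemma pstep_far u v : (L0 < dist s u v)%N -> pstep u v = 0.
Proof.
move=> uv; rewrite /pstep (@eq_walk_op _ (fun=> 0)) ?walk_op_cst // => w uw.
rewrite /dirac1; case: eqP => // ?; subst; lia.
Qed.

Lemma pstep_gen : exists2 e, 0 < e & forall u i, e <= pstep u (u * s i)%g.
Proof.
(* Along a one-letter word the neighbour is reached with probability at least [1 / q i]; the product
   over all letters bounds this below independently of [i]. *)
have [b b0 bP] := wd_gen; exists (b * \prod_(i < N) (q i)%:R^-1).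
  by rewrite mulr_gt0 // prodr_gt0 // => i _; rewrite invr_gt0 q_gt0.
move=> u i; have [b' bb' b'ws] := bP i.
rewrite /pstep /walk_op (big_rem (b', [:: i])) //= ler_wpDr //.
  rewrite big_seq sumr_ge0 // => c /mem_rem cw.
  by rewrite mulr_ge0 ?(wd_ge0 cw) // word_op_ge0 // => v; rewrite ler0n.
apply: ler_pM => //.
- exact: ltW.
- by apply: prodr_ge0 => j _; apply: qV_ge0.
apply: (@le_trans _ _ ((q i)%:R^-1)).
  rewrite (bigD1 i) //= ler_piMr ?qV_ge0 //; apply: prodr_ile1 => j _.
  by rewrite qV_ge0 qV_le1.
rewrite /letter_op /dirac1 eqxx mulr1; case: ifP => _; first exact: qV_le1.
by rewrite ler_wpDr // mulr_ge0 ?ler0n // subr_ge0 qV_le1.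
Qed.

End Walk.

Arguments dirac1 {R W}.

Lemma esum_seq {R : realType} {T : choiceType} (r : seq T) (a : T -> \bar R) :
  uniq r -> (forall x, 0 <= a x)%E -> (forall x, x \notin r -> a x = 0%E) ->
  (\esum_(x in [set: T]) a x = \sum_(x <- r) a x)%E.
Proof.
move=> ur a0 ar.
have -> : (\sum_(x <- r) a x = \esum_(x in [set` r]) a x)%E.
  by rewrite esum_fset // fsbig_seq.
rewrite [RHS]esum_mkcond; apply: eq_esum => x _.
by case: ifPn => // /negP h; apply: ar; apply/negP => xr; apply: h; rewrite inE.
Qed.

(** * Spectral gap *)

Section Gap.
Context {R : realType} {N : nat} {W : groupType} (s : 'I_N -> W).
Context {G : involutive_generators s}.
Variables (q : 'I_N -> nat) (m : W -> R) (ws : seq (R * seq 'I_N)) (L0 : nat).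
Context {D : walk_data s q m ws L0}.

Local Notation letter_op := (letter_op s q).
Local Notation word_op := (word_op s q).
Local Notation walk_op := (walk_op s q ws).

(** Integration against the reversing measure, with values in the extended reals, so that invariance
    can be used before anything is known to be finite. *)
Definition mass (h : W -> R) : \bar R := (\esum_(u in [set: W]) (m u * h u)%:E)%E.

Let m0 w : 0 < m w. Proof. exact: wd_m0. Qed.
Let m_ge0 w : 0 <= m w. Proof. exact: ltW. Qed.
Let q0 i : 0 < (q i)%:R :> R. Proof. exact: q_gt0. Qed.
Let qV0 i : 0 <= (q i)%:R^-1 :> R. Proof. exact: qV_ge0. Qed.
Let qV1 i : (q i)%:R^-1 <= 1 :> R. Proof. exact: qV_le1. Qed.
Lemma mass_ge0 (h : W -> R) : (forall u, 0 <= h u) -> (0 <= mass h)%E.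
Proof. by move=> h0; apply: esum_ge0 => u _; rewrite lee_fin mulr_ge0. Qed.

Lemma le_mass h k : (forall u, h u <= k u) -> (mass h <= mass k)%E.
Proof. by move=> hk; apply: le_esum => u _; rewrite lee_fin ler_wpM2l. Qed.

Lemma eq_mass h k : h =1 k -> mass h = mass k.
Proof. by move=> hk; apply: eq_esum => u _; rewrite hk. Qed.

Lemma massD (h k : W -> R) : (forall u, 0 <= h u) -> (forall u, 0 <= k u) ->
  mass (fun u => h u + k u) = (mass h + mass k)%E.
Proof.
move=> h0 k0; rewrite /mass -esumD; first last.
- by move=> u _; rewrite lee_fin mulr_ge0.
- by move=> u _; rewrite lee_fin mulr_ge0.
by apply: eq_esum => u _; rewrite mulrDr EFinD.
Qed.

Lemma massZ c (h : W -> R) : 0 <= c -> (forall u, 0 <= h u) ->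
  mass (fun u => c * h u) = (c%:E * mass h)%E.
Proof.
move=> c0 h0; rewrite /mass -esumZl // => [|u]; last by rewrite lee_fin mulr_ge0.
by apply: eq_esum => u _; rewrite -EFinM mulrCA.
Qed.

Lemma mass_ge (h : W -> R) v : (forall u, 0 <= h u) -> ((m v * h v)%:E <= mass h)%E.
Proof.
move=> h0; rewrite -(@esum_set1 _ _ v (fun u => (m u * h u)%:E)); last first.
  by rewrite lee_fin mulr_ge0.
rewrite /mass [leLHS]esum_mkcond; apply: le_esum => u _.
by case: ifP => // _; rewrite lee_fin mulr_ge0.
Qed.

Lemma reindex_gen i (a : W -> \bar R) :
  (\esum_(u in [set: W]) a (u * s i)%g = \esum_(u in [set: W]) a u)%E.
Proof.
apply: esym; apply: (reindex_esum setT setT (fun u => (u * s i)%g)).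
split=> // [u v _ _ /mulIg //|u _]; by exists (u * s i)%g; rewrite ?mulgss.
Qed.

(** [m u * letter_op i] splits into the weight [al] of the edge to [u * s i] and the weight [be] of
    staying. The edge weight is the same from both ends, which is detailed balance, and the two add
    up to [m u]; invariance of [mass] follows by reindexing with the involution that sends [u] to
    [u * s i]. *)
Let al i (u : W) : R := if ascent s u i then m u else m u * (q i)%:R^-1.
Let be i (u : W) : R := if ascent s u i then 0 else m u * (1 - (q i)%:R^-1).

Let al_ge0 i u : 0 <= al i u.
Proof. by rewrite /al; case: ifP => // _; rewrite mulr_ge0. Qed.

Let be_ge0 i u : 0 <= be i u.
Proof. by rewrite /be; case: ifP => // _; rewrite mulr_ge0 // subr_ge0. Qed.

Let al_s i u : al i (u * s i)%g = al i u.
Proof.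
rewrite /al ascent_s; case: (boolP (ascent s u i)) => /= h.
  by rewrite (wd_m h) mulrC mulKf ?gt_eqF.
have h' : ascent s (u * s i)%g i by rewrite ascent_s h.
by rewrite -{2}(mulgss u i) (wd_m h') mulrC mulKf ?gt_eqF.
Qed.

Let albe i u : al i u + be i u = m u.
Proof. by rewrite /al /be; case: ifP => _; ring. Qed.

Let letterE i F u :
  m u * letter_op i F u = al i u * F (u * s i)%g + be i u * F u.
Proof. by rewrite /letter_op /al /be; case: ifP => _; ring. Qed.

Lemma mass_letter i (h : W -> R) : (forall u, 0 <= h u) -> mass (letter_op i h) = mass h.
Proof.
move=> h0; rewrite /mass.
rewrite (eq_esum (b := fun u => (al i (u * s i)%g * h (u * s i)%g)%:E + (be i u * h u)%:E)%E); last first.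
  by move=> u _; rewrite letterE al_s EFinD.
rewrite esumD; first last.
- by move=> u _; rewrite lee_fin mulr_ge0.
- by move=> u _; rewrite lee_fin mulr_ge0.
rewrite (reindex_gen i (fun u => (al i u * h u)%:E)) -esumD; first last.
- by move=> u _; rewrite lee_fin mulr_ge0.
- by move=> u _; rewrite lee_fin mulr_ge0.
by apply: eq_esum => u _; rewrite -EFinD -mulrDl albe.
Qed.

Lemma mass_word l (h : W -> R) : (forall u, 0 <= h u) -> mass (word_op l h) = mass h.
Proof.
by elim: l => //= i l IH h0; rewrite mass_letter ?IH // => u; apply: word_op_ge0.
Qed.

Lemma mass_walk (h : W -> R) : (forall u, 0 <= h u) -> mass (walk_op h) = mass h.
Proof.
move=> h0; rewrite /mass.
rewrite (eq_esum (b := fun u => \sum_(c <- ws) if c \in ws then (m u * (c.1 * word_op c.2 h u))%:E else 0)%E); last first.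
  move=> u _; rewrite walk_op_words mulr_sumr -sumEFin big_seq [RHS]big_seq.
  by apply: eq_bigr => c ->.
rewrite esum_sum; last first.
  move=> u c _ _; case: ifP => // cw.
  by rewrite lee_fin !mulr_ge0 ?(wd_ge0 cw) // word_op_ge0.
transitivity (\sum_(c <- ws) (c.1)%:E * mass h)%E.
  rewrite [LHS]big_seq [RHS]big_seq; apply: eq_bigr => c cw; rewrite cw.
  by rewrite -(mass_word c.2 h0) -massZ ?(wd_ge0 cw) //; exact: word_op_ge0.
rewrite [LHS]big_seq -ge0_sume_distrl => [|c cw]; last by rewrite lee_fin (wd_ge0 cw).
rewrite -big_seq; by rewrite sumEFin (wd_sum (walk_data := D)) mul1e.
Qed.

(** A Dirichlet form of two functions: the operator is applied to [g] and tested with [f]. Since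
    products of letters need not be symmetric, the case [f = g] would not control the norm. *)
Definition energy i (f g : W -> R) : \bar R :=
  mass (fun u => letter_op i (fun v => (f u - g v) ^+ 2) u).

Lemma energy_ge0 i f g : (0 <= energy i f g)%E.
Proof. by apply: mass_ge0 => u; apply: letter_op_ge0 => v; apply: sqr_ge0. Qed.

Lemma energy_sym i f g : energy i f g = energy i g f.
Proof.
rewrite /energy /mass.
have E f' g' : (\esum_(u in [set: W]) (m u * letter_op i (fun v => (f' u - g' v) ^+ 2) u)%:E
   = \esum_(u in [set: W]) (al i u * (f' u - g' (u * s i)%g) ^+ 2)%:E
     + \esum_(u in [set: W]) (be i u * (f' u - g' u) ^+ 2)%:E)%E.
  rewrite -esumD; first last.
  - by move=> u _; rewrite lee_fin mulr_ge0 // sqr_ge0.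
  - by move=> u _; rewrite lee_fin mulr_ge0 // sqr_ge0.
  by apply: eq_esum => u _; rewrite letterE EFinD.
rewrite !E; congr (_ + _)%E; last by apply: eq_esum => u _; rewrite -sqrrN opprB.
rewrite -(reindex_gen i); apply: eq_esum => u _.
by rewrite al_s mulgss -sqrrN opprB.
Qed.

Lemma walk_quad a g u : walk_op (fun v => (a - g v) ^+ 2) u =
  a ^+ 2 - 2 * a * walk_op g u + walk_op (fun v => g v ^+ 2) u.
Proof.
rewrite -[X in X - _](walk_op_cst (D := D) _ u).
rewrite -[X in _ + X]mul1r -[X in X - _]mul1r -[_ - _]/(_ + - _) -mulNr -walk_op_lin.
rewrite -[X in X + _]mul1r -walk_op_lin.
by apply: (eq_walk_op (D := D)) => v _; ring.
Qed.

(** Expanding the square, [walk_op] of [(f u - g v) ^+ 2] is [f u ^+ 2] minus twice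
    [f u * walk_op g u] plus [walk_op] of [g ^+ 2], whose mass is that of [g ^+ 2]. All words
    contribute nonnegatively, and the word [[:: i]] alone contributes at least [b] times the
    energy. *)
Lemma defect : exists2 b, 0 < b & forall i (f g : W -> R), (forall u, 0 <= f u) -> (forall u, 0 <= g u) ->
  (2%:E * mass (fun u => f u * walk_op g u)%R + b%:E * energy i f g <=
   mass (fun u => f u ^+ 2)%R + mass (fun u => g u ^+ 2)%R)%E.
Proof.
have [b b0 bP] := wd_gen (walk_data := D); exists b => // i f g f0 g0.
have [b' bb' b'ws] := bP i.
have Q0 u v : 0 <= (f u - g v) ^+ 2 by apply: sqr_ge0.
have LQ0 u : 0 <= letter_op i (fun v => (f u - g v) ^+ 2) u by apply: letter_op_ge0.
have W0 u : 0 <= walk_op g u by apply: walk_op_ge0.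
rewrite -(mass_walk (h := fun u => g u ^+ 2)) => [|u]; last exact: sqr_ge0.
rewrite -!massZ //; last 2 first.
- exact: ltW.
- by move=> u; rewrite mulr_ge0.
rewrite -!massD; first last.
- by move=> u; apply: walk_op_ge0 => v; apply: sqr_ge0.
- by move=> u; apply: sqr_ge0.
- by move=> u; rewrite mulr_ge0 // ltW.
- by move=> u; rewrite !mulr_ge0.
apply: le_mass => u.
have : b * letter_op i (fun v => (f u - g v) ^+ 2) u <= walk_op (fun v => (f u - g v) ^+ 2) u.
  rewrite [leRHS]walk_op_words (big_rem (b', [:: i])) //=; apply: ler_wpDr; last exact: ler_wpM2r.
  rewrite big_seq sumr_ge0 // => c /mem_rem cw.
  by rewrite mulr_ge0 ?(wd_ge0 cw) // word_op_ge0.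
rewrite walk_quad; lra.
Qed.

Lemma mass_walk_sqr g : (mass (fun u => walk_op g u ^+ 2)%R <= mass (fun u => g u ^+ 2)%R)%E.
Proof.
rewrite -(mass_walk (h := fun u => g u ^+ 2)) => [|u]; last exact: sqr_ge0.
apply: le_mass => u; rewrite -subr_ge0.
have <- : walk_op (fun v => (walk_op g u - g v) ^+ 2) u =
  walk_op (fun v => g v ^+ 2) u - walk_op g u ^+ 2 by rewrite walk_quad; ring.
by apply: walk_op_ge0 => v; apply: sqr_ge0.
Qed.

Lemma energy_ge i f g u :
  ((m u * (q i)%:R^-1 * (f u - g (u * s i)%g) ^+ 2)%:E <= energy i f g)%E.
Proof.
apply: le_trans (mass_ge u _); last by move=> v; apply: letter_op_ge0 => w; apply: sqr_ge0.
rewrite lee_fin letterE; apply: ler_wpDr; first by rewrite mulr_ge0 ?sqr_ge0.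
apply: ler_wpM2r; rewrite ?sqr_ge0 // /al.
by case: ifP => // _; rewrite ler_piMr.
Qed.

(** * Hardy and Poincare inequalities along the automaton *)

Section Hardy.
Context {V : finType} (star : V) (edge : V -> 'I_N -> V -> bool).
Context {A : strongly_automatic s star edge}.
Variable K : nat.
Hypothesis rec_K : recurrent_outside s star edge K.
Hypothesis infW : forall n, exists w, (n < len s w)%N.

Local Notation gamma := (gamma s star edge).
Local Notation ctype := (ctype s star edge).

(** The edges of a forest along which the Hardy inequality is summed. A vertex of recurrent type
    always has such a child, again of recurrent type, and every vertex has at most one parent
    because the last edge of its path is determined. *)
Definition child u i : bool :=
  `[< exists t', edge (ctype u) i t' /\ recurrent edge t' >].

Definition inner u : bool := [exists i, child u i].

Lemma childP u i : child u i -> exists t',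
  [/\ gamma (u * s i)%g = rcons (gamma u) (i, t'), ctype (u * s i)%g = t' & recurrent edge t'].
Proof.
move=> /asboolP[t' [e rt]]; exists t'.
have pe : is_path edge (ctype u) [:: (i, t')] by rewrite /= e.
have := gamma_ext pe; have := ctype_ext pe; rewrite /= mulg1 => -> ->.
by rewrite cats1; split.
Qed.

Lemma child_ascent u i : child u i -> ascent s u i.
Proof. by move=> /childP[t' [g _ _]]; rewrite /ascent -!size_gamma g size_rcons. Qed.

Lemma child_inj u v i j : child u i -> child v j -> (u * s i = v * s j)%g -> i = j.
Proof.
move=> /childP[t [gu _ _]] /childP[t' [gv _ _]] uv; move: gu; rewrite uv gv.
by move=> /rcons_inj[_ ->].
Qed.

Lemma recurrent_inner u : recurrent edge (ctype u) -> inner u.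
Proof.
move=> /recurrent_edge[i [t' [e rt]]]; apply/existsP; exists i.
by apply/asboolP; exists t'.
Qed.

Lemma inner_outside u : ~~ inner u -> (len s u <= K)%N.
Proof.
move=> h; apply: contraNT h; rewrite -ltnNge => h; apply: recurrent_inner.
by apply: rec_K; rewrite /Defs.ball /= dist1; apply/negP; rewrite -ltnNge.
Qed.

Let Q : R := 1 + \sum_(i < N) (q i)%:R.

Let qQ i : (q i)%:R <= Q.
Proof.
by rewrite /Q (bigD1 i) //= addrCA ler_wpDr // addr_ge0 // sumr_ge0.
Qed.

Let Q1 : 1 <= Q. Proof. by rewrite /Q ler_wpDr // sumr_ge0 // => j _; rewrite ler0n. Qed.

Definition tot_energy f g : \bar R := (\sum_(i < N) energy i f g)%E.

Lemma tot_energy_sym f g : tot_energy f g = tot_energy g f.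
Proof. by apply: eq_bigr => i _; rewrite energy_sym. Qed.

Let ind u : R := (inner u)%:R.

(** At an inner [u] with child [u * s i], let [x] be the value of [f] at [u] and [y] that of [g] at
    the child. Then [x ^+ 2 <= 3 * (x - y) ^+ 2 + 3 / 2 * y ^+ 2], and multiplying by [m (u * s i)],
    at least [2 * m u] by thickness, puts [2] on the left against [3 / 2] on the right. Each [y] is
    counted at most once, so the inequality can be closed with itself. *)
Lemma hardy (f g : W -> R) :
  (mass (fun u => 2 * (ind u * f u ^+ 2))%R <=
   (3 * Q ^+ 2)%:E * tot_energy f g + mass (fun u => 3 / 2 * (ind u * g u ^+ 2))%R)%E.
Proof.
pose S1 i u : R := (child u i)%:R * m (u * s i)%g * (f u - g (u * s i)%g) ^+ 2.
pose S2 i u : R := (child u i)%:R * m (u * s i)%g * g (u * s i)%g ^+ 2.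
have S1_0 i u : 0 <= S1 i u by apply: mulr_ge0 (sqr_ge0 _); apply: mulr_ge0 => //; apply: ler0n.
have S2_0 i u : 0 <= S2 i u by apply: mulr_ge0 (sqr_ge0 _); apply: mulr_ge0 => //; apply: ler0n.
pose T1 u := \sum_(i < N) S1 i u.
pose T2 u := \sum_(i < N) S2 i u.
have T1_0 u : 0 <= T1 u by apply: sumr_ge0.
have T2_0 u : 0 <= T2 u by apply: sumr_ge0.
have step1 : (\esum_(u in [set: W]) (T1 u)%:E <= (Q ^+ 2)%:E * tot_energy f g)%E.
  rewrite (eq_esum (b := fun u => \sum_(i < N) (S1 i u)%:E)%E); last by move=> u _; rewrite sumEFin.
  rewrite esum_sum => [|u i _ _]; last by rewrite lee_fin.
  rewrite /tot_energy ge0_sume_distrr => [|i _]; last exact: energy_ge0.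
  apply: lee_sum => i _; rewrite -massZ ?sqr_ge0 //; last first.
    by move=> u; apply: letter_op_ge0 => v; apply: sqr_ge0.
  apply: le_esum => u _; rewrite lee_fin /S1; case: (boolP (child u i)) => [cu|_]; last first.
    rewrite !mul0r; apply: mulr_ge0 => //; apply: mulr_ge0 (sqr_ge0 _) _.
    by apply: letter_op_ge0 => v; apply: sqr_ge0.
  rewrite mul1r (wd_m (child_ascent cu)) letter_opE (child_ascent cu).
  rewrite [leRHS]mulrA; apply: ler_wpM2r; rewrite ?sqr_ge0 // mulrC; apply: ler_wpM2l => //.
  by rewrite (le_trans (qQ i)) // expr2 ler_peMl // (le_trans ler01).
(* Reindexed by the child, each vertex has at most one parent; if it has one, it is itself of
   recurrent type, hence inner. *)
have step2 : (\esum_(u in [set: W]) (T2 u)%:E <= mass (fun u => ind u * g u ^+ 2)%R)%E.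
  rewrite (eq_esum (b := fun u => \sum_(i < N) (S2 i u)%:E)%E); last by move=> u _; rewrite sumEFin.
  rewrite esum_sum => [|u i _ _]; last by rewrite lee_fin.
  pose S3 i u : R := (child (u * s i)%g i)%:R * m u * g u ^+ 2.
  rewrite (eq_bigr (fun i => \esum_(u in [set: W]) (S3 i u)%:E)%E); last first.
    move=> i _; rewrite -(reindex_gen i); apply: eq_esum => u _.
    by rewrite /S2 /S3 mulgss.
  rewrite -esum_sum => [|u i _ _]; last by rewrite lee_fin; apply: mulr_ge0 (sqr_ge0 _); apply: mulr_ge0 => //; apply: ler0n.
  apply: le_esum => u _; rewrite sumEFin lee_fin /S3.
  rewrite -mulr_suml -mulr_suml [leRHS]mulrCA -mulrA; apply: ler_wpM2r.
    by apply: mulr_ge0 => //; apply: sqr_ge0.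
  have [[i ci]|nc] := pselect (exists i, child (u * s i)%g i); last first.
    rewrite big1 ?ler0n // => i _; case: (boolP (child _ i)) => // ci; case: nc.
    by exists i.
  rewrite (bigD1 i) //= big1 => [|j ji]; last first.
    case: (boolP (child _ j)) => // cj; move: ji; rewrite (child_inj cj ci) ?eqxx //.
    by rewrite !mulgss.
  have [t' [_ tE rt]] := childP ci; rewrite mulgss in tE.
  by rewrite ci addr0 /ind recurrent_inner // tE.
have -> : (mass (fun u => 3 / 2 * (ind u * g u ^+ 2))%R =
    (3 / 2)%:E * mass (fun u => ind u * g u ^+ 2)%R)%E.
  by rewrite massZ // => u; apply: mulr_ge0 (ler0n _ _) (sqr_ge0 _).
have step1' : ((3 : R)%:E * (\esum_(u in [set: W]) (T1 u)%:E) <= (3 * Q ^+ 2)%:E * tot_energy f g)%E.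
  by rewrite EFinM -muleA; apply: lee_wpmul2l step1; rewrite lee_fin.
have step2' : ((3 / 2 : R)%:E * (\esum_(u in [set: W]) (T2 u)%:E) <=
    (3 / 2)%:E * mass (fun u => ind u * g u ^+ 2)%R)%E.
  by apply: lee_wpmul2l step2; rewrite lee_fin divr_ge0.
apply: le_trans (leeD step1' step2'); rewrite -!esumZl // ?divr_ge0 //.
rewrite /mass -esumD => [|u _|u _]; rewrite -?EFinM ?lee_fin ?mulr_ge0 ?divr_ge0 //.
apply: le_esum => u _; rewrite -!EFinM -EFinD lee_fin /ind.
case: (boolP (inner u)) => [/existsP[i ci]|_]; last first.
  by rewrite mul0r !mulr0 addr_ge0 ?mulr_ge0 ?divr_ge0.
rewrite mul1r /T1 /T2 !mulr_sumr -big_split /= (bigD1 i) //=; apply: ler_wpDr.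
  by apply: sumr_ge0 => j _; have := S1_0 j u; have := S2_0 j u; lra.
rewrite /S1 /S2 ci !mul1r (wd_m (child_ascent ci)).
have q2 : 2 <= (q i)%:R :> R by rewrite ler_nat q_ge2.
set x := f u; set y := g _.
have h1 : x ^+ 2 <= 3 * (x - y) ^+ 2 + 3 / 2 * y ^+ 2.
  rewrite -subr_ge0; have -> : 3 * (x - y) ^+ 2 + 3 / 2 * y ^+ 2 - x ^+ 2 =
    2 * (x - 3 / 2 * y) ^+ 2 by field.
  by rewrite mulr_ge0 ?sqr_ge0.
have h2 : m u * (2 * x ^+ 2) <= m u * (q i)%:R * x ^+ 2.
  by rewrite mulrA !ler_wpM2r ?sqr_ge0 // ler_wpM2l.
have h3 : m u * (q i)%:R * x ^+ 2 <= m u * (q i)%:R * (3 * (x - y) ^+ 2 + 3 / 2 * y ^+ 2).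
  by rewrite ler_wpM2l // mulr_ge0 // ltW.
by apply: (le_trans h2); apply: (le_trans h3); rewrite le_eqVlt; apply/orP; left; apply/eqP; ring.
Qed.

Definition l2 (f : W -> R) : Prop := (mass (fun u => f u ^+ 2)%R < +oo)%E.

Let in2_fin f : l2 f -> (mass (fun u => ind u * f u ^+ 2)%R) \is a fin_num.
Proof.
move=> lf; rewrite ge0_fin_numE; last first.
  by apply: mass_ge0 => u; rewrite mulr_ge0 ?sqr_ge0 ?ler0n.
apply: le_lt_trans lf; apply: le_mass => u; rewrite ler_piMl ?sqr_ge0 //.
by rewrite /ind; case: (inner u).
Qed.

Lemma tot_energy_ge0 f g : (0 <= tot_energy f g)%E.
Proof. by apply: sume_ge0 => i _; apply: energy_ge0. Qed.

(** With [a], [b] the inner masses of the squares of [f], [g] and [e] the energy, the Hardy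
    inequalities read [2 * a <= 3 * Q ^+ 2 * e + 3 / 2 * b] and the same with [a], [b] exchanged.
    Adding them gives [a + b <= 12 * Q ^+ 2 * e]; the masses must be finite to be subtracted. *)
Lemma inner_poincare (f g : W -> R) : l2 f -> l2 g ->
  (mass (fun u => ind u * f u ^+ 2)%R <= (12 * Q ^+ 2)%:E * tot_energy f g)%E.
Proof.
move=> lf lg; have h1 := hardy f g; have h2 := hardy g f; move: h1 h2.
rewrite (tot_energy_sym g f).
rewrite !massZ ?divr_ge0 // => [||||]; try by move=> u; rewrite mulr_ge0 ?sqr_ge0 ?ler0n.
have := in2_fin lf; have := in2_fin lg; have := tot_energy_ge0 f g.
case: (tot_energy f g) => [e||] //; last first.
  move=> _ _ _ _ _; rewrite mulry gtr0_sg ?mul1e ?leey // mulr_gt0 // exprn_gt0 //.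
  exact: lt_le_trans Q1.
rewrite lee_fin => e0; set a := mass _; set b := mass _.
case: a => // a; case: b => // b _ _.
rewrite -!EFinM -!EFinD !lee_fin; nra.
Qed.

(** Vertices that are not inner lie in the ball of radius [K] and escape the Hardy inequality. A
    pointwise bound by the energy is carried to them from a deep vertex, one edge at a time; along
    an edge [f] and [g] exchange their roles. *)
Definition controlled v : Prop := exists2 C, 0 <= C &
  forall f g : W -> R, l2 f -> l2 g ->
    (((f v) ^+ 2 + (g v) ^+ 2)%:E <= C%:E * tot_energy f g)%E.

Lemma inner_controlled v : inner v -> controlled v.
Proof.
move=> iv; exists (24 * Q ^+ 2 / m v).
  by rewrite divr_ge0 // mulr_ge0 // sqr_ge0.
have H (f g : W -> R) : l2 f -> l2 g ->
    ((f v ^+ 2)%:E <= (12 * Q ^+ 2 / m v)%:E * tot_energy f g)%E.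
  move=> lf lg; have h := inner_poincare lf lg.
  have h0 u : 0 <= ind u * f u ^+ 2 by rewrite mulr_ge0 ?sqr_ge0 ?ler0n.
  have := le_trans (mass_ge v h0) h; rewrite /ind iv mul1r => {}h.
  have -> : 12 * Q ^+ 2 / m v = (m v)^-1 * (12 * Q ^+ 2) by rewrite mulrC.
  by rewrite (EFinM (m v)^-1) -muleA lee_pdivlMl // -EFinM.
move=> f g lf lg; rewrite EFinD (le_trans (leeD (H _ _ lf lg) (H _ _ lg lf))) //.
rewrite (tot_energy_sym g f) -ge0_muleDl ?lee_fin; last 2 first.
- by rewrite divr_ge0 // mulr_ge0 // sqr_ge0.
- by rewrite divr_ge0 // mulr_ge0 // sqr_ge0.
rewrite -EFinD; apply: lee_wpmul2r; first exact: tot_energy_ge0.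
by rewrite lee_fin le_eqVlt; apply/orP; left; apply/eqP; ring.
Qed.

Lemma energy_diff i f g v :
  (((f v - g (v * s i)%g) ^+ 2)%:E <= ((q i)%:R / m v)%:E * tot_energy f g)%E.
Proof.
have h : (energy i f g <= tot_energy f g)%E.
  rewrite /tot_energy (bigD1 i) //= leeDl // sume_ge0 // => j _.
  exact: energy_ge0.
have {h} := le_trans (energy_ge i f g v) h.
rewrite EFinM -lee_pdivlMl ?divr_gt0 //.
by rewrite invf_div.
Qed.

Lemma controlled_s v i : controlled v -> controlled (v * s i)%g.
Proof.
move=> [C C0 H]; set w := (v * s i)%g.
exists (2 * ((q i)%:R / m w + (q i)%:R / m v) + 2 * C).
  by rewrite addr_ge0 ?mulr_ge0 // addr_ge0 // divr_ge0 // ltW.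
move=> f g lf lg.
have h1 := energy_diff i f g w; have h2 := energy_diff i f g v; have h3 := H f g lf lg.
rewrite {1}/w mulgss -/w in h1; rewrite -/w in h2.
move: h1 h2 h3; have := tot_energy_ge0 f g; case: (tot_energy f g) => [e||] //.
  rewrite -!EFinM !lee_fin => e0.
  set x := f w; set y := g v; set x' := f v; set y' := g w => h1 h2 h3.
  have k1 : x ^+ 2 <= 2 * (x - y) ^+ 2 + 2 * y ^+ 2.
    by have := sqr_ge0 (x - 2 * y); lra.
  have k2 : y' ^+ 2 <= 2 * (x' - y') ^+ 2 + 2 * x' ^+ 2.
    by have := sqr_ge0 (y' - 2 * x'); lra.
  lra.
move=> _ _ _ _; rewrite mulry gtr0_sg ?mul1e ?leey //.
by rewrite ltr_wpDr ?mulr_ge0 // mulr_gt0 // addr_gt0 // divr_gt0.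
Qed.

Lemma all_controlled v : controlled v.
Proof.
have [w0 w0K] := infW K.
have c0 : controlled w0.
  apply: inner_controlled; apply: contraLR w0K => /inner_outside.
  by rewrite -leqNgt.
have [l lE] := gen_all (s := s) (w0^-1 * v)%g.
have -> : v = (w0 * wprod s l)%g by rewrite lE mulVKg.
elim: l w0 c0 {w0K lE} => [|i l IH] w0 c0; first by rewrite mulg1.
by rewrite /= mulgA; apply: IH; apply: controlled_s.
Qed.

Lemma poincare : exists2 C, 0 < C & forall f g : W -> R, l2 f -> l2 g ->
  (mass (fun u => f u ^+ 2)%R + mass (fun u => g u ^+ 2)%R <= C%:E * tot_energy f g)%E.
Proof.
have /choice[c cP] : forall v, exists C, 0 <= C /\ forall f g : W -> R, l2 f -> l2 g ->
    (((f v) ^+ 2 + (g v) ^+ 2)%:E <= C%:E * tot_energy f g)%E.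
  by move=> v; have [C C0 H] := all_controlled v; exists C.
pose S := \sum_(v <- bseq s K) m v * c v.
have S0 : 0 <= S by apply: sumr_ge0 => v _; rewrite mulr_ge0 //; have [] := cP v.
exists (24 * Q ^+ 2 + S + 1).
  by rewrite ltr_wpDl // addr_ge0 // mulr_ge0 // sqr_ge0.
move=> f g lf lg; have e0 := tot_energy_ge0 f g.
have i0 (h : W -> R) u : 0 <= ind u * h u ^+ 2 by rewrite mulr_ge0 ?sqr_ge0 ?ler0n.
pose out u : R := (~~ inner u)%:R * (f u ^+ 2 + g u ^+ 2).
have out0 u : 0 <= out u by rewrite mulr_ge0 ?addr_ge0 ?sqr_ge0 ?ler0n.
have -> : (mass (fun u => f u ^+ 2)%R + mass (fun u => g u ^+ 2)%R =
    mass (fun u => ind u * f u ^+ 2)%R + mass (fun u => ind u * g u ^+ 2)%R + mass out)%E.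
  rewrite -!massD // => [|u|u|u]; rewrite ?addr_ge0 ?sqr_ge0 //.
  by apply: eq_mass => u; rewrite /out /ind; case: (inner u) => /=; ring.
have out_le : (mass out <= S%:E * tot_energy f g)%E.
  rewrite /mass (esum_seq (bseq_uniq s K)); last 2 first.
  - by move=> u; rewrite lee_fin mulr_ge0.
  - move=> u; rewrite mem_bseq => uK; congr EFin; rewrite /out.
    case: (boolP (inner u)) => [_|/inner_outside]; first by rewrite mul0r mulr0.
    by rewrite (negbTE uK).
  rewrite /S -sumEFin ge0_sume_distrl => [|v _]; last first.
    by rewrite lee_fin mulr_ge0 //; have [] := cP v.
  apply: lee_sum => v _; rewrite (EFinM _ (out v)) (EFinM _ (c v)) -muleA; apply: lee_wpmul2l.
    by rewrite lee_fin.
  have [_ /(_ f g lf lg) h] := cP v; apply: le_trans h; rewrite lee_fin /out.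
  by rewrite ler_piMl ?addr_ge0 ?sqr_ge0 //; case: (inner v).
apply: (le_trans (leeD (leeD (inner_poincare lf lg) (inner_poincare lg lf)) out_le)).
have Q20 : 0 <= 12 * Q ^+ 2 by rewrite mulr_ge0 // sqr_ge0.
rewrite (tot_energy_sym g f) -!ge0_muleDl ?lee_fin ?addr_ge0 // -!EFinD.
by apply: lee_wpmul2r => //; rewrite lee_fin; lra.
Qed.

(** The Poincare inequality turns [defect], averaged over the letters, into [2 * <f, walk_op g> <=
    rho * (|f|^2 + |g|^2)] for nonnegative [f] and [g], where [rho = 1 - eps]. With [f] equal to
    [walk_op g] divided by [rho], this becomes [|walk_op g|^2 <= rho^2 * |g|^2]. *)
Lemma spectral_gap : exists2 rho : R, 0 < rho < 1 &
  forall g : W -> R, (forall u, 0 <= g u) -> l2 g ->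
    (mass (fun u => walk_op g u ^+ 2)%R <= (rho ^+ 2)%:E * mass (fun u => g u ^+ 2)%R)%E.
Proof.
have [C C0 HC] := poincare; have [b b0 Hb] := defect.
pose Nn : R := N%:R + 1; have Nn0 : 0 < Nn by rewrite ltr_wpDl.
(* [eps] is the relative energy loss in one step *)
pose eps := b / (C * Nn + b); have CN0 : 0 < C * Nn by rewrite mulr_gt0.
have e01 : 0 < eps < 1.
  by rewrite /eps divr_gt0 ?addr_gt0 //= ltr_pdivrMr ?addr_gt0 // mul1r ltrDr.
have gap (f g : W -> R) x y z : (forall u, 0 <= f u) -> (forall u, 0 <= g u) ->
    mass (fun u => f u ^+ 2)%R = x%:E -> mass (fun u => g u ^+ 2)%R = y%:E ->
    mass (fun u => f u * walk_op g u)%R = z%:E -> 2 * z <= (1 - eps) * (x + y).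
  move=> f0 g0 fx gy fgz.
  have h1 i := Hb i f g f0 g0.
  have h2 := HC f g; rewrite /l2 fx gy !ltry in h2; have {h2} h2 := h2 isT isT.
  have E i : exists2 e, energy i f g = e%:E & 2 * z + b * e <= x + y.
    have := h1 i; rewrite fx gy fgz; have := energy_ge0 i f g.
    case: (energy i f g) => [e|_|] //; last by rewrite gt0_muley ?lte_fin // addey // leye_eq.
    by rewrite -!EFinM -!EFinD !lee_fin => _ h; exists e.
  have /choice[e eP] : forall i, exists e, energy i f g = e%:E /\ 2 * z + b * e <= x + y.
    by move=> i; have [e ? ?] := E i; exists e.
  rewrite /tot_energy (eq_bigr (fun i => (e i)%:E)) in h2; last by move=> i _; have [] := eP i.
  rewrite sumEFin -EFinM -EFinD lee_fin in h2.
  have h3 : b * \sum_(i < N) e i <= N%:R * (x + y - 2 * z).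
    rewrite mulr_sumr -[X in _ <= X%:R * _](card_ord N) -sum1_card natr_sum mulr_suml.
    by apply: ler_sum => i _; have [_] := eP i; lra.
  have [w w0] := infW 0; have [[|i l] sl _] := lenP (s := s) w; first by rewrite -sl in w0.
  have z0 : 0 <= x + y - 2 * z.
    have [ei h] := eP i; have := energy_ge0 i f g; rewrite ei lee_fin => /(mulr_ge0 (ltW b0)); lra.
  have h4 : b * (x + y) <= (C * Nn + b) * (x + y - 2 * z).
    have : b * (x + y) <= C * (N%:R * (x + y - 2 * z)).
      by apply: le_trans (ler_wpM2l (ltW C0) h3); rewrite mulrCA ler_wpM2l // ltW.
    move=> /le_trans; apply; rewrite mulrA ler_wpM2r // /Nn mulrDr mulr1 -addrA lerDl.
    by rewrite addr_ge0 // ltW.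
  have : eps * (x + y) <= x + y - 2 * z.
    by rewrite /eps mulrAC ler_pdivrMr ?addr_gt0 // [leRHS]mulrC.
  lra.
exists (1 - eps); first lra.
move=> g g0 lg; have P0 u : 0 <= walk_op g u by apply: walk_op_ge0.
have fin (h : W -> R) : l2 h -> exists2 x, mass (fun u => h u ^+ 2)%R = x%:E & 0 <= x.
  rewrite /l2; have : (0 <= mass (fun u => h u ^+ 2)%R)%E by apply: mass_ge0 => u; apply: sqr_ge0.
  by case: (mass _) => // x; rewrite lee_fin => x0 _; exists x.
have lP : l2 (walk_op g) by apply: le_lt_trans (mass_walk_sqr g) lg.
have [y yE y0] := fin _ lg; have [x xE x0] := fin _ lP.
set rho := 1 - eps; have r0 : 0 < rho by rewrite /rho; lra.
have := gap (fun u => rho^-1 * walk_op g u) g (rho ^- 2 * x) y (rho^-1 * x).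
rewrite yE; move=> /(_ _ g0 _ erefl) h.
have {}h : 2 * (rho^-1 * x) <= rho * (rho ^- 2 * x + y).
  apply: h => [u||].
  - by rewrite mulr_ge0 // invr_ge0 ltW.
  - rewrite (eq_mass (k := fun u => rho ^- 2 * walk_op g u ^+ 2)) => [|u]; last first.
      by rewrite exprMn exprVn.
    rewrite massZ ?xE //; first by rewrite invr_ge0 sqr_ge0.
    by move=> u; apply: sqr_ge0.
  - rewrite (eq_mass (k := fun u => rho^-1 * walk_op g u ^+ 2)) => [|u]; last first.
      by rewrite -mulrA expr2.
    rewrite massZ ?xE //; first by rewrite invr_ge0 ltW.
    by move=> u; apply: sqr_ge0.
rewrite xE -EFinM lee_fin.
have k1 : rho * (rho^-1 * x) = x by rewrite mulrA mulfV ?mul1r // gt_eqF.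
have k2 : rho * (rho * (rho ^- 2 * x + y)) = x + rho ^+ 2 * y.
  by rewrite mulrDr mulrDr !mulrA -expr2 mulfV ?mul1r // expf_neq0 // gt_eqF.
have := ler_wpM2l (ltW r0) h; rewrite mulrCA k1 k2; lra.
Qed.

(** The iterates of the operator on the indicator of [y]: the target comes before the starting
    point, so [pn n y u] is the probability of going from [u] to [y] in [n] steps. *)
Definition pn n y : W -> R := iter n walk_op (dirac1 y).

Lemma pn0 y u : pn 0 y u = (u == y)%:R. Proof. by []. Qed.

Lemma pnS n y u : pn n.+1 y u = walk_op (pn n y) u. Proof. by []. Qed.

Lemma pn_ge0 n y u : 0 <= pn n y u.
Proof.
elim: n u => [|n IH] u; first by rewrite /pn /= ler0n.
by apply: walk_op_ge0 => v; apply: IH.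
Qed.

Lemma mass_dirac y : mass (fun u => dirac1 y u ^+ 2)%R = (m y)%:E.
Proof.
rewrite /mass (@esum_seq _ _ [:: y]) //.
- by rewrite big_seq1 /dirac1 eqxx expr1n mulr1.
- by move=> u; rewrite lee_fin mulr_ge0 // sqr_ge0.
- by move=> u; rewrite inE /dirac1 => /negbTE ->; rewrite expr0n mulr0.
Qed.

(** One term of the [l2] bound. The masses are kept because their ratio is what makes a light vertex
    hard to reach from a heavy one. *)
Lemma pn_decay : exists2 rho : R, 0 < rho < 1 &
  forall n x y, m x * pn n y x ^+ 2 <= rho ^+ (2 * n) * m y.
Proof.
have [rho rho01 H] := spectral_gap; exists rho => // n x y.
have H' : (mass (fun u => pn n y u ^+ 2)%R <= (rho ^+ (2 * n) * m y)%:E)%E.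
  elim: n => [|n IH]; first by rewrite mass_dirac mul1r.
  have l : l2 (pn n y) by apply: le_lt_trans IH (ltry _).
  apply: le_trans (H _ (pn_ge0 n y) l) _.
  rewrite mulnS exprD -mulrA (EFinM (rho ^+ 2)); apply: lee_wpmul2l IH.
  by rewrite lee_fin sqr_ge0.
by rewrite -lee_fin; apply: le_trans H'; apply: mass_ge => u; apply: sqr_ge0.
Qed.

End Hardy.
End Gap.

Lemma expr_small {R : realType} (r e : R) : 0 < r < 1 -> 0 < e -> exists n : nat, r ^+ n < e.
Proof.
move=> /andP[r0 r1] e0.
have r1' : `|r| < 1 by rewrite gtr0_norm.
have /cvgrPdist_lt /(_ e e0) [n _ h] := cvg_expr r1'.
exists n; have := h n (leqnn n); rewrite /= sub0r normrN ger0_norm //.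
by rewrite exprn_ge0 // ltW.
Qed.

Lemma nat_above {R : realType} (x : R) : exists n : nat, x <= n%:R.
Proof.
exists (Num.truncn x).+1; apply: ltW; exact: truncnS_gt.
Qed.

(** * Discrete random variables *)

Section Limits.
Context {R : realType}.

Lemma cvgn_ge (u : nat -> R) (l a : R) : u n @[n --> \oo] --> l ->
  (\forall n \near \oo, a <= u n) -> a <= l.
Proof.
move=> ul h; rewrite -(cvg_lim _ ul) //; apply: limr_ge => //.
by apply/cvg_ex; exists l.
Qed.

Lemma cvgn_le (u : nat -> R) (l a : R) : u n @[n --> \oo] --> l ->
  (\forall n \near \oo, u n <= a) -> l <= a.
Proof.
move=> ul h; rewrite -(cvg_lim _ ul) //; apply: limr_le => //.
by apply/cvg_ex; exists l.
Qed.

Lemma cvgn_uniq (u : nat -> R) (l l' : R) : u n @[n --> \oo] --> l ->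
  u n @[n --> \oo] --> l' -> l = l'.
Proof. by move=> h1 h2; apply: (cvg_unique _ h1 h2). Qed.

End Limits.

Section Discrete.
Context {R : realType} {d : measure_display} {Om : measurableType d}.
Variable P : probability Om R.

(** Measurability for the discrete structure on [T], stated by fibres so that [T] carries no
    sigma-algebra; for countable [T] all preimages are then measurable. *)
Definition dmeas {T : Type} (f : Om -> T) : Prop :=
  forall t, measurable [set om | f om = t].

Section OneVariable.
Context {T : choiceType} (cT : countable [set: T]).

Lemma bigcup_countableT_measurable (F : T -> set Om) :
  (forall t, measurable (F t)) -> measurable (\bigcup_t F t).
Proof.
move=> mF; have [h hi] := countable_injP _ cT.
have -> : \bigcup_t F t = \bigcup_n (\bigcup_(t in [set t | h t = n]) F t).
  apply/seteqP; split=> om; first by move=> [t _ Ft]; exists (h t) => //; exists t.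
  by move=> [n _ [t _ Ft]]; exists t.
apply: bigcupT_measurable => n.
have [[t ht]|nt] := pselect (exists t, h t = n).
  have -> : \bigcup_(t in [set t | h t = n]) F t = F t; last exact: mF.
  apply/seteqP; split=> om; last by move=> Ft; exists t.
  by move=> [t' /= ht' Ft]; rewrite (hi t t') ?inE // ht ht'.
have -> : \bigcup_(t in [set t | h t = n]) F t = set0; last exact: measurable0.
by apply/seteqP; split=> om // [t ht _]; apply: nt; exists t.
Qed.

Lemma dmeas_preimage (f : Om -> T) (S : set T) : dmeas f -> measurable [set om | S (f om)].
Proof.
move=> mf.
have -> : [set om | S (f om)] = \bigcup_t (if `[< S t >] then [set om | f om = t] else set0).
  apply/seteqP; split=> om /=.
    by move=> Sf; exists (f om) => //; move/asboolP: Sf => ->.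
  by move=> [t _]; case: ifPn => // /asboolP St /= ->.
by apply: bigcup_countableT_measurable => t; case: ifP => _ //; exact: measurable0.
Qed.

Lemma total_probability (f : Om -> T) (A : set Om) : dmeas f -> measurable A ->
  (P A = \esum_(t in [set: T]) P (A `&` [set om | f om = t]))%E.
Proof.
move=> mf mA; have [h hi] := countable_injP _ cT.
have hi' : injective h by move=> x y; apply: hi; rewrite inE.
pose F n := A `&` [set om | h (f om) = n].
have mF n : measurable (F n).
  apply: measurableI => //; exact: (dmeas_preimage [set t | h t = n] mf).
have AE : A = \bigcup_n F n.
  by apply/seteqP; split=> om; [move=> Ao; exists (h (f om))|move=> [n _ []]].
have tF : trivIset setT F.
  by move=> i j _ _ [om [[_ /= <-] [_ /= <-]]].
rewrite {1}AE measure_bigcup //.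
rewrite nneseries_esum // (_ : [set x | x \in [set: nat]] = setT); last first.
  by apply/seteqP; split=> x //= _; rewrite inE.
have -> : (\esum_(t in [set: T]) P (A `&` [set om | f om = t]) =
    \esum_(t in [set: T]) P (F (h t)))%E.
  apply: eq_esum => t _; congr (P _); apply/seteqP; split=> om [Ao /= ft]; split=> //=.
    by rewrite ft.
  exact: hi'.
rewrite -(@esum_image _ _ _ setT h (fun n => P (F n))); last by move=> x y _ _; apply: hi'.
rewrite [RHS]esum_mkcond; apply: eq_esum => n _; case: ifPn => // /negP nh.
have -> : F n = set0; last exact: measure0.
apply/seteqP; split=> om // [_ /= hf]; apply: nh; rewrite inE /=.
by exists (f om).
Qed.

End OneVariable.

Lemma dmeas_comp {T : choiceType} {U : Type} (g : T -> U) (f : Om -> T) :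
  countable [set: T] -> dmeas f -> dmeas (fun om => g (f om)).
Proof. by move=> cT mf u; apply: (dmeas_preimage cT [set t | g t = u]). Qed.

Lemma dmeas_pair {T U : Type} (f : Om -> T) (g : Om -> U) :
  dmeas f -> dmeas g -> dmeas (fun om => (f om, g om)).
Proof.
move=> mf mg [t u].
have -> : [set om | (f om, g om) = (t, u)] = [set om | f om = t] `&` [set om | g om = u].
  by apply/seteqP; split=> om /= [-> ->].
exact: measurableI.
Qed.

Lemma dmeas_mkseq {T : Type} (f : nat -> Om -> T) n :
  (forall i, dmeas (f i)) -> dmeas (fun om => mkseq (f^~ om) n).
Proof.
move=> mf t; have [st|st] := eqVneq (size t) n; last first.
  rewrite (_ : [set _ | _] = set0); first exact: measurable0.
  by apply/seteqP; split=> om //= h; move: st; rewrite -h size_mkseq eqxx.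
have [x0|nT] := pselect (exists x : T, True); last first.
  case: t st => [|x t] st; last by case: nT; exists x.
  rewrite (_ : [set _ | _] = setT); first exact: measurableT.
  apply/seteqP; split=> om //= _.
  by rewrite -st.
case: x0 => x0 _.
have -> : [set om | mkseq (f^~ om) n = t] =
    \bigcap_i (if (i < n)%N then [set om | f i om = nth x0 t i] else setT).
  apply/seteqP; split=> om /=.
    by move=> <- i _; case: ifP => // i_n /=; rewrite nth_mkseq.
  move=> h; apply: (@eq_from_nth _ x0); rewrite size_mkseq // => i i_n.
  by rewrite nth_mkseq //; have := h i I; rewrite i_n.
by apply: bigcapT_measurable => i; case: ifP => // _; apply: mf.
Qed.

Definition Pr (A : set Om) : R := fine (P A).

Lemma fine_Pr A : fine (P A) = Pr A. Proof. by []. Qed.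

Lemma Pr_set0 : Pr set0 = 0. Proof. by rewrite /Pr measure0. Qed.

Lemma Pr_setT : Pr setT = 1. Proof. by rewrite /Pr probability_setT. Qed.

Lemma PrE A : measurable A -> P A = (Pr A)%:E.
Proof. by move=> mA; rewrite /Pr fineK // fin_num_measure. Qed.

Lemma Pr_ge0 A : 0 <= Pr A.
Proof. by rewrite /Pr fine_ge0. Qed.

Lemma le_Pr A B : measurable A -> measurable B -> A `<=` B -> Pr A <= Pr B.
Proof.
move=> mA mB AB; rewrite -lee_fin -!PrE //; apply: le_measure; rewrite ?inE //.
Qed.

Lemma Pr_le1 A : measurable A -> Pr A <= 1.
Proof. by move=> mA; rewrite -lee_fin -PrE // probability_le1. Qed.

Lemma PrU_le A B : measurable A -> measurable B -> Pr (A `|` B) <= Pr A + Pr B.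
Proof.
move=> mA mB; have mU := measurableU _ _ mA mB.
rewrite -lee_fin EFinD -!PrE //.
have := measureU2 P mA mB; exact.
Qed.

Lemma Pr_disj A B : measurable A -> measurable B -> A `&` B = set0 ->
  Pr (A `|` B) = Pr A + Pr B.
Proof.
move=> mA mB AB; apply: EFin_inj; rewrite EFinD -!PrE //; last exact: measurableU.
exact: measureU.
Qed.

Lemma Pr_split A B : measurable A -> measurable B -> Pr A = Pr (A `&` B) + Pr (A `\` B).
Proof.
move=> mA mB; rewrite -Pr_disj; [|exact: measurableI|exact: measurableD|].
  congr Pr; apply/seteqP; split=> om; last by move=> [[]|[]].
  by move=> Ao; have [Bo|Bo] := pselect (B om); [left|right].
by rewrite setDE setIACA setICr setI0.
Qed.

Lemma Pr0_sub A B : measurable A -> measurable B -> A `<=` B -> Pr B = 0 -> Pr A = 0.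
Proof.
move=> mA mB AB B0; apply/eqP; rewrite eq_le Pr_ge0 andbT -B0.
exact: le_Pr.
Qed.

Lemma Pr_as A B : measurable A -> measurable B -> Pr (~` B) = 0 -> Pr (A `&` B) = Pr A.
Proof.
move=> mA mB B0; rewrite [RHS](Pr_split mA mB).
rewrite (@Pr0_sub (A `\` B) (~` B)) ?addr0 //.
- exact: measurableD.
- exact: measurableC.
Qed.

Lemma eq_Pr_as A A' B : measurable A -> measurable A' -> measurable B -> Pr (~` B) = 0 ->
  (forall om, B om -> A om <-> A' om) -> Pr A = Pr A'.
Proof.
move=> mA mA' mB B0 h; rewrite -(Pr_as mA mB B0) -(Pr_as mA' mB B0); congr Pr.
by apply/seteqP; split=> om [? Bo]; split=> //; apply/(h om Bo).
Qed.

Lemma Pr_setC A : measurable A -> Pr (~` A) = 1 - Pr A.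
Proof.
move=> mA; apply: EFin_inj; rewrite EFinB -!PrE //; last exact: measurableC.
exact: probability_setC.
Qed.

Lemma Pr_bigcap_cvg (F : nat -> set Om) : (forall n, measurable (F n)) ->
  (forall n, F n.+1 `<=` F n) -> Pr (F n) @[n --> \oo] --> Pr (\bigcap_n F n).
Proof.
move=> mF Fd; have mI : measurable (\bigcap_n F n) by apply: bigcap_measurable.
apply: fine_cvg; rewrite -PrE //; apply: nonincreasing_cvg_mu => //.
  by apply: le_lt_trans (probability_le1 P (mF 0%N)) (ltry _).
apply/nonincreasing_seqP => n; apply/subsetPset; exact: Fd.
Qed.

Lemma Pr_bigcup_cvg (F : nat -> set Om) : (forall n, measurable (F n)) ->
  (forall n, F n `<=` F n.+1) -> Pr (F n) @[n --> \oo] --> Pr (\bigcup_n F n).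
Proof.
move=> mF Fd; have mI : measurable (\bigcup_n F n) by apply: bigcupT_measurable.
apply: fine_cvg; rewrite -PrE //; apply: nondecreasing_cvg_mu => //.
apply/nondecreasing_seqP => n; apply/subsetPset; exact: Fd.
Qed.

Lemma Pr_bigcup_le (F : nat -> set Om) (a : nat -> R) (b : R) : (forall n, measurable (F n)) ->
  (forall n, Pr (F n) <= a n) -> (forall n, \sum_(i < n) a i <= b) -> Pr (\bigcup_n F n) <= b.
Proof.
move=> mF Fa ab.
pose G n := \bigcup_(i in [set i | (i < n)%N]) F i.
have mG n : measurable (G n) by apply: bigcup_measurable.
have -> : \bigcup_n F n = \bigcup_n G n.
  apply/seteqP; split=> om; first by move=> [n _ Fn]; exists n.+1 => //; exists n => /=.
  by move=> [n _ [i _ Fi]]; exists i.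
have Gle n : Pr (G n) <= b.
  apply: le_trans (ab n); elim: n => [|n IH].
    by rewrite (_ : G 0%N = set0) /Pr ?measure0 ?big_ord0 //; apply/seteqP; split=> om // [i].
  rewrite big_ord_recr /=; apply: le_trans (lerD IH (Fa n)).
  have -> : G n.+1 = G n `|` F n.
    apply/seteqP; split=> om.
      move=> [i /=]; rewrite ltnS leq_eqVlt => /orP[/eqP -> Fn|h Fi]; first by right.
      by left; exists i.
    by move=> [[i /= h Fi]|Fn]; [exists i => //=; apply: ltnW|exists n => /=].
  exact: PrU_le.
have := @Pr_bigcup_cvg G mG; move=> /(_ _)/cvg_lim <- //; last first.
  by move=> n om [i /= h Fi]; exists i => //=; apply: ltnW.
apply: limr_le; last by apply: nearW.
by apply/cvg_ex; eexists; apply: Pr_bigcup_cvg => // n om [i /= h Fi]; exists i => //=; apply: ltnW.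
Qed.

Lemma Pr_bigcup0 (F : nat -> set Om) : (forall n, measurable (F n)) ->
  (forall n, Pr (F n) = 0) -> Pr (\bigcup_n F n) = 0.
Proof.
move=> mF F0; apply/eqP; rewrite eq_le Pr_ge0 andbT.
apply: (@Pr_bigcup_le _ (fun=> 0)) => // n; first by rewrite F0.
by rewrite big1.
Qed.

Lemma countable_nat : countable [set: nat].
Proof. exact: countableP. Qed.

Lemma countable_seq {T : choiceType} : countable [set: T] -> countable [set: seq T].
Proof.
move=> cT; have [h hi] := countable_injP _ cT.
have hi' : injective h by move=> x y; apply: hi; rewrite inE.
apply/countable_injP; exists (fun l : seq T => choice.pickle (map h l : seq nat)) => x y _ _.
by move=> /(pcan_inj choice.pickleK); apply: inj_map.
Qed.

Lemma countable_prod {T U : choiceType} : countable [set: T] -> countable [set: U] ->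
  countable [set: T * U].
Proof. by move=> cT cU; rewrite -setXTT; apply: countableX. Qed.

End Discrete.

(** * Laws of trajectories *)

Section MarkovChain.
Context {R : realType} {T : choiceType} (cT : countable [set: T]).
Context {d : measure_display} {Om : measurableType d}.
Variables (P : probability Om R) (X : nat -> Om -> T).
Local Notation Pr := (Pr P).

Definition hist n om : seq T := mkseq (X^~ om) n.+1.

Lemma hist_eq n om om' : hist n om = hist n om' <-> forall i, (i <= n)%N -> X i om = X i om'.
Proof.
split=> [h i i_n|h].
  have := congr1 (fun l => nth (X 0%N om) l i) h.
  by rewrite !nth_mkseq.
apply: (@eq_from_nth _ (X 0%N om)); rewrite !size_mkseq // => i i_n.
by rewrite !nth_mkseq //; apply: h.
Qed.

(** Events of the first [n] steps, without a filtration: on a countable state space such a set is a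
    countable union of histories, hence measurable. *)
Definition past n (B : set Om) : Prop :=
  forall om om', (forall i, (i <= n)%N -> X i om = X i om') -> B om -> B om'.

Lemma past_le n k B : (n <= k)%N -> past n B -> past k B.
Proof. by move=> nk pB om om' h; apply: pB => i i_n; apply: h; apply: leq_trans nk. Qed.

Lemma pastI n A B : past n A -> past n B -> past n (A `&` B).
Proof. by move=> pA pB om om' h [Ao Bo]; split; [apply: pA Ao|apply: pB Bo]. Qed.

Lemma past_pred n k (S : set T) : (k <= n)%N -> past n [set om | S (X k om)].
Proof. by move=> kn om om' h /=; rewrite h. Qed.

Lemma past_at n k u : (k <= n)%N -> past n [set om | X k om = u].
Proof. by move=> kn om om' h /= <-; rewrite h. Qed.

Lemma pastT n : past n setT.
Proof. by []. Qed.

Hypothesis mX : forall n, dmeas (X n).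

Lemma dmeas_hist n : dmeas (hist n).
Proof. exact: dmeas_mkseq. Qed.

Lemma measurable_past n B : past n B -> measurable B.
Proof.
move=> pB; have -> : B = [set om | (hist n @` B) (hist n om)].
  apply/seteqP; split=> om /=; first by exists om.
  by move=> [om' Bom' /hist_eq h]; apply: pB Bom'.
by apply: dmeas_preimage; [exact: countable_seq|exact: dmeas_hist].
Qed.

Variables (p : T -> T -> R) (o : T).
Hypothesis p0 : forall x y, 0 <= p x y.
Hypothesis law : forall (n : nat) (x : nat -> T),
  P [set om | forall i, (i <= n)%N -> X i om = x i] =
  (if x 0%N == o then \prod_(i < n) p (x i) (x i.+1) else 0)%:E.

Lemma chain_law n (x : nat -> T) : Pr [set om | forall i, (i <= n)%N -> X i om = x i] =
  if x 0%N == o then \prod_(i < n) p (x i) (x i.+1) else 0.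
Proof. by rewrite -fine_Pr law. Qed.

Lemma hist_law n (t : seq T) u v : size t = n.+1 -> nth o t n = u ->
  Pr [set om | hist n om = t /\ X n.+1 om = v] = Pr [set om | hist n om = t] * p u v.
Proof.
move=> st tn.
have -> : [set om | hist n om = t] = [set om | forall i, (i <= n)%N -> X i om = nth o t i].
  apply/seteqP; split=> om /=; first by move=> <- i i_n; rewrite nth_mkseq.
  move=> h; apply: (@eq_from_nth _ o); rewrite size_mkseq // => i i_n.
  by rewrite nth_mkseq //; apply: h.
have -> : [set om | hist n om = t /\ X n.+1 om = v] =
    [set om | forall i, (i <= n.+1)%N -> X i om = nth o (rcons t v) i].
  apply/seteqP; split=> om /=.
    move=> [ht hv] i; rewrite leq_eqVlt => /orP[/eqP ->|i_n].
      by rewrite nth_rcons st ltnn eqxx.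
    by rewrite nth_rcons st i_n -ht nth_mkseq.
  move=> h; split; last by rewrite h // nth_rcons st ltnn eqxx.
  apply: (@eq_from_nth _ o); rewrite size_mkseq // => i i_n.
  rewrite nth_mkseq // h; last exact: ltnW.
  by rewrite nth_rcons st i_n.
rewrite !chain_law nth_rcons st /=; case: ifP => _; last by rewrite mul0r.
rewrite big_ord_recr /=; congr (_ * _); last first.
  by rewrite !nth_rcons st ltnSn ltnn eqxx tn.
apply: eq_bigr => i _; rewrite !nth_rcons st.
have -> : (i < n.+1)%N by rewrite ltnS ltnW.
by have -> : (i.+1 < n.+1)%N by rewrite ltnS.
Qed.

Lemma markov_step n B u v : past n B ->
  Pr (B `&` [set om | X n om = u] `&` [set om | X n.+1 om = v]) =
  Pr (B `&` [set om | X n om = u]) * p u v.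
Proof.
move=> pB; set A := B `&` _.
have pA : past n A by apply: pastI => //; apply: past_at.
have mA := measurable_past pA.
have mAv : measurable (A `&` [set om | X n.+1 om = v]) by apply: measurableI => //; exact: mX.
apply: EFin_inj; rewrite EFinM -!PrE //.
have cs : countable [set: seq T] by apply: countable_seq.
rewrite (total_probability P cs (dmeas_hist n)) //.
rewrite (total_probability P cs (dmeas_hist n) mA) muleC.
rewrite -esumZl; [|exact: p0|by move=> t; apply: measure_ge0].
apply: eq_esum => t _.
have [[om [Ao ht]]|nA] := pselect (exists om, A om /\ hist n om = t); last first.
  have -> : A `&` [set om | hist n om = t] = set0.
    by apply/seteqP; split=> om // [Ao ht]; apply: nA; exists om.
  have -> : A `&` [set om | X n.+1 om = v] `&` [set om | hist n om = t] = set0.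
    by apply/seteqP; split=> om // [[Ao _] ht]; apply: nA; exists om.
  by rewrite !measure0 mule0.
have AE om' : hist n om' = t -> A om'.
  by rewrite -ht => h; apply: pA Ao => i i_n; apply: esym; move: i i_n; apply/hist_eq.
have -> : A `&` [set om | hist n om = t] = [set om | hist n om = t].
  by apply/seteqP; split=> om' /=; [case|move=> h; split=> //; apply: AE].
have -> : A `&` [set om | X n.+1 om = v] `&` [set om | hist n om = t] =
    [set om | hist n om = t /\ X n.+1 om = v].
  apply/seteqP; split=> om' /=; first by case=> -[].
  by move=> [h1 h2]; split=> //; split=> //; apply: AE.
rewrite !PrE; first 1 last.
- exact: dmeas_hist.
- have -> : [set om | hist n om = t /\ X n.+1 om = v] =
    [set om | hist n om = t] `&` [set om | X n.+1 om = v] by [].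
  by apply: measurableI; [apply: dmeas_hist|exact: mX].
rewrite (@hist_law n t u) ?EFinM 1?muleC //; first by rewrite -ht size_mkseq.
by rewrite -ht nth_mkseq //; have [_] := Ao.
Qed.

End MarkovChain.

(** * Events on the space of trajectories *)

Section Sequences.
Context {T : choiceType} (x0 : T) (cT : countable [set: T]).

Definition cylinder (l : seq T) : set (nat -> T) :=
  [set y | forall i, (i < size l)%N -> y i = nth x0 l i].
Definition cylinders : set (set (nat -> T)) := [set E | E = set0 \/ exists l, E = cylinder l].
(** Last entry times look at the whole future, so laws of trajectories have to be compared on the
    sigma-algebra generated by the cylinders and not on cylinders only. *)
Definition seqm : set (set (nat -> T)) := <<s setT, cylinders >>.

Lemma cylindersI : setI_closed cylinders.
Proof.
suff H l l' : (size l <= size l')%N -> cylinders (cylinder l `&` cylinder l').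
  move=> E E' [->|[l ->]]; first by move=> _; rewrite set0I; left.
  move=> [->|[l' ->]]; first by rewrite setI0; left.
  by case/orP: (leq_total (size l) (size l')) => h; [|rewrite setIC]; apply: H.
move=> sl; have [h|h] := pselect (forall i, (i < size l)%N -> nth x0 l i = nth x0 l' i).
  right; exists l'; apply/seteqP; split=> y; first by case.
  by move=> h'; split=> // i il; rewrite h // h' // (leq_trans il).
left; apply/seteqP; split=> y // -[h1 h2]; apply: h => i il; rewrite -h1 // h2 //.
exact: leq_trans sl.
Qed.

Lemma seqm0 : seqm set0. Proof. by have [] := smallest_sigma_algebra setT cylinders. Qed.
Lemma seqmC E : seqm E -> seqm (~` E).
Proof. by move=> h; rewrite -setTD; have [_ H _] := smallest_sigma_algebra setT cylinders; apply: H. Qed.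
Lemma seqm_bigcup (E : nat -> set (nat -> T)) : (forall i, seqm (E i)) -> seqm (\bigcup_i E i).
Proof. by move=> h; have [_ _ H] := smallest_sigma_algebra setT cylinders; apply: H. Qed.
Lemma seqm_bigcap (E : nat -> set (nat -> T)) : (forall i, seqm (E i)) -> seqm (\bigcap_i E i).
Proof.
move=> h; rewrite -[X in seqm X]setCK setC_bigcap; apply: seqmC; apply: seqm_bigcup => i.
exact: seqmC.
Qed.
Lemma seqm_all (E : nat -> set (nat -> T)) : (forall i, seqm (E i)) ->
  seqm [set y | forall i, E i y].
Proof.
by move=> h; rewrite (_ : [set _ | _] = \bigcap_i E i) ?bigcapT_set //;
  [apply: seqm_bigcap|apply/seteqP; split=> y hy i //; apply: hy].
Qed.
Lemma seqm_ex (E : nat -> set (nat -> T)) : (forall i, seqm (E i)) ->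
  seqm [set y | exists i, E i y].
Proof.
by move=> h; rewrite (_ : [set _ | _] = \bigcup_i E i);
  [apply: seqm_bigcup|apply/seteqP; split=> y [i]; [exists i|move=> _; exists i]].
Qed.
Lemma seqmT : seqm setT. Proof. by rewrite -setC0; apply: seqmC; apply: seqm0. Qed.
Lemma seqm_cst (Q : Prop) : seqm [set y | Q].
Proof.
have [q|q] := pselect Q; first by rewrite (_ : [set _ | _] = setT); [exact: seqmT|apply/seteqP; split].
by rewrite (_ : [set _ | _] = set0); [exact: seqm0|apply/seteqP; split].
Qed.
Lemma seqmI E F : seqm E -> seqm F -> seqm (E `&` F).
Proof.
move=> hE hF; rewrite (_ : E `&` F = [set y | forall i : nat, (if i is 0 then E else F) y]).
  by apply: seqm_all => -[].
apply/seteqP; split=> y; first by move=> [h h'] [|i].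
by move=> h; split; [apply: (h 0%N)|apply: (h 1%N)].
Qed.
Lemma seqm_imp (Q : Prop) E : seqm E -> seqm [set y | Q -> E y].
Proof.
move=> h; have [q|q] := pselect Q.
  by rewrite (_ : [set y | _] = E) //; apply/seteqP; split=> y /= hy; first exact: hy.
by rewrite (_ : [set _ | _] = setT); [exact: seqmT|apply/seteqP; split=> // y _ /q].
Qed.
Lemma seqm_cylinder l : seqm (cylinder l).
Proof. by apply: sub_sigma_algebra; right; exists l. Qed.
Lemma seqm_count {U : choiceType} (cU : countable [set: U]) (E : U -> set (nat -> T)) :
  (forall u, seqm (E u)) -> seqm [set y | exists u, E u y].
Proof.
move=> h; have /countable_injP [f finj] := cU.
have fi x y : f x = f y -> x = y by apply: finj; rewrite inE.
rewrite (_ : [set _ | _] = [set y | exists n, [set y | exists2 u, f u = n & E u y] y]).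
  apply: seqm_ex => n; have [[u un]|no] := pselect (exists u, f u = n).
    rewrite (_ : [set _ | _] = E u) //; apply/seteqP; split=> y /= => [[u' u'n]|Eu].
      by rewrite (fi u u') // u'n.
    by exists u.
  rewrite (_ : [set _ | _] = set0); first exact: seqm0.
  by apply/seteqP; split=> y //= [u un]; case: no; exists u.
apply/seteqP; split=> y /= => [[u Eu]|[n [u _ Eu]]]; last by exists u.
by exists (f u), u.
Qed.
Lemma seqm_pred i (S : set T) : seqm [set y | S (y i)].
Proof.
rewrite (_ : [set _ | _] = [set y | exists l, [set y | (size l = i.+1 /\ S (nth x0 l i)) /\ cylinder l y] y]).
  apply: (seqm_count (countable_seq cT)) => l.
  exact: seqmI (seqm_cst _) (seqm_cylinder l).
apply/seteqP; split=> y /= => [Sy|[l [[sl Sl]]]]; last by move=> /(_ i); rewrite sl => ->.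
exists (mkseq y i.+1); rewrite size_mkseq nth_mkseq //; split=> // j; rewrite size_mkseq => ji.
by rewrite nth_mkseq.
Qed.

Context {R : realType} {d : measure_display} {Om : measurableType d} (P : probability Om R).

Lemma seqm_preimage (Y : nat -> Om -> T) E : (forall i, dmeas (Y i)) -> seqm E ->
  measurable [set om | E (Y ^~ om)].
Proof.
move=> mY; suff : seqm `<=` [set E | measurable [set om | E (Y ^~ om)]] by apply.
apply: smallest_sub; first split=> /=.
- by rewrite (_ : [set om | _] = set0) //; apply/seteqP; split.
- move=> E' h; rewrite (_ : [set om | _] = ~` [set om | E' (Y ^~ om)]); first exact: measurableC.
  by apply/seteqP; split=> om // [].
- move=> F h; rewrite (_ : [set om | _] = \bigcup_k [set om | F k (Y ^~ om)]) //.
  exact: bigcupT_measurable.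
move=> E' [->|[l ->]] /=; first by rewrite (_ : [set om | _] = set0) //; apply/seteqP; split.
rewrite (_ : [set om | _] = \bigcap_(i in `I_(size l)) [set om | Y i om = nth x0 l i]).
  by apply: fin_bigcap_measurable => [|i _]; [exact: finite_II|exact: mY].
by apply/seteqP; split=> om h i; apply: h.
Qed.

(** Dynkin's lambda-system theorem, as cylinders are stable under intersection. The factors [c] and
    [c'] let conditional laws be compared in cross-multiplied form, whatever the conditioning events
    weigh. *)
Lemma eq_law (Y Y' : nat -> Om -> T) (B B' : set Om) (c c' : R) E :
  (forall i, dmeas (Y i)) -> (forall i, dmeas (Y' i)) -> measurable B -> measurable B' ->
  (forall l, c * Pr P (B `&` [set om | cylinder l (Y ^~ om)]) =
             c' * Pr P (B' `&` [set om | cylinder l (Y' ^~ om)])) ->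
  seqm E ->
  c * Pr P (B `&` [set om | E (Y ^~ om)]) = c' * Pr P (B' `&` [set om | E (Y' ^~ om)]).
Proof.
move=> mY mY' mB mB' hc.
pose H : set (set (nat -> T)) := [set E | seqm E /\
  c * Pr P (B `&` [set om | E (Y ^~ om)]) = c' * Pr P (B' `&` [set om | E (Y' ^~ om)])].
suff HH : <<s setT, cylinders >> `<=` H by move=> /HH [].
have mE E' : seqm E' -> measurable (B `&` [set om | E' (Y ^~ om)]).
  by move=> h; apply: measurableI => //; apply: seqm_preimage.
have mE' E' : seqm E' -> measurable (B' `&` [set om | E' (Y' ^~ om)]).
  by move=> h; apply: measurableI => //; apply: seqm_preimage.
apply: (lambda_system_subset cylindersI) => //; last first.
  move=> E' [->|[l ->]]; last by split; [exact: seqm_cylinder|exact: hc].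
  split; first exact: seqm0.
  have e F : F `&` [set om : Om | False] = set0 by apply/seteqP; split=> om [].
  by rewrite /set0 /mkset !e !Pr_set0 /= !mulr0.
split=> //.
- split; first exact: seqmT.
  have := hc [::]; suff -> : cylinder [::] = setT by [].
  by apply/seteqP; split.
- move=> E1 E2 sub [s1 h1] [s2 h2].
  have sD : seqm (E1 `\` E2) by rewrite setDE; apply: seqmI => //; apply: seqmC.
  split=> //.
  have key F (Z : nat -> Om -> T) (mF : forall E', seqm E' -> measurable (F `&` [set om | E' (Z ^~ om)])) :
      Pr P (F `&` [set om | (E1 `\` E2) (Z ^~ om)]) =
      Pr P (F `&` [set om | E1 (Z ^~ om)]) - Pr P (F `&` [set om | E2 (Z ^~ om)]).
    rewrite (_ : F `&` [set om | E1 (Z ^~ om)] =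
      (F `&` [set om | E2 (Z ^~ om)]) `|` (F `&` [set om | (E1 `\` E2) (Z ^~ om)])).
      rewrite Pr_disj; [by rewrite addrC addKr|exact: mF|exact: mF|].
      by apply/seteqP; split=> om // [[_ h] [_ [_]]].
    apply/seteqP; split=> om /= => [[Fo E1o]|[[Fo E2o]|[Fo [E1o _]]]].
    - by have [h|h] := pselect (E2 (Z ^~ om)); [left|right].
    - by split=> //; apply: sub.
    - by [].
  by rewrite (key _ _ mE) (key _ _ mE') !mulrBr h1 h2.
- move=> F ndF hF; have sF k : seqm (F k) by have [] := hF k.
  split; first exact: seqm_bigcup.
  have key X (Z : nat -> Om -> T) (mF : forall E', seqm E' -> measurable (X `&` [set om | E' (Z ^~ om)])) a :
      a * Pr P (X `&` [set om | F k (Z ^~ om)]) @[k --> \oo] -->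
      a * Pr P (X `&` [set om | (\bigcup_k F k) (Z ^~ om)]).
    apply: cvgMr; rewrite (_ : X `&` [set om | _] = \bigcup_k (X `&` [set om | F k (Z ^~ om)])).
      apply: Pr_bigcup_cvg => k; first exact: mF.
      move=> om [Xo Fo]; split=> //; have /subsetPset : (F k <= F k.+1)%O by apply: ndF.
      by apply.
    by rewrite -setI_bigcupr.
  apply: cvgn_uniq (key _ _ mE c) _; have := key _ _ mE' c'.
  by apply: cvg_trans; apply: near_eq_cvg; near=> k; have [_ ->] := hF k.
Unshelve. all: by end_near.
Qed.

End Sequences.

Section DiscreteMore.
Context {R : realType} {d : measure_display} {Om : measurableType d} (P : probability Om R).

Lemma dmeas_at {T : Type} (f : nat -> Om -> T) (N : Om -> nat) : dmeas N -> (forall n, dmeas (f n)) ->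
  dmeas (fun om => f (N om) om).
Proof.
move=> mN mf t; rewrite (_ : [set om | _] = \bigcup_n ([set om | N om = n] `&` [set om | f n om = t])).
  by apply: bigcupT_measurable => n; apply: measurableI; [exact: mN|exact: mf].
by apply/seteqP; split=> om /= => [h|[n _ [<-]]] //; exists (N om).
Qed.

(** Summation over the values of an auxiliary variable; Markov properties at random times are proved
    by it, one value at a time. *)
Lemma Pr_total_eq {T : choiceType} (cT : countable [set: T]) (f f' : Om -> T) (E E' : set Om) (c : R) :
  0 <= c -> dmeas f -> dmeas f' -> measurable E -> measurable E' ->
  (forall t, Pr P (E `&` [set om | f om = t]) = Pr P (E' `&` [set om | f' om = t]) * c) ->
  Pr P E = Pr P E' * c.
Proof.
move=> c0 mf mf' mE mE' h; apply: EFin_inj; rewrite mulrC EFinM -!PrE //.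
rewrite (total_probability P cT mf mE) (total_probability P cT mf' mE') -esumZl //.
apply: eq_esum => t _; rewrite !PrE; last 2 first.
- by apply: measurableI => //; apply: mf'.
- by apply: measurableI => //; apply: mf.
by rewrite h mulrC.
Qed.

End DiscreteMore.

(** * Laws of large numbers *)

Section LawOfLargeNumbers.
Context {R : realType} {d : measure_display} {Om : measurableType d} (P : probability Om R).
Local Notation Pr := (Pr P).

(** [Q] itself may be non-measurable; it suffices that it contains a measurable set of full
    measure. *)
Definition asure (Q : set Om) : Prop := exists E, [/\ measurable E, Pr (~` E) = 0 & E `<=` Q].

Lemma asure_mono (Q Q' : set Om) : Q `<=` Q' -> asure Q -> asure Q'.
Proof. by move=> QQ [E [h1 h2 h3]]; exists E; split=> // om /h3 /QQ. Qed.

Lemma asure_all (Q : nat -> set Om) : (forall n, asure (Q n)) -> asure [set om | forall n, Q n om].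
Proof.
move=> /choice [E hE]; exists (\bigcap_n E n); split.
- by apply: bigcapT_measurable => n; case: (hE n).
- rewrite setC_bigcap; apply: Pr_bigcup0 => n; case: (hE n) => // mE _ _; exact: measurableC.
by move=> om h n; case: (hE n) => _ _; apply; apply: h.
Qed.

Lemma asureI (Q Q' : set Om) : asure Q -> asure Q' -> asure (Q `&` Q').
Proof.
move=> h h'; apply: (@asure_mono [set om | forall n : nat, (if n is 0 then Q else Q') om]).
  by move=> om h0; split; [apply: (h0 0%N)|apply: (h0 1%N)].
by apply: (asure_all (Q := fun n : nat => if n is 0 then Q else Q')) => -[].
Qed.

Lemma asure_meas (Q : set Om) : measurable Q -> Pr (~` Q) = 0 -> asure Q.
Proof. by move=> mQ h; exists Q; split. Qed.

Lemma integral_indics (I : Type) (r : seq I) (a : I -> R) (B : I -> set Om) :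
  (forall i, 0 <= a i) -> (forall i, measurable (B i)) ->
  (\int[P]_om (\sum_(i <- r) a i * \1_(B i) om)%:E = (\sum_(i <- r) a i * Pr (B i))%:E)%E.
Proof.
move=> a0 mB; rewrite -sumEFin.
under eq_integral do rewrite -sumEFin.
rewrite ge0_integral_sum //; last 2 first.
- move=> i; apply/measurable_EFinP; apply: measurable_funM => //; exact: measurable_indic.
- by move=> i om _; rewrite lee_fin mulr_ge0.
apply: eq_bigr => i _; under eq_integral do rewrite EFinM.
rewrite ge0_integralZl_EFin //; last by apply/measurable_EFinP; exact: measurable_indic.
by rewrite (EFinM (a i)); congr (_ * _)%E; rewrite integral_indic // setIT; apply: PrE.
Qed.

(** The expectation of a pointwise inequality between step functions, in a form that keeps counting
    arguments inside finite sums. *)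
Lemma Pr_indic_le (I J : Type) (r : seq I) (r' : seq J) (a : I -> R) (b : J -> R)
    (A : I -> set Om) (B : J -> set Om) :
  (forall i, 0 <= a i) -> (forall j, 0 <= b j) ->
  (forall i, measurable (A i)) -> (forall j, measurable (B j)) ->
  (forall om, \sum_(i <- r) a i * \1_(A i) om <= \sum_(j <- r') b j * \1_(B j) om) ->
  \sum_(i <- r) a i * Pr (A i) <= \sum_(j <- r') b j * Pr (B j).
Proof.
move=> a0 b0 mA mB h; rewrite -lee_fin -!integral_indics //.
have mf (K : Type) (t : seq K) (c : K -> R) (F : K -> set Om) : (forall i, measurable (F i)) ->
    measurable_fun setT (fun om => (\sum_(i <- t) c i * \1_(F i) om)%:E).
  move=> mF; apply/measurable_EFinP; apply: measurable_sum => i.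
  apply: measurable_funM => //; exact: measurable_indic.
apply: ge0_le_integral => //; try exact: mf.
- by move=> om _; rewrite lee_fin; apply: sumr_ge0 => i _; rewrite mulr_ge0.
- by move=> om _; rewrite lee_fin; apply: h.
Qed.

Lemma Pr_le_sum (I : finType) (Q : pred I) (F : I -> set Om) E : measurable E ->
  (forall i, measurable (F i)) -> (forall om, E om -> exists2 i, Q i & F i om) ->
  Pr E <= \sum_(i | Q i) Pr (F i).
Proof.
move=> mE mF h; have := @Pr_indic_le unit I [:: tt] (enum Q) (fun=> 1) (fun=> 1) (fun=> E) F.
rewrite big_seq1 mul1r big_enum_cond /= => H.
apply: le_trans (H _ _ _ _ _) _ => // [om|]; last first.
  by rewrite le_eqVlt; apply/orP; left; apply/eqP/eq_big => [i|i _]; rewrite ?mul1r // andbT.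
rewrite big_seq1 mul1r big_enum_cond /= indicE; have [/[1!inE] Eo|_] := boolP (om \in E); last first.
  by apply: sumr_ge0 => i _; rewrite mulr_ge0.
have [i Qi Fi] := h om Eo; rewrite (bigD1 i) ?inE ?andbT //= mul1r indicE mem_set //.
by rewrite lerDl; apply: sumr_ge0 => j _; rewrite mulr_ge0.
Qed.

Lemma borel_cantelli (F : nat -> set Om) (C r : R) : 0 <= C -> 0 <= r < 1 ->
  (forall n, measurable (F n)) -> (forall n, Pr (F n) <= C * r ^+ n) ->
  asure [set om | exists n0, forall n, (n0 <= n)%N -> ~ F n om].
Proof.
move=> C0 /andP[r0 r1] mF hF.
pose U n0 := \bigcup_j F (n0 + j)%N.
have mU n : measurable (U n) by apply: bigcupT_measurable.
have PU n : Pr (U n) <= C / (1 - r) * r ^+ n.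
  apply: (@Pr_bigcup_le _ _ _ P _ (fun j => C * r ^+ n * r ^+ j)) => // [j|j].
    by apply: le_trans (hF _) _; rewrite exprD mulrA.
  rewrite -mulr_sumr mulrAC; apply: ler_wpM2r; first by rewrite exprn_ge0.
  apply: ler_wpM2l => //; have q0 : 0 < 1 - r by rewrite subr_gt0.
  have -> : \sum_(i < j) r ^+ i = (1 - r ^+ j) / (1 - r).
    apply: (mulIf (lt0r_neq0 q0)); rewrite divfK ?lt0r_neq0 //.
    by have h := subrX1 r j; rewrite -[RHS]opprB h; ring.
  by rewrite ler_pdivrMr // mulVf ?lt0r_neq0 // lerBlDr lerDl exprn_ge0.
exists (~` \bigcap_n U n); split.
- by apply: measurableC; apply: bigcapT_measurable.
- rewrite setCK; apply/eqP; rewrite eq_le Pr_ge0 andbT.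
  have cv : C / (1 - r) * r ^+ n @[n --> \oo] --> (0 : R).
    rewrite -[X in _ --> X](mulr0 (C / (1 - r))); apply: cvgMr.
    by apply: cvg_expr; rewrite ger0_norm.
  apply: (cvgn_ge cv); exists 0%N => // n _ /=; apply: le_trans (PU n).
  apply: le_Pr => //; first exact: bigcapT_measurable.
  by move=> om; apply.
move=> om h; apply: contrapT => no; apply: h => n _; apply: contrapT => h'; apply: no.
exists n => k nk Fk; apply: h'; exists (k - n)%N => //; by rewrite subnKC.
Qed.

(** [expR x] is at most [1 / (1 - x)], and [(1 + x + 2 * x ^+ 2) * (1 - x)] equals
    [1 + x ^+ 2 * (1 - 2 * x)], which is at least [1] here. *)
Lemma expR_le_quad (x : R) : x <= 2^-1 -> expR x <= 1 + x + 2 * x ^+ 2.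
Proof.
move=> hx; have h1 : 1 - x <= expR (- x) by have := expR_ge1Dx (- x).
have h2 : 0 < 1 - x by lra.
have h3 : expR x * (1 - x) <= 1.
  apply: le_trans (ler_wpM2l (expR_ge0 x) h1) _.
  by rewrite -expRD subrr expR0.
rewrite -(ler_pM2r h2); apply: le_trans h3 _.
have : 0 <= x ^+ 2 * (1 - 2 * x) by apply: mulr_ge0; [exact: sqr_ge0|lra].
nra.
Qed.

Section Bounded.
Variables (M : nat) (Y : nat -> Om -> nat) (p : nat -> R).
Hypothesis mY : forall n, dmeas (Y n).
Hypothesis YM : forall n om, (Y n om <= M)%N.
Hypothesis p0 : forall k, 0 <= p k.
Hypothesis p1 : \sum_(k < M.+1) p k = 1.
Hypothesis lawY : forall n (f : {ffun 'I_n -> 'I_M.+1}),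
  Pr [set om | forall i : 'I_n, Y i om = f i] = \prod_(i < n) p (f i).
Let mu : R := \sum_(k < M.+1) k%:R * p k.

Let mu_ge0 : 0 <= mu.
Proof. by apply: sumr_ge0 => k _; rewrite mulr_ge0. Qed.
Let mu_le : mu <= M%:R.
Proof.
apply: (@le_trans _ _ (\sum_(k < M.+1) M%:R * p k)); last by rewrite -mulr_sumr p1 mulr1.
by apply: ler_sum => k _; apply: ler_wpM2r => //; rewrite ler_nat -ltnS.
Qed.

Let bad sg e n : set Om := [set om | n%:R * e <= sg * (\sum_(i < n) (Y i om)%:R - n%:R * mu)].

Let bad_meas sg e n : measurable (bad sg e n).
Proof.
have h := dmeas_mkseq n mY.
have := dmeas_preimage (countable_seq countable_nat)
  (fun l : seq nat => n%:R * e <= sg * (\sum_(i < n) (nth 0%N l i)%:R - n%:R * mu)) h.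
congr measurable; apply/seteqP; split=> om /=.
  by under eq_bigr do rewrite nth_mkseq //.
by under [X in _ -> _ <= sg * (X - _)]eq_bigr do rewrite nth_mkseq //.
Qed.

Lemma chernoff (sg e : R) : `|sg| = 1 -> 0 < e -> exists2 r : R, 0 <= r < 1 &
  forall n, Pr (bad sg e n) <= r ^+ n.
Proof.
move=> sg1 e0; have sg2 : sg ^+ 2 = 1 by rewrite -real_normK ?num_real // sg1 expr1n.
have M1 : 0 < M.+1%:R :> R by rewrite ltr0n.
(* The first bound keeps the exponent below [1 / 2], where the quadratic estimate holds; the second
   makes the quadratic term at most half of the gain [la * e]. *)
pose la : R := Num.min (2^-1 / M.+1%:R) (e / (4 * M.+1%:R ^+ 2)).
have la0 : 0 < la by rewrite lt_min !divr_gt0 // mulr_gt0 // exprn_gt0.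
have la1 : la * M.+1%:R <= 2^-1 by rewrite -ler_pdivlMr // ge_min lexx.
have la2 : la * (4 * M.+1%:R ^+ 2) <= e.
  by rewrite -ler_pdivlMr ?mulr_gt0 ?exprn_gt0 // ge_min lexx orbT.
pose x : R := 2 * la ^+ 2 * M.+1%:R ^+ 2 - la * e.
have x0 : x < 0.
  rewrite /x; have := ler_wpM2l (ltW la0) la2; have : 0 < la * e by rewrite mulr_gt0.
  nra.
exists (expR x) => [|n]; first by rewrite expR_ge0 expR_lt1.
pose h (k : nat) : R := expR (la * (sg * (k%:R - mu))).
have hh : \sum_(k < M.+1) p k * h k <= expR (2 * la ^+ 2 * M.+1%:R ^+ 2).
  have -> : expR (2 * la ^+ 2 * M.+1%:R ^+ 2) = expR (x + la * e) by congr expR; rewrite /x; ring.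
  apply: le_trans (expR_ge1Dx _); rewrite /x subrK.
  apply: (@le_trans _ _ (\sum_(k < M.+1) (p k + la * sg * (k%:R * p k - mu * p k) + 2 * la ^+ 2 * M.+1%:R ^+ 2 * p k))).
    apply: ler_sum => k _; have kM : k%:R <= M%:R :> R by rewrite ler_nat -ltnS.
    have k0 : 0 <= k%:R :> R by [].
    have MM : M.+1%:R = M%:R + 1 :> R by rewrite -addn1 natrD.
    set t := sg * (k%:R - mu); have t2 : t ^+ 2 <= M.+1%:R ^+ 2.
      rewrite /t exprMn sg2 mul1r MM; have := mu_ge0; have := mu_le; nra.
    have t1 : t <= M.+1%:R.
      apply: le_trans (ler_norm _) _; rewrite -ler_sqr ?nnegrE // real_normK ?num_real //.
    have lt : la * t <= 2^-1 by apply: le_trans la1; apply: ler_wpM2l => //; exact: ltW.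
    have q1 := expR_le_quad lt; have q2 := ler_wpM2l (p0 k) q1.
    apply: le_trans q2 _; have q3 : la ^+ 2 * t ^+ 2 <= la ^+ 2 * M.+1%:R ^+ 2.
      by apply: ler_wpM2l => //; exact: sqr_ge0.
    have q4 := ler_wpM2l (p0 k) q3; rewrite exprMn.
    have -> : la * sg * (k%:R * p k - mu * p k) = p k * (la * t) by rewrite /t; ring.
    have -> : 2 * la ^+ 2 * M.+1%:R ^+ 2 * p k = 2 * (p k * (la ^+ 2 * M.+1%:R ^+ 2)) by ring.
    lra.
  rewrite !big_split /= -!mulr_sumr p1 sumrB -mulr_sumr p1 -/mu !mulr1 subrr mulr0 addr0.
  lra.
pose Q (f : {ffun 'I_n -> 'I_M.+1}) := n%:R * e <= sg * (\sum_(i < n) (f i)%:R - n%:R * mu).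
have mF (f : {ffun 'I_n -> 'I_M.+1}) : measurable [set om | forall i : 'I_n, Y i om = f i].
  rewrite (_ : [set om | _] = \bigcap_(i in [set: 'I_n]) [set om | Y i om = f i]).
    by apply: fin_bigcap_measurable => [|i _]; [exact: finite_finset|exact: mY].
  by apply/seteqP; split=> om H i => [_|]; apply: H.
apply: le_trans (Pr_le_sum (Q := Q) (bad_meas sg e n) mF _) _.
  move=> om b; exists [ffun i : 'I_n => inord (Y i om)].
    rewrite /Q; under eq_bigr do rewrite ffunE inordK ?ltnS //.
    exact: b.
  by move=> i; rewrite ffunE inordK // ltnS.
apply: (@le_trans _ _ (\sum_(f : {ffun 'I_n -> 'I_M.+1}) (\prod_i (p (f i) * h (f i))) * expR (- (la * (n%:R * e))))).
  rewrite [leRHS](bigID Q) /= -[leLHS]addr0; apply: lerD; last first.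
    by apply: sumr_ge0 => f _; rewrite mulr_ge0 ?expR_ge0 // prodr_ge0 // => i _; rewrite mulr_ge0 // expR_ge0.
  apply: ler_sum => f Qf; rewrite lawY big_split /= -mulrA.
  rewrite -[leLHS]mulr1; apply: ler_wpM2l; first by apply: prodr_ge0.
  rewrite /h -expR_sum -expRD -[leLHS]expR0 ler_expR -mulr_sumr -mulr_sumr -mulrBr mulr_ge0 //; first exact: ltW.
  by rewrite subr_ge0 sumrB sumr_const card_ord -[mu *+ n]mulr_natl; apply: Qf.
rewrite -mulr_suml -(bigA_distr_bigA (fun (i : 'I_n) (k : 'I_M.+1) => p k * h k)).
rewrite prodr_const card_ord.
apply: (@le_trans _ _ (expR (2 * la ^+ 2 * M.+1%:R ^+ 2) ^+ n * expR (- (la * (n%:R * e))))).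
  apply: ler_wpM2r; first exact: expR_ge0.
  apply: lerXn2r => //; rewrite nnegrE; last exact: expR_ge0.
  by apply: sumr_ge0 => k _; rewrite mulr_ge0 // expR_ge0.
rewrite -!expRM_natl -expRD ler_expR le_eqVlt; apply/orP; left; apply/eqP; rewrite /x; ring.
Qed.

Lemma slln_bounded : asure [set om | (\sum_(i < n) (Y i om)%:R) / n%:R @[n --> \oo] --> mu].
Proof.
have H sg k : `|sg| = 1 -> asure [set om | exists n0, forall n, (n0 <= n)%N -> ~ bad sg (k.+1%:R^-1) n om].
  move=> sg1; have k0 : 0 < k.+1%:R^-1 :> R by rewrite invr_gt0.
  have [r r01 rP] := chernoff sg1 k0.
  have mb n : measurable (bad sg k.+1%:R^-1 n) := bad_meas sg k.+1%:R^-1 n.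
  apply: (borel_cantelli (C := 1) ler01 r01 mb) => n.
  by rewrite mul1r.
have H1 := asure_all (fun k => H 1 k (normr1 R)).
have H2 := asure_all (fun k => H (-1) k (ltac:(by rewrite normrN1))).
apply: asure_mono (asureI H1 H2) => om [h1 h2] /=.
apply/cvgrPdist_lt => e e0.
have [k ke] : exists k : nat, k.+1%:R^-1 < e.
  exists (Num.truncn e^-1); rewrite invf_plt ?posrE //; exact: truncnS_gt.
have [n1 n1P] := h1 k; have [n2 n2P] := h2 k.
exists (maxn n1 n2).+1 => // n /=; rewrite gtn_max => /andP[a b].
have n0 : 0 < n%:R :> R by rewrite ltr0n (leq_trans _ a).
have := n1P n (ltnW a); have := n2P n (ltnW b); rewrite /bad /= => /negP; rewrite -ltNge => q1 /negP.
rewrite -ltNge => q2; apply: lt_trans ke.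
set S := \sum_(i < n) _ in q1 q2 *; have : n%:R * (S / n%:R) = S by rewrite mulrC divfK ?lt0r_neq0.
move: (S / n%:R) => y yE; rewrite mul1r in q2; rewrite mulN1r opprB in q1.
rewrite ltr_norml; apply/andP; split; rewrite -(ltr_pM2l n0) mulrBr yE //.
by rewrite mulrN ltrNl opprB.
Qed.

End Bounded.
End LawOfLargeNumbers.

Lemma asureP {R : realType} {d : measure_display} {Om : measurableType d} (P : probability Om R)
    (Q : set Om) : asure P Q <-> {ae P, forall om, Q om}.
Proof.
split=> [[E [mE E0 EQ]]|[E [mE E0 QE]]].
  exists (~` E); split; first exact: measurableC.
    by rewrite -(fineK (fin_num_measure P _ (measurableC mE))) -/(Pr P _) E0.
  by move=> om /= nQ Eom; exact/nQ/EQ.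
exists (~` E); split; first exact: measurableC.
  by rewrite setCK /Pr E0.
by move=> om nE; apply: contrapT => nQ; exact/nE/QE.
Qed.

(** Scan from the left: an index that is not bad is skipped, a bad one is covered by the interval of
    length at most [K] that it comes with, on which [la] times the length is dominated by the sum of
    [a]. The intervals are disjoint and the last one overruns by at most [K]. *)
Lemma rising_sun {R : realType} (a : nat -> R) (la : R) (bad : nat -> bool) K n :
  (forall i, 0 <= a i) -> 0 <= la ->
  (forall j, bad j -> exists k, (0 < k <= K)%N /\ la * k%:R <= \sum_(j <= l < j + k) a l) ->
  forall i, la * \sum_(i <= j < i + n) (bad j)%:R <= \sum_(i <= l < i + n + K) a l.
Proof.
move=> a0 la0 badP; have s0 i j : 0 <= \sum_(i <= l < j) a l by apply: sumr_ge0.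
elim/ltn_ind: n => n IH i; case: n IH => [|n] IH.
  by rewrite addn0 big_geq // mulr0.
have [bi|nb] := boolP (bad i); last first.
  rewrite big_ltn; last by rewrite addnS ltnS leq_addr.
  rewrite (negbTE nb) add0r -addSnnS [leRHS]big_ltn; last by rewrite !addSn ltnS -addnA leq_addr.
  apply: le_trans (IH n (ltnSn n) i.+1) _.
  by rewrite lerDr.
have [k [/andP[k0 kK] hk]] := badP i bi.
have [kn|nk] := leqP k n.+1.
  have e1 : (i + n.+1 = i + k + (n.+1 - k))%N by rewrite -addnA subnKC.
  have l1 : (i <= i + k)%N by rewrite leq_addr.
  rewrite {1}e1 (@big_cat_nat _ _ _ (i + k)) ?leq_addr //=.
  rewrite [leRHS](@big_cat_nat _ _ _ (i + k)) //=; last by rewrite e1 -addnA leq_addr.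
  rewrite mulrDr; apply: lerD.
    apply: le_trans hk; apply: ler_wpM2l => //.
    apply: (@le_trans _ _ (\sum_(i <= j < i + k) 1)).
      by apply: ler_sum => j _; case: (bad j).
    by rewrite sumr_const_nat addKn.
  rewrite {1}e1; apply: (IH (n.+1 - k)%N).
  by rewrite ltn_subrL k0.
apply: (@le_trans _ _ (la * k%:R)).
  apply: ler_wpM2l => //; apply: (@le_trans _ _ (\sum_(i <= j < i + n.+1) 1)).
    by apply: ler_sum => j _; case: (bad j).
  by rewrite sumr_const_nat addKn ler_nat ltnW.
apply: le_trans hk _; rewrite [leRHS](@big_cat_nat _ _ _ (i + k)) ?leq_addr //=.
  by rewrite lerDl.
by rewrite -addnA leq_add2l (leq_trans kK) // leq_addl.
Qed.

(** * The strong law for nonnegative integrable iid variables *)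

Section StrongLaw.
Context {R : realType} {d : measure_display} {Om : measurableType d} (P : probability Om R).
Local Notation Pr := (Pr P).
Local Notation asure := (asure P).

Definition iid (Z : nat -> Om -> nat) (g : nat -> R) : Prop :=
  (forall n, dmeas (Z n)) /\
  forall l : seq nat, Pr [set om | forall i, (i < size l)%N -> Z i om = nth 0%N l i] =
    \prod_(x <- l) g x.

Variables (Z : nat -> Om -> nat) (g : nat -> R).
Hypothesis iidZ : iid Z g.

Let mZ n : dmeas (Z n). Proof. by case: iidZ. Qed.
Let mZS n (S : set nat) : measurable [set om | S (Z n om)].
Proof. exact: (dmeas_preimage countable_nat S (mZ n)). Qed.


Lemma iid_g k : Pr [set om | Z 0%N om = k] = g k.
Proof.
have [_ /(_ [:: k])] := iidZ; rewrite big_seq1 => <-; congr Pr.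
by apply/seteqP; split=> om /= => [h [|i]|/(_ 0%N isT)].
Qed.

Let g0 k : 0 <= g k. Proof. by rewrite -iid_g Pr_ge0. Qed.

Let joint (l : seq nat) (S : nat -> set nat) n : set Om :=
  [set om | (forall i, (i < size l)%N -> Z i om = nth 0%N l i) /\
            forall i, (i < n)%N -> S i (Z (size l + i)%N om)].

Let joint_meas l S n : measurable (joint l S n).
Proof.
apply: measurableI.
  rewrite (_ : (fun x => _) = \bigcap_(i in `I_(size l)) [set om | Z i om = nth 0%N l i]).
    by apply: fin_bigcap_measurable => [|i _]; [exact: finite_II|exact: mZ].
  by apply/seteqP; split=> om h i; apply: h.
rewrite (_ : (fun x => _) = \bigcap_(i in `I_n) [set om | S i (Z (size l + i)%N om)]).
  by apply: fin_bigcap_measurable => [|i _]; [exact: finite_II|exact: mZS].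
by apply/seteqP; split=> om h i; apply: h.
Qed.

Lemma iid_joint l S n : Pr (joint l S n) =
  \prod_(x <- l) g x * \prod_(i < n) Pr [set om | S i (Z 0%N om)].
Proof.
elim: n l S => [|n IH] l S.
  rewrite big_ord0 mulr1; have [_ <-] := iidZ; congr Pr.
  by apply/seteqP; split=> om; [case|split].
rewrite big_ord_recl mulrCA; apply: (Pr_total_eq (P := P) countable_nat _ (mZ (size l)) (mZ 0)).
- by apply: mulr_ge0; apply: prodr_ge0 => i _ //; rewrite Pr_ge0.
- exact: joint_meas.
- exact: (mZS 0 (S 0%N)).
move=> t; have [St|nS] := pselect (S 0%N t); last first.
  have e1 : joint l S n.+1 `&` [set om | Z (size l) om = t] = set0.
    by apply/seteqP; split=> om // [[_ /(_ 0%N isT)] /=]; rewrite addn0 => h e; rewrite e in h.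
  have e2 : [set om | S 0%N (Z 0%N om)] `&` [set om | Z 0%N om = t] = set0.
    by apply/seteqP; split=> om // [/= h e]; rewrite e in h.
  by rewrite e1 e2 !Pr_set0 mul0r.
have -> : [set om | S 0%N (Z 0%N om)] `&` [set om | Z 0%N om = t] = [set om | Z 0%N om = t].
  by apply/seteqP; split=> om => [[]|/= e] //; split=> //=; rewrite e.
have -> : joint l S n.+1 `&` [set om | Z (size l) om = t] = joint (rcons l t) (fun i => S i.+1) n.
  apply/seteqP; split=> om.
    move=> [[h1 h2] /= h3]; split=> i; rewrite size_rcons => ih; last by rewrite addSnnS; apply: h2.
    rewrite nth_rcons; move: ih; rewrite ltnS leq_eqVlt => /orP[/eqP ->|il].
      by rewrite ltnn eqxx.
    by rewrite il; apply: h1.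
  move=> [h1 h2]; rewrite size_rcons in h1 h2; have hl : Z (size l) om = t.
    by rewrite h1 // nth_rcons ltnn eqxx.
  split=> //; split=> [i il|[|i] ih]; first by rewrite h1 ?nth_rcons ?il // ltnW.
    by rewrite addn0 hl.
  by rewrite -addSnnS; apply: h2.
have -> : \prod_(i < n) Pr [set om | S (lift ord0 i) (Z 0%N om)] =
    \prod_(i < n) Pr [set om | S i.+1 (Z 0%N om)] by apply: eq_bigr => i _; rewrite lift0.
by rewrite IH iid_g big_rcons /=; ring.
Qed.

Lemma iid_shift j l : Pr [set om | forall i, (i < size l)%N -> Z (j + i)%N om = nth 0%N l i] =
  \prod_(x <- l) g x.
Proof.
pose S i : set nat := if (i < j)%N then setT else [set x | x = nth 0%N l (i - j)].
have := iid_joint [::] S (j + size l); rewrite big_nil mul1r big_split_ord /=.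
rewrite big1; last by move=> i _; rewrite /S ltn_ord (_ : [set om | _] = setT) ?Pr_setT.
rewrite mul1r => h; rewrite [RHS](big_nth 0%N) big_mkord.
transitivity (Pr (joint [::] S (j + size l))).
  congr Pr; apply/seteqP; split=> om /=.
    move=> h'; split=> // i ih; rewrite add0n /S; case: ltnP => // ji /=.
    by rewrite -h' ?subnKC // ltn_subLR.
  move=> [_ h'] i il; have := h' (j + i)%N; rewrite ltn_add2l => /(_ il).
  by rewrite add0n /S ltnNge leq_addr /= addKn.
rewrite h; apply: eq_bigr => i _; rewrite /S ltnNge leq_addr /= addKn.
by rewrite -iid_g.
Qed.

(** The mean of the truncated variable [minn (Z 0) M], written by tails; integrability will mean
    that it converges as [M] grows. *)
Definition tail_sum (M : nat) : R := \sum_(j < M) Pr [set om | (j < Z 0%N om)%N].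

Let minE M om : (minn (Z 0%N om) M)%:R = \sum_(j < M) \1_[set om | (j < Z 0%N om)%N] om :> R.
Proof.
elim: M => [|M IH]; first by rewrite big_ord0 minn0.
rewrite big_ord_recr /= -IH indicE; have [h|h] := ltnP M (Z 0%N om).
  by rewrite mem_set // (minn_idPr h) -natr1.
rewrite memNset ?addr0; last by rewrite /=; apply/negP; rewrite -leqNgt.
by rewrite (minn_idPl (leqW h)).
Qed.

Lemma tail_sumE M : tail_sum M =
  \sum_(k < M.+1) k%:R * Pr [set om | minn (Z 0%N om) M = k].
Proof.
have mA (k : 'I_M.+1) : measurable [set om | minn (Z 0%N om) M = k].
  exact: (mZS 0 [set z | minn z M = k]).
have mB (j : 'I_M) : measurable [set om | (j < Z 0%N om)%N] by exact: (mZS 0 [set z | (j < z)%N]).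
have key om : \sum_(k <- index_enum 'I_M.+1) k%:R * \1_[set om | minn (Z 0%N om) M = k] om =
    \sum_(j <- index_enum 'I_M) 1 * \1_[set om | (j < Z 0%N om)%N] om :> R.
  under [RHS]eq_bigr do rewrite mul1r.
  rewrite -minE (bigD1 (Ordinal (ltac:(by rewrite ltnS geq_minr) : (minn (Z 0%N om) M < M.+1)%N))) //=.
  rewrite indicE mem_set // mulr1 big1 ?addr0 // => k /eqP kn.
  by rewrite indicE memNset ?mulr0 //= => e; apply: kn; apply: val_inj.
apply/eqP; rewrite eq_le /tail_sum; apply/andP; split.
  have := @Pr_indic_le _ _ _ P _ _ (index_enum 'I_M) (index_enum 'I_M.+1) (fun=> 1) (fun k => k%:R) _ _ (fun=> ler01) (fun k => ler0n R k) mB mA.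
  under eq_bigr do rewrite mul1r.
  by apply=> om; rewrite key.
have h := @Pr_indic_le _ _ _ P _ _ (index_enum 'I_M.+1) (index_enum 'I_M) (fun k => k%:R) (fun=> 1) _ _ (fun k => ler0n R k) (fun=> ler01) mA mB.
apply: le_trans (h _) _ => [om|]; first by rewrite key.
by rewrite le_eqVlt; apply/orP; left; apply/eqP; apply: eq_bigr => j _; rewrite mul1r.
Qed.

Lemma slln_min M : asure [set om |
  (\sum_(i < n) (minn (Z i om) M)%:R) / n%:R @[n --> \oo] --> tail_sum M].
Proof.
rewrite tail_sumE; apply: (@slln_bounded _ _ _ P M (fun i om => minn (Z i om) M)
  (fun k => Pr [set om | minn (Z 0%N om) M = k])).
- by move=> n; exact: (dmeas_comp (fun z => minn z M) countable_nat (mZ n)).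
- by move=> n om; rewrite geq_minr.
- by move=> k; rewrite Pr_ge0.
- have mA (k : 'I_M.+1) : measurable [set om | minn (Z 0%N om) M = k].
    exact: (mZS 0 [set z | minn z M = k]).
  have key om : \sum_(k <- index_enum 'I_M.+1) 1 * \1_[set om | minn (Z 0%N om) M = k] om =
      \sum_(j <- [:: tt]) 1 * \1_[set: Om] om :> R.
    rewrite big_seq1 mul1r indicE mem_set // (bigD1 (Ordinal (ltac:(by rewrite ltnS geq_minr) : (minn (Z 0%N om) M < M.+1)%N))) //=.
    rewrite indicE mem_set // mul1r big1 ?addr0 // => k /eqP kn.
    by rewrite indicE memNset ?mulr0 //= => e; apply: kn; apply: val_inj.
  apply/eqP; rewrite eq_le; apply/andP; split.
    have := @Pr_indic_le _ _ _ P _ _ (index_enum 'I_M.+1) [:: tt] (fun=> 1) (fun=> 1) _ (fun=> setT) (fun=> ler01) (fun=> ler01) mA (fun=> measurableT).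
    rewrite big_seq1 mul1r Pr_setT; under eq_bigr do rewrite mul1r.
    by apply=> om; rewrite key.
  have h := @Pr_indic_le _ _ _ P _ _ [:: tt] (index_enum 'I_M.+1) (fun=> 1) (fun=> 1) (fun=> setT) _ (fun=> ler01) (fun=> ler01) (fun=> measurableT) mA.
  rewrite big_seq1 mul1r Pr_setT in h; apply: le_trans (h _) _ => [om|]; first by rewrite key.
  by rewrite le_eqVlt; apply/orP; left; apply/eqP; apply: eq_bigr => j _; rewrite mul1r.
move=> n f; pose S i : set nat := if insub i is Some i' then [set z | minn z M = f i'] else setT.
have := iid_joint [::] S n; rewrite big_nil mul1r => h.
transitivity (Pr (joint [::] S n)).
  congr Pr; apply/seteqP; split=> om /=.
    by move=> h'; split=> // i ih; rewrite add0n /S (insubT (fun i => i < n)%N ih); apply: (h' (Ordinal ih)).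
  by move=> [_ h'] i; have := h' i (ltn_ord i); rewrite add0n /S valK.
by rewrite h; apply: eq_bigr => i _; rewrite /S valK.
Qed.

Section FiniteMean.
Variable mu : R.
Hypothesis tail_cvg : tail_sum M @[M --> \oo] --> mu.

Let tail_ndecr M M' : (M <= M')%N -> tail_sum M <= tail_sum M'.
Proof.
move=> /subnKC <-; rewrite /tail_sum big_split_ord /= lerDl.
by apply: sumr_ge0 => i _; rewrite Pr_ge0.
Qed.

Let tail_le M : tail_sum M <= mu.
Proof. by apply: (cvgn_ge tail_cvg); exists M => // n /= Mn; apply: tail_ndecr. Qed.

Let ex M K M' la : set Om := [set om | exists k, (0 < k <= K)%N /\
  la * k%:R <= \sum_(i < k) (minn (Z i om) M' - M)%:R :> R].

Let ex_meas M K M' la : measurable (ex M K M' la).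
Proof.
have h := dmeas_mkseq K mZ.
have := dmeas_preimage (countable_seq countable_nat)
  (fun l : seq nat => exists k, (0 < k <= K)%N /\
  la * k%:R <= \sum_(i < k) (minn (nth 0%N l i) M' - M)%:R :> R) h.
congr measurable; apply/seteqP; split=> om /= [k [kK hk]]; exists k; split=> //; move: hk;
  by congr (_ <= _); apply: eq_bigr => i _; rewrite nth_mkseq // (leq_trans (ltn_ord i)) //; case/andP: kK.
Qed.

Let ex_shift M K M' la j : Pr [set om | exists k, (0 < k <= K)%N /\
  la * k%:R <= \sum_(i < k) (minn (Z (j + i) om) M' - M)%:R :> R] = Pr (ex M K M' la).
Proof.
pose E : set (nat -> nat) := [set y | exists l, [set y | ((0 < size l <= K)%N /\
  la * (size l)%:R <= \sum_(i < size l) (minn (nth 0%N l i) M' - M)%:R :> R) /\ cylinder 0%N l y] y].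
have sE : seqm 0%N E.
  apply: (seqm_count (countable_seq countable_nat)) => l.
  apply: (seqmI (E := [set y | (0 < size l <= K)%N /\
    la * (size l)%:R <= \sum_(i < size l) (minn (nth 0%N l i) M' - M)%:R :> R])); first exact: seqm_cst.
  exact: seqm_cylinder.
have EE (Y : nat -> Om -> nat) : [set om | exists k, (0 < k <= K)%N /\
    la * k%:R <= \sum_(i < k) (minn (Y i om) M' - M)%:R :> R] = setT `&` [set om | E (Y ^~ om)].
  rewrite setTI; apply/seteqP; split=> om /=.
    move=> [k [kK hk]]; exists (mkseq (Y ^~ om) k); rewrite /= size_mkseq; split; last first.
      by move=> i; rewrite size_mkseq => ik; rewrite nth_mkseq.
    by split=> //; under eq_bigr do rewrite nth_mkseq //.
  move=> [l [[h1 h2] h3]]; exists (size l); split=> //.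
  by under eq_bigr do rewrite h3 //.
rewrite /ex (EE (fun i => Z (j + i)%N)) (EE Z) -[LHS]mul1r -[RHS]mul1r.
apply: (eq_law (x0 := 0%N) (Y := fun i => Z (j + i)%N) (Y' := Z) (fun i => mZ (j + i)) mZ measurableT measurableT _ sE).
by move=> l; rewrite !setTI; congr (_ * _); rewrite [LHS]iid_shift; have [_ <-] := iidZ.
Qed.

(** Maximal inequality for the excess over the level [M], capped at [M'] so that it is a finite sum
    of indicators. [rising_sun] is applied to [n] starting points at once; these are equally likely
    to be bad by stationarity, and the mean excess is at most [mu - tail_sum M]. *)
Lemma maximal M K M' la : 0 < la -> la * Pr (ex M K M' la) <= mu - tail_sum M.
Proof.
move=> la0; have [MM|MM] := leqP M M'; last first.
  apply: (@le_trans _ _ 0); last by rewrite subr_ge0.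
  rewrite (_ : ex _ _ _ _ = set0) ?Pr_set0 ?mulr0 //.
  apply/seteqP; split=> om // [k [/andP[k0 _]]]; rewrite big1.
    by rewrite leNgt mulr_gt0 // ltr0n.
  move=> i _; apply/eqP; rewrite pnatr_eq0 subn_eq0.
  by rewrite (leq_trans (geq_minr _ _)) // ltnW.
pose X j := [set om | exists k, (0 < k <= K)%N /\
  la * k%:R <= \sum_(i < k) (minn (Z (j + i) om) M' - M)%:R :> R].
pose B (p : nat * nat) := [set om | (p.2 < Z p.1 om)%N].
have mB p : measurable (B p) by exact: (mZS p.1 [set z | (p.2 < z)%N]).
have PB p : Pr (B p) = Pr [set om | (p.2 < Z 0%N om)%N].
  have := iid_joint [::] (fun i => if i == p.1 then [set z | (p.2 < z)%N] else setT) p.1.+1.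
  rewrite big_nil mul1r big_ord_recr /= eqxx big1 ?mul1r => [<-|i _]; last first.
    by rewrite (ltn_eqF (ltn_ord i)) (_ : [set om | _] = setT) ?Pr_setT.
  congr Pr; apply/seteqP; split=> om /=.
    by move=> h; split=> // i _; rewrite add0n; case: eqP => // ->.
  by move=> [_ /(_ p.1 (ltnSn _))]; rewrite eqxx.
have mX j : measurable (X j).
  have h := dmeas_mkseq K (fun i => mZ (j + i)).
  have := dmeas_preimage (countable_seq countable_nat)
    (fun l : seq nat => exists k, (0 < k <= K)%N /\
    la * k%:R <= \sum_(i < k) (minn (nth 0%N l i) M' - M)%:R :> R) h.
  congr measurable; apply/seteqP; split=> om /= [k [kK hk]]; exists k; split=> //; move: hk;
    by congr (_ <= _); apply: eq_bigr => i _; rewrite nth_mkseq // (leq_trans (ltn_ord i)) //; case/andP: kK.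
have aE l om : (minn (Z l om) M' - M)%:R = \sum_(j < M') (M <= j)%N%:R * \1_(B (l, nat_of_ord j)) om :> R.
  elim: M' {MM X mX} => [|e IH]; first by rewrite big_ord0 minn0 sub0n.
  rewrite big_ord_recr /= -IH indicE /B /=.
  have [h|h] := ltnP e (Z l om).
    rewrite mem_set // (minn_idPr h) mulr1; have [h'|h'] := leqP M e.
      by rewrite subSn // -natr1.
    by rewrite (eqP (_ : e.+1 - M == 0)%N) ?subn_eq0 // (eqP (_ : e - M == 0)%N) ?subn_eq0 ?addr0 // ltnW.
  rewrite memNset ?mulr0 ?addr0; last by rewrite /=; apply/negP; rewrite -leqNgt.
  by rewrite (minn_idPl (leqW h)).
have step n : n%:R * (la * Pr (ex M K M' la)) <= (n + K)%:R * (mu - tail_sum M).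
  have h1 := @Pr_indic_le _ _ _ P _ _ (index_enum 'I_n) (index_enum ('I_(n + K) * 'I_M')%type)
    (fun=> la) (fun p => (M <= p.2)%N%:R) (fun j => X j) (fun p => B (nat_of_ord p.1, nat_of_ord p.2))
    (fun=> ltW la0) (fun=> ler0n _ _) (fun j => mX j) (fun p => mB _).
  have -> : n%:R * (la * Pr (ex M K M' la)) = \sum_(j < n) la * Pr (X j).
    under eq_bigr do rewrite /X ex_shift.
    by rewrite sumr_const card_ord mulr_natl.
  apply: le_trans (h1 _) _.
    move=> om; rewrite -(pair_bigA _ (fun (l : 'I_(n + K)) (j : 'I_M') => (M <= j)%N%:R * \1_(B (nat_of_ord l, nat_of_ord j)) om)) /=.
    under [leRHS]eq_bigr do rewrite -aE.
    have /= := @rising_sun R (fun l => (minn (Z l om) M' - M)%:R) la (fun j => `[< X j om >]) K n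
      (fun i => ler0n _ _) (ltW la0) _ 0%N.
    rewrite !add0n !big_mkord => h2; rewrite -mulr_sumr; apply: h2.
    move=> j /asboolP [k [kK hk]]; exists k; split=> //; apply: le_trans hk _.
    rewrite -[X in _ <= \sum_(X <= _ < _) _]add0n big_addn addKn big_mkord.
    by under [leRHS]eq_bigr do rewrite addnC.
  rewrite -(pair_bigA _ (fun (l : 'I_(n + K)) (j : 'I_M') => (M <= j)%N%:R * Pr (B (nat_of_ord l, nat_of_ord j)))) /=.
  under eq_bigr => l _ do under eq_bigr => j _ do rewrite PB /=.
  rewrite sumr_const card_ord -[leLHS]mulr_natl; apply: ler_wpM2l => //.
  rewrite lerBrDr; apply: le_trans (tail_le M'); rewrite /tail_sum -(subnKC MM) !big_split_ord /=.
  rewrite big1 ?add0r; last by move=> i _; rewrite leqNgt ltn_ord mul0r.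
  rewrite [leRHS]addrC lerD2r; apply: ler_sum => i _.
  by rewrite leq_addr mul1r.
(* The overrun costs only [K] more terms, which become negligible as [n] grows. *)
rewrite leNgt; apply/negP => lt; have e0 : 0 <= mu - tail_sum M by rewrite subr_ge0.
have [n hn] := nat_above (K%:R * (mu - tail_sum M) / (la * Pr (ex M K M' la) - (mu - tail_sum M))).
have d0 : 0 < la * Pr (ex M K M' la) - (mu - tail_sum M) by rewrite subr_gt0.
rewrite ler_pdivrMr // in hn.
have := step n.+1; rewrite natrD -natr1; move: hn lt; move: (la * _) (mu - _) => x y; nra.
Qed.

(** Truncation gives the lower bound. For the upper one, the average exceeds that of the truncated
    variables by at most [1 / p.+1] unless the maximal event at level [M] occurs, and the
    probability of that event vanishes as [M] grows because the truncated means converge. *)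
Lemma slln : asure [set om | (\sum_(i < n) (Z i om)%:R) / n%:R @[n --> \oo] --> mu].
Proof.
pose U M la := \bigcup_k ex M k k la.
have mU M la : measurable (U M la) by apply: bigcupT_measurable => k; exact: ex_meas.
have exmono M la k : ex M k k la `<=` ex M k.+1 k.+1 la.
  move=> om [j [/andP[j0 jk] hj]]; exists j; split; first by rewrite j0 leqW.
  apply: le_trans hj _; apply: ler_sum => i _; rewrite ler_nat leq_sub2r //.
  by rewrite leq_min geq_minl /= (leq_trans (geq_minr _ _)).
have PU M la : 0 < la -> Pr (U M la) <= (mu - tail_sum M) / la.
  move=> la0; apply: (cvgn_le (Pr_bigcup_cvg (P := P) (fun k => ex_meas M k k la) (exmono M la))).
  by exists 0%N => // k _ /=; rewrite ler_pdivlMr // mulrC; apply: maximal.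
have U0 la : 0 < la -> Pr (\bigcap_M U M la) = 0.
  move=> la0; apply/eqP; rewrite eq_le Pr_ge0 andbT.
  have cv : (mu - tail_sum M) / la @[M --> \oo] --> (0 : R).
    rewrite -[X in _ --> X](mul0r la^-1) -(subrr mu).
    by apply: cvgMl; apply: cvgB => //; apply: cvg_cst.
  apply: (cvgn_ge cv); exists 0%N => // M _ /=; apply: le_trans (PU M la la0).
  by apply: le_Pr => //; [apply: bigcapT_measurable|move=> om; apply].
have ip (p : nat) : 0 < p.+1%:R^-1 :> R by rewrite invr_gt0.
have H1 p : asure (~` \bigcap_M U M p.+1%:R^-1).
  apply: asure_meas; first by apply: measurableC; apply: bigcapT_measurable.
  by rewrite setCK; apply: U0.
apply: asure_mono (asureI (asure_all H1) (asure_all slln_min)) => om [h1 h2] /=.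
apply/cvgrPdist_lt => e'; move: (e' : R) => e {e'} e0.
have [p pe] : exists p : nat, p.+1%:R^-1 < e / 2.
  exists (Num.truncn (e / 2)^-1); rewrite invf_plt ?posrE ?divr_gt0 //; exact: truncnS_gt.
have [M hM] : exists M, ~ U M p.+1%:R^-1 om.
  by apply: contrapT => no; apply: (h1 p) => M _; apply: contrapT => h; apply: no; exists M.
have e2 : 0 < e / 2 by rewrite divr_gt0.
have /cvgrPdist_lt /(_ _ e2) [M' _ hM'] := tail_cvg.
have {}hM' := hM' M' (leqnn _).
have /cvgrPdist_lt /(_ _ e2) [n1 _ hn1] := h2 M.
have /cvgrPdist_lt /(_ _ e2) [n2 _ hn2] := h2 M'.
exists (maxn n1 n2).+1 => // n /=; rewrite gtn_max => /andP[a b].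
have n0 : 0 < n%:R :> R by rewrite ltr0n (leq_trans _ a).
have {}hn1 := hn1 n (ltnW a); have {}hn2 := hn2 n (ltnW b).
have q1 : (\sum_(i < n) (minn (Z i om) M')%:R) / n%:R <= (\sum_(i < n) (Z i om)%:R) / n%:R :> R.
  apply: ler_wpM2r; first by rewrite invr_ge0.
  by apply: ler_sum => i _; rewrite ler_nat geq_minl.
have q2 : (\sum_(i < n) (Z i om)%:R) / n%:R <= (\sum_(i < n) (minn (Z i om) M)%:R) / n%:R + p.+1%:R^-1 :> R.
  rewrite ler_pdivrMr // mulrDl divfK ?lt0r_neq0 // -lerBlDl -sumrB.
  rewrite leNgt; apply/negP => lt; apply: hM.
  pose k := maxn n (\max_(i < n) Z i om).
  exists k => //; exists n; rewrite -(ltr0n R) n0 leq_maxl; split=> //.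
  apply: le_trans (ltW lt) _; apply: ler_sum => i _.
  have -> : minn (Z i om) k = Z i om.
    apply/minn_idPl; rewrite /k leq_max; apply/orP; right.
    exact: (leq_bigmax (F := fun i : 'I_n => Z i om) i).
  by rewrite lerBlDr -natrD ler_nat; case: (leqP (Z i om) M) => h; rewrite ?leq_addl ?subnK ?(ltnW h).
have q3 := tail_le M; have q4 := tail_le M'.
move: hM' hn1 hn2; rewrite !ltr_norml => /andP[x1 x2] /andP[x3 x4] /andP[x5 x6].
move: q1 q2 x3 x4 x5 x6; move: (_ / _) (_ / _) (_ / _) => y1 y2 y3 q1 q2 x3 x4 x5 x6.
move: pe q2 {hM}; move: (p.+1%:R^-1) => z pe q2.
apply/andP; split; lra.
Qed.

End FiniteMean.
End StrongLaw.

(** * From limits along a sequence of times to limits along all times *)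

Section Ratios.
Context {R : realType}.

Lemma cvgn_inv : (n%:R^-1 : R) @[n --> \oo] --> (0 : R).
Proof.
apply/cvgrPdist_lt => e' ; move: (e' : R) => e {e'} e0.
have [k ke] := nat_above (e^-1 : R).
exists k.+1 => // n /= kn; rewrite sub0r normrN ger0_norm //.
have n0 : 0 < n%:R :> R by rewrite ltr0n (leq_trans _ kn).
rewrite invf_plt ?posrE //; apply: le_lt_trans ke _; by rewrite ltr_nat.
Qed.

Lemma cvgn_shift (x : nat -> R) (a : R) : x n @[n --> \oo] --> a -> x n.+1 @[n --> \oo] --> a.
Proof.
move=> /cvgrPdist_lt h; apply/cvgrPdist_lt => e e0; have [k _ hk] := h e e0.
by exists k => // n kn; apply: hk; apply: leqW.
Qed.

Lemma cvgn_shiftl (x : nat -> R) (a : R) : x n / n%:R @[n --> \oo] --> a ->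
  x n.+1 / n%:R @[n --> \oo] --> a.
Proof.
move=> /cvgn_shift h.
have h2 : x n.+1 / n.+1%:R * (1 + n%:R^-1) @[n --> \oo] --> a.
  rewrite -[a]mulr1 -[X in a * X]addr0; apply: cvgM => //.
  by apply: cvgD; [apply: cvg_cst|exact: cvgn_inv].
apply: cvg_trans h2; apply: near_eq_cvg; exists 1%N => // n /= n1.
have n0 : n%:R != 0 :> R by rewrite pnatr_eq0 -lt0n.
by rewrite -natr1; field; rewrite n0 natr1 pnatr_eq0.
Qed.

Variable Tn : nat -> nat.
Hypothesis TnS : forall n, (Tn n < Tn n.+1)%N.

Lemma Tn_ge n : (n <= Tn n)%N.
Proof. by elim: n => // n IH; apply: leq_ltn_trans IH (TnS n). Qed.

Lemma Tn_mono a b : (a <= b)%N -> (Tn a <= Tn b)%N.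
Proof.
move=> /subnKC <-; elim: (b - a)%N => [|e IH]; first by rewrite addn0.
by rewrite addnS (leq_trans IH) // ltnW.
Qed.

Lemma Tn_between k : (Tn 0 <= k)%N -> exists2 n, (Tn n <= k)%N & (k < Tn n.+1)%N.
Proof.
move=> k0; have ex : exists n, (k < Tn n.+1)%N.
  by exists k; apply: leq_trans (Tn_ge k.+1).
case: (ex_minnP ex) => [[|n]] hn hm; first by exists 0%N.
exists n.+1 => //; rewrite leqNgt; apply/negP => /hm; by rewrite ltnn.
Qed.

Lemma sandwich (x lo hi : nat -> R) (z : R) :
  (forall n k, (0 < n)%N -> (Tn n <= k)%N -> (k < Tn n.+1)%N -> lo n <= x k <= hi n) ->
  lo n @[n --> \oo] --> z -> hi n @[n --> \oo] --> z -> x n @[n --> \oo] --> z.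
Proof.
move=> h /cvgrPdist_lt hlo /cvgrPdist_lt hhi; apply/cvgrPdist_lt => e e0.
have [k1 _ h1] := hlo e e0; have [k2 _ h2] := hhi e e0.
exists (Tn (maxn k1 k2).+1) => // k /= kk.
have [n n1 n2] := Tn_between (leq_trans (Tn_mono (leq0n _)) kk).
have kn : (maxn k1 k2 < n)%N.
  rewrite ltnNge; apply/negP => le.
  by have := Tn_mono (le : (n.+1 <= (maxn k1 k2).+1)%N); rewrite leqNgt (leq_ltn_trans kk n2).
have [n0 a b] : [/\ (0 < n)%N, (k1 <= n)%N & (k2 <= n)%N].
  by move: kn; rewrite gtn_max => /andP[a b]; split; [apply: leq_ltn_trans a|exact: ltnW|exact: ltnW].
have /andP[q1 q2] := h n k n0 n1 n2.
have := h1 n a; have := h2 n b; rewrite /= !ltr_norml => /andP[u1 u2] /andP[u3 u4].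
apply/andP; split.
  by apply: lt_le_trans u1 _; rewrite lerD2l lerN2.
by apply: le_lt_trans u4; rewrite lerD2l lerN2.
Qed.

(** Renewal-reward argument: between [Tn n] and [Tn n.+1] the monotone [B] is caught between its
    values at the ends, and consecutive ends are asymptotically equal. *)
Lemma ratio_cvg (B : nat -> R) (a l : R) : 0 < l -> (forall k, 0 <= B k) ->
  (forall k j, (k <= j)%N -> B k <= B j) ->
  B (Tn n) / n%:R @[n --> \oo] --> a -> (Tn n)%:R / n%:R @[n --> \oo] --> l ->
  B k / k%:R @[k --> \oo] --> a / l.
Proof.
move=> l0 B0 Bm hB hT; have lN : l != 0 by rewrite lt0r_neq0.
apply: (@sandwich _ (fun n => B (Tn n) / (Tn n.+1)%:R) (fun n => B (Tn n.+1) / (Tn n)%:R)).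
- move=> n k n0 k1 k2; have T0 : (0 < Tn n)%N := leq_trans n0 (Tn_ge n).
  have k0 : (0 < k)%N := leq_trans T0 k1.
  apply/andP; split; apply: ler_pM => //; rewrite ?invr_ge0 //.
  + by apply: Bm.
  + have k3 := ltnW k2; rewrite lef_pV2 ?posrE ?ltr0n ?ler_nat //; exact: leq_trans k3.
  + by apply: Bm; apply: ltnW.
  + by rewrite lef_pV2 ?posrE ?ltr0n ?ler_nat.
- have h1 : B (Tn n) / n%:R * ((Tn n.+1)%:R / n%:R)^-1 @[n --> \oo] --> a / l.
    by apply: cvgM => //; apply: cvgV => //; exact: (cvgn_shiftl (x := fun n => (Tn n)%:R)).
  apply: cvg_trans h1; apply: near_eq_cvg; exists 1%N => // n /= n1.
  have n0 : n%:R != 0 :> R by rewrite pnatr_eq0 -lt0n.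
  have T0 : (Tn n.+1)%:R != 0 :> R by rewrite pnatr_eq0 -lt0n (leq_trans _ (Tn_ge _)).
  by field; rewrite n0 T0.
have h1 : B (Tn n.+1) / n%:R * ((Tn n)%:R / n%:R)^-1 @[n --> \oo] --> a / l.
  by apply: cvgM; [exact: (cvgn_shiftl (x := fun n => B (Tn n)))|apply: cvgV].
apply: cvg_trans h1; apply: near_eq_cvg; exists 1%N => // n /= n1.
have n0 : n%:R != 0 :> R by rewrite pnatr_eq0 -lt0n.
have T0 : (Tn n)%:R != 0 :> R by rewrite pnatr_eq0 -lt0n (leq_trans _ (Tn_ge _)).
by field; rewrite n0 T0.
Qed.

Lemma small_cvg (x b : nat -> R) (l : R) : 0 < l -> (forall k, 0 <= x k) ->
  (forall n k, (Tn n <= k)%N -> (k < Tn n.+1)%N -> x k <= b n) ->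
  b n / n%:R @[n --> \oo] --> (0 : R) -> (Tn n)%:R / n%:R @[n --> \oo] --> l ->
  x k / k%:R @[k --> \oo] --> (0 : R).
Proof.
move=> l0 x0 xb hb hT; have lN : l != 0 by rewrite lt0r_neq0.
apply: (@sandwich _ (fun=> 0) (fun n => b n / (Tn n)%:R)); last 2 first.
- exact: cvg_cst.
- have h1 : b n / n%:R * ((Tn n)%:R / n%:R)^-1 @[n --> \oo] --> 0 / l.
    by apply: cvgM => //; apply: cvgV.
  rewrite mul0r in h1; apply: cvg_trans h1; apply: near_eq_cvg; exists 1%N => // n /= n1.
  have n0 : n%:R != 0 :> R by rewrite pnatr_eq0 -lt0n.
  have T0 : (Tn n)%:R != 0 :> R by rewrite pnatr_eq0 -lt0n (leq_trans _ (Tn_ge _)).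
  by field; rewrite n0 T0.
move=> n k n0 k1 k2; rewrite mulr_ge0 ?invr_ge0 //=.
have T0 : (0 < Tn n)%N := leq_trans n0 (Tn_ge n).
have k0 : (0 < k)%N := leq_trans T0 k1.
apply: ler_pM => //; rewrite ?invr_ge0 //; first exact: xb.
by rewrite lef_pV2 ?posrE ?ltr0n ?ler_nat.
Qed.

End Ratios.

(** * Exchange of sums and Fatou's lemma *)

Section NonnegativeSums.
Context {R : realType}.
Local Open Scope ereal_scope.

Lemma esum_swap {T U : choiceType} (I : set T) (J : set U) (a : T -> U -> \bar R) :
  (forall i j, 0 <= a i j) ->
  \esum_(i in I) \esum_(j in J) a i j = \esum_(j in J) \esum_(i in I) a i j.
Proof.
move=> a0; rewrite esum_esum // esum_esum //.
apply: (@reindex_esum _ _ _ (J `*`` (fun=> I)) (I `*`` (fun=> J)) (fun k => (k.2, k.1))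
  (fun k => a k.1 k.2)).
split=> [[i j] [/= h1 h2] //|[i j] [i' j'] _ _ [-> ->] //|[j i] [/= h1 h2]].
by exists (i, j).
Qed.

(** Finite parts of the sum pass to the limit. Applied to [B] and to a constant minus [B], it gives
    both inequalities of a bounded convergence theorem for countable sums. *)
Lemma esum_fatou {T : choiceType} (I : set T) (v : T -> R) (B : nat -> T -> R) (S be : R) :
  (forall x, 0 <= v x)%R -> \esum_(x in I) (v x)%:E = 1 -> (0 <= be)%R ->
  (forall n x, 0 <= B n x)%R ->
  (forall n, (0 < n)%N -> \esum_(x in I) (v x * B n x)%:E <= S%:E) ->
  (forall x, I x -> B n x @[n --> \oo] --> be) -> (be <= S)%R.
Proof.
move=> v0 v1 be0 B0 hS hB.
have fin (X : set T) : fsets I X -> (be%:E * \sum_(x \in X) (v x)%:E <= S%:E).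
  move=> [fX XI]; rewrite fsbig_finite // sumEFin -EFinM lee_fin.
  apply: (@cvgn_le _ (fun n => \sum_(x <- fset_set X) v x * B n x)%R).
    rewrite big_distrr /=.
    have : {in (fset_set X : seq T), forall x, I x} by move=> x; rewrite in_fset_set // inE => /XI.
    elim: (fset_set X : seq T) => [_|x l IH hx].
      by rewrite big_nil; under eq_fun do rewrite big_nil; exact: cvg_cst.
    rewrite big_cons; under eq_fun do rewrite big_cons.
    have h1 : (v x * B n x)%R @[n --> \oo] --> (be * v x)%R.
      by rewrite [(be * _)%R]mulrC; apply: cvgMr; apply: hB; apply: hx; rewrite inE eqxx.
    apply: (cvgD h1); apply: IH => y yl; apply: hx; rewrite inE yl orbT //.
  exists 1%N => // n /= n0; rewrite -lee_fin; apply: le_trans (hS n n0).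
  apply: esum_ge; exists X => //; rewrite fsbig_finite // sumEFin.
  by [].
have [b0|b0] := eqVneq be 0%R.
  rewrite b0 -lee_fin; apply: le_trans (hS 1%N isT); apply: esum_ge0 => x _.
  by rewrite lee_fin mulr_ge0.
have bp : (0 < be)%R by rewrite lt_def b0.
have : (be%:E * (\esum_(x in I) (v x)%:E) <= S%:E)%E.
  rewrite -lee_pdivlMl //; apply: ge_ereal_sup => _ [X IX <-].
  by rewrite lee_pdivlMl //; apply: fin.
by rewrite v1 mule1 lee_fin.
Qed.

End NonnegativeSums.

Section Integrals.
Context {R : realType} {d : measure_display} {Om : measurableType d} (P : probability Om R).
Local Notation Pr := (Pr P).

Lemma total_probability_on {T : choiceType} (cT : countable [set: T]) (Q : set T) (f : Om -> T)
    (E : set Om) : dmeas f -> measurable E ->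
  (forall t, ~ Q t -> Pr (E `&` [set om | f om = t]) = 0) ->
  ((Pr E)%:E = \esum_(t in Q) (Pr (E `&` [set om | f om = t]))%:E)%E.
Proof.
move=> mf mE h; have mI t : measurable (E `&` [set om | f om = t]) by apply: measurableI.
rewrite -PrE // (total_probability P cT mf mE) [RHS]esum_mkcond; apply: eq_esum => t _.
rewrite PrE //; case: ifPn => //; rewrite notin_setE => /h -> //.
Qed.

(** Dominated convergence on the event [B], for random variables given as weighted sums of
    indicators, so that the conclusion speaks of probabilities only. *)
Lemma bounded_cvg (I : Type) (r : nat -> seq I) (w : nat -> I -> R) (A : nat -> I -> set Om)
    (B : set Om) (M ka : R) :
  (forall n i, 0 <= w n i) -> (forall n i, measurable (A n i)) -> measurable B ->
  (forall n om, \sum_(i <- r n) w n i * \1_(A n i) om <= M) ->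
  asure P [set om | \sum_(i <- r n) w n i * \1_(A n i) om @[n --> \oo] --> ka] ->
  \sum_(i <- r n) w n i * Pr (B `&` A n i) @[n --> \oo] --> ka * Pr B.
Proof.
move=> w0 mA mB bM [E [mE PE EQ]].
have mi n : measurable_fun setT (fun om => \sum_(i <- r n) w n i * \1_(A n i) om).
  elim: (r n) => [|a l IH].
    by under eq_fun do rewrite big_nil; exact: measurable_cst.
  under eq_fun do rewrite big_cons; apply: measurable_funD => //.
  by apply: measurable_funM => //; exact: measurable_indic.
have := @dominated_convergence _ Om R P setT measurableT
  (fun n om => (\sum_(i <- r n) w n i * \1_(B `&` A n i) om)%:E)
  (fun om => (ka * \1_B om)%:E) (fun=> M%:E).
have sE n om : \sum_(i <- r n) w n i * \1_(B `&` A n i) om =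
    \1_B om * \sum_(i <- r n) w n i * \1_(A n i) om.
  by rewrite big_distrr /=; apply: eq_bigr => i _; rewrite indicI /= mulrCA.
have s0 n om : 0 <= \sum_(i <- r n) w n i * \1_(A n i) om by apply: sumr_ge0 => i _; apply: mulr_ge0.
case.
- move=> n; apply/measurable_EFinP; under eq_fun do rewrite sE.
  by apply: measurable_funM => //; exact: measurable_indic.
- by apply/measurable_EFinP; apply: measurable_funM => //; exact: measurable_indic.
- exists (~` E); split; [exact: measurableC| |].
    by apply: etrans (PrE P (measurableC mE)) _; rewrite PE.
  move=> om h /EQ /= cv; apply: h => _; apply: cvg_EFin; first exact: nearW.
  rewrite /comp /=; under eq_fun do rewrite sE.
  by rewrite [ka * _]mulrC; apply: cvgMr.
- exact: finite_measure_integrable_cst.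
- apply: aeW => om n _; rewrite lee_fin sE ger0_norm ?mulr_ge0 //.
  by rewrite -[M]mul1r; apply: ler_pM => //; rewrite indicE; case: (_ \in _).
move=> _ _; have iE : (fun n => \int[P]_x (\sum_(i <- r n) w n i * \1_(B `&` A n i) x)%:E)%E =
    (fun n => (\sum_(i <- r n) w n i * Pr (B `&` A n i))%:E).
  by apply/funext => n; rewrite integral_indics // => i; apply: measurableI.
rewrite /= in iE *; rewrite iE.
have -> : (\int[P]_om (ka * \1_B om)%:E = (ka * Pr B)%:E)%E.
  under eq_integral do rewrite EFinM.
  rewrite integralZl //; last first.
    apply: (@le_integrable _ Om R P setT measurableT _ (fun=> 1%:E)).
    - by apply/measurable_EFinP; exact: measurable_indic.
    - by move=> om _; rewrite lee_fin indicE; case: (_ \in _); rewrite normr1 ?normr0.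
    - exact: finite_measure_integrable_cst.
  by rewrite EFinM; congr (_ * _)%E; rewrite integral_indic // setIT; apply: PrE.
by move=> /fine_cvgP[].
Qed.

Lemma nat_integral (f : Om -> nat) (B : set Om) : dmeas f -> measurable B ->
  (\int[P]_(om in B) ((f om)%:R)%:E =
   \esum_(i in [set: nat]) (Pr (B `&` [set om | (i < f om)%N]))%:E)%E.
Proof.
move=> mf mB.
have mS i : measurable [set om | (i < f om)%N].
  exact: (dmeas_preimage countable_nat (f := f) (fun n => (i < n)%N)).
rewrite -nneseries_esumT; last by move=> i; rewrite lee_fin Pr_ge0.
transitivity (\int[P]_(om in B) (\sum_(i <oo) (\1_[set om | (i < f om)%N] om)%:E))%E.
  apply: eq_integral => om _; rewrite (nneseries_split 0 (f om)) // add0n eseries0 ?adde0; last first.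
    by move=> i le _; rewrite indicE memNset //= ltnNge le.
  rewrite big_mkord (eq_bigr (fun=> 1%E)) ?sumEFin ?sumr_const ?card_ord //.
  by move=> i _; rewrite indicE mem_set //=.
rewrite integral_nneseries //; last first.
  by move=> i; apply/measurable_EFinP; apply: measurable_funTS; exact: measurable_indic.
apply: eq_eseriesr => i _.
have -> : (Pr (B `&` [set om | (i < f om)%N]))%:E = P (B `&` [set om | (i < f om)%N]).
  by rewrite PrE //; apply: measurableI.
by rewrite setIC; apply: integral_indic.
Qed.

End Integrals.

(** * Interpolation between consecutive entry times *)

Section Interpolation.
Context {R : realType}.
Variables (e : nat -> nat) (ka : R) (x g b : nat -> R) (h : R).
Hypothesis ka0 : 0 < ka.
Hypothesis ecv : (e k)%:R / k%:R @[k --> \oo] --> ka.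
Hypothesis gcv : g k / k%:R @[k --> \oo] --> h.
Hypothesis bcv : b k / k%:R @[k --> \oo] --> (0 : R).
Hypothesis xg : forall k n, (e k <= n)%N -> (n < e k.+1)%N -> `|x n - g k| <= b k.

Lemma interpolation_unbounded n : exists k, (n < e k.+1)%N.
Proof.
have /cvgrPdist_lt /(_ _ (divr_gt0 ka0 (ltr0n _ 2))) [k0 _ hk] := cvgn_shiftl ecv.
have [j hj] := nat_above (n%:R / (ka / 2)).
pose k := (maxn k0 j).+1; exists k.
have := hk k (leq_trans (leq_maxl k0 j) (leqnSn _)); rewrite /= ltr_norml => /andP[_ h1].
have k1 : (0 : R) < k%:R by rewrite ltr0n.
have h2 : ka / 2 < (e k.+1)%:R / k%:R by lra.
rewrite ltr_pdivlMr // in h2; rewrite -(ltr_nat R); apply: le_lt_trans h2.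
rewrite mulrC -ler_pdivrMr ?divr_gt0 //; apply: (le_trans hj).
by rewrite ler_nat /k leqW // leq_maxr.
Qed.

(** The least [k] with [n < e k.+1]; minimality yields [e k <= n] as soon as [e 0 <= n], although
    [e] is not assumed monotone. *)
Let kk n : nat := ex_minn (interpolation_unbounded n).

Let kk_hi n : (n < e (kk n).+1)%N. Proof. by rewrite /kk; case: ex_minnP. Qed.
Let kk_lo n : (e 0 <= n)%N -> (e (kk n) <= n)%N.
Proof.
rewrite /kk; case: ex_minnP => -[|k] // h1 h2 _.
by rewrite leqNgt; apply/negP => /h2; rewrite ltnn.
Qed.
Let kk_cvg : kk n @[n --> \oo] --> \oo.
Proof.
move=> A [k0 _ hk]; exists (\max_(j < k0) e j.+1)%N => // n /= hn; apply: hk => /=.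
rewrite leqNgt; apply/negP => lt; have := kk_hi n; rewrite ltnNge => /negP; apply.
by apply: leq_trans hn; apply: (leq_bigmax (F := fun j : 'I_k0 => e j.+1) (Ordinal lt)).
Qed.

Lemma interpolation : x n / n%:R @[n --> \oo] --> h / ka.
Proof.
have cv (f : nat -> R) (l : R) : f k @[k --> \oo] --> l -> f (kk n) @[n --> \oo] --> l.
  by move=> hf; apply: cvg_comp kk_cvg hf.
have [n1 hn1] : exists n1, forall n, (n1 <= n)%N -> (0 < kk n)%N.
  have [n1 _ h1] := kk_cvg (nbhs_infty_gt 0); exists n1 => n hn; exact: (h1 n hn).
have nk : n%:R / (kk n)%:R @[n --> \oo] --> ka.
  apply: (@squeeze_cvgr _ _ _ _ (fun n => (e (kk n))%:R / (kk n)%:R) (fun n => (e (kk n).+1)%:R / (kk n)%:R)).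
  - exists (maxn (e 0) n1) => // n; rewrite /= geq_max => /andP[h0 h1].
    have k0 := hn1 n h1; rewrite !ler_pM2r ?invr_gt0 ?ltr0n // !ler_nat kk_lo //=.
    by rewrite ltnW // kk_hi.
  - exact: (cv (fun k => (e k)%:R / k%:R) ka ecv).
  - exact: (cv (fun k => (e k.+1)%:R / k%:R) ka (cvgn_shiftl ecv)).
have kn : (kk n)%:R / n%:R @[n --> \oo] --> ka^-1.
  rewrite (_ : (fun n => (kk n)%:R / n%:R) = (fun n => (n%:R / (kk n)%:R)^-1)).
    by apply: cvgV => //; exact: lt0r_neq0.
  by apply/funext => n; rewrite invf_div.
have xk : x n / (kk n)%:R @[n --> \oo] --> h.
  apply: (@squeeze_cvgr _ _ _ _ (fun n => (g (kk n) / (kk n)%:R - b (kk n) / (kk n)%:R))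
     (fun n => (g (kk n) / (kk n)%:R + b (kk n) / (kk n)%:R))).
  - exists (maxn (e 0) n1) => // n; rewrite /= geq_max => /andP[h0 h1].
    have k0 := hn1 n h1; rewrite -mulrBl -mulrDl !ler_pM2r ?invr_gt0 ?ltr0n //.
    have := xg (kk_lo h0) (kk_hi n); rewrite ler_norml => /andP[a1 a2]; apply/andP; split; lra.
  - have := cvgB (cv _ _ gcv) (cv _ _ bcv); rewrite subr0; exact.
  - have := cvgD (cv _ _ gcv) (cv _ _ bcv); rewrite addr0; exact.
have h0 : (x n / (kk n)%:R) * ((kk n)%:R / n%:R) @[n --> \oo] --> h / ka by apply: cvgM.
apply: cvg_trans h0; apply: near_eq_cvg; exists n1 => // n /= h1.
by rewrite mulrA divfK // pnatr_eq0 -lt0n hn1.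
Qed.

End Interpolation.

(** * The walk as a Markov chain and its survival in a set *)

Section Chain.
Context {R : realType} {N : nat} {W : groupType} (s : 'I_N -> W).
Context {G : involutive_generators s}.
Variables (q : 'I_N -> nat) (m : W -> R) (ws : seq (R * seq 'I_N)) (L0 : nat).
Context {D : walk_data s q m ws L0}.
Context {d : measure_display} {Om : measurableType d}.
Variables (P : probability Om R) (Xb : nat -> Om -> W).

Local Notation walk_op := (walk_op s q ws).
Local Notation pstep := (pstep s q ws).
Local Notation pn := (pn s q ws).
Local Notation Pr := (Pr P).

Class walk_chain : Prop := WalkChain {
  wc_meas : forall n, dmeas (Xb n);
  wc_law : forall n (x : nat -> W),
    Pr [set om | forall i, (i <= n)%N -> Xb i om = x i] =
    if x 0%N == 1%g then \prod_(i < n) pstep (x i) (x i.+1) else 0 }.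

Context {C : walk_chain}.

Lemma countable_gen : countable [set: W].
Proof. exact: (countable_W (s := s)). Qed.

Lemma Xb_meas n : dmeas (Xb n).
Proof. exact: wc_meas. Qed.

Lemma past_meas n B : past Xb n B -> measurable B.
Proof. by apply: measurable_past; [exact: countable_gen|exact: wc_meas]. Qed.

Lemma meas_pred k (S : set W) : measurable [set om | S (Xb k om)].
Proof. by apply: (@past_meas k); apply: past_pred. Qed.

Lemma markov1 n B u v : past Xb n B ->
  Pr (B `&` [set om | Xb n om = u] `&` [set om | Xb n.+1 om = v]) =
  Pr (B `&` [set om | Xb n om = u]) * pstep u v.
Proof.
apply: (markov_step countable_gen wc_meas (o := 1%g)) => [x y|k x]; first exact: pstep_ge0.
rewrite PrE ?wc_law //; apply: (@past_meas k) => om om' h h1 i ik.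
by rewrite -h // h1.
Qed.

Lemma total_next n A F a u : 0 <= a -> (forall v, 0 <= F v) -> measurable A ->
  (forall v, Pr (A `&` [set om | Xb n.+1 om = v]) = a * pstep u v * F v) ->
  Pr A = a * walk_op F u.
Proof.
move=> a0 F0 mA h; apply: EFin_inj; rewrite -PrE //.
rewrite (total_probability P countable_gen (Xb_meas n.+1) mA).
have mAv v : measurable (A `&` [set om | Xb n.+1 om = v]).
  by apply: measurableI => //; apply: wc_meas.
rewrite (esum_seq (bseq_at_uniq s u L0)) => [|v|v]; last 2 first.
- exact: measure_ge0.
- rewrite mem_bseq_at -ltnNge => uv.
  by rewrite PrE // h (pstep_far (D := D) uv) mulr0 mul0r.
rewrite (walk_opE (D := D)) mulr_sumr -sumEFin; apply: eq_bigr => v _.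
by rewrite PrE // h mulrA.
Qed.

Lemma markov_op n B u (F : W -> R) (E : set Om) : past Xb n B -> (forall v, 0 <= F v) ->
  measurable E ->
  (forall v, Pr (B `&` [set om | Xb n om = u] `&` [set om | Xb n.+1 om = v] `&` E) =
    Pr (B `&` [set om | Xb n om = u] `&` [set om | Xb n.+1 om = v]) * F v) ->
  Pr (B `&` [set om | Xb n om = u] `&` E) = Pr (B `&` [set om | Xb n om = u]) * walk_op F u.
Proof.
move=> pB F0 mE h; apply: (@total_next n) => //; first exact: Pr_ge0.
  apply: measurableI => //; apply: (@past_meas n); apply: pastI => //.
  exact: past_at.
by move=> v; rewrite -(markov1 u v pB) -h; congr Pr; apply: setIAC.
Qed.

Lemma markov_n n k B u y : past Xb n B ->
  Pr (B `&` [set om | Xb n om = u] `&` [set om | Xb (n + k)%N om = y]) =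
  Pr (B `&` [set om | Xb n om = u]) * pn k y u.
Proof.
elim: k n B u => [|k IH] n B u pB.
  rewrite addn0 pn0; case: eqP => [->|uy].
    by rewrite mulr1 -setIA setIid.
  rewrite mulr0 (_ : _ `&` _ = set0) ?Pr_set0 //.
  by apply/seteqP; split=> om // [[_ /= h1] /= h2]; apply: uy; rewrite -h1 -h2.
rewrite pnS; apply: markov_op => //.
- exact: pn_ge0.
- exact: wc_meas.
- move=> v; rewrite addnS -addSn; apply: IH.
  by apply: pastI; [apply: past_le pB|apply: past_at].
Qed.

(** The walk killed outside [A]. The starting point is tested too, so [k] steps test [k.+1]
    positions. *)
Fixpoint stay (A : set W) k u : R :=
  if k is k'.+1 then (u \in A)%:R * walk_op (stay A k') u else (u \in A)%:R.

Lemma stay_ge0 A k u : 0 <= stay A k u.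
Proof.
elim: k u => [|k IH] u /=; first exact: ler0n.
by apply: mulr_ge0; [exact: ler0n|apply: walk_op_ge0].
Qed.

Lemma stay_le1 A k u : stay A k u <= 1.
Proof.
elim: k u => [|k IH] u /=; first by case: (u \in A).
apply: mulr_ile1; rewrite ?ler0n //; last 2 first.
- by case: (u \in A).
- by rewrite -(walk_op_cst (D := D) 1 u); apply: (le_walk_op (D := D)).
by apply: walk_op_ge0 => v; apply: stay_ge0.
Qed.

Lemma stay_decr A k u : stay A k.+1 u <= stay A k u.
Proof.
elim: k u => [|k IH] u.
  rewrite /= ler_piMr ?ler0n //; apply: (@le_trans _ _ (walk_op (fun=> 1) u)).
    by apply: (le_walk_op (D := D)) => v; case: (v \in A).
  by rewrite (walk_op_cst (D := D)).
rewrite [leRHS]/= [leLHS]/=; apply: ler_wpM2l; first exact: ler0n.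
by apply: (le_walk_op (D := D)) => v; apply: IH.
Qed.

Definition stays A n k : set Om := [set om | forall j, (j <= k)%N -> A (Xb (n + j)%N om)].

Lemma stays_past A n k : past Xb (n + k) (stays A n k).
Proof. by move=> om om' h Ao j jk; rewrite -h ?leq_add2l //; apply: Ao. Qed.

Lemma markov_stay (A : set W) n k B u : past Xb n B ->
  Pr (B `&` [set om | Xb n om = u] `&` stays A n k) =
  Pr (B `&` [set om | Xb n om = u]) * stay A k u.
Proof.
have E0 (E F : set Om) : ~ A u -> F `<=` [set om | A (Xb n om)] ->
    Pr (E `&` [set om | Xb n om = u] `&` F) = 0.
  move=> Au FA; rewrite (_ : _ `&` _ = set0) ?Pr_set0 //.
  by apply/seteqP; split=> om // [[_ /= Xu] /FA /=]; rewrite Xu.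
elim: k n B u E0 => [|k IH] n B u E0 pB; rewrite [stay _ _ _]/=.
  case: (boolP (u \in A)) => uA; rewrite ?mulr1 ?mulr0.
    congr Pr; apply/seteqP; split=> om; first by case.
    move=> [Bo Xu]; split=> // j; rewrite leqn0 => /eqP ->; rewrite addn0 Xu.
    by move: uA; rewrite inE.
  apply: E0; first by move=> ?; move: uA; rewrite notin_setE.
  by move=> om /(_ 0%N isT); rewrite addn0.
case: (boolP (u \in A)) => uA; rewrite ?mul1r ?mul0r; last first.
  rewrite mulr0; apply: E0; first by move=> ?; move: uA; rewrite notin_setE.
  by move=> om /(_ 0%N isT); rewrite addn0.
apply: markov_op => //; first exact: stay_ge0.
  by apply: past_meas; apply: stays_past.
move=> v; rewrite -IH; last 2 first.
- move=> E F Av FA; rewrite (_ : _ `&` _ = set0) ?Pr_set0 //.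
  by apply/seteqP; split=> om // [[_ /= Xv] /FA /=]; rewrite Xv.
- by apply: pastI; [apply: past_le pB|apply: past_at].
congr Pr; apply/seteqP; split=> om [[[Bo Xu] Xv] st]; split=> //.
  by move=> j jk; rewrite addSnnS; apply: st.
move=> [|j] jk; last by rewrite -addSnnS; apply: st.
by rewrite addn0 Xu; move: uA; rewrite inE.
Qed.

Definition stay_inf A u : R := limn (stay A ^~ u).

Lemma stay_infE A u : stay_inf A u = limn (stay A ^~ u). Proof. by []. Qed.

Lemma stay_cvg A u : stay A k u @[k --> \oo] --> stay_inf A u.
Proof.
apply: nonincreasing_is_cvgn.
  by apply/nonincreasing_seqP => k; apply: stay_decr.
by exists 0 => _ [k _ <-]; apply: stay_ge0.
Qed.

Lemma stay_inf_le1 A u : stay_inf A u <= 1.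
Proof. apply: (cvgn_le (@stay_cvg A u)).
by apply: nearW => k; apply: stay_le1. Qed.

Definition stays_inf A n : set Om := [set om | forall j, (n <= j)%N -> A (Xb j om)].

Lemma stays_infE A n : stays_inf A n = \bigcap_k stays A n k.
Proof.
apply/seteqP; split=> om h; first by move=> k _ j _; apply: h; apply: leq_addr.
by move=> j nj; have := h (j - n)%N I (j - n)%N (leqnn _); rewrite subnKC.
Qed.

Lemma stays_inf_meas A n : measurable (stays_inf A n).
Proof.
rewrite stays_infE; apply: bigcapT_measurable => k.
by apply: past_meas; apply: stays_past.
Qed.

Lemma markov_stays_inf (A : set W) n B u : past Xb n B ->
  Pr (B `&` [set om | Xb n om = u] `&` stays_inf A n) =
  Pr (B `&` [set om | Xb n om = u]) * stay_inf A u.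
Proof.
move=> pB; set B' := B `&` _.
have mB' : measurable B' by apply: (@past_meas n); apply: pastI => //; apply: past_at.
have mst k : measurable (B' `&` stays A n k).
  by apply: measurableI => //; apply: past_meas; apply: stays_past.
have h1 := @Pr_bigcap_cvg _ _ _ P (fun k => B' `&` stays A n k) mst.
have {}h1 : Pr (B' `&` stays A n k) @[k --> \oo] --> Pr (B' `&` stays_inf A n).
  have -> : B' `&` stays_inf A n = \bigcap_k (B' `&` stays A n k).
    rewrite stays_infE; apply/seteqP; split=> om h; first by move=> k _; case: h => ? /(_ k I).
    by split=> [|k _]; [have [] := h 0%N I|have [] := h k I].
  apply: h1 => k om [? h]; split=> // j jk; apply: h; exact: leqW.
have h2 : Pr (B' `&` stays A n k) @[k --> \oo] --> Pr B' * stay_inf A u.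
  under eq_fun do rewrite markov_stay //.
  by apply: cvgM; [exact: cvg_cst|exact: stay_cvg].
exact: (cvg_unique _ h1 h2).
Qed.

Definition follows n u (l : seq 'I_N) : set Om :=
  [set om | forall j, (j <= size l)%N -> Xb (n + j)%N om = (u * wprod s (take j l))%g].

Lemma follows_past n u l : past Xb (n + size l) (follows n u l).
Proof. by move=> om om' h Ao j jl; rewrite -h ?leq_add2l //; apply: Ao. Qed.

(** Every letter of a prescribed word costs at most a constant factor. This is the tool for steering
    the walk; the constant is capped by [1] so that powers can be compared for words of different
    lengths. *)
Lemma markov_follows : exists2 e : R, 0 < e <= 1 & forall n B u l, past Xb n B ->
  e ^+ size l * Pr (B `&` [set om | Xb n om = u]) <= Pr (B `&` follows n u l).
Proof.
have [e0 e00 eP] := pstep_gen (D := D).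
exists (Num.min e0 1); first by rewrite lt_min e00 ltr01 ge_min lexx orbT.
move=> n B u l pB; elim/last_ind: l => [|l i IH].
  rewrite expr0 mul1r le_eqVlt; apply/orP; left; apply/eqP; congr Pr.
  apply/seteqP; split=> om [Bo h]; split=> //.
    by move=> j; rewrite leqn0 => /eqP ->; rewrite addn0 mulg1.
  by have := h 0%N isT; rewrite addn0 mulg1.
set v := (u * wprod s l)%g.
have -> : B `&` follows n u (rcons l i) =
    (B `&` follows n u l) `&` [set om | Xb (n + size l)%N om = v] `&`
      [set om | Xb (n + size l).+1 om = (v * s i)%g].
  apply/seteqP; split=> om.
    move=> [Bo h]; split.
      split; first split=> //.
        move=> j jl; rewrite h ?size_rcons ?leqW // -cats1 takel_cat //.
      have := h (size l); rewrite size_rcons leqnSn => /(_ isT) /= ->.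
      by rewrite -cats1 take_size_cat.
    have := h (size l).+1; rewrite size_rcons leqnn => /(_ isT) /=.
    by rewrite addnS -(size_rcons l i) take_size wprod_rcons mulgA.
  move=> [[[Bo h] hv] hvi]; split=> // j; rewrite size_rcons leq_eqVlt ltnS.
  move=> /orP[/eqP ->|jl]; last by rewrite h // -cats1 takel_cat.
  by rewrite addnS hvi -(size_rcons l i) take_size wprod_rcons mulgA.
have pBf : past Xb (n + size l) (B `&` follows n u l).
  by apply: pastI; [apply: past_le pB; apply: leq_addr|apply: follows_past].
rewrite markov1 //.
have -> : B `&` follows n u l `&` [set om | Xb (n + size l)%N om = v] = B `&` follows n u l.
  apply/seteqP; split=> om; first by case.
  by move=> [Bo h]; split=> //=; rewrite h // take_size.
rewrite size_rcons exprSr mulrAC; apply: ler_pM => //.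
- apply: mulr_ge0; last exact: Pr_ge0.
  by rewrite exprn_ge0 // le_min (ltW e00) ler01.
- by rewrite le_min (ltW e00) ler01.
- by apply: le_trans (eP v i); rewrite ge_min lexx.
Qed.

Definition short_jumps : set Om := [set om | forall i, (dist s (Xb i om) (Xb i.+1 om) <= L0)%N].

Lemma short_jumps_meas : measurable short_jumps.
Proof.
have -> : short_jumps = \bigcap_i [set om | (dist s (Xb i om) (Xb i.+1 om) <= L0)%N].
  by apply/seteqP; split=> om h i; [move=> _; apply: h|apply: h].
apply: bigcapT_measurable => i; apply: (@past_meas i.+1) => om om' h /=.
by rewrite !h.
Qed.

Lemma short_jumps_as : Pr (~` short_jumps) = 0.
Proof.
have -> : ~` short_jumps = \bigcup_i [set om | (L0 < dist s (Xb i om) (Xb i.+1 om))%N].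
  apply/seteqP; split=> om; last by move=> [i _ /=] h /(_ i); rewrite leqNgt h.
  by move=> /existsNP[i /negP]; rewrite -ltnNge => h; exists i.
have pi i : past Xb i.+1 [set om | (L0 < dist s (Xb i om) (Xb i.+1 om))%N].
  by move=> om om' h /=; rewrite !h.
apply: Pr_bigcup0 => i; first exact: past_meas (pi i).
have mi := past_meas (pi i).
apply: EFin_inj; rewrite -PrE //.
have mp := dmeas_pair (Xb_meas i) (Xb_meas i.+1).
rewrite (total_probability P (countable_prod countable_gen countable_gen) mp mi).
apply: esum1 => -[u v] _; set E := _ `&` _.
have [uv|uv] := ltnP L0 (dist s u v); last first.
  rewrite (_ : E = set0) ?measure0 //; apply/seteqP; split=> om // [/= h [hu hv]].
  by move: h; rewrite hu hv ltnNge uv.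
have -> : E = setT `&` [set om | Xb i om = u] `&` [set om | Xb i.+1 om = v].
  apply/seteqP; split=> om; first by move=> [_ /= [-> ->]].
  by move=> [[_ /= h1] /= h2]; split=> /=; rewrite h1 h2.
rewrite PrE; last first.
  by apply: measurableI; [apply: measurableI => //|]; apply: wc_meas.
by rewrite markov1 // (pstep_far (D := D) uv) mulr0.
Qed.

End Chain.

Lemma minn_step M l j : exists2 t, minn (M * j.+1) l = (minn (M * j) l + t)%N & (t <= M)%N.
Proof. by exists (minn (M * j.+1) l - minn (M * j) l)%N; nia. Qed.

Lemma radius_bound1 dl Bk j a : (a <= (j + 2) * dl + Bk)%N -> (a <= 4 * dl + 2 * Bk + dl * j)%N.
Proof. nia. Qed.

Lemma radius_bound2 dl Bk j k a b : (a <= (j + 2) * dl + Bk)%N -> (b <= Bk)%N -> (j <= k.+1)%N ->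
  (a + b <= 4 * dl + 2 * Bk + dl * k)%N.
Proof. nia. Qed.

(** * Staying in a cone forever *)

Section StayInCone.
Context {R : realType} {N : nat} {W : groupType} (s : 'I_N -> W).
Context {G : involutive_generators s}.
Variables (q : 'I_N -> nat) (m : W -> R) (ws : seq (R * seq 'I_N)) (L0 : nat).
Context {D : walk_data s q m ws L0}.
Context {d : measure_display} {Om : measurableType d}.
Variables (P : probability Om R) (Xb : nat -> Om -> W).
Context {C : walk_chain s q ws P Xb}.

Local Notation len := (len s).
Local Notation dist := (dist s).
Local Notation pn := (pn s q ws).
Local Notation Pr := (Pr P).

Definition qmax : nat := (\max_(i < N) q i).+1.

Lemma q_le_qmax i : (q i)%:R <= qmax%:R :> R.
Proof. by rewrite ler_nat leqW // (leq_bigmax i). Qed.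

Lemma m_gen_le u i : m (u * s i)%g <= qmax%:R * m u.
Proof.
have m0 w : 0 < m w by apply: (wd_m0 (walk_data := D)).
case: (boolP (ascent s u i)) => h.
  by rewrite (wd_m (walk_data := D) h); apply: ler_wpM2r; [exact: ltW|exact: q_le_qmax].
have h' : ascent s (u * s i)%g i by rewrite ascent_s.
rewrite -{2}(mulgss u i) (wd_m (walk_data := D) h') mulrA ler_peMl //; first exact: ltW.
by rewrite -natrM ler1n muln_gt0 /=; have := wd_q (walk_data := D) i; lia.
Qed.

Lemma m_dist_le u v : m v <= qmax%:R ^+ (dist u v) * m u.
Proof.
have [l sl lE] := lenP (s := s) (u^-1 * v)%g.
have -> : dist u v = size l by rewrite sl.
have -> : v = (u * wprod s l)%g by rewrite lE mulVKg.
elim/last_ind: l {sl lE} => [|l i IH]; first by rewrite mul1r mulg1.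
rewrite wprod_rcons mulgA size_rcons exprS -mulrA.
by apply: le_trans (m_gen_le _ _) _; apply: ler_wpM2l.
Qed.

Lemma m_geodesic u l : len (u * wprod s l)%g = (len u + size l)%N ->
  2 ^+ size l * m u <= m (u * wprod s l)%g.
Proof.
elim/last_ind: l => [|l i IH]; first by rewrite mul1r mulg1.
rewrite wprod_rcons mulgA size_rcons => h.
have h1 := lenMs_le (G := G) (u * wprod s l)%g i.
have h2 : (len (u * wprod s l)%g <= len u + size l)%N.
  by rewrite (leq_trans (lenM _ _)) // leq_add2l len_wprod.
have h3 : len (u * wprod s l)%g = (len u + size l)%N.
  by apply/eqP; rewrite eqn_leq h2 /= -ltnS -addnS -h; exact: h1.
have asc : ascent s (u * wprod s l)%g i by rewrite /ascent h; lia.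
rewrite (wd_m (walk_data := D) asc) exprS -mulrA; apply: ler_pM => //.
- by rewrite mulr_ge0 ?exprn_ge0 // ltW // (wd_m0 (walk_data := D)).
- by rewrite ler_nat (wd_q (walk_data := D)).
- exact: IH.
Qed.

Lemma Pr_in_seq_le (E : set Om) k (l : seq W) : measurable E ->
  Pr (E `&` [set om | Xb k om \in l]) <= \sum_(y <- l) Pr (E `&` [set om | Xb k om = y]).
Proof.
move=> mE; elim: l => [|y l IH].
  rewrite big_nil (_ : _ `&` _ = set0) ?Pr_set0 //.
  by apply/seteqP; split=> om // [].
rewrite big_cons; apply: le_trans (lerD (lexx _) IH).
have mp (S : set W) : measurable (E `&` [set om | S (Xb k om)]).
  by apply: measurableI => //; apply: (meas_pred (C := C)).
apply: le_trans (PrU_le _ (mp [set z | z = y]) (mp [set z | z \in l])).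
apply: le_Pr.
- exact: (mp [set z | z \in y :: l]).
- by apply: measurableU; [exact: (mp [set z | z = y])|exact: (mp [set z | z \in l])].
by move=> om [Eo /=]; rewrite inE => /orP[/eqP|] h; [left|right].
Qed.

Lemma short_jumps_dist om a t : short_jumps s L0 Xb om ->
  (dist (Xb a om) (Xb (a + t)%N om) <= L0 * t)%N.
Proof.
move=> sj; elim: t => [|t IH]; first by rewrite addn0 distxx.
rewrite (leq_trans (dist_triangle (Xb (a + t)%N om) _ _)) // mulnS addnC.
by rewrite leq_add // addnS; apply: sj.
Qed.

Context {V : finType} (star : V) (edge : V -> 'I_N -> V -> bool).
Context {A : strongly_automatic s star edge}.
Variables (K : nat) (dhyp : R).
Hypothesis rec_K : recurrent_outside s star edge K.
Hypothesis infW : forall n, exists w, (n < len w)%N.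
Hypothesis thin : thin_triangles s dhyp.

Local Notation cone := (cone s star edge).

Lemma dhyp_ge0 : 0 <= dhyp.
Proof.
have [z [h _]] := thin_btw thin 1%g (ltac:(by rewrite /btw !distxx) : btw s 1%g 1%g 1%g).
exact: le_trans h.
Qed.

(* Every ancestor of [x] at distance [2 * r] is [4 ^ r] times lighter than [x],
   which makes it unlikely to be approached. *)
Lemma pn_ancestor : exists2 rho : R, 0 < rho < 1 & forall n r t x b y,
  cone b x -> (len b + 2 * r <= len x)%N -> (dist b y <= t)%N ->
  pn n y x <= rho ^+ n * qmax%:R ^+ t * 2 ^- r.
Proof.
have [rho rho01 H] := pn_decay (D := D) rec_K infW; exists rho => // n r t x b y bx bxr byt.
have m0 w : 0 < m w by apply: (wd_m0 (walk_data := D)).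
have rho0 : 0 <= rho ^+ n by rewrite exprn_ge0 // ltW //; case/andP: rho01.
have q1 : 1 <= qmax%:R :> R by rewrite ler1n.
have mx : 4 ^+ r * m b <= m x.
  have [l sl lE] := lenP (s := s) (b^-1 * x)%g.
  have xE : x = (b * wprod s l)%g by rewrite lE mulVKg.
  have sl' : len x = (len b + size l)%N by rewrite (cone_dist bx) sl.
  have := @m_geodesic b l; rewrite -xE => /(_ sl'); apply: le_trans.
  apply: ler_wpM2r; first exact: ltW.
  have -> : (4 : R) = 2 ^+ 2 by rewrite -natrX.
  by rewrite -exprM; apply: ler_weXn2l; [rewrite ler1n|lia].
have my : m y <= qmax%:R ^+ (2 * t) * m b.
  apply: le_trans (m_dist_le b y) _; apply: ler_wpM2r; first exact: ltW.
  by apply: ler_weXn2l => //; lia.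
rewrite ler_pdivlMr ?exprn_gt0 // -ler_sqr ?nnegrE; last 2 first.
- apply: mulr_ge0; [exact: (pn_ge0 (D := D))|exact: exprn_ge0].
- by rewrite mulr_ge0 // exprn_ge0.
rewrite -(ler_pM2r (m0 b)) !exprMn -!exprM.
have := H n x y.
have p0 : 0 <= pn n y x ^+ 2 by apply: sqr_ge0.
have -> : (2 : R) ^+ (r * 2) = 4 ^+ r by rewrite mulnC exprM -natrX.
move=> h; have h2 := ler_wpM2r p0 mx; have h3 := ler_wpM2l (exprn_ge0 (2 * n) (ltW (proj1 (andP rho01)))) my.
rewrite [(n * 2)%N]mulnC [(t * 2)%N]mulnC.
rewrite -[leRHS]mulrA; apply: le_trans h3; apply: le_trans h; apply: le_trans h2.
by rewrite le_eqVlt; apply/orP; left; apply/eqP; ring.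
Qed.

(** To leave [cone w1] the walk must come back near [v1]: a geodesic from [x] to the exit point
    passes within [dhyp] of [v1], and some sample of the walk, taken every [M] steps, is close to
    [v1] up to an error linear in its index [j]. By [pn_ancestor] this has probability at most
    [4^-1 * 2^-1 ^+ j] at time [M * j], which sums to at most [1 / 2]. *)
Lemma stay_in_cone : exists R0 : nat, forall w1 v1 x n B, past Xb n B -> cone v1 x ->
  (len v1 + R0 <= len x)%N -> (forall y, (dist v1 y)%:R <= dhyp -> cone w1 y) ->
  2^-1 * Pr (B `&` [set om | Xb n om = x]) <=
  Pr (B `&` [set om | Xb n om = x] `&` stays_inf Xb (cone w1) n).
Proof.
have [rho rho01 H] := pn_ancestor; have [rho0 rho1] := andP rho01.
have [dl dlP] := nat_above dhyp.
(* Per unit of radius, one factor for the number of points in a ball and one for the ratio of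
   masses. *)
pose A0 : R := N.+1%:R * qmax%:R.
have A01 : 1 <= A0 by rewrite /A0 -natrM ler1n.
have A00 : 0 < A0 by apply: lt_le_trans A01.
have [M' M'P] := expr_small rho01 (ltac:(by rewrite divr_gt0 // exprn_gt0) : 0 < 2^-1 / A0 ^+ dl).
(* In [M] steps the decay [rho ^+ M] must beat the growth [A0 ^+ dl] that one more sample adds to
   the radius, with a factor [1 / 2] to spare. *)
pose M := M'.+1.
have MP : A0 ^+ dl * rho ^+ M <= 2^-1.
  rewrite -ler_pdivlMl ?exprn_gt0 // mulrC exprS; apply: le_trans (ltW M'P).
  by rewrite ler_piMl ?exprn_ge0 // ltW.
pose Bk := (L0 * M)%N.
pose c0 := A0 ^+ (4 * dl + 2 * Bk).
have c00 : 0 < c0 by rewrite exprn_gt0.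
have h01 : 0 < (2^-1 : R) < 1 by rewrite invr_gt0 ltr0n /= invf_lt1 ?ltr0n // ltr1n.
(* The initial depth [2 * r] pays for the constant part of the radius and leaves the factor
   [1 / 4]. *)
have [r rP] := expr_small h01 (ltac:(by rewrite divr_gt0) : 0 < 4^-1 / c0).
have {}rP : c0 * 2^-1 ^+ r <= 4^-1 by rewrite -ler_pdivlMl // mulrC ltW.
exists (2 * r)%N => w1 v1 x n B pB v1x v1r v1b.
set E := B `&` _; have pE : past Xb n E by apply: pastI => //; apply: past_at.
have mE : measurable E := past_meas (G := G) (C := C) pE.
have PE0 := Pr_ge0 P E.
pose rad j := (4 * dl + 2 * Bk + dl * j)%N.
pose F j := E `&` [set om | Xb (n + M * j)%N om \in bseq_at s v1 (rad j)].
have mF j : measurable (F j).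
  apply: measurableI; first exact: mE.
  exact: (meas_pred (C := C) (n + M * j) [set z | z \in bseq_at s v1 (rad j)]).
have FP j : Pr (F j) <= Pr E * (4^-1 * 2^-1 ^+ j).
  apply: le_trans (Pr_in_seq_le _ _ mE) _.
  rewrite (eq_bigr (fun y => Pr E * pn (M * j) y x)); last by move=> y _; apply: markov_n.
  rewrite -mulr_sumr; apply: ler_wpM2l => //.
  apply: (@le_trans _ _ (\sum_(y <- bseq_at s v1 (rad j)) rho ^+ (M * j) * qmax%:R ^+ rad j * 2 ^- r)).
    rewrite big_seq [leRHS]big_seq; apply: ler_sum => y; rewrite mem_bseq_at => h.
    exact: (@H (M * j)%N r (rad j) x v1 y v1x v1r h).
  rewrite big_const_seq count_predT iter_addr_0 -[leLHS]mulr_natl.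
  apply: (@le_trans _ _ (N.+1%:R ^+ rad j * (rho ^+ (M * j) * qmax%:R ^+ rad j * 2 ^- r))).
    apply: ler_wpM2r; first by rewrite !mulr_ge0 ?exprn_ge0 ?invr_ge0 ?exprn_ge0 // ltW.
    by rewrite -natrX ler_nat size_bseq_at.
  have -> : N.+1%:R ^+ rad j * (rho ^+ (M * j) * qmax%:R ^+ rad j * 2 ^- r) =
    (c0 * 2^-1 ^+ r) * (A0 ^+ dl * rho ^+ M) ^+ j.
    rewrite [in RHS]exprMn -!exprM /c0 -exprVn -mulrA.
    rewrite !exprD /A0 !exprMn; ring.
  apply: ler_pM => //; [by rewrite mulr_ge0 ?exprn_ge0 // ltW|by rewrite exprn_ge0 // mulr_ge0 ?exprn_ge0 // ltW|].
  by apply: lerXn2r; rewrite ?nnegrE // mulr_ge0 ?exprn_ge0 // ltW.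
have UP : Pr (\bigcup_j F j) <= 2^-1 * Pr E.
  apply: (@Pr_bigcup_le _ _ _ P F _ _ mF FP) => k.
  rewrite -mulr_sumr mulrC; apply: ler_wpM2r => //; rewrite -mulr_sumr.
  have : \sum_(i < k) (2^-1 : R) ^+ i = 2 - 2 * 2^-1 ^+ k.
    elim: k => [|k IH]; first by rewrite big_ord0 expr0; ring.
    by rewrite big_ord_recr /= IH exprS; field.
  move=> ->; have : 0 <= (2^-1 : R) ^+ k by rewrite exprn_ge0.
  lra.
have mS : measurable (stays_inf Xb (cone w1) n) := stays_inf_meas (G := G) (C := C) (cone w1) n.
have mJ : measurable (short_jumps s L0 Xb) := short_jumps_meas (G := G) L0 (C := C).
have mU : measurable (\bigcup_j F j) by apply: bigcupT_measurable.
have sub : E `&` short_jumps s L0 Xb `<=` (E `&` stays_inf Xb (cone w1) n) `|` \bigcup_j F j.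
  move=> om [Eo sj]; have [st|nst] := pselect (stays_inf Xb (cone w1) n om); first by left.
  right; have [l nl] : exists l, ~ cone w1 (Xb (n + l)%N om).
    apply: contrapT => h; apply: nst => k nk; apply: contrapT => hk; apply: h.
    by exists (k - n)%N; rewrite subnKC.
  have Xn : Xb n om = x by case: Eo.
  have [z xzp vz] := cone_separation thin v1x v1b nl.
  (* The samples are frozen at the exit time, so that the last index gives the exit point itself. *)
  pose p j := Xb (n + minn (M * j) l)%N om.
  have pB' j : (dist (p j) (p j.+1) <= Bk)%N.
    have [t tE tM] := minn_step M l j; rewrite /p tE addnA.
    by apply: leq_trans (short_jumps_dist _ _ sj) _; rewrite leq_mul2l tM orbT.
  have lM : (l < M * (l %/ M).+1)%N by rewrite mulnC ltn_ceil.
  have p0 : p 0%N = x by rewrite /p muln0 min0n addn0.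
  have pl : p (l %/ M).+1 = Xb (n + l)%N om by rewrite /p (minn_idPr _) // ltnW.
  have [|j /andP[_ jl] hj] := geodesic_chain thin pB' (leq0n (l %/ M).+1) _ dhyp_ge0 (b := v1) (D := dhyp).
    by exists z; rewrite ?p0 ?pl.
  have {}hj : (dist v1 (p j) <= (j + 2) * dl + Bk)%N.
    rewrite -(ler_nat R) natrD natrM natrD; apply: le_trans hj _; rewrite subn0.
    have : (j%:R : R) * dhyp <= j%:R * dl%:R by apply: ler_wpM2l.
    by move: dlP; lra.
  have Ml : (M * (l %/ M) <= l)%N by rewrite mulnC leq_divM.
  have [Mj|Mj] := leqP (M * j)%N l.
    exists j => //; split=> //=; rewrite mem_bseq_at.
    by apply: radius_bound1; move: hj; rewrite /p (minn_idPl Mj).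
  (* Here the close sample is the exit point; the last multiple of [M] before it is at most [Bk]
     away, which is why the radius allows for two blocks. *)
  exists (l %/ M)%N => //; split=> //=; rewrite mem_bseq_at.
  move: hj; rewrite /p (minn_idPr (ltnW Mj)) => hj.
  apply: leq_trans (dist_triangle (Xb (n + l)%N om) _ _) _.
  apply: (radius_bound2 hj _ jl).
  have lE : (n + l = n + M * (l %/ M) + (l - M * (l %/ M)))%N by rewrite -addnA subnKC.
  rewrite distC lE; apply: leq_trans (short_jumps_dist _ _ sj) _.
  rewrite leq_mul2l leq_subLR addnC -mulnS; apply/orP; right; exact: ltnW.
have := le_Pr P (measurableI _ _ mE mJ) (measurableU _ _ (measurableI _ _ mE mS) mU) sub.
have J0 : Pr (~` short_jumps s L0 Xb) = 0 by apply: (short_jumps_as (D := D) (C := C)).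
rewrite (Pr_as mE mJ J0) => /le_trans /(_ (PrU_le _ (measurableI _ _ mE mS) mU)).
lra.
Qed.

End StayInCone.

(** * Coverings *)

Section Coverings.
Context {R : realType} {N : nat} {W : groupType} (s : 'I_N -> W).
Context {G : involutive_generators s}.
Context {V : finType} (star : V) (edge : V -> 'I_N -> V -> bool).
Context {A : strongly_automatic s star edge}.
Variables (dhyp L1 : R) (L0 K : nat) (Cov : V -> set W).

Local Notation len := (len s).
Local Notation dist := (dist s).
Local Notation cone := (cone s star edge).
Local Notation ctype := (ctype s star edge).
Local Notation cov_at := (cov_at s star edge Cov).
Local Notation covn := (covn s star edge K Cov).

Class covering_system : Prop := CoveringSystem {
  cs_thin : thin_triangles s dhyp;
  cs_rec : recurrent_outside s star edge K;
  cs_inf : forall n, exists w, (n < len w)%N;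
  cs_jump : L0%:R + 1 <= L1;
  cs_hyp : dhyp + 1 <= L1;
  cs_cov : forall t, recurrent edge t -> is_covering s star edge L1 t (Cov t) }.
Context {S : covering_system}.

Local Notation I1 r := (Defs.intr s L1 (cone r)).
Local Notation I3 r := (Defs.intr s (3 * L1) (cone r)).

Lemma L1_ge1 : 1 <= L1.
Proof. by apply: le_trans (cs_jump (covering_system := S)); rewrite lerDr. Qed.

Lemma deep_rec x : (K < len x)%N -> recurrent edge (ctype x).
Proof.
move=> h; apply: (cs_rec (covering_system := S)); rewrite /Defs.ball /= dist1.
by apply/negP; rewrite -ltnNge.
Qed.

Lemma I1_cone r : I1 r `<=` cone r.
Proof. exact: intr_sub. Qed.

Lemma I3_below r x : I3 r x -> cone x `<=` I1 r.
Proof.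
move=> rx; apply: (cone_interior (cs_thin (covering_system := S)) _ rx).
by have := cs_hyp (covering_system := S); lra.
Qed.

Lemma cone_I3 r x : cone r x -> I3 x `<=` I3 r.
Proof. by move=> rx; apply: intr_mono => z; apply: cone_trans. Qed.

Lemma cone_I1 r x : cone r x -> I1 x `<=` I1 r.
Proof. by move=> rx; apply: intr_mono => z; apply: cone_trans. Qed.

Lemma exists_descent r : (0 < len r)%N -> exists i, len r = (len (r * s i)%g).+1.
Proof.
have [l sl lE] := lenP (s := s) r; move: sl; rewrite -lE.
elim/last_ind: l {lE} => [|l i _]; first by rewrite len1.
rewrite size_rcons wprod_rcons => h _; exists i; rewrite mulgss.
by apply/eqP; rewrite eqn_leq lenMs_le -h ltnS len_wprod.
Qed.

(** The apex itself is not interior: it has a neighbour of smaller length, which cannot be in its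
    cone. *)
Lemma I3_lt r x : (0 < len r)%N -> I3 r x -> (len r < len x)%N.
Proof.
move=> r0 h; have /intrP [rx rb] := h; rewrite ltn_neqAle (cone_len rx) andbT.
apply/eqP => e; have xr : x = r by apply: cone_len_eq rx _; rewrite e.
have [i ri] := exists_descent r0.
have /cone_len : cone r (r * s i)%g.
  by apply: rb; rewrite xr dist_gen; have := L1_ge1; lra.
by rewrite ri ltnn.
Qed.

Lemma cov_I3 x y : (K < len x)%N -> cov_at x y -> I3 x y.
Proof. by move=> dx [u Cu <-]; apply: (cov_int (cs_cov (covering_system := S) (deep_rec dx))). Qed.

Lemma cov_lt x y : (K < len x)%N -> cov_at x y -> (len x < len y)%N.
Proof. by move=> dx /(cov_I3 dx); apply: I3_lt; apply: leq_trans dx. Qed.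

Lemma cov_cone_sub x y : (K < len x)%N -> cov_at x y -> cone x y.
Proof. by move=> dx /(cov_I3 dx) /intr_sub. Qed.

Lemma cov_uniq x y y' z : (K < len x)%N -> cov_at x y -> cov_at x y' ->
  cone y z -> cone y' z -> y = y'.
Proof.
move=> dx [u Cu <-] [u' Cu' <-] yz y'z; congr (_ * _)%g; apply: contrapT => ne.
have := cov_disj (cs_cov (covering_system := S) (deep_rec dx)) (erefl _) Cu Cu' ne.
by move/seteqP => [h _]; apply: (h z).
Qed.

Lemma cov_at_ctype x x' u : ctype x = ctype x' -> cov_at x (x * u)%g -> cov_at x' (x' * u)%g.
Proof. by move=> e [v Cv /mulgI vu]; exists v; rewrite -?e // vu. Qed.

(** A suitable distance depends only on the type of [x] and on [t], and there are finitely many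
    pairs of types. *)
Lemma cov_bounded : exists umax, forall x t, (K < len x)%N -> recurrent edge t ->
  exists y, [/\ cov_at x y, ctype y = t & (dist x y <= umax)%N].
Proof.
have /choice [f fP] : forall p : V * V, exists n, forall x, ctype x = p.1 -> (K < len x)%N ->
    recurrent edge p.2 -> exists y, [/\ cov_at x y, ctype y = p.2 & (dist x y <= n)%N].
  move=> [t t'] /=.
  have [[x [xt dx rt']]|no] :=
    pselect (exists x, [/\ ctype x = t, (K < len x)%N & recurrent edge t']); last first.
    by exists 0%N => x xt dx rt'; case: no; exists x.
  have rt : recurrent edge t by rewrite -xt; apply: deep_rec.
  have /seteqP [_ ct] := cov_types (cs_cov (covering_system := S) rt) xt.
  have [u Cu xut] := ct t' rt'; exists (len u) => x' x't dx' _.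
  exists (x' * u)%g; split; rewrite ?distMr //; first by exists u; rewrite ?x't.
  rewrite -xut; apply/esym.
  have cu : cone x (x * u)%g.
    by apply: intr_sub (cov_int (cs_cov (covering_system := S) rt) xt Cu).
  by have [] := cone_ctype (etrans xt (esym x't)) cu.
exists (\max_p f p) => x t dx rt; have [y [h1 h2 h3]] := fP (ctype x, t) x erefl dx rt.
by exists y; split=> //; apply: leq_trans h3 (leq_bigmax _).
Qed.

Lemma cov_reach : exists Lr, forall x z, (K < len x)%N -> I3 x z -> (Lr < dist x z)%N ->
  exists2 y, cov_at x y & cone y z.
Proof.
have /choice [f fP] : forall t, exists n, forall x z, ctype x = t -> (K < len x)%N -> I3 x z ->
    (n < dist x z)%N -> exists2 y, cov_at x y & cone y z.
  move=> t.
  have [rt|nt] := pselect (recurrent edge t); last first.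
    by exists 0%N => x z xt /deep_rec; rewrite xt.
  have [L LP] := cov_rest (cs_cov (covering_system := S) rt).
  exists L => x z xt dx xz Lz; apply: contrapT => no.
  case: (LP x xt z); first by split=> [|[u Cu uz]]; [exact: intr_sub xz|apply: no; exists (x * u)%g => //; exists u; rewrite ?xt].
    by case: xz.
  by rewrite /Defs.ball /= leqNgt Lz.
exists (\max_t f t) => x z dx xz h; apply: (fP (ctype x)) => //.
exact: leq_ltn_trans (leq_bigmax _) h.
Qed.

(* Level [0] is the sphere of radius [K.+1] and level [k.+1] is [covn k]. *)
Definition cnode (k : nat) : set W :=
  if k is k'.+1 then covn k' else [set w | len w = K.+1].

Lemma cnodeS k : cnode k.+1 = \bigcup_(w in cnode k) cov_at w.
Proof.
case: k => [|k] //=; congr bigcup; apply/seteqP; rewrite /Defs.ball; split=> w /=; rewrite dist1.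
  by move=> [h1 /negP]; rewrite -ltnNge => h2; apply/eqP; rewrite eqn_leq h1 h2.
by move=> ->; split=> //; rewrite ltnn.
Qed.

Lemma cnode_parent k r : cnode k.+1 r -> exists2 w, cnode k w & cov_at w r.
Proof. by rewrite cnodeS => -[w h1 h2]; exists w. Qed.

Lemma cnode_child k w r : cnode k w -> cov_at w r -> cnode k.+1 r.
Proof. by rewrite cnodeS => h1 h2; exists w. Qed.

Lemma cnode_deep k r : cnode k r -> (K + k < len r)%N.
Proof.
elim: k r => [|k IH] r; first by move=> /= ->; rewrite addn0.
move=> /cnode_parent [w /IH wk wr]; rewrite addnS.
apply: leq_ltn_trans (cov_lt _ wr); last by apply: leq_ltn_trans wk; rewrite leq_addr.
exact: wk.
Qed.

Lemma deep_cnode k r : cnode k r -> (K < len r)%N.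
Proof. by move/cnode_deep; apply: leq_ltn_trans; rewrite leq_addr. Qed.

Lemma cnode_uniq k r r' z : cnode k r -> cnode k r' -> cone r z -> cone r' z -> r = r'.
Proof.
elim: k r r' => [|k IH] r r'.
  move=> /= rK r'K rz r'z; apply/esym; apply: cone_len_eq (cone_linear rz r'z _) _.
    by rewrite rK r'K.
  by rewrite rK r'K.
move=> /cnode_parent [w wk wr] /cnode_parent [w' w'k w'r'] rz r'z.
have dw := deep_cnode wk; have dw' := deep_cnode w'k.
have e : w = w'.
  apply: IH => //; first by apply: cone_trans (cov_cone_sub dw wr) rz.
  by apply: cone_trans (cov_cone_sub dw' w'r') r'z.
by rewrite -e in w'r'; apply: cov_uniq wr w'r' rz r'z.
Qed.

Lemma covn_deep k r : covn k r -> (K < len r)%N.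
Proof. exact: (@deep_cnode k.+1). Qed.

Lemma covn_len k r : covn k r -> (k < len r)%N.
Proof. by move/(@cnode_deep k.+1); apply: leq_ltn_trans; rewrite addnS ltnW // ltnS leq_addl. Qed.

Lemma covn_uniq k r r' z : covn k r -> covn k r' -> cone r z -> cone r' z -> r = r'.
Proof. exact: (@cnode_uniq k.+1). Qed.

(** Descent through successive covering elements, each raising the length by at least [1] and at
    most [umax]; one step is enough to be deep in [cone x]. *)
Lemma descend : exists umax, forall j x, (K < len x)%N -> exists z,
  [/\ cone x z, (j <= dist x z)%N, (dist x z <= umax * j)%N & (0 < j)%N -> I3 x z].
Proof.
have [umax uP] := cov_bounded; exists umax; elim=> [|j IH] x dx.
  by exists x; rewrite distxx; split=> //; apply: cone_refl.
have [z [xz jz zj xz3]] := IH x dx.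
have dz : (K < len z)%N by apply: leq_trans dx (cone_len xz).
have [y [zy _ yd]] := uP z _ dz (deep_rec dz).
have zyc := cov_cone_sub dz zy; have xy : cone x y by apply: cone_trans zyc.
exists y; split=> //.
- by rewrite -(leq_add2l (len x)) -cone_dist // addnS (leq_trans _ (cov_lt dz zy)) // ltnS (cone_dist xz) leq_add2l.
- by rewrite (leq_trans (dist_triangle z _ _)) // mulnS addnC leq_add.
- by move=> _; apply: cone_I3 xz _ (cov_I3 dz zy).
Qed.

(** Follow the covering cones that contain [x] down to the last one, with apex [a]. A point [z] far
    below [x] is covered by a child [y] of [a]; the cones of [x] and [y] both contain [z], so they
    are nested, and [y] lies below [x] because [x] is not in the cone of [y]. *)
Lemma find_cnode : exists T, forall x, (K < len x)%N -> exists k y,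
  [/\ cnode k.+1 y, cone x y, (len x < len y)%N & (dist x y <= T)%N].
Proof.
have [umax uP] := descend; have [Lr LP] := cov_reach.
exists (umax * Lr.+1)%N => x dx.
suff H n : forall k a, cnode k a -> cone a x -> (len x <= len a + n)%N -> exists k y,
    [/\ cnode k.+1 y, cone x y, (len x < len y)%N & (dist x y <= umax * Lr.+1)%N].
  apply: (H (len x) 0%N (anc s star edge K.+1 x)); rewrite ?leq_addl //.
    by rewrite /= len_anc.
  exact: cone_anc.
elim: n => [|n IH] k a ak ax xn.
  have da := deep_cnode ak; have [z [xz jz zj /(_ isT) xz3]] := uP Lr.+1 x dx.
  have xa : x = a by apply: cone_len_eq ax _; rewrite addn0 in xn.
  have [y ay yz] := LP x z dx xz3 jz; rewrite xa in ay.
  have lay := cov_lt da ay; have yca := cov_cone_sub da ay.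
  exists k, y; split; rewrite ?xa //; first exact: cnode_child ak ay.
  rewrite (leq_trans _ zj) // xa -(leq_add2l (len a)) -(cone_dist yca).
  by rewrite -xa -(cone_dist xz) (cone_len yz).
have [[y' ay' yx]|no] := pselect (exists2 y', cov_at a y' & cone y' x).
  apply: (IH k.+1 y') => //; first exact: cnode_child ak ay'.
  by have := cov_lt (deep_cnode ak) ay'; move: xn; rewrite addnS; move: (len _) (len _) (len _); lia.
have da := deep_cnode ak; have [z [xz jz zj /(_ isT) xz3]] := uP Lr.+1 x dx.
have az : (Lr < dist a z)%N.
  have az : cone a z by apply: cone_trans xz.
  by rewrite -(ltn_add2l (len a)) -(cone_dist az) (cone_dist xz) -addnS leq_add // (cone_len ax).
have [y ay yz] := LP a z da (cone_I3 ax xz3) az.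
have nyx : ~ cone y x by move=> yx; apply: no; exists y.
have xy : cone x y by apply: cone_between yz xz nyx.
have lxy : (len x < len y)%N.
  rewrite ltnNge; apply/negP => h; apply: nyx.
  by rewrite (cone_len_eq xy h); apply: cone_refl.
exists k, y; split=> //; first exact: cnode_child ak ay.
by rewrite (leq_trans _ zj) // -(leq_add2l (len x)) -(cone_dist xy) -(cone_dist xz) (cone_len yz).
Qed.

(** From a shallow point the path goes back to the identity and out to a fixed deep point, so that
    no point on the way is longer than its end. *)
Lemma reach_deep : exists T, forall x, exists l x', [/\ (x * wprod s l)%g = x', (size l <= T)%N,
  (K < len x')%N & forall j, (len (x * wprod s (take j l))%g <= len x')%N].
Proof.
have [xd dxd] := cs_inf (covering_system := S) K; exists (K + len xd)%N => x.
have [dx|dx] := ltnP K (len x).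
  by exists [::], x; rewrite mulg1; split=> // j; rewrite mulg1.
have [a sa aE] := lenP (s := s) (x^-1)%g; have [b sb bE] := lenP (s := s) xd.
rewrite lenV in sa.
exists (a ++ b), xd; split=> //.
- by rewrite wprod_cat aE bE mulVKg.
- by rewrite size_cat sa sb leq_add2r.
move=> j; rewrite take_cat; case: ltnP => ja.
  have -> : (x * wprod s (take j a))%g = ((wprod s (drop j a))^-1)%g.
    by apply: (mulIg (wprod s (drop j a))); rewrite mulVg -mulgA -wprod_cat cat_take_drop aE mulgV.
  rewrite lenV (leq_trans (len_wprod _)) // size_drop (leq_trans (leq_subr _ _)) // sa.
  by rewrite ltnW // (leq_ltn_trans dx).
rewrite wprod_cat aE mulVKg (leq_trans (len_wprod _)) // -sb.
by rewrite size_take_min geq_minr.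
Qed.

Lemma ctype_tr r r' u : ctype r = ctype r' -> cone r (r * u)%g -> ctype (r * u)%g = ctype (r' * u)%g.
Proof. by move=> e h; have [] := cone_ctype e h. Qed.

(* [u0] is the first point of the interior on a geodesic into it: a walk that
   arrives along this geodesic cannot have entered before. *)
Lemma entry_point t : recurrent edge t -> exists l0, forall r, (K < len r)%N -> ctype r = t ->
  I3 r (r * wprod s l0)%g /\
  forall j, (j < size l0)%N -> ~ I3 r (r * wprod s (take j l0))%g.
Proof.
move=> rt.
have [[r [dr rE]]|no] := pselect (exists r, (K < len r)%N /\ ctype r = t); last first.
  by exists [::] => r dr rE; case: no; exists r.
have [umax uP] := cov_bounded; have [y [ry _ _]] := uP r t dr rt.
have [l sl lE] := lenP (s := s) (r^-1 * y)%g.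
have ex : exists j, `[< I3 r (r * wprod s (take j l))%g >].
  by exists (size l); apply/asboolP; rewrite take_size lE mulVKg; apply: cov_I3.
case: (ex_minnP ex) => j0 /asboolP h0 hmin.
exists (take j0 l) => r' dr' r'E.
have e : ctype r = ctype r' by rewrite rE r'E.
split=> [|j]; first exact: intr_ctype e h0.
rewrite size_take_min => jm h.
have jj0 : (j < j0)%N by apply: leq_trans jm (geq_minl _ _).
have : I3 r (r * wprod s (take j l))%g.
  apply: (intr_ctype (esym e)); by rewrite take_takel ?(ltnW jj0) // in h.
by move=> /asboolP /hmin; rewrite leqNgt jj0.
Qed.

(* From any point a bounded number of steps leads to the entry point of some
   covering cone, in such a way that the cone is entered only at the end. *)
Lemma route t : recurrent edge t -> exists l0 T, [/\
  (forall r, (K < len r)%N -> ctype r = t -> I3 r (r * wprod s l0)%g) &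
  forall x, exists k r l, [/\ covn k.+1 r, ctype r = t, (x * wprod s l = r * wprod s l0)%g &
    [/\ (size l <= T)%N, ~ I1 r x &
     forall j, (j < size l)%N -> ~ I3 r (x * wprod s (take j l))%g]]].
Proof.
move=> rt; have [l0 l0P] := entry_point rt; have [T1 T1P] := reach_deep.
have [T2 T2P] := find_cnode; have [umax uP] := cov_bounded.
exists l0, (T1 + (T2 + umax) + size l0)%N; split=> [r dr rE|x]; first by have [] := l0P r dr rE.
have [l1 [x' [l1E sl1 dx' l1l]]] := T1P x.
have [k [y [yk x'y lx'y dx'y]]] := T2P x' dx'.
have dy := deep_cnode yk; have [r [yr rE dyr]] := uP y t dy rt.
have ry := cov_lt dy yr.
have [l2 sl2 l2E] := lenP (s := s) (x'^-1 * r)%g.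
have dr : (K < len r)%N := ltn_trans dy ry.
have x'r : cone x' r by apply: cone_trans (cov_cone_sub dy yr).
have lr : len r = (len x' + size l2)%N by rewrite (cone_dist x'r) sl2.
have x'l : (len x' < len r)%N by apply: ltn_trans ry.
(* Before arriving at [r] the route stays shorter than [r], hence outside its cone. *)
have below j : (j < size (l1 ++ l2))%N -> (len (x * wprod s (take j (l1 ++ l2)))%g < len r)%N.
  move=> jh; rewrite take_cat; have [jl|jl] := ltnP j (size l1).
    exact: leq_ltn_trans (l1l j) x'l.
  rewrite wprod_cat mulgA l1E (leq_ltn_trans (lenM _ _)) // lr ltn_add2l.
  rewrite (leq_ltn_trans (len_wprod _)) // size_take_min (leq_ltn_trans (geq_minl _ _)) //.
  by rewrite ltn_subLR // -size_cat.
have ncone z : (len z < len r)%N -> ~ cone r z by move=> h /cone_len; rewrite leqNgt h.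
exists k, r, (l1 ++ l2 ++ l0); split; [|by []| |split].
- exact: (cnode_child yk yr).
- by rewrite !wprod_cat !mulgA l1E l2E mulVKg.
- rewrite !size_cat addnA leq_add2r leq_add // sl2 (leq_trans (dist_triangle y _ _)) //.
  by rewrite leq_add.
- move=> /I1_cone; apply: ncone; apply: leq_ltn_trans (ltn_trans lx'y ry).
  by have := l1l 0%N; rewrite take0 mulg1.
move=> j; rewrite catA size_cat take_cat => jh; have [jl|jl] := ltnP j (size (l1 ++ l2)).
  by move=> /intr_sub; apply: ncone; apply: below.
rewrite wprod_cat mulgA wprod_cat mulgA l1E l2E mulVKg.
by have [_] := l0P r dr rE; apply; rewrite ltn_subLR.
Qed.

End Coverings.

(** * Last entry times *)

Section Process.
Context {R : realType} {N : nat} {W : groupType} (s : 'I_N -> W).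
Context {G : involutive_generators s}.
Variables (q : 'I_N -> nat) (m : W -> R) (ws : seq (R * seq 'I_N)) (L0 : nat).
Context {D : walk_data s q m ws L0}.
Context {d : measure_display} {Om : measurableType d}.
Variables (P : probability Om R) (Xb : nat -> Om -> W).
Context {C : walk_chain s q ws P Xb}.
Context {V : finType} (star : V) (edge : V -> 'I_N -> V -> bool).
Context {A : strongly_automatic s star edge}.
Variables (dhyp L1 : R) (K : nat) (Cov : V -> set W).
Context {S : covering_system s star edge dhyp L1 L0 K Cov}.

Local Notation len := (len s).
Local Notation dist := (dist s).
Local Notation cone := (cone s star edge).
Local Notation ctype := (ctype s star edge).
Local Notation cov_at := (cov_at s star edge Cov).
Local Notation covn := (covn s star edge K Cov).
Local Notation I1 r := (Defs.intr s L1 (cone r)).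
Local Notation I3 r := (Defs.intr s (3 * L1) (cone r)).
Local Notation word_op := (word_op s q).
Local Notation walk_op := (walk_op s q ws).
Local Notation pstep := (pstep s q ws).
Local Notation pn := (pn s q ws).
Local Notation stay := (stay s q ws).
Local Notation stay_inf := (stay_inf s q ws).
Local Notation Pr := (Pr P).
Local Notation asure := (asure P).
Local Notation etime := (etime s star edge L1 K Cov Xb).
Local Notation Rpos := (Rpos s star edge L1 K Cov Xb).

Let cW : countable [set: W]. Proof. exact: (countable_W (G := G)). Qed.
Let past_m n B : past Xb n B -> measurable B.
Proof. by move=> h; apply: (past_meas (C := C)) h. Qed.
Let deep k r : covn k r -> (K < len r)%N.
Proof. by move=> h; apply: (covn_deep (S := S)) h. Qed.
Let meas_stays B n : measurable (stays_inf Xb B n).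
Proof. exact: (stays_inf_meas (C := C)). Qed.
Let meas_at n x : measurable [set om | Xb n om = x].
Proof. exact: (Xb_meas (C := C)). Qed.

Let markov_si B n E u : past Xb n E ->
  Pr (E `&` [set om | Xb n om = u] `&` stays_inf Xb B n) =
  Pr (E `&` [set om | Xb n om = u]) * stay_inf B u.
Proof. by move=> h; apply: (markov_stays_inf (D := D) (C := C)). Qed.

(** Inside [cone r] lengths are [len r] plus the length seen from [r], so that ascents, and with
    them the step operator, look the same from [r] as from the identity. *)
Lemma ascent_cone r u i : cone r (r * u)%g -> cone r (r * (u * s i))%g ->
  ascent s (r * u)%g i = ascent s u i.
Proof.
move=> h1 h2; rewrite /ascent -mulgA (cone_dist h1) (cone_dist h2) !distMr.
by rewrite ltn_add2l.
Qed.

Lemma word_op_cone r l (F : W -> R) u : (forall v, (dist u v <= size l)%N -> cone r (r * v)%g) ->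
  word_op l F (r * u)%g = word_op l (fun v : W => F (r * v)%g : R) u.
Proof.
elim: l u => [|i l IH] u h //=; rewrite /letter_op.
have hu : cone r (r * u)%g by apply: h; rewrite distxx.
have hs : cone r (r * (u * s i))%g by apply: h; rewrite dist_gen.
rewrite ascent_cone // -mulgA !IH // => v uv; apply: h.
  by apply: leq_trans (dist_triangle (u * s i)%g _ _) _; rewrite dist_gen add1n.
exact: leqW.
Qed.

Lemma walk_op_cone r F u : I1 r (r * u)%g ->
  walk_op F (r * u)%g = walk_op (fun v => F (r * v)%g) u.
Proof.
move=> /intrP [_ h]; rewrite walk_op_words big_seq [RHS]big_seq; apply: eq_bigr => c cw.
congr (_ * _); apply: word_op_cone => v uv; apply: h; rewrite distM.
have : (dist u v <= L0)%N by apply: leq_trans uv (wd_size (walk_data := D) cw).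
rewrite -(ler_nat R) => /le_trans; apply.
by have := cs_jump (covering_system := S); lra.
Qed.

Lemma I1_tr r r' u : ctype r = ctype r' -> (r * u)%g \in I1 r = ((r' * u)%g \in I1 r').
Proof.
by move=> e; apply/idP/idP; rewrite !inE; apply: intr_ctype.
Qed.

Lemma I3_tr r r' u : ctype r = ctype r' -> I3 r (r * u)%g <-> I3 r' (r' * u)%g.
Proof. by move=> e; split; apply: intr_ctype. Qed.

(** Both sides equal [pstep u v], since in the interior of a cone the step operator commutes with
    translation by the apex. *)
Lemma pstep_hom r r' u v : ctype r = ctype r' -> I1 r (r * u)%g ->
  pstep (r * u)%g (r * v)%g = pstep (r' * u)%g (r' * v)%g.
Proof.
move=> e h; rewrite !pstepE !walk_op_cone //; last by apply: intr_ctype h.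
by apply: (eq_walk_op (D := D)) => w _; rewrite /dirac1 !(inj_eq (mulgI _)).
Qed.

Lemma stay_hom r r' k u : ctype r = ctype r' ->
  stay (I1 r) k (r * u)%g = stay (I1 r') k (r' * u)%g.
Proof.
move=> e; elim: k u => [|k IH] u /=; rewrite (I1_tr u e) //.
have [h|_] := boolP (_ \in _); last by rewrite !mul0r.
rewrite !mul1r; rewrite inE in h; rewrite !walk_op_cone //; last by apply: (intr_ctype (esym e)) h.
by apply: (eq_walk_op (D := D)) => w _; apply: IH.
Qed.

Lemma stay_inf_hom r r' u : ctype r = ctype r' ->
  stay_inf (I1 r) (r * u)%g = stay_inf (I1 r') (r' * u)%g.
Proof. by move=> e; rewrite !stay_infE; congr (limn _); apply/funext => k; apply: stay_hom. Qed.

Lemma start_pos : Pr [set om | Xb 0%N om = 1%g] = 1.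
Proof.
have := wc_law (walk_chain := C) 0 (fun=> 1%g); rewrite eqxx big_ord0 => <-.
congr Pr; apply/seteqP; split=> om /=; first by move=> h [|i].
by move=> /(_ 0%N (leqnn _)).
Qed.

Lemma reach_pos x : 0 < Pr [set om | Xb (len x) om = x].
Proof.
have [e /andP[e0 _] H] := markov_follows (D := D) (C := C).
have [l sl lE] := lenP (s := s) x.
have := H 0%N setT 1%g l (@pastT _ _ _ _ _); rewrite !setTI start_pos mulr1 => h.
have h0 : 0 < Pr (follows s Xb 0 1%g l) by apply: lt_le_trans h; rewrite exprn_gt0.
apply: lt_le_trans h0 _; apply: le_Pr.
- exact: (past_m (@follows_past _ _ _ _ _ Xb 0 1%g l)).
- exact: Xb_meas.
by move=> om /(_ (size l) (leqnn _)); rewrite add0n take_size lE mul1g sl.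
Qed.

Lemma cone_path x z : cone x z -> exists l, [/\ (x * wprod s l)%g = z, size l = dist x z &
  forall j, cone x (x * wprod s (take j l))%g].
Proof.
move=> xz; have /coneP [g [gp zE gE]] := xz; exists (labels g); split=> // [|j].
  rewrite zE distMr /labels size_map; apply/eqP; rewrite -(eqn_add2l (len x)).
  have := size_gamma (s := s) (star := star) (edge := edge) z.
  rewrite gE size_cat size_gamma => ->.
  by rewrite (cone_dist xz) zE distMr.
rewrite /labels -map_take; apply: cone_ext.
by move: gp; rewrite -{1}(cat_take_drop j g) is_path_cat => /andP[].
Qed.

(** From [x] the walk is steered along a word of bounded length to a point [z2] at depth [R0] below
    some [z1], whose neighbourhood lies in [cone x]; from there [stay_in_cone] keeps it in [cone x],
    which is contained in the interior of [cone r]. *)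
Lemma stay_lower : exists2 c1 : R, 0 < c1 & forall r x, (K < len r)%N -> I3 r x ->
  c1 <= stay_inf (I1 r) x.
Proof.
have [e /andP[e0 e1] H] := markov_follows (D := D) (C := C).
have [umax uP] := descend (S := S).
have [R0 R0P] := stay_in_cone (D := D) (C := C) (A := A) (cs_rec (covering_system := S))
  (cs_inf (covering_system := S)) (cs_thin (covering_system := S)).
exists (e ^+ (umax + umax * R0) / 2); first by rewrite divr_gt0 // exprn_gt0.
move=> r x dr rx.
have dx : (K < len x)%N by apply: leq_trans dr (cone_len (intr_sub rx)).
have [z1 [xz1 _ dz1 /(_ isT) xz1']] := uP 1%N x dx.
have d1 : (K < len z1)%N by apply: leq_trans dx (cone_len xz1).
have [z2 [z12 lz2 dz2 _]] := uP R0 z1 d1.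
have xz2 : cone x z2 by apply: cone_trans z12.
have [l [lE sl lc]] := cone_path xz2.
have p0 := reach_pos x; set n := len x in p0.
have st := H n setT x l (@pastT _ _ _ _ _); rewrite !setTI in st.
set F := follows s Xb n x l in st.
have pF : past Xb (n + size l) F by apply: follows_past.
have Fz : F `<=` [set om | Xb (n + size l) om = z2].
  by move=> om /(_ (size l) (leqnn _)) /= ->; rewrite take_size lE.
have h3 : 2^-1 * Pr F <= Pr (F `&` stays_inf Xb (cone x) (n + size l)).
  have := @R0P x z1 z2 (n + size l)%N F pF z12.
  rewrite (setIidl Fz).
  apply; first by rewrite (cone_dist z12) leq_add2l.
  move=> y hy; have /intrP [_] := xz1'; apply; apply: le_trans hy _.
  by have := cs_hyp (covering_system := S); have := L1_ge1 (S := S); lra.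
have xI : cone x `<=` I1 r by apply: (I3_below (S := S)).
have hE := @markov_si (I1 r) n setT x (@pastT _ _ _ _ _); rewrite !setTI in hE.
have h4 : Pr (F `&` stays_inf Xb (cone x) (n + size l)) <= Pr [set om | Xb n om = x] * stay_inf (I1 r) x.
  rewrite -hE; apply: le_Pr.
  - apply: measurableI; first exact: (past_m pF).
    exact: meas_stays.
  - by apply: measurableI.
  move=> om [Fo st']; split.
    by have := Fo 0%N isT; rewrite addn0 take0 mulg1.
  move=> j nj; apply: xI; have [jl|jl] := leqP j (n + size l).
    by rewrite -(subnKC nj) Fo ?leq_subLR //; apply: lc.
  by apply: st'; apply: ltnW.
rewrite -(ler_pM2l p0); apply: le_trans h4; apply: le_trans h3.
rewrite mulrC mulrAC; rewrite [leRHS]mulrC; apply: ler_wpM2r; first by rewrite invr_ge0.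
apply: le_trans st; apply: ler_wpM2r; first exact: Pr_ge0.
apply: ler_wiXn2l => //; first exact: ltW.
rewrite sl; apply: leq_trans (dist_triangle z1 _ _) _.
by rewrite leq_add // (leq_trans dz1) // muln1.
Qed.

Definition settled r n om := I3 r (Xb n om) /\ stays_inf Xb (I1 r) n om.

Lemma settled_cone r r' n om : cone r r' -> settled r' n om -> settled r n om.
Proof.
by move=> rr' [h1 h2]; split=> [|j nj]; [apply: cone_I3 rr' _ h1|apply: cone_I1 rr' _ (h2 j nj)].
Qed.

Lemma settled_uniq k r r' n n' om : covn k r -> covn k r' -> settled r n om -> settled r' n' om ->
  r = r'.
Proof.
move=> kr kr' [_ h] [_ h']; apply: (covn_uniq (S := S) kr kr' (z := Xb (maxn n n') om)).
  by apply: intr_sub (h _ _); rewrite leq_maxl.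
by apply: intr_sub (h' _ _); rewrite leq_maxr.
Qed.

Lemma enteredE k om n : entered s star edge L1 K Cov Xb k om n <->
  exists2 r, covn k r & settled r n om.
Proof. by split=> [[r [h1 h2 h3]]|[r h1 [h2 h3]]]; exists r. Qed.

Lemma etimeP k om : (exists n, entered s star edge L1 K Cov Xb k om n) ->
  [/\ covn k (Rpos k om), settled (Rpos k om) (etime k om) om &
   forall n, settled (Rpos k om) n om -> (etime k om <= n)%N].
Proof.
move=> ex; have ex' : exists n, `[< entered s star edge L1 K Cov Xb k om n >].
  by case: ex => n h; exists n; apply/asboolP.
have [h hm] : entered s star edge L1 K Cov Xb k om (etime k om) /\
    forall n, entered s star edge L1 K Cov Xb k om n -> (etime k om <= n)%N.
  rewrite /Defs.etime; case: xgetP => [n -> //|/(_ (ex_minn ex')) []].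
  by case: ex_minnP => n /asboolP h hm; split=> // n' /asboolP /hm.
have [r kr rs] := (proj1 (enteredE _ _ _)) h.
have rx : cone r (Xb (etime k om) om) by case: rs => /intr_sub.
have -> : Rpos k om = r.
  rewrite /Defs.Rpos; case: xgetP => [r' -> [kr' r'x]|/(_ r) []//].
  by apply: (covn_uniq (S := S) kr' kr r'x).
by split=> // n h'; apply: hm; apply/enteredE; exists r.
Qed.

Lemma first_settled k r n om : covn k r -> settled r n om ->
  (forall n', (n' < n)%N -> ~ settled r n' om) -> etime k om = n /\ Rpos k om = r.
Proof.
move=> kr rn no; have ex : exists n', entered s star edge L1 K Cov Xb k om n'.
  by exists n; apply/enteredE; exists r.
have [k' s' m'] := etimeP ex; have e := settled_uniq k' kr s' rn; split=> //.
rewrite e in s' m'; apply/eqP; rewrite eqn_leq m' //= leqNgt; apply/negP => /no; exact.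
Qed.

(** * Regenerations by repeated attempts *)

Section Attempts.
Variables (t0 : V) (u0 : W) (c : R) (T : nat).

(** At the entry point [r * u0] the apex can be recovered from the position alone, so [regen] can be
    defined without last entry times. *)
Definition root n om : W := (Xb n om * u0^-1)%g.
(** An earlier entry that has survived up to time [n]. Only positions up to [n] occur, which makes
    [surviving] an event of the past; followed by survival after [n], it amounts to an earlier
    settled time. *)
Definition early r n om : Prop := exists2 n', (n' < n)%N &
  I3 r (Xb n' om) /\ forall j, (n' <= j <= n)%N -> I1 r (Xb j om).
Definition surviving n k : set Om := [set om |
  [/\ exists2 l, covn l.+1 (root n om) & ctype (root n om) = t0, ~ early (root n om) n om &
   forall j, (j <= k)%N -> I1 (root n om) (Xb (n + j)%N om)]].
Definition regen n : set Om := \bigcap_k surviving n k.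

Lemma surviving_past n k : past Xb (n + k) (surviving n k).
Proof.
move=> om om' h; rewrite /surviving /=.
have e : root n om' = root n om by rewrite /root h // leq_addr.
rewrite e => -[h1 h2 h3]; split=> // [[n' n'n [a b]]|j jk]; last by rewrite -h ?leq_add2l //; apply: h3.
apply: h2; exists n' => //; rewrite h; last by rewrite (leq_trans (ltnW n'n)) // leq_addr.
split=> // j /andP[j1 j2]; rewrite h; last by rewrite (leq_trans j2) // leq_addr.
by apply: b; rewrite j1.
Qed.

Lemma surviving_meas n k : measurable (surviving n k).
Proof. exact: (past_m (@surviving_past n k)). Qed.

Lemma regen_meas n : measurable (regen n).
Proof. by apply: bigcap_measurable => [|k _]; [exists 0%N|exact: surviving_meas]. Qed.

Lemma regenP n om : regen n om -> exists k r, [/\ covn k.+1 r, ctype r = t0, Xb n om = (r * u0)%g,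
  stays_inf Xb (I1 r) n om & forall n', (n' < n)%N -> ~ settled r n' om].
Proof.
move=> h; have [[k kr rt] ne _] := h 0%N I; exists k, (root n om); split=> //.
- by rewrite /root mulgKV.
- by move=> j nj; have [_ _ /(_ _ (leqnn _))] := h (j - n)%N I; rewrite subnKC.
by move=> n' n'n [h3 h1]; apply: ne; exists n' => //; split=> // j /andP[jn _]; apply: h1.
Qed.

Lemma regen_intro k r n om : covn k.+1 r -> ctype r = t0 -> Xb n om = (r * u0)%g ->
  stays_inf Xb (I1 r) n om -> ~ early r n om -> regen n om.
Proof.
move=> kr rt Xn st ne l _; have e : root n om = r by rewrite /root Xn mulgK.
by rewrite /surviving /= e; split=> // [|j _]; [exists k|apply: st; rewrite leq_addr].
Qed.

Lemma le_Pr_states (c' : R) n (B E : set Om) : measurable B -> measurable E -> 0 <= c' ->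
  (forall x, c' * Pr (B `&` [set om | Xb n om = x]) <= Pr (E `&` [set om | Xb n om = x])) ->
  c' * Pr B <= Pr E.
Proof.
move=> mB mE c0 h; rewrite -lee_fin EFinM -!PrE //.
rewrite (total_probability P (countable_gen (G := G)) (Xb_meas (C := C) n) mB).
rewrite (total_probability P (countable_gen (G := G)) (Xb_meas (C := C) n) mE).
rewrite -esumZl //; apply: le_esum => x _.
have mI F : measurable F -> measurable (F `&` [set om | Xb n om = x]).
  by move=> mF; apply: measurableI => //; apply: (Xb_meas (C := C)).
by rewrite (PrE P (mI _ mB)) (PrE P (mI _ mE)) -EFinM lee_fin.
Qed.

Hypothesis c01 : 0 < c < 1.
Hypothesis attempt : forall n B, past Xb n B ->
  c * Pr B <= Pr (B `&` \bigcup_(j in [set j | (j <= T)%N]) regen (n + j)).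

Definition no_regen n : set Om := [set om | forall j, (n <= j)%N -> ~ regen j om].

Lemma no_regen_meas n : measurable (no_regen n).
Proof.
rewrite (_ : no_regen n = \bigcap_(j in [set j | (n <= j)%N]) ~` regen j); last first.
  by apply/seteqP; split=> om h j; apply: h.
by apply: bigcap_measurable => [|j _]; [exists n => /=|apply: measurableC; exact: regen_meas].
Qed.

Lemma no_regen_past n n' B : past Xb n' B -> (n <= n')%N ->
  Pr (no_regen n `&` B) <= (1 - c) * Pr B.
Proof.
move=> pB nn'; have mB := past_m pB.
set U := \bigcup_(j in [set j | (j <= T)%N]) regen (n' + j).
have mU : measurable U.
  rewrite /U (_ : [set j | _] = `I_T.+1) //.
  by apply: bigcup_measurable => j _; exact: regen_meas.
have := attempt pB; rewrite -/U => h.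
have := Pr_split P mB mU => hs.
have : Pr (no_regen n `&` B) <= Pr (B `\` U).
  apply: le_Pr; [exact: measurableI (no_regen_meas n) mB|exact: measurableD|].
  move=> om [nr Bo]; split=> // -[j _]; apply: nr; exact: leq_trans nn' (leq_addr _ _).
lra.
Qed.

Definition failed n M k : set Om := [set om | forall j, (j <= M)%N -> ~ surviving (n + j) k om].

Lemma failed_past n M k : past Xb (n + M + k) (failed n M k).
Proof.
move=> om om' h fo j jM h'; apply: (fo j jM); apply: surviving_past h' => i ih.
by rewrite h // (leq_trans ih) // leq_add2r leq_add2l.
Qed.

(** An attempt after any event of the past succeeds with probability at least [c], but [no_regen n]
    depends on the future. It is the intersection over [M] of the unions over [k] of [failed n M k],
    which are events of the past; passing to both limits bounds its probability by [1 - c] times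
    itself. *)
Lemma no_regen0 n : Pr (no_regen n) = 0.
Proof.
have mf M k : measurable (failed n M k) := past_m (@failed_past n M k).
have step M : Pr (no_regen n) <= (1 - c) * Pr (\bigcup_k failed n M k).
  have c1 : forall k, failed n M k `<=` failed n M k.+1.
    move=> k om h j jM [h1 h2 h3]; apply: (h j jM); split=> // i ik; apply: h3; exact: leqW.
  have c2 := Pr_bigcup_cvg (P := P) (mf M) c1.
  have sub : no_regen n `<=` \bigcup_k failed n M k.
    move=> om nr; have /choice [f fP] : forall j, exists k, ~ surviving (n + j) k om.
      move=> j; apply: contrapT => h; apply: (nr (n + j)%N (leq_addr _ _)) => k _.
      by apply: contrapT => h'; apply: h; exists k.
    exists (\max_(j < M.+1) f j)%N => // j jM [h1 h2 h3]; apply: (fP j); split=> // i ij.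
    apply: h3; apply: leq_trans ij _.
    exact: (leq_bigmax (F := fun j : 'I_M.+1 => f j) (Ordinal (jM : (j < M.+1)%N))).
  have c3 : Pr (no_regen n `&` failed n M k) @[k --> \oo] --> Pr (no_regen n).
    rewrite [X in _ --> Pr X](_ : no_regen n = \bigcup_k (no_regen n `&` failed n M k)).
      apply: Pr_bigcup_cvg => k; first by apply: measurableI (no_regen_meas n) (mf M k).
      by move=> om [h1 h2]; split=> //; apply: c1.
    by rewrite -setI_bigcupr (setIidl sub).
  have c4 : (1 - c) * Pr (failed n M k) - Pr (no_regen n `&` failed n M k) @[k --> \oo] -->
      (1 - c) * Pr (\bigcup_k failed n M k) - Pr (no_regen n).
    by apply: cvgB => //; apply: cvgMr.
  rewrite -subr_ge0; apply: cvgn_ge c4 _; exists 0%N => // k _ /=; rewrite subr_ge0.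
  apply: no_regen_past (@failed_past n M k) _; by rewrite -addnA leq_addr.
have mU M : measurable (\bigcup_k failed n M k) by apply: bigcupT_measurable.
have d1 M : \bigcup_k failed n M.+1 k `<=` \bigcup_k failed n M k.
  by move=> om [k _ h]; exists k => // j jM; apply: h; apply: leqW.
have d2 := Pr_bigcap_cvg (P := P) mU d1.
have capE : \bigcap_M \bigcup_k failed n M k `<=` no_regen n.
  move=> om h j nj rj; have [k _ /(_ (j - n)%N (leqnn _))] := h (j - n)%N I.
  by apply; rewrite subnKC //; apply: rj.
have d3 : (1 - c) * Pr (\bigcup_k failed n M k) @[M --> \oo] -->
    (1 - c) * Pr (\bigcap_M \bigcup_k failed n M k) by apply: cvgMr.
have h1 : Pr (no_regen n) <= (1 - c) * Pr (\bigcap_M \bigcup_k failed n M k).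
  by apply: cvgn_ge d3 _; exists 0%N => // M _; apply: step.
have h2 : Pr (\bigcap_M \bigcup_k failed n M k) <= Pr (no_regen n).
  by apply: le_Pr capE; [apply: bigcapT_measurable|exact: no_regen_meas].
have h3 := Pr_ge0 P (no_regen n).
by apply/eqP; rewrite eq_le h3 andbT; case/andP: c01 => *; nra.
Qed.

Definition regens : set Om := [set om | forall n, exists2 j, (n <= j)%N & regen j om].

Lemma regens_meas : measurable regens.
Proof.
rewrite (_ : regens = \bigcap_n ~` no_regen n).
  by apply: bigcap_measurable => [|n _]; [exists 0%N|apply: measurableC; exact: no_regen_meas].
apply/seteqP; split=> om h n.
  by move=> _ nr; have [j nj rj] := h n; apply: nr rj.
by apply: contrapT => no; apply: (h n I) => j nj rj; apply: no; exists j.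
Qed.

Lemma regens_as : Pr (~` regens) = 0.
Proof.
have mU : measurable (\bigcup_n no_regen n) by apply: bigcupT_measurable; exact: no_regen_meas.
apply: Pr0_sub (measurableC regens_meas) mU _ (Pr_bigcup0 _ no_regen0); last exact: no_regen_meas.
move=> om h; apply: contrapT => no; apply: h => n; apply: contrapT => h'; apply: no.
by exists n => // j nj rj; apply: h'; exists j.
Qed.

End Attempts.

Lemma lineage j i r : covn (j + i) r -> exists2 r', covn j r' & cone r' r.
Proof.
elim: i r => [|i IH] r; first by rewrite addn0 => h; exists r => //; apply: cone_refl.
rewrite addnS => /(cnode_parent (k := (j + i).+1)) [w wk wr].
have [r' jr' r'w] := IH w wk; exists r' => //; apply: cone_trans r'w _.
by apply: (cov_cone_sub (S := S)) wr; apply: deep wk.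
Qed.

(** The levels can be made to increase: if the cone of a later regeneration had no greater level,
    the cone of that level containing the earlier one would be the same cone, settled before its own
    first time. *)
Lemma regens_entered t0 u0 om : (forall r, (K < len r)%N -> ctype r = t0 -> I3 r (r * u0)%g) ->
  regens t0 u0 om -> forall k, exists n, entered s star edge L1 K Cov Xb k om n.
Proof.
move=> u0P rg k; suff [n [k' [r [kk' kr rs]]]] : exists n k' r, [/\ (k <= k')%N, covn k' r & settled r n om].
  have [r' kr' r'r] := @lineage k (k' - k) r (ltac:(by rewrite subnKC)).
  by exists n; apply/enteredE; exists r' => //; apply: settled_cone rs.
elim: k => [|k [n [k' [r [kk' kr rs]]]]].
  have [n _ /regenP [k [r [kr rt Xn st _]]]] := rg 0%N; exists n, k.+1, r; split=> //; split=> //.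
  by rewrite Xn; apply: u0P => //; apply: deep kr.
have [n' nn' /regenP [l [r' [lr' rt Xn st no]]]] := rg n.+1; exists n', l.+1, r'; split=> //; last first.
  by split=> //; rewrite Xn; apply: u0P => //; apply: deep lr'.
rewrite (leq_ltn_trans kk') // ltnNge; apply/negP => lk'.
have [r'' lr'' r''r] := @lineage l.+1 (k' - l.+1) r (ltac:(by rewrite subnKC)).
have r''n := settled_cone r''r rs.
have dr' := deep lr'.
have e : r'' = r'.
  apply: settled_uniq lr'' lr' r''n (_ : settled r' n' om); split=> //.
  by rewrite Xn; apply: u0P.
by apply: (no n nn'); rewrite -e.
Qed.

(** An attempt follows the route to an entry point of a cone of type [t0] and then stays in it; the
    first has probability at least [e ^+ T], the second at least [c1]. The route starts outside the
    interior of depth [L1] and reaches depth [3 * L1] only at its end, so the entry is not early. *)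
Lemma attempts t0 : recurrent edge t0 -> exists u0 c T, [/\
  (forall r, (K < len r)%N -> ctype r = t0 -> I3 r (r * u0)%g), 0 < c < 1 &
  forall n B, past Xb n B ->
    c * Pr B <= Pr (B `&` \bigcup_(j in [set j | (j <= T)%N]) regen t0 u0 (n + j))].
Proof.
move=> rt; have [l0 [T [l0P rP]]] := route (S := S) rt.
have [e /andP[e0 e1] H] := markov_follows (D := D) (C := C).
have [c1 c10 c1P] := stay_lower.
have c11 : c1 <= 1.
  have [x dx] := cs_inf (covering_system := S) K; have [k [r [l [kr rE _ _]]]] := rP x.
  have dr := deep kr.
  by apply: (le_trans (c1P r (r * wprod s l0)%g dr (l0P r dr rE))); apply: (stay_inf_le1 (D := D)).
(* Halving makes the constant strictly less than [1]. *)
exists (wprod s l0), (e ^+ T * c1 / 2), T; split=> //.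
  rewrite divr_gt0 ?mulr_gt0 ?exprn_gt0 //=.
  have : e ^+ T * c1 <= 1 by rewrite -[leRHS]mulr1 ler_pM ?exprn_ge0 ?exprn_ile1 // ltW.
  lra.
move=> n B pB; have mB := past_m pB.
set U := \bigcup_(j in _) _.
have mU : measurable U.
  rewrite /U (_ : [set j | _] = `I_T.+1) //.
  by apply: bigcup_measurable => j _; exact: regen_meas.
have q0 : 0 <= e ^+ T * c1 by rewrite mulr_ge0 // ?exprn_ge0 // ltW.
apply: (@le_trans _ _ (e ^+ T * c1 * Pr B)).
  by apply: ler_wpM2r; [exact: Pr_ge0|lra].
apply: (@le_Pr_states _ n) => // [|x]; first exact: measurableI.
have [k [r [l [kr rE lE [lT nI1 nI3]]]]] := rP x.
have dr := deep kr.
have pF := @follows_past _ _ s _ _ Xb n x l.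
set F := follows s Xb n x l in pF.
have pBF : past Xb (n + size l) (B `&` F) by apply: pastI pF; apply: past_le pB; rewrite leq_addr.
have BFx : (B `&` F) `&` [set om | Xb (n + size l)%N om = (r * wprod s l0)%g] = B `&` F.
  apply/seteqP; split=> om [] // Bo Fo; split=> //.
  by have := Fo (size l) (leqnn _); rewrite take_size lE.
have h1 := H n B x l pB; rewrite -/F in h1.
have h2 := @markov_si (I1 r) _ _ (r * wprod s l0)%g pBF.
rewrite BFx in h2.
have h3 : e ^+ T * c1 * Pr (B `&` [set om | Xb n om = x]) <= Pr (B `&` F) * stay_inf (I1 r) (r * wprod s l0)%g.
  apply: (@le_trans _ _ (e ^+ size l * Pr (B `&` [set om | Xb n om = x]) * c1)).
    rewrite mulrAC; apply: ler_wpM2r; first exact: ltW.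
    by apply: ler_wpM2r; [exact: Pr_ge0|apply: ler_wiXn2l => //; exact: ltW].
  apply: ler_pM => //.
  - by rewrite mulr_ge0 ?Pr_ge0 // exprn_ge0 // ltW.
  - exact: ltW.
  - by apply: c1P => //; apply: l0P.
apply: le_trans h3 _; rewrite -h2; apply: le_Pr.
- by apply: measurableI; [exact: (past_m pBF)|exact: meas_stays].
- by apply: measurableI; [exact: measurableI|exact: meas_at].
move=> om [[Bo Fo] st].
have Xn : Xb n om = x by have := Fo 0%N isT; rewrite addn0 take0 mulg1.
split=> //; split=> //; exists (size l) => //; apply: regen_intro kr rE _ st _.
  by have := Fo (size l) (leqnn _); rewrite take_size lE.
move=> [n' n'l [h3 h1']]; have [nn'|nn'] := leqP n n'.
  apply: (nI3 (n' - n)%N); first by rewrite ltn_subLR.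
  by rewrite -Fo ?subnKC // leq_subLR ltnW.
by apply: nI1; rewrite -Xn; apply: h1'; rewrite (ltnW nn') leq_addr.
Qed.

(** * The Green function and its Harnack inequality *)

Lemma pn_Pr n x : pn n x 1%g = Pr [set om | Xb n om = x].
Proof.
have p0 : past Xb 0 setT by [].
have h := markov_n (C := C) n 1%g x p0.
rewrite setTI (start_pos) mul1r add0n in h; rewrite -h.
apply: (@eq_Pr_as _ _ _ _ _ _ [set om | Xb 0%N om = 1%g]).
- by apply: measurableI; exact: Xb_meas.
- exact: Xb_meas.
- exact: Xb_meas.
- by rewrite Pr_setC ?(start_pos) ?subrr //; exact: Xb_meas.
- by move=> om h0; split=> [[]|].
Qed.

Definition grn (x : W) : R := limn (fun n => \sum_(i < n) pn i x 1%g).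

Lemma pn_sum_bounded x : exists B, forall n, \sum_(i < n) pn i x 1%g <= B.
Proof.
have [rho /andP[r0 r1] hr] := pn_decay (D := D) (cs_rec (covering_system := S)) (cs_inf (covering_system := S)).
have m1 := wd_m0 (walk_data := D) 1%g; have mx := wd_m0 (walk_data := D) x.
pose a := Num.sqrt (m x / m 1%g).
have le n : pn n x 1%g <= rho ^+ n * a.
  have p0 : 0 <= rho ^+ n by apply: exprn_ge0; exact: ltW.
  have pn0 : 0 <= pn n x 1%g by apply: (pn_ge0 (D := D)).
  rewrite -[leLHS]ger0_norm // -sqrtr_sqr -[rho ^+ n]ger0_norm //.
  rewrite -sqrtr_sqr -sqrtrM ?sqr_ge0 // ler_wsqrtr // mulrA ler_pdivlMr // mulrC -exprM mulnC.
  exact: hr.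
exists (a / (1 - rho)) => n; apply: (@le_trans _ _ (\sum_(i < n) rho ^+ i * a)).
  by apply: ler_sum => i _; apply: le.
rewrite -big_distrl /= mulrC ler_wpM2l ?sqrtr_ge0 //.
have d0 : 0 < 1 - rho by lra.
rewrite -[leRHS]mul1r ler_pdivlMr // mulrC; have := subrX1 rho n.
have p0 : 0 <= rho ^+ n by rewrite exprn_ge0 // ltW.
move=> h; have {}h : (1 - rho) * (\sum_(i < n) rho ^+ i) = 1 - rho ^+ n by rewrite -opprB mulNr -h opprB.
by rewrite h; lra.
Qed.

Lemma grn_cvg x : \sum_(i < n) pn i x 1%g @[n --> \oo] --> grn x.
Proof.
have [B hB] := pn_sum_bounded x.
have nd : {homo (fun n => \sum_(i < n) pn i x 1%g) : a b / (a <= b)%N >-> a <= b}.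
  move=> a b /subnKC <-; rewrite big_split_ord /= lerDl; apply: sumr_ge0 => i _.
  exact: (pn_ge0 (D := D)).
apply: nondecreasing_is_cvgn => //; exists B => _ [n _ <-]; exact: hB.
Qed.

Lemma grn_ge n x : \sum_(i < n) pn i x 1%g <= grn x.
Proof.
apply: (cvgn_ge (u := fun n => \sum_(i < n) pn i x 1%g)); first exact: grn_cvg.
exists n => // j /= /subnKC <-.
rewrite big_split_ord /= lerDl; apply: sumr_ge0 => i _; exact: (pn_ge0 (D := D)).
Qed.

Lemma grn_pos x : 0 < grn x.
Proof.
apply: lt_le_trans (grn_ge (len x).+1 x); rewrite big_ord_recr /=.
rewrite ltr_wpDl ?sumr_ge0 // => [i _|]; first exact: (pn_ge0 (D := D)).
by rewrite pn_Pr; apply: reach_pos.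
Qed.

#[local] Hint Resolve grn_pos : core.

Lemma grn_gen : exists2 e : R, 0 < e <= 1 & forall x i, e * grn x <= grn (x * s i)%g.
Proof.
have [e e0 he] := pstep_gen (D := D).
exists (Num.min e 1) => [|x i]; first by rewrite ge_min lexx orbT lt_min e0 ltr01.
apply: (@le_trans _ _ (e * grn x)); first by rewrite ler_wpM2r ?ge_min ?lexx // ltW // grn_pos.
apply: (@cvgn_le _ (fun n => e * \sum_(i < n) pn i x 1%g)).
  by apply: cvgMr; exact: grn_cvg.
apply: nearW => n; apply: le_trans (grn_ge n.+1 _).
rewrite big_ord_recl big_distrr ler_wpDl ?(pn_ge0 (D := D)) //; apply: ler_sum => j _.
rewrite -[lift ord0 j : nat]/(j.+1) !pn_Pr.
have pT : past Xb j setT by [].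
have := markov1 (C := C) x (x * s i)%g pT; rewrite setTI => h.
apply: (@le_trans _ _ (Pr [set om | Xb j om = x] * pstep x (x * s i)%g)).
  by rewrite -[leLHS]/(e * Pr [set om | Xb j om = x]) mulrC ler_wpM2l ?Pr_ge0 // he.
rewrite -(h G _ _ D); apply: le_Pr => [||om []] //.
by apply: measurableI; exact: Xb_meas.
Qed.

Lemma grn_dist : exists2 e : R, 0 < e <= 1 & forall x y, e ^+ dist x y * grn x <= grn y.
Proof.
have [e e01 he] := grn_gen; exists e => // x y; have /andP[e0 e1] := e01.
rewrite /Defs.dist; have [l hl hw] := lenP (G := G) (x^-1 * y)%g; rewrite -hl.
have -> : y = (x * wprod s l)%g by rewrite hw mulVKg.
elim/last_ind: l {hl hw} => [|l i IH]; first by rewrite expr0 mul1r /= mulg1.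
rewrite size_rcons wprod_rcons mulgA; apply: le_trans (he _ _).
by rewrite exprS -mulrA ler_wpM2l // ltW.
Qed.

(** Harnack inequality: one more step keeps at least a fixed fraction of [grn], in either direction.
    It allows the position and the apex to be exchanged at a cost linear in their distance. *)
Lemma ln_grn_lip : exists2 c : R, 0 <= c & forall x y, `|ln (grn x) - ln (grn y)| <= c * (dist x y)%:R.
Proof.
have [e /andP[e0 e1] he] := grn_dist; exists (- ln e); first by rewrite oppr_ge0 ln_le0.
have le x y : ln (grn x) - ln (grn y) <= - ln e * (dist x y)%:R.
  have h1 : ln (e ^+ dist x y * grn x) <= ln (grn y).
    by rewrite ler_ln ?posrE ?mulr_gt0 ?exprn_gt0 ?grn_pos.
  rewrite lnM ?posrE ?exprn_gt0 ?grn_pos // lnXn // in h1.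
  by rewrite mulNr -mulr_natr in h1 *; lra.
move=> x y; rewrite ler_norml; apply/andP; split; last exact: le.
by have := le y x; rewrite (distC (G := G)) => h; lra.
Qed.

Class regeneration (t0 : V) (u0 : W) (c : R) (T : nat) : Prop := Regeneration {
  rg_rec : recurrent edge t0;
  rg_int : forall r, (K < len r)%N -> ctype r = t0 -> I3 r (r * u0)%g;
  rg_c : 0 < c < 1;
  rg_attempt : forall n B, past Xb n B ->
    c * Pr B <= Pr (B `&` \bigcup_(j in [set j | (j <= T)%N]) regen t0 u0 (n + j)) }.

Lemma regeneration_exists : exists t0 u0 c T, regeneration t0 u0 c T.
Proof.
have [x dx] := cs_inf (covering_system := S) K.
have rt : recurrent edge (ctype x) by apply: (deep_rec (S := S)).
have [u0 [c [T [h1 h2 h3]]]] := attempts rt.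
by exists (ctype x), u0, c, T.
Qed.

(** * Last entry times and the conditional law of the future *)

Section Regenerated.
Context {t0 : V} {u0 : W} {c : R} {T : nat} {Rg : regeneration t0 u0 c T}.

(** One almost sure event on which the pathwise statements hold without exception. *)
Definition good : set Om :=
  regens t0 u0 `&` short_jumps s L0 Xb `&` [set om | Xb 0%N om = 1%g].

Lemma good_meas : measurable good.
Proof.
apply: measurableI => //; apply: measurableI; last exact: (short_jumps_meas L0 (C := C)).
exact: regens_meas.
Qed.

Lemma good_as : Pr (~` good) = 0.
Proof.
have h1 : Pr (~` regens t0 u0) = 0.
  exact: (regens_as (rg_c (regeneration := Rg)) (rg_attempt (regeneration := Rg))).
have h2 : Pr (~` short_jumps s L0 Xb) = 0 by apply: (short_jumps_as (D := D) (C := C)).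
have h3 : Pr (~` [set om | Xb 0%N om = 1%g]) = 0.
  by rewrite Pr_setC // (start_pos) subrr.
have m1 : measurable (regens t0 u0) by exact: regens_meas.
have m2 : measurable (short_jumps s L0 Xb) by exact: (short_jumps_meas L0 (C := C)).
rewrite /good !setCI; apply/eqP; rewrite eq_le Pr_ge0 andbT.
apply: le_trans (PrU_le _ _ _) _; [|exact: measurableC|].
  by apply: measurableU; exact: measurableC.
rewrite h3 addr0; apply: le_trans (PrU_le _ _ _) _; rewrite ?h1 ?h2 ?addr0 //; exact: measurableC.
Qed.

Lemma goodP k om : good om -> [/\ covn k (Rpos k om), settled (Rpos k om) (etime k om) om &
   forall n, settled (Rpos k om) n om -> (etime k om <= n)%N].
Proof.
move=> [[h _] _]; apply: etimeP.
exact: (regens_entered (rg_int (regeneration := Rg)) h).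
Qed.

Lemma good_next k om : good om -> cov_at (Rpos k om) (Rpos k.+1 om).
Proof.
move=> g; have [h1 h2 _] := goodP k g; have [h1' h2' _] := goodP k.+1 g.
have [w wk wr] := cnode_parent (k := k.+1) h1'.
have cw : cone w (Rpos k.+1 om) by apply: (cov_cone_sub (S := S)) wr; apply: deep wk.
have e := settled_uniq wk h1 (settled_cone cw h2') h2.
by rewrite -e.
Qed.

Lemma good_cone1 k om : good om -> cone (Rpos k om) (Rpos k.+1 om).
Proof.
move=> g; apply: (cov_cone_sub (S := S)) (good_next k g).
by have [h _ _] := goodP k g; apply: deep h.
Qed.

Lemma good_cone k j om : good om -> cone (Rpos k om) (Rpos (k + j) om).
Proof.
move=> g; elim: j => [|j IH]; first by rewrite addn0; apply: cone_refl.
by rewrite addnS; apply: cone_trans IH (good_cone1 _ g).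
Qed.

Lemma good_le1 k om : good om -> (etime k om <= etime k.+1 om)%N.
Proof.
move=> g; have [_ _ h] := goodP k g; apply: h.
by have [_ h' _] := goodP k.+1 g; apply: settled_cone h'; apply: good_cone1.
Qed.

Lemma good_le k j om : good om -> (etime k om <= etime (k + j) om)%N.
Proof.
move=> g; elim: j => [|j IH]; first by rewrite addn0.
by rewrite addnS (leq_trans IH) // good_le1.
Qed.

Lemma good_deep k om : good om -> (K < len (Rpos k om))%N.
Proof. by move=> g; have [h _ _] := goodP k g; apply: deep h. Qed.

Fixpoint dcov (j : nat) (r : W) : set W :=
  if j is j'.+1 then \bigcup_(w in dcov j' r) cov_at w else [set r].

Lemma dcov_cone j r w : (K < len r)%N -> dcov j r w -> cone r w.
Proof.
move=> dr; elim: j w => [|j IH] w /=; first by move=> ->; apply: cone_refl.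
move=> [w' /IH rw' w'w]; have lw : (K < len w')%N by apply: leq_trans dr (cone_len rw').
by apply: cone_trans rw' _; apply: (cov_cone_sub (S := S)) w'w.
Qed.

Lemma dcov_covn k j r w : covn k r -> dcov j r w -> covn (k + j) w.
Proof.
move=> kr; elim: j w => [|j IH] w /=; first by move=> ->; rewrite addn0.
by move=> [w' /IH h h']; rewrite addnS; apply: (cnode_child (k := (k + j).+1)) h h'.
Qed.

Lemma dcov_tr j r r' v : (K < len r)%N -> ctype r = ctype r' -> dcov j r (r * v)%g ->
  dcov j r' (r' * v)%g.
Proof.
move=> dr e; elim: j v => [|j IH] v /=.
  by rewrite -[RHS]mulg1 => /mulgI ->; rewrite mulg1.
move=> [w]; rewrite -(mulVKg r w); move: (r^-1 * w)%g => v' h h'.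
exists (r' * v')%g; first exact: IH.
have rv' := dcov_cone dr h.
have e' : ctype (r * v')%g = ctype (r' * v')%g by apply: ctype_tr.
have vE : (v = v' * (v'^-1 * v))%g by rewrite mulVKg.
by rewrite vE mulgA; rewrite vE mulgA in h'; apply: cov_at_ctype h'.
Qed.

Lemma good_dcov k j om : good om -> dcov j (Rpos k om) (Rpos (k + j) om).
Proof.
move=> g; elim: j => [|j IH] /=; first by rewrite addn0.
by rewrite addnS; exists (Rpos (k + j) om) => //; apply: good_next.
Qed.

(** Later last entry times and cones are expressed through the trajectory [z] after [e_k] and the
    apex [r] alone; [dcov] replaces [covn] so that no absolute level is mentioned. *)
Definition sett (z : nat -> W) r n := I3 r (z n) /\ forall j, (n <= j)%N -> I1 r (z j).
Definition isfirst j r (z : nat -> W) n w :=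
  [/\ dcov j r w, sett z w n & forall n', (n' < n)%N -> ~ sett z w n'].

Lemma isfirst_tr j r r' y n v : (K < len r)%N -> ctype r = ctype r' ->
  isfirst j r (fun i => r * y i)%g n (r * v)%g ->
  isfirst j r' (fun i => r' * y i)%g n (r' * v)%g.
Proof.
move=> dr e [h1 h2 h3]; have rv := dcov_cone dr h1.
have e' : ctype (r * v)%g = ctype (r' * v)%g by apply: ctype_tr.
have yE r1 i : (r1 * y i = r1 * v * (v^-1 * y i))%g by rewrite -mulgA mulVKg.
have t3 i : I3 (r * v)%g (r * y i)%g <-> I3 (r' * v)%g (r' * y i)%g.
  by rewrite (yE r) (yE r'); apply: I3_tr.
have t1 i : I1 (r * v)%g (r * y i)%g <-> I1 (r' * v)%g (r' * y i)%g.
  by rewrite (yE r) (yE r'); split; apply: intr_ctype.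
have ts n' : sett (fun i => r * y i)%g (r * v)%g n' <-> sett (fun i => r' * y i)%g (r' * v)%g n'.
  by split=> -[a b]; split=> [|j' h]; [apply/t3|apply/t1/b|apply/t3|apply/t1/b].
by split=> [||n' h]; [apply: dcov_tr h1|apply/ts|move/ts; apply: h3].
Qed.

(** Times before [e_k] do not interfere: a time settled for a deeper cone is settled for [R_k], so
    it cannot precede [e_k]. *)
Lemma good_isfirst k j n w om : good om ->
  isfirst j (Rpos k om) (fun i => Xb (etime k om + i) om) n w <->
  (etime (k + j) om = etime k om + n /\ Rpos (k + j) om = w)%N.
Proof.
move=> g; have [c1 s1 m1] := goodP k g; have [c2 s2 m2] := goodP (k + j) g.
have tr w' n' : sett (fun i => Xb (etime k om + i) om) w' n' <-> settled w' (etime k om + n')%N om.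
  split=> -[a b]; split=> // i ni.
    by rewrite -(subnKC (leq_trans (leq_addr _ _) ni)); apply: b; rewrite leq_subRL // (leq_trans (leq_addr _ _) ni).
  by apply: b; rewrite leq_add2l.
split=> [[h1 h2 h3]|[h1 h2]].
  apply: first_settled; [exact: dcov_covn h1|exact/tr|].
  move=> n' n'n st; have [le|lt] := leqP (etime k om) n'.
    by apply: (h3 (n' - etime k om)%N); [rewrite ltn_subLR|apply/tr; rewrite subnKC].
  have : settled (Rpos k om) n' om.
    by apply: settled_cone st; apply: dcov_cone h1; apply: good_deep.
  by move/m1; rewrite leqNgt lt.
rewrite -h2; split; first exact: good_dcov.
  by apply/tr; rewrite -h1.
by move=> n' n'n /tr /m2; rewrite h1 leq_add2l leqNgt n'n.
Qed.

Definition ref (t : V) : W := xget 1%g [set r | (K < len r)%N /\ ctype r = t].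

Lemma refP r : (K < len r)%N -> (K < len (ref (ctype r)))%N /\ ctype (ref (ctype r)) = ctype r.
Proof. by move=> dr; rewrite /ref; case: xgetP => [r' -> //|/(_ r) []]. Qed.

Definition theta k om : nat -> W := fun i => ((Rpos k om)^-1 * Xb (etime k om + i) om)%g.

(** The event is moved to a fixed apex of each type, so that it becomes an event of the translated
    trajectory [theta] and depends on the apex through its type only. *)
Definition FS t j n v : set (nat -> W) :=
  [set y | isfirst j (ref t) (fun i => ref t * y i)%g n (ref t * v)%g].

Lemma FSP k j n v om : good om -> FS (ctype (Rpos k om)) j n v (theta k om) <->
  (etime (k + j) om = etime k om + n /\ Rpos (k + j) om = (Rpos k om * v)%g)%N.
Proof.
move=> g; have dr := good_deep k g; have [dr' e] := refP dr.
rewrite -(good_isfirst k j n _ g) /FS /=.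
have -> : (fun i => Xb (etime k om + i) om) = (fun i => Rpos k om * theta k om i)%g.
  by apply/funext => i; rewrite /theta mulVKg.
by split; apply: isfirst_tr.
Qed.

Lemma FS_seqm t j n v : seqm 1%g (FS t j n v).
Proof.
rewrite /FS /isfirst /sett.
have a1 w i : seqm 1%g [set y : nat -> W | I1 w (ref t * y i)%g].
  by apply: (seqm_pred (x0 := 1%g) cW i (fun x => I1 w (ref t * x)%g)).
have a3 w i : seqm 1%g [set y : nat -> W | I3 w (ref t * y i)%g].
  by apply: (seqm_pred (x0 := 1%g) cW i (fun x => I3 w (ref t * x)%g)).
have st w i : seqm 1%g [set y : nat -> W | I3 w (ref t * y i)%g /\
    forall j', (i <= j')%N -> I1 w (ref t * y j')%g].
  apply: (seqmI (E := [set y : nat -> W | I3 w (ref t * y i)%g])) => //.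
  apply: (seqm_all (E := fun j' => [set y : nat -> W | (i <= j')%N -> I1 w (ref t * y j')%g])) => j'.
  exact: (seqm_imp _ (E := [set y : nat -> W | I1 w (ref t * y j')%g])).
rewrite (_ : [set y | _] = [set y | dcov j (ref t) (ref t * v)%g] `&`
  ([set y | I3 (ref t * v)%g (ref t * y n)%g /\ forall j', (n <= j')%N -> I1 (ref t * v)%g (ref t * y j')%g] `&`
   [set y | forall n', (n' < n)%N -> ~ (I3 (ref t * v)%g (ref t * y n')%g /\
     forall j', (n' <= j')%N -> I1 (ref t * v)%g (ref t * y j')%g)])); last first.
  by apply/seteqP; split=> y /=; [case|move=> [? []]].
apply: seqmI; first exact: seqm_cst.
apply: seqmI; first exact: st.
apply: (seqm_all (E := fun n' => [set y | (n' < n)%N -> ~ (I3 (ref t * v)%g (ref t * y n')%g /\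
     forall j', (n' <= j')%N -> I1 (ref t * v)%g (ref t * y j')%g)])) => n'.
apply: (seqm_imp _ (E := [set y : nat -> W | ~ (I3 (ref t * v)%g (ref t * y n')%g /\
     forall j', (n' <= j')%N -> I1 (ref t * v)%g (ref t * y j')%g)])).
exact: seqmC (st _ _).
Qed.

Lemma entered_meas k n : measurable [set om | entered s star edge L1 K Cov Xb k om n].
Proof.
rewrite (_ : [set om | _] = \bigcup_r [set om | covn k r /\ settled r n om]); last first.
  by apply/seteqP; split=> om /= => [/enteredE [r h1 h2]|[r _ [h1 h2]]]; [exists r|apply/enteredE; exists r].
apply: (bigcup_countableT_measurable cW) => r.
have [kr|nk] := pselect (covn k r); last first.
  by rewrite (_ : [set om | _] = set0) //; apply/seteqP; split=> om // [].
rewrite (_ : [set om | _] = [set om | I3 r (Xb n om)] `&` stays_inf Xb (I1 r) n); last first.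
  by apply/seteqP; split=> om /= => [[_ []]|[]].
by apply: measurableI => //; exact: (meas_pred (C := C) n (I3 r)).
Qed.

Lemma etime_meas k : dmeas (etime k).
Proof.
pose en n := [set om | entered s star edge L1 K Cov Xb k om n].
pose lt n := en n `&` \bigcap_(i in `I_n) ~` en i.
have men n : measurable (en n) := entered_meas k n.
have mlt n : measurable (lt n).
  apply: measurableI => //; apply: fin_bigcap_measurable => [|i _]; first exact: finite_II.
  exact: measurableC.
have ltE n om : lt n om <-> entered s star edge L1 K Cov Xb k om n /\
    forall m', entered s star edge L1 K Cov Xb k om m' -> (n <= m')%N.
  split=> -[a b]; split=> // i h; first by rewrite leqNgt; apply/negP => /b.
  by move=> /b; rewrite leqNgt h.
(* The value [0] also collects the outcomes without any entry, by the default of [etime]. *)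
have hE n : [set om | etime k om = n] = lt n `|` (if n is 0 then \bigcap_i ~` en i else set0).
  apply/seteqP; split=> om.
    rewrite /= /Defs.etime; case: xgetP => [n' -> h|no] => [<-|<-]; first by left; apply/ltE.
    right=> i _ eni; have ex : exists i, `[< en i om >] by exists i; apply/asboolP.
    apply: (no (ex_minn ex)); case: ex_minnP => j /asboolP h hm; split=> // m' hm'.
    by apply: hm; apply/asboolP.
  move=> [/ltE [h1 h2]|].
    rewrite /= /Defs.etime; case: xgetP => [n' -> [h1' h2']|/(_ n) []//].
    by apply/eqP; rewrite eqn_leq h2' // h2.
  case: n => // h; rewrite /= /Defs.etime; case: xgetP => // n' _ [h1 _].
  by case: (h n' I).
move=> n; rewrite hE; apply: measurableU => //; case: n => [|n]; last exact: measurable0.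
by apply: bigcapT_measurable => i; apply: measurableC.
Qed.

Lemma Rpos_meas k : dmeas (Rpos k).
Proof.
have h : dmeas (fun om => Xb (etime k om) om).
  by apply: (dmeas_at (f := Xb)); [exact: etime_meas|exact: (Xb_meas (C := C))].
exact: (dmeas_comp (fun x => xget 1%g [set w | covn k w /\ cone w x]) cW h).
Qed.

Lemma theta_meas k i : dmeas (fun om => theta k om i).
Proof.
have h : dmeas (fun om => (Rpos k om, Xb (etime k om + i)%N om)).
  apply: dmeas_pair; first exact: Rpos_meas.
  apply: (dmeas_at (f := fun n => Xb (n + i)%N)); first exact: etime_meas.
  by move=> n; exact: (Xb_meas (C := C)).
exact: (dmeas_comp (fun p => p.1^-1 * p.2)%g (countable_prod cW cW) h).
Qed.

(* Law of the trajectory seen from [r], for a walk at [r * u] that stays in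
   the cone of [r]: the weight of the continuation [l]. *)
Fixpoint weight r u (l : seq W) : R :=
  if l is b :: l' then ((r * u)%g \in I1 r)%:R * pstep (r * u)%g (r * b)%g * weight r b l'
  else stay_inf (I1 r) (r * u)%g.

Lemma weight_tr r r' u l : ctype r = ctype r' -> weight r u l = weight r' u l.
Proof.
move=> e; elim: l u => [|b l IH] u /=; first exact: stay_inf_hom.
rewrite (I1_tr u e) IH; have [h|_] := boolP (_ \in _); last by rewrite !mul0r.
congr (_ * _ * _); apply: pstep_hom => //.
by rewrite inE in h; apply: (intr_ctype (esym e)) h.
Qed.

Definition ahead n r (l : seq W) : set Om :=
  [set om | forall i, (i < size l)%N -> Xb (n.+1 + i)%N om = (r * nth 1 l i)%g].

Lemma weightP r n B u l : past Xb n B ->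
  Pr (B `&` [set om | Xb n om = (r * u)%g] `&` stays_inf Xb (I1 r) n `&` ahead n r l) =
  Pr (B `&` [set om | Xb n om = (r * u)%g]) * weight r u l.
Proof.
elim: l n B u => [|b l IH] n B u pB.
  rewrite /= (_ : ahead n r [::] = setT); last by apply/seteqP; split.
  by rewrite setIT (markov_stays_inf (D := D) (C := C)).
set E := B `&` _; have pE : past Xb n E by apply: pastI => //; apply: past_at.
have [h|h] := boolP ((r * u)%g \in I1 r); last first.
  rewrite /= (negbTE h) !mul0r mulr0 (_ : _ `&` ahead _ _ _ = set0) ?Pr_set0 //.
  apply/seteqP; split=> om // [[[_ /= e] st] _].
  by move/negP: h; apply; rewrite inE -e; apply: st.
rewrite /= h mul1r mulrA -(markov1 (D := D) (C := C)) //.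
rewrite -IH; last by apply: past_le pE.
congr Pr; apply/seteqP; split=> om /=.
  move=> [[Eo st] a]; split; last first.
    by move=> i il; have := a i.+1; rewrite /= addnS; apply.
  split; last by move=> j nj; apply: st; apply: ltnW.
  by split=> //; have := a 0%N; rewrite /= addn0; apply.
move=> [[[Eo e] st] a]; split; last first.
  by move=> [|i] /= il; rewrite ?addn0 // addnS -addSn; apply: a.
split=> // j; rewrite leq_eqVlt => /orP[/eqP <-|]; last exact: st.
by case: Eo => _ /= ->; rewrite inE in h.
Qed.

(** Given the past up to [n], the position and survival in the cone, the weight of a continuation is
    a product of steps inside the cone and a survival probability, both determined by the type. The
    identity is cross-multiplied, since an atom may be null. *)
Lemma atom_law r r' n n' B B' u E : past Xb n B -> past Xb n' B' -> ctype r = ctype r' ->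
  seqm 1%g E ->
  let a := B `&` [set om | Xb n om = (r * u)%g] `&` stays_inf Xb (I1 r) n in
  let a' := B' `&` [set om | Xb n' om = (r' * u)%g] `&` stays_inf Xb (I1 r') n' in
  Pr a' * Pr (a `&` [set om | E (fun i => r^-1 * Xb (n + i) om)%g]) =
  Pr a * Pr (a' `&` [set om | E (fun i => r'^-1 * Xb (n' + i) om)%g]).
Proof.
move=> pB pB' e sE a a'.
have ma : measurable a by apply: measurableI => //; apply: measurableI => //; apply: past_m pB.
have ma' : measurable a' by apply: measurableI => //; apply: measurableI => //; apply: past_m pB'.
have mY r1 n1 i : dmeas (fun om => (r1^-1 * Xb (n1 + i)%N om)%g).
  exact: (dmeas_comp (fun x => r1^-1 * x)%g cW (Xb_meas (C := C) (n1 + i))).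
apply: (eq_law (x0 := 1%g) (Y := fun i om => (r^-1 * Xb (n + i)%N om)%g)
  (Y' := fun i om => (r'^-1 * Xb (n' + i)%N om)%g)) => //.
case=> [|b l].
  rewrite (_ : cylinder _ _ = setT); last by apply/seteqP; split.
  by rewrite (_ : [set om | _] = setT) // !setIT mulrC.
have [->|nb] := eqVneq b u; last first.
  have e0 r1 n1 B1 : B1 `&` [set om | Xb n1 om = (r1 * u)%g] `&` stays_inf Xb (I1 r1) n1 `&`
     [set om | cylinder 1%g (b :: l) (fun i => r1^-1 * Xb (n1 + i) om)%g] = set0.
    apply/seteqP; split=> om // [[[_ /= e1] _] /(_ 0%N isT)] /=.
    by rewrite addn0 e1 mulKg => /eqP; rewrite eq_sym (negbTE nb).
  by rewrite !e0 Pr_set0 !mulr0.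
have e0 r1 n1 B1 : B1 `&` [set om | Xb n1 om = (r1 * u)%g] `&` stays_inf Xb (I1 r1) n1 `&`
     [set om | cylinder 1%g (u :: l) (fun i => r1^-1 * Xb (n1 + i) om)%g] =
   B1 `&` [set om | Xb n1 om = (r1 * u)%g] `&` stays_inf Xb (I1 r1) n1 `&` ahead n1 r1 l.
  apply/seteqP; split=> om [h1 h2]; split=> //.
    by move=> i il; have /= := h2 i.+1 il; rewrite -addSnnS => <-; rewrite mulVKg.
  move=> [|i] /= il; first by case: h1 => -[_ /= e1] _; rewrite addn0 e1 mulKg.
  by rewrite -addSnnS h2 // mulKg.
have w0 r1 n1 B1 : past Xb n1 B1 -> Pr (B1 `&` [set om | Xb n1 om = (r1 * u)%g] `&` stays_inf Xb (I1 r1) n1) =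
    Pr (B1 `&` [set om | Xb n1 om = (r1 * u)%g]) * weight r1 u [::].
  by move=> p1; rewrite (markov_stays_inf (D := D) (C := C)).
rewrite /a /a' !e0 !weightP // !w0 // (weight_tr u [::] e) (weight_tr u l e).
by ring.
Qed.

(** A reference atom for each type and offset, of positive probability when the offset is deep: the
    conditional law depends on these two data only, so it is read off here. *)
Definition refatom (y : V * W) : set Om :=
  [set om | Xb (len (ref y.1 * y.2)%g) om = (ref y.1 * y.2)%g] `&`
  stays_inf Xb (I1 (ref y.1)) (len (ref y.1 * y.2)%g).

Definition law (y : V * W) (E : set (nat -> W)) : R :=
  Pr (refatom y `&` [set om | E (fun i => (ref y.1)^-1 * Xb (len (ref y.1 * y.2) + i) om)%g]) /
  Pr (refatom y).

Lemma refatom_pos r u : (K < len r)%N -> I3 r (r * u)%g -> 0 < Pr (refatom (ctype r, u)).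
Proof.
move=> dr ru; have [dr' e] := refP dr; rewrite /refatom /=; set r' := ref _ in dr' e *.
have [c1 c10 c1P] := stay_lower.
rewrite -[X in X `&` _]setTI (markov_stays_inf (D := D) (C := C)); last exact: pastT.
rewrite setTI mulr_gt0 //; first exact: reach_pos.
by apply: lt_le_trans c10 (c1P _ _ dr' _); apply: (intr_ctype (esym e)).
Qed.

Lemma atom_lawE r n B u E : past Xb n B -> (K < len r)%N -> I3 r (r * u)%g -> seqm 1%g E ->
  let a := B `&` [set om | Xb n om = (r * u)%g] `&` stays_inf Xb (I1 r) n in
  Pr (a `&` [set om | E (fun i => r^-1 * Xb (n + i) om)%g]) = Pr a * law (ctype r, u) E.
Proof.
move=> pB dr ru sE a; have [dr' e] := refP dr.
have h := @atom_law r (ref (ctype r)) n (len (ref (ctype r) * u)%g) B setT u E pB (@pastT _ _ _ _ _) (esym e) sE.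
rewrite /= !setTI in h; have p0 := refatom_pos dr ru.
rewrite /law mulrA; apply: (mulIf (lt0r_neq0 p0)); rewrite divfK ?lt0r_neq0 //.
by rewrite mulrC h.
Qed.

Definition state k om : V * W := (ctype (Rpos k om), theta k om 0%N).
Definition record k om : W * seq W := (Rpos k om, hist Xb (etime k om) om).

(* Events determined by the path up to the last entry time [e_k] and the cone
   that is entered then. *)
Definition kpast k (B : set Om) : Prop := measurable B /\ forall om om', good om -> good om' -> record k om = record k om' -> B om -> B om'.

Lemma cWs : countable [set: W * seq W].
Proof. by apply: countable_prod => //; apply: countable_seq. Qed.

Lemma record_meas k : dmeas (record k).
Proof.
apply: dmeas_pair; first exact: Rpos_meas.
by apply: (dmeas_at (f := hist Xb)); [exact: etime_meas|exact: (dmeas_hist (Xb_meas (C := C)))].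
Qed.

Lemma recordE k om om' : record k om = record k om' ->
  [/\ etime k om = etime k om', Rpos k om = Rpos k om' &
      hist Xb (etime k om) om = hist Xb (etime k om') om'].
Proof.
move=> h; have /= h1 := congr1 fst h; have /= h2 := congr1 snd h; split=> //.
by have := congr1 size h2; rewrite !size_mkseq => -[].
Qed.

Lemma state_meas k : dmeas (state k).
Proof.
apply: dmeas_pair; last exact: theta_meas.
exact: (dmeas_comp ctype cW (Rpos_meas k)).
Qed.

(** The decisive description of a last entry time: an outcome has the record of [om0] iff it has the
    same history and from then on stays in the interior of the same cone. The first part is an event
    of the past, to which the Markov property applies, and the second is survival. *)
Lemma record_atom k om0 om : good om0 -> good om ->
  record k om = record k om0 <->
  hist Xb (etime k om0) om = hist Xb (etime k om0) om0 /\ stays_inf Xb (I1 (Rpos k om0)) (etime k om0) om.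
Proof.
move=> g0 g; have [k0 s0 m0] := goodP k g0; have [k1 s1 m1] := goodP k g.
split=> [h|[h1 h2]].
  have [e h1 h2] := recordE h; rewrite -e; split; first by rewrite h2 e.
  by rewrite -h1; case: s1.
have hX : forall i, (i <= etime k om0)%N -> Xb i om = Xb i om0 by apply/hist_eq.
have [e1 e2] : etime k om = etime k om0 /\ Rpos k om = Rpos k om0.
  apply: first_settled k0 _ _.
    by split=> //; rewrite hX //; case: s0.
  move=> n' n'n [a b]; have : settled (Rpos k om0) n' om0.
    split; first by rewrite -hX // ltnW.
    move=> j n'j; have [jl|jl] := leqP j (etime k om0); first by rewrite -hX //; apply: b.
    by case: s0 => _; apply; apply: ltnW.
  by move/m0; rewrite leqNgt n'n.
by rewrite /record e1 e2 h1.
Qed.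

(** Markov property at [e_k], although [e_k] is not a stopping time: each value of [record] is an
    atom by [record_atom], and [law] is the conditional law of the future there. *)
Lemma regen_law k B y E : kpast k B -> seqm 1%g E ->
  Pr (B `&` [set om | state k om = y] `&` [set om | E (theta k om)]) =
  Pr (B `&` [set om | state k om = y]) * law y E.
Proof.
move=> [mB hB] sE.
have ms : measurable [set om | state k om = y] := state_meas k y.
have theta_meas : measurable [set om | E (theta k om)].
  exact: (seqm_preimage (Y := fun i om => theta k om i) (theta_meas k) sE).
have mBs := measurableI _ _ mB ms.
have l0 : 0 <= law y E by rewrite /law mulr_ge0 ?invr_ge0 ?Pr_ge0.
apply: (Pr_total_eq (P := P) cWs l0 (record_meas k) (record_meas k)) => //; first exact: measurableI.
move=> t; have mt : measurable [set om | record k om = t] := record_meas k t.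
have [[om0 [g0 B0 y0 t0']]|no] := pselect (exists om0,
    [/\ good om0, B om0, state k om0 = y & record k om0 = t]); last first.
  have z F : measurable F -> Pr (B `&` [set om | state k om = y] `&` F `&` [set om | record k om = t]) = 0.
    move=> mF; have mm := measurableI _ _ (measurableI _ _ mBs mF) mt.
    rewrite -(Pr_as mm good_meas good_as) (_ : _ `&` good = set0) ?Pr_set0 //.
    by apply/seteqP; split=> om // [[[[Bo so] _] ro] go]; apply: no; exists om.
  rewrite z // -[B `&` _]setIT z ?mul0r //.
have [c0 s0 _] := goodP k g0; set r := Rpos k om0 in c0 s0; set n := etime k om0 in s0.
have dr := deep c0.
pose H := [set om | hist Xb n om = hist Xb n om0].
have pH : past Xb n H by move=> om om' /hist_eq h; rewrite /H /= h.
have X0 : Xb n om0 = (r * y.2)%g by rewrite -y0 /state /theta /= addn0 mulVKg.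
have ru : I3 r (r * y.2)%g by rewrite -X0; case: s0.
have rt : ctype r = y.1 by rewrite -y0.
have := atom_lawE pH dr ru sE; rewrite /= rt -surjective_pairing.
set a := _ `&` stays_inf _ _ _ => ha.
have ma : measurable a by apply: measurableI => //; apply: measurableI => //; apply: past_m pH.
have aE om : good om -> a om <-> record k om = t.
  move=> g; rewrite -t0' (record_atom k g0 g); split=> [[[h1 _] h2]|[h1 h2]] //.
  split=> //; split=> //=; have /hist_eq h := h1.
  by rewrite h.
have ath om : good om -> record k om = t -> B om /\ state k om = y.
  move=> g h; have e : record k om0 = record k om by rewrite t0' h.
  split; first by apply: hB g0 g e B0.
  rewrite -y0 /state /theta !addn0; have [ee h1 h2] := recordE e.
  have /hist_eq h3 : hist Xb (etime k om0) om0 = hist Xb (etime k om0) om by rewrite h2 ee.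
  by rewrite -h1 -ee h3.
have -> : Pr (B `&` [set om | state k om = y] `&` [set om | record k om = t]) = Pr a.
  apply: (eq_Pr_as _ ma good_meas good_as); first exact: measurableI.
  by move=> om g; rewrite (aE om g); split=> [[] //|h]; split=> //; apply: ath.
rewrite -ha; apply: (eq_Pr_as _ _ good_meas good_as).
- by apply: measurableI => //; apply: measurableI.
- apply: measurableI => //; apply: (seqm_preimage (Y := fun i om => (r^-1 * Xb (n + i) om)%g) _ sE).
  by move=> i; exact: (dmeas_comp (fun x => r^-1 * x)%g cW (Xb_meas (C := C) (n + i))).
move=> om g; have e : record k om = t -> theta k om = (fun i => r^-1 * Xb (n + i) om)%g.
  rewrite -t0' => /recordE [ee h1 _].
  by rewrite /theta ee h1.
split=> [[[[Bo so] th] ro]|[ao th]].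
  by split; [apply/aE|move: th => /=; rewrite e].
have ro : record k om = t by apply/aE.
by have [Bo so] := ath om g ro; split=> //; split=> //=; rewrite e.
Qed.

#[local] Hint Resolve good_meas good_as etime_meas Rpos_meas state_meas record_meas theta_meas : core.

(** Earlier cones are ancestors of the current one, and an earlier entry can be lost only by leaving
    its interior before [e_k], since afterwards the path stays in a smaller cone. *)
Lemma record_le k j om om' : good om -> good om' -> record k om = record k om' -> (j <= k)%N ->
  [/\ etime j om = etime j om', Rpos j om = Rpos j om' & state j om = state j om'].
Proof.
move=> g g' /recordE [e1 e2 e3] jk; rewrite -e1 in e3; have kE := subnKC jk.
have {}e3 : forall i, (i <= etime k om)%N -> Xb i om = Xb i om' by apply/hist_eq.
have [c1 s1 m1] := goodP j g; have [c2 s2 m2] := goodP j g'.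
have rj : Rpos j om = Rpos j om'.
  apply: (covn_uniq (S := S) c1 c2 (z := Rpos k om)).
    by rewrite -kE; apply: good_cone.
  by rewrite e2 -kE; apply: good_cone.
have lej : (etime j om <= etime k om)%N by rewrite -kE; apply: good_le.
have lej' : (etime j om' <= etime k om')%N by rewrite -kE; apply: good_le.
have [_ sk _] := goodP k g; have [_ sk' _] := goodP k g'.
have tr om1 om2 : good om1 -> good om2 -> etime k om1 = etime k om2 -> Rpos k om1 = Rpos k om2 ->
    Rpos j om1 = Rpos j om2 ->
    (forall i, (i <= etime k om1)%N -> Xb i om1 = Xb i om2) -> (etime j om2 <= etime j om1)%N.
  move=> g1 g2 ek rk rj' X12; have [_ [a b] _] := goodP j g1; have [_ _ mm] := goodP j g2.
  have [_ [_ b2] _] := goodP k g2.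
  have le1 : (etime j om1 <= etime k om1)%N by rewrite -kE; apply: good_le.
  apply: mm; rewrite -rj'; split; first by rewrite -X12.
  move=> i ji; have [ik|ki] := leqP i (etime k om1); first by rewrite -X12 //; apply: b.
  rewrite rj'; apply: (cone_I1 (s := s)) (b2 _ _); first by rewrite -kE; apply: good_cone.
  by rewrite -ek ltnW.
have ej : etime j om = etime j om'.
  apply/eqP; rewrite eqn_leq (tr om om') // andbT.
  by apply: tr => // i ik; rewrite e3 // e1.
split=> //; rewrite /state /theta !addn0 rj -ej.
by rewrite e3.
Qed.

(** * Renewal at the visits of the state [(t0, u0)] *)

Definition cnt k om : nat := \sum_(1 <= j < k.+1) (state j om == (t0, u0)).

Lemma cntS k om : cnt k.+1 om = (cnt k om + (state k.+1 om == (t0, u0)))%N.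
Proof. by rewrite /cnt big_nat_recr. Qed.

Lemma cnt_le k j om : (cnt k om <= cnt (k + j) om)%N.
Proof. by elim: j => [|j IH]; rewrite ?addn0 // addnS cntS (leq_trans IH) // leq_addr. Qed.

Lemma cnt_lt k j om : (k < j)%N -> state j om = (t0, u0) -> (cnt k om < cnt j om)%N.
Proof.
case: j => // j kj h; rewrite cntS h eqxx addn1 ltnS -(subnKC (kj : (k <= j)%N)).
exact: cnt_le.
Qed.

Definition tick i om : nat :=
  xget 0%N [set k | (0 < k)%N /\ (state k om = (t0, u0) /\ cnt k om = i.+1)].

Lemma tickE k i om : (0 < k)%N -> tick i om = k <-> state k om = (t0, u0) /\ cnt k om = i.+1.
Proof.
move=> k0; rewrite /tick; case: xgetP => [k' _ [k'0 [s' c']]|no].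
  split=> [<- //|[h1 h2]]; case: (ltngtP k' k) => // lt.
    by have := cnt_lt lt h1; rewrite c' h2 ltnn.
  by have := cnt_lt lt s'; rewrite c' h2 ltnn.
by split=> [e|h]; [rewrite -e ltnn in k0|case: (no k)].
Qed.

Lemma good_visits k0 om : good om -> exists2 k, (k0 < k)%N & state k om = (t0, u0).
Proof.
move=> g; have [[h _] _] := g; have [n kn rn] := h (etime k0 om).+1.
have [k [r [kr rt Xn st no]]] := regenP rn.
have dr : (K < len r)%N by apply: (covn_deep (S := S)) kr.
have sr : settled r n om.
  by split=> //; rewrite Xn; apply: (rg_int (regeneration := Rg)).
have [e1 e2] := first_settled kr sr no.
exists k.+1; last by rewrite /state /theta e1 e2 addn0 Xn mulKg rt.
rewrite ltnNge; apply/negP => le; have := good_le k.+1 (k0 - k.+1) g.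
by rewrite subnKC // e1 leqNgt kn.
Qed.

Lemma next_visit k0 om : good om -> exists k, [/\ (k0 < k)%N, state k om = (t0, u0) &
  cnt k om = (cnt k0 om).+1].
Proof.
move=> g; have ex : exists k, (k0 < k)%N && (state k om == (t0, u0)).
  by have [k h1 h2] := good_visits k0 g; exists k; rewrite h1 h2 eqxx.
case: (ex_minnP ex) => k /andP[h1 /eqP h2] hm; exists k; split=> //.
have no j : (k0 + j < k)%N -> cnt (k0 + j) om = cnt k0 om.
  elim: j => [|j IH] lt; first by rewrite addn0.
  rewrite addnS cntS IH; last by apply: ltn_trans lt; rewrite addnS.
  case: eqP => [e|_]; last by rewrite addn0.
  have := hm (k0 + j).+1; rewrite ltnS leq_addr e eqxx /= => /(_ isT).
  by rewrite leqNgt -addnS lt.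
case: k h1 h2 {hm} no => // k h1 h2 no; rewrite cntS h2 eqxx addn1; congr _.+1.
by rewrite -(no (k - k0)%N) subnKC.
Qed.

Lemma tickP i om : good om -> [/\ (0 < tick i om)%N, state (tick i om) om = (t0, u0) &
  cnt (tick i om) om = i.+1].
Proof.
move=> g; have [k [h1 h2 h3]] : exists k, [/\ (0 < k)%N, state k om = (t0, u0) & cnt k om = i.+1].
  elim: i => [|i [k [h1 h2 h3]]].
    have [k [h1 h2 h3]] := next_visit 0 g; exists k; split=> //.
    by rewrite h3 /cnt big_geq.
  have [k' [h1' h2' h3']] := next_visit k g; exists k'; split=> //; last by rewrite h3' h3.
  exact: leq_ltn_trans h1'.
by have -> : tick i om = k by apply/tickE.
Qed.

Lemma tick_lt i om : good om -> (tick i om < tick i.+1 om)%N.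
Proof.
move=> g; have [h1 h2 h3] := tickP i g; have [h1' h2' h3'] := tickP i.+1 g.
rewrite ltnNge; apply/negP => le.
by have := cnt_le (tick i.+1 om) (tick i om - tick i.+1 om) om; rewrite subnKC // h3 h3' ltnn.
Qed.

Lemma tick_mono i j om : good om -> (i <= j)%N -> (tick i om <= tick j om)%N.
Proof.
move=> g /subnKC <-; elim: (j - i)%N => [|e IH]; first by rewrite addn0.
by rewrite addnS (leq_trans IH) // ltnW // tick_lt.
Qed.

Lemma tick_next i l om : good om -> (0 < l)%N ->
  tick i.+1 om = (tick i om + l)%N <-> (state (tick i om + l) om = (t0, u0) /\
    forall j, (0 < j < l)%N -> state (tick i om + j) om <> (t0, u0)).
Proof.
move=> g l0; have [h1 h2 h3] := tickP i g; set k := tick i om in h1 h2 h3 *.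
have kl0 : (0 < k + l)%N by rewrite addn_gt0 h1.
split=> [/(tickE _ _ kl0) [a b]|[a b]].
  split=> // j /andP[j0 jl] e; have := cnt_lt (ltac:(by rewrite -[X in (X < _)%N]addn0 ltn_add2l) : (k < k + j)%N) e.
  have := cnt_lt (ltac:(by rewrite ltn_add2l) : (k + j < k + l)%N) a.
  by rewrite b h3 ltnS => x y; have := leq_trans y x; rewrite ltnn.
apply/(tickE _ _ kl0); split=> //; rewrite -h3.
have no j : (j < l)%N -> cnt (k + j) om = cnt k om.
  elim: j => [|j IH] lt; first by rewrite addn0.
  rewrite addnS cntS IH ?(ltnW lt) // -addnS; case: eqP => [e|_]; last by rewrite addn0.
  by case: (b j.+1).
by case: l l0 kl0 a {b} no => // l _ _ a no; rewrite addnS cntS -addnS a eqxx addn1 no.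
Qed.

Lemma cnt_meas k : dmeas (cnt k).
Proof.
elim: k => [|k IH].
  move=> t; have -> : [set om | cnt 0 om = t] = [set om | 0%N = t].
    by apply/seteqP; split=> om /=; rewrite /cnt big_geq.
  have [->|n] := eqVneq 0%N t; last by rewrite (_ : [set om | _] = set0) //; apply/seteqP; split=> om //= e; rewrite e eqxx in n.
  by rewrite (_ : [set om | _] = setT) //; apply/seteqP; split.
have -> : cnt k.+1 = (fun om => cnt k om + (state k.+1 om == (t0, u0)))%N by apply/funext => om; rewrite cntS.
have h := dmeas_pair IH (state_meas k.+1).
apply: (dmeas_comp (fun p : nat * (V * W) => (p.1 + (p.2 == (t0, u0)))%N) _ h).
apply: countable_prod; first exact: countable_nat.
by apply: countable_prod => //; apply: finite_set_countable; exact: finite_finset.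
Qed.

Lemma tick_meas i : dmeas (tick i).
Proof.
have mS k : (0 < k)%N -> measurable [set om | tick i om = k].
  move=> k0; rewrite (_ : [set om | _] = [set om | state k om = (t0, u0)] `&` [set om | cnt k om = i.+1]).
    by apply: measurableI; [exact: state_meas|exact: cnt_meas].
  by apply/seteqP; split=> om /=; rewrite (tickE _ _ k0).
move=> [|k]; last exact: mS.
rewrite (_ : [set om | _] = ~` \bigcup_k [set om | tick i om = k.+1]).
  by apply: measurableC; apply: bigcupT_measurable => k; apply: mS.
apply/seteqP; split=> om /= => [e [k _ /=]|h]; first by rewrite e.
by apply: contrapT => ne; apply: h; exists (tick i om).-1 => //=; rewrite prednK // lt0n; apply/eqP.
Qed.

Section CyclesF.
Variable F : nat -> nat.

(** [F] selects what is counted in a cycle: [id] for time, the constant [1] for levels, a truncation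
    [minn^~ M] for passages to the limit. *)
Definition gap k om : nat := F (etime k.+1 om - etime k om).
Definition cyc i om : nat := \sum_(tick i om <= j < tick i.+1 om) gap j om.

Lemma gap_meas k : dmeas (gap k).
Proof.
have h := dmeas_pair (etime_meas k.+1) (etime_meas k).
exact: (dmeas_comp (fun p : nat * nat => F (p.1 - p.2)) (countable_prod countable_nat countable_nat) h).
Qed.

Lemma cyc_meas i : dmeas (cyc i).
Proof.
apply: (dmeas_at (N := tick i.+1) (f := fun b om => \sum_(tick i om <= j < b) gap j om)%N); first exact: tick_meas.
move=> b; apply: (dmeas_at (N := tick i) (f := fun a om => \sum_(a <= j < b) gap j om)%N); first exact: tick_meas.
move=> a; have h := dmeas_mkseq b gap_meas.
have -> : (fun om => \sum_(a <= j < b) gap j om)%N = (fun om => \sum_(a <= j < b) nth 0%N (mkseq (gap ^~ om) b) j)%N.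
  by apply/funext => om; apply: eq_big_nat => j /andP[_ jb]; rewrite nth_mkseq.
exact: (dmeas_comp (fun l : seq nat => \sum_(a <= j < b) nth 0%N l j)%N (countable_seq countable_nat) h).
Qed.

(* The trajectory, seen from the apex of the cone entered at a visit of the
   state [(t0, u0)], has [sq] as last entry times and cones until the next
   visit. *)
Definition cycle_seq (z : nat) (sq : seq (nat * W)) : set (nat -> W) := [set y |
  [/\ (1 < size sq)%N,
    forall j, (j < size sq)%N -> FS t0 j (nth (0%N, 1%g) sq j).1 (nth (0%N, 1%g) sq j).2 y,
    forall j, (0 < j < size sq)%N ->
      ((ctype (ref t0 * (nth (0%N, 1%g) sq j).2)%g, ((nth (0%N, 1%g) sq j).2^-1 * y (nth (0%N, 1%g) sq j).1)%g)
        = (t0, u0)) <-> j = (size sq).-1 &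
    (\sum_(j < (size sq).-1) F ((nth (0%N, 1%g) sq j.+1).1 - (nth (0%N, 1%g) sq j).1))%N = z]].
Definition Phi z : set (nat -> W) := [set y | exists sq, cycle_seq z sq y].

Lemma Phi_seqm z : seqm 1%g (Phi z).
Proof.
apply: (seqm_count (countable_seq (countable_prod countable_nat cW))) => sq.
have hFS j : seqm 1%g [set y | (j < size sq)%N -> FS t0 j (nth (0%N, 1%g) sq j).1 (nth (0%N, 1%g) sq j).2 y].
  by apply: seqm_imp; apply: FS_seqm.
pose Q j (y : nat -> W) := ((ctype (ref t0 * (nth (0%N, 1%g) sq j).2)%g,
   ((nth (0%N, 1%g) sq j).2^-1 * y (nth (0%N, 1%g) sq j).1)%g) = (t0, u0)) <-> j = (size sq).-1.
have hQ j : seqm 1%g [set y | (0 < j < size sq)%N -> Q j y].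
  apply: seqm_imp; apply: (seqm_pred (x0 := 1%g) cW (nth (0%N, 1%g) sq j).1
    (fun x => ((ctype (ref t0 * (nth (0%N, 1%g) sq j).2)%g, ((nth (0%N, 1%g) sq j).2^-1 * x)%g) = (t0, u0)) <-> j = (size sq).-1)).
have h1 := seqm_all hFS; have h2 := seqm_all hQ.
have h3 := seqmI (seqmI h1 h2) (seqm_cst ((1 < size sq)%N /\
  (\sum_(j < (size sq).-1) F ((nth (0%N, 1%g) sq j.+1).1 - (nth (0%N, 1%g) sq j).1))%N = z)).
move: h3; rewrite (_ : _ `&` _ `&` _ = cycle_seq z sq) //.
by apply/seteqP; split=> y /=; [move=> [[? ?] []]|move=> [? ? ? ?]].
Qed.

Lemma PhiP i z om : good om -> cyc i om = z <-> Phi z (theta (tick i om) om).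
Proof.
move=> g; have [k0 sk _] := tickP i g; set k := tick i om in k0 sk *.
have rt : ctype (Rpos k om) = t0 by case: sk.
have [dr e] : (K < len (ref t0))%N /\ ctype (ref t0) = t0.
  by rewrite -[X in ref X]rt -[X in _ = X]rt; apply: refP; apply: good_deep.
have fs j n v : FS t0 j n v (theta k om) <->
    (etime (k + j) om = etime k om + n /\ Rpos (k + j) om = (Rpos k om * v)%g)%N.
  by rewrite -[X in FS X]rt; apply: FSP.
have stE j n v : FS t0 j n v (theta k om) ->
    (ctype (ref t0 * v)%g, (v^-1 * theta k om n)%g) = state (k + j) om.
  move=> /fs [e1 e2]; rewrite /state /theta e2 addn0 -e1 invMg mulgA; congr (_, _).
  apply/esym; apply: ctype_tr; first by rewrite rt e.
  by rewrite -e2; apply: good_cone.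
have cycE : cyc i om = (\sum_(j < tick i.+1 om - k) gap (k + j) om)%N.
  rewrite /cyc -/k -{1}[k]add0n big_addn big_mkord; apply: eq_bigr => j _.
  by rewrite addnC.
split=> [<-|[sq [h1 h2 h3 h4]]].
  set l := (tick i.+1 om - k)%N in cycE.
  have l0 : (0 < l)%N by rewrite subn_gt0 tick_lt.
  have nE : tick i.+1 om = (k + l)%N by rewrite subnKC // ltnW // tick_lt.
  pose f j := ((etime (k + j) om - etime k om)%N, ((Rpos k om)^-1 * Rpos (k + j) om)%g).
  exists (mkseq f l.+1); have fE j : (j < l.+1)%N -> nth (0%N, 1%g) (mkseq f l.+1) j = f j.
    by move=> jl; rewrite nth_mkseq.
  have fsj j : FS t0 j (f j).1 (f j).2 (theta k om).
    by apply/fs; rewrite /f /= subnKC ?good_le // mulVKg.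
  rewrite /cycle_seq size_mkseq; split; rewrite ?succnK //.
  - by move=> j jl; rewrite fE.
  - move=> j /andP[j0 jl]; rewrite fE // (stE _ _ _ (fsj j)).
    have [h1 h2] := (proj1 (tick_next i g l0)) nE.
    split=> [sj|->] //; apply/eqP; rewrite eqn_leq -ltnS jl leqNgt; apply/negP => lt.
    by case: (h2 j); rewrite ?j0.
  rewrite cycE; apply: eq_bigr => j _.
  rewrite (fE j.+1) ?ltnS // (fE j) ?(ltnW (ltn_ord j)) ?ltnS 1?ltnW // /gap /f.
  by rewrite -[in RHS]addnS subnBA ?good_le // subnK ?good_le.
set l := (size sq).-1 in h3 h4; have sl : size sq = l.+1 by rewrite prednK // ltnW.
have l0 : (0 < l)%N by rewrite -ltnS -sl.
rewrite sl in h2 h3.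
have nE : tick i.+1 om = (k + l)%N.
  apply/(tick_next i g l0); split; first by rewrite -(stE _ _ _ (h2 l (ltnSn l))); apply/h3; rewrite ?l0 ?ltnSn.
  move=> j /andP[j0 jl] sj; have jl' : (j < l.+1)%N by rewrite ltnW.
  have := h2 j jl' => /stE; rewrite sj => /h3; rewrite j0 jl' => /(_ isT) jE.
  by rewrite jE ltnn in jl.
rewrite cycE nE addKn -h4; apply: eq_bigr => j _.
have jl1 : (j < l.+1)%N by rewrite ltnW // ltnS.
have jl2 : (j.+1 < l.+1)%N by rewrite ltnS.
have [a1 _] := (proj1 (fs _ _ _)) (h2 j jl1); have [a2 _] := (proj1 (fs _ _ _)) (h2 j.+1 jl2).
by rewrite /gap -addnS a1 a2 subnDl.
Qed.

Lemma past_cyc (l : seq nat) k :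
  kpast k ([set om | forall j, (j < size l)%N -> cyc j om = nth 0%N l j] `&` [set om | tick (size l) om = k]).
Proof.
split.
  apply: measurableI; last exact: tick_meas.
  rewrite (_ : [set om | _] = \bigcap_(i in `I_(size l)) [set om | cyc i om = nth 0%N l i]).
    by apply: fin_bigcap_measurable => [|i _]; [exact: finite_II|exact: cyc_meas].
  by apply/seteqP; split=> om h i; apply: h.
move=> om om' g g' r [h1 /= h2].
have eqs j : (j <= k)%N -> state j om = state j om' by move=> jk; have [] := record_le g g' r jk.
have eqt j : (j <= k)%N -> etime j om = etime j om' by move=> jk; have [] := record_le g g' r jk.
have eqc j : (j <= k)%N -> cnt j om = cnt j om'.
  elim: j => [|j IH] jk; first by rewrite /cnt !big_geq.
  by rewrite !cntS IH ?(ltnW jk) // eqs.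
have tj j : (j <= size l)%N -> tick j om' = tick j om /\ (tick j om <= k)%N.
  move=> jl; have le : (tick j om <= k)%N by rewrite -h2; apply: tick_mono.
  split=> //; have [p1 p2 p3] := tickP j g.
  by apply/tickE => //; rewrite -eqs // -eqc.
split; last by have [-> _] := tj _ (leqnn _).
move=> j jl; have [t1 t1'] := tj j (ltnW jl); have [t2 t2'] := tj j.+1 jl.
rewrite -h1 // /cyc t1 t2; apply: eq_big_nat => i /andP[_ ij].
by rewrite /gap !eqt // ?(ltnW (leq_trans ij t2')) // (leq_trans ij).
Qed.

(** At each visit the state is the same, so the next cycle has the same law [law (t0, u0)] given the
    past; the random index of the visit is handled by summing over its values. *)
Lemma cyc_iid : iid P cyc (fun z => law (t0, u0) (Phi z)).
Proof.
split; first exact: cyc_meas.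
elim/last_ind => [|l z IH].
  rewrite big_nil (_ : [set om | _] = setT) ?Pr_setT //.
  by apply/seteqP; split.
rewrite big_rcons /= -IH.
pose B := [set om | forall j, (j < size l)%N -> cyc j om = nth 0%N l j].
have mB : measurable B.
  rewrite /B (_ : [set om | _] = \bigcap_(i in `I_(size l)) [set om | cyc i om = nth 0%N l i]).
    by apply: fin_bigcap_measurable => [|i _]; [exact: finite_II|exact: cyc_meas].
  by apply/seteqP; split=> om h i; apply: h.
have mz : measurable [set om | cyc (size l) om = z] := @cyc_meas (size l) z.
have -> : [set om | forall j, (j < size (rcons l z))%N -> cyc j om = nth 0%N (rcons l z) j] =
    B `&` [set om | cyc (size l) om = z].
  apply/seteqP; split=> om /=.
    move=> h; split=> [j jl|]; first by rewrite h ?size_rcons ?nth_rcons ?jl // ltnS ltnW.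
    by rewrite h ?size_rcons // nth_rcons ltnn eqxx.
  move=> [h h'] j; rewrite size_rcons nth_rcons ltnS leq_eqVlt => /orP[/eqP ->|jl].
    by rewrite ltnn eqxx.
  by rewrite jl; apply: h.
have l0 : 0 <= law (t0, u0) (Phi z) by rewrite /law mulr_ge0 ?invr_ge0 ?Pr_ge0.
apply: (Pr_total_eq (P := P) countable_nat l0 (tick_meas (size l)) (tick_meas (size l))) => //.
  exact: measurableI.
move=> k; have kp := past_cyc l k; rewrite -/B in kp.
have mtk : measurable [set om | tick (size l) om = k] := tick_meas (size l) k.
have mBk := measurableI _ _ mB mtk.
have mPhi : measurable [set om | Phi z (theta k om)].
  exact: (seqm_preimage (Y := fun i om => theta k om i) (theta_meas k) (Phi_seqm z)).
have h := regen_law (t0, u0) kp (Phi_seqm z).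
have e1 : Pr (B `&` [set om | tick (size l) om = k] `&` [set om | state k om = (t0, u0)]) =
    Pr (B `&` [set om | tick (size l) om = k]).
  apply: (eq_Pr_as _ mBk good_meas good_as); first exact: measurableI (state_meas k _).
  move=> om g; split=> [[] //|[b /= t]]; split=> //.
  by have [_ h2 _] := tickP (size l) g; rewrite /= -t.
rewrite e1 in h; rewrite -h; apply: (eq_Pr_as _ _ good_meas good_as).
- by apply: measurableI => //; apply: measurableI.
- by apply: measurableI => //; apply: measurableI => //; exact: state_meas.
move=> om g; split=> [[[b cz] /= t]|[[[b /= t] st] ph]].
  split; last by move: cz => /= /(PhiP (size l) z g); rewrite t.
  by split=> //=; have [_ h2 _] := tickP (size l) g; rewrite -t.
by split=> //; split=> //; apply/(PhiP (size l) z g); rewrite t.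
Qed.

End CyclesF.

#[local] Hint Resolve tick_meas cyc_meas : core.

Let iidc F : exists g, iid P (cyc F) g.
Proof. by eexists; apply: cyc_iid. Qed.
Let mregen n : measurable (regen t0 u0 n). Proof. exact: regen_meas. Qed.
Let et_mono i j om : good om -> (i <= j)%N -> (etime i om <= etime j om)%N.
Proof. by move=> g /subnKC <-; apply: good_le. Qed.

(** * Mean cycle length and growth of the last entry times *)

Lemma asure_good : asure good. Proof. exact: asure_meas good_meas good_as. Qed.

Lemma asure_ex (Q : set Om) : asure Q -> exists om, Q om.
Proof.
move=> [E [mE hE EQ]]; apply: contrapT => no.
have : Pr (~` E) = 1.
  rewrite (_ : ~` E = setT) ?Pr_setT //.
  by apply/seteqP; split=> // om _ /EQ ?; apply: no; exists om.
by rewrite hE => /esym /eqP; rewrite oner_eq0.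
Qed.

Lemma cyc_sum F n om : good om ->
  (\sum_(i < n) cyc F i om = \sum_(tick 0 om <= j < tick n om) gap F j om)%N.
Proof.
move=> g; elim: n => [|n IH]; first by rewrite big_ord0 big_geq.
rewrite big_ord_recr /= IH /cyc -(@big_cat_nat _ _ _ (tick n om)) //=.
- by apply: tick_mono.
- by apply: ltnW; apply: tick_lt.
Qed.

Lemma gap_sumD a b om : good om -> (a <= b)%N ->
  (etime a om + \sum_(a <= j < b) gap id j om = etime b om)%N.
Proof.
move=> g /subnKC <-; elim: (b - a)%N => [|e IH]; first by rewrite addn0 big_geq // addn0.
rewrite addnS big_nat_recr ?leq_addr //= addnA IH /gap subnKC //.
by apply: et_mono.
Qed.

Lemma cyc_le F F' i om : (forall n, (F n <= F' n)%N) -> (cyc F i om <= cyc F' i om)%N.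
Proof. by move=> h; apply: leq_sum => j _; apply: h. Qed.

Lemma Pr_cyc_meas F j i : measurable [set om | (j < cyc F i om)%N].
Proof. exact: (dmeas_preimage countable_nat (fun x => j < x)%N (cyc_meas F i)). Qed.

Lemma tail_le F F' M : (forall n, (F n <= F' n)%N) -> tail_sum P (cyc F) M <= tail_sum P (cyc F') M.
Proof.
move=> h; apply: ler_sum => j _; apply: le_Pr; try exact: Pr_cyc_meas.
by move=> om /= /leq_trans; apply; apply: cyc_le.
Qed.

Lemma tail_lim F B : (forall M, tail_sum P (cyc F) M <= B) ->
  exists mu : R, tail_sum P (cyc F) M @[M --> \oo] --> mu.
Proof.
move=> h; exists (limn (tail_sum P (cyc F))).
apply: nondecreasing_is_cvgn.
  move=> a b /subnKC <-; rewrite /tail_sum big_split_ord /= lerDl.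
  by apply: sumr_ge0 => i _; rewrite Pr_ge0.
by exists B => _ [n _ <-].
Qed.

Lemma regen_tick n om : good om -> regen t0 u0 n om -> exists i, etime (tick i om) om = n.
Proof.
move=> g rn; have [k [r [kr rt Xn st no]]] := regenP rn.
have dr : (K < len r)%N by apply: (covn_deep (S := S)) kr.
have sr : settled r n om.
  by split=> //; rewrite Xn; apply: (rg_int (regeneration := Rg)).
have [e1 e2] := first_settled kr sr no.
have sk : state k.+1 om = (t0, u0).
  by rewrite /state /theta e1 e2 addn0 Xn mulKg rt.
exists (cnt k.+1 om).-1.
suff -> : tick (cnt k.+1 om).-1 om = k.+1 by [].
apply/tickE => //; split=> //; rewrite prednK //.
by rewrite cntS sk eqxx addn1.
Qed.

Lemma regen_count n i om : good om -> (n <= etime (tick i om) om)%N ->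
  \sum_(j < n) \1_(regen t0 u0 j) om <= i%:R :> R.
Proof.
move=> g ni.
have -> : \sum_(j < n) \1_(regen t0 u0 j) om = (size [seq j <- iota 0 n | `[< regen t0 u0 j om >]])%:R :> R.
  rewrite -(big_mkord xpredT (fun j => \1_(regen t0 u0 j) om)) /index_iota subn0.
  elim: (iota 0 n) => [|j l IH]; first by rewrite big_nil.
  rewrite big_cons IH indicE /=; case: asboolP => h.
    by rewrite mem_set //= addrC natr1.
  by rewrite memNset //= add0r.
rewrite ler_nat -[X in (_ <= X)%N](size_iota 0 i) -[X in (_ <= X)%N](size_map (fun j => etime (tick j om) om)).
apply: uniq_leq_size; first by rewrite filter_uniq // iota_uniq.
move=> j; rewrite mem_filter mem_iota => /andP[/asboolP rj /andP[_ jn]].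
have [i' ii'] := regen_tick g rj; apply/mapP; exists i' => //; rewrite mem_iota /= add0n.
rewrite ltnNge; apply/negP => le; have := et_mono g (tick_mono g le).
by rewrite ii' leqNgt (leq_trans jn ni).
Qed.

Lemma regen_freq n : n%:R * c <= \sum_(j < n * T.+1) Pr (regen t0 u0 j).
Proof.
elim: n => [|n IH]; first by rewrite mul0r mul0n big_ord0.
rewrite mulSn addnC big_split_ord /= -natr1 mulrDl mul1r; apply: lerD => //.
have := rg_attempt (regeneration := Rg) (@pastT _ _ _ Xb (n * T.+1)).
rewrite setTI Pr_setT ?mulr1.
move=> h; apply: le_trans h _.
apply: (@Pr_le_sum _ _ _ P 'I_T.+1 xpredT (fun j => regen t0 u0 (n * T.+1 + j))) => //.
- by rewrite (_ : [set j | _] = `I_T.+1) //; apply: bigcup_measurable => j _; exact: mregen.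
- by move=> om [j /= jT rj]; exists (Ordinal (jT : (j < T.+1)%N)).
Qed.

(** If the mean exceeded [b * T.+1], the first [n] cycles would last at least [b * T.+1 * n] steps
    with probability close to [1], allowing hardly more than [n] regenerations up to that time. But
    every [T.+1] steps produce on average at least [c] regenerations, hence [n * b * c], at least
    [3 * n], in all. *)
Lemma mean_finite : exists B, forall M, tail_sum P (cyc id) M <= B.
Proof.
have /andP[c0 c1] := rg_c (regeneration := Rg).
have [b hb] := nat_above (3 / c); rewrite ler_pdivrMr // in hb.
have b0 : (0 < b)%N.
  by rewrite lt0n; apply/eqP => b0; rewrite b0 mul0r in hb; move: hb; lra.
exists (b * T.+1)%:R => M; rewrite leNgt; apply/negP => lt.
have [g0 ig] := iidc id.
pose Gn n := [set om | (b * T.+1 * n <= etime (tick n om) om)%N].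
have mG n : measurable (Gn n).
  have h : dmeas (fun om => etime (tick n om) om) by apply: (dmeas_at (f := etime)).
  exact: (dmeas_preimage countable_nat (fun x => b * T.+1 * n <= x)%N h).
pose Ev n0 := \bigcap_j Gn (n0 + j)%N.
have mEv n : measurable (Ev n) by apply: bigcapT_measurable => j; exact: mG.
have aEv : asure (\bigcup_n Ev n).
  apply: asure_mono (asureI asure_good (slln_min ig M)) => om [g h] /=.
  have /cvgrPdist_lt /(_ (tail_sum P (cyc id) M - (b * T.+1)%:R)) := h.
  rewrite subr_gt0 => /(_ lt) [k _ hk]; exists k.+1 => // j _ /=.
  have := hk (k.+1 + j)%N (ltac:(by rewrite /= addSn leqW // leq_addr)); rewrite /= /Gn /=.
  set n := (k.+1 + j)%N; have n0 : 0 < n%:R :> R by rewrite ltr0n.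
  rewrite ltr_norml => /andP[_ h2]; have {}h2 : (b * T.+1)%:R < (\sum_(i < n) (minn (cyc id i om) M)%:R) / n%:R :> R.
    by move: h2; rewrite ltrD2l ltrN2.
  rewrite ltr_pdivlMr // -natrM -natr_sum ltr_nat in h2.
  apply: leq_trans (ltnW h2) _; apply: (@leq_trans (\sum_(i < n) cyc id i om)).
    by apply: leq_sum => i _; rewrite geq_minl.
  by rewrite cyc_sum // -(gap_sumD g (tick_mono g (leq0n n))) leq_addl.
have cv : Pr (Ev n) @[n --> \oo] --> (1 : R).
  have -> : 1 = Pr (\bigcup_n Ev n) :> R.
    have [E [mE hE EE]] := aEv; have mU : measurable (\bigcup_n Ev n) by apply: bigcupT_measurable.
    have : Pr (~` \bigcup_n Ev n) = 0.
      by apply: Pr0_sub (measurableC mU) (measurableC mE) _ hE; apply: subsetC.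
    by rewrite Pr_setC // => /eqP; rewrite subr_eq0 => /eqP.
  by apply: Pr_bigcup_cvg => // n om h j _; rewrite addSnnS; apply: h.
(* Outside an event of at most this probability there are at most [n] regenerations; on it the
   trivial bound [Nn] contributes at most [n], so the total is at most [2 * n]. *)
pose ep : R := (b * T.+1)%:R^-1.
have bT0 : 0 < (b * T.+1)%:R :> R by rewrite ltr0n muln_gt0 b0.
have ep0 : 0 < ep by rewrite invr_gt0.
have /cvgrPdist_lt /(_ ep ep0) [k _ hk] := cv.
have {hk} := hk k.+1 (leqnSn k); rewrite /= => hk; set n := k.+1 in hk.
have PG : Pr (~` Gn n) <= ep.
  have hG : Pr (Ev n) <= Pr (Gn n).
    by apply: le_Pr => // om h; have := h 0%N I; rewrite addn0.
  by rewrite Pr_setC //; move: hk; rewrite ltr_norml => /andP[_]; lra.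
have n0 : 0 < n%:R :> R by rewrite ltr0n.
pose Nn := (n * b * T.+1)%N.
have key : \sum_(j < Nn) Pr (regen t0 u0 j) <= n%:R + Nn%:R * ep.
  have mrg j : measurable (regen t0 u0 j `&` good) by exact: measurableI.
  have h := @Pr_indic_le _ _ _ P _ bool (index_enum 'I_Nn) [:: true; false] (fun=> 1)
    (fun bb => if bb then n%:R else Nn%:R) (fun j => regen t0 u0 j `&` good)
    (fun bb => if bb then setT else ~` Gn n) (fun=> ler01) (fun bb => ltac:(by case: bb))
    (fun j => mrg j) (fun bb => ltac:(by case: bb => //; apply: measurableC)).
  have e1 : \sum_(j < Nn) Pr (regen t0 u0 j) = \sum_(j < Nn) 1 * Pr (regen t0 u0 j `&` good).
    by apply: eq_bigr => j _; rewrite mul1r (Pr_as _ good_meas good_as).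
  rewrite e1; apply: le_trans (h _) _.
    move=> om; rewrite !big_cons big_nil addr0 indicE mem_set // mulr1.
    have [g|ng] := pselect (good om); last first.
      rewrite big1 ?addr_ge0 ?mulr_ge0 // => j _.
      by rewrite indicE memNset ?mulr0 // => -[].
    rewrite (eq_bigr (fun j : 'I_Nn => \1_(regen t0 u0 j) om)); last first.
      move=> j _; rewrite mul1r !indicE; congr (nat_of_bool _)%:R.
      by apply/idP/idP; rewrite !inE; [case|move=> h'; split].
    have [hG|hG] := pselect (Gn n om).
      rewrite [X in _ + X](_ : _ = 0) ?addr0; last by rewrite indicE memNset ?mulr0 // => h'; apply: h'.
      apply: regen_count => //; apply: leq_trans hG.
      by rewrite /Nn -mulnA mulnC.
    rewrite [X in _ + X](_ : _ = Nn%:R); last by rewrite indicE mem_set ?mulr1.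
    apply: (@le_trans _ _ Nn%:R); last by rewrite lerDr.
    apply: (@le_trans _ _ (\sum_(j < Nn) 1)); last by rewrite sumr_const card_ord.
    by apply: ler_sum => j _; rewrite indicE; case: (_ \in _).
  rewrite !big_cons big_nil addr0 Pr_setT ?mulr1.
  by rewrite lerD2l; apply: ler_wpM2l.
have := regen_freq (n * b)%N; rewrite -/Nn => h2.
have h3 := le_trans h2 key.
have e2 : Nn%:R * ep = n%:R by rewrite /Nn /ep -mulnA natrM mulfK // lt0r_neq0.
rewrite e2 natrM in h3; have h4 := ler_wpM2l (ltW n0) hb.
move: h3 h4 n0; move: (n%:R) (b%:R) => x y; nra.
Qed.

Lemma len_Rpos k om : good om -> (k < len (Rpos k om))%N.
Proof. by move=> g; have [h _ _] := goodP k g; apply: (covn_len (S := S)) h. Qed.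

Lemma good_X n om : good om -> (len (Xb n om) <= L0 * n)%N.
Proof.
move=> [[_ sj] x0]; have h : (dist (Xb 0 om) (Xb (0 + n) om) <= L0 * n)%N by apply: short_jumps_dist.
by rewrite add0n (x0 : Xb 0 om = 1%g) dist1 in h.
Qed.

Lemma Rpos_len k om : good om -> (len (Rpos k om) <= L0 * etime k om)%N.
Proof.
move=> g; have [_ [h _] _] := goodP k g; apply: leq_trans (good_X _ g).
by apply: (@cone_len _ _ s _ _ star edge); apply: intr_sub h.
Qed.

(** The level grows at most linearly in time: [k] is less than the length of [R_k], which is at most
    [L0 * e_k]. *)
Lemma mean_index_finite : exists B, forall M, tail_sum P (cyc (fun=> 1%N)) M <= B.
Proof.
have [B hB] := mean_finite; have [mu hmu] := tail_lim hB.
exists (L0%:R * mu) => M; have [g1 ig1] := iidc (fun=> 1%N); have [g2 ig2] := iidc id.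
have [om [[g h1] h2]] := asure_ex (asureI (asureI asure_good (slln_min ig1 M)) (slln ig2 hmu)).
have cv : L0%:R * ((\sum_(i < n) (cyc id i om)%:R) / n%:R + (etime (tick 0 om) om)%:R * n%:R^-1) -
    (\sum_(i < n) (minn (cyc (fun=> 1%N) i om) M)%:R) / n%:R @[n --> \oo] -->
    L0%:R * (mu + (etime (tick 0 om) om)%:R * 0) - tail_sum P (cyc (fun=> 1%N)) M.
  apply: cvgB => //; apply: cvgMr; apply: cvgD => //; apply: cvgMr; exact: cvgn_inv.
rewrite -subr_ge0; rewrite mulr0 addr0 in cv; apply: (cvgn_ge cv).
exists 1%N => // n /= n1; rewrite subr_ge0 -mulrDl mulrA; apply: ler_wpM2r; first by rewrite invr_ge0.
rewrite -!natr_sum -natrD -natrM ler_nat cyc_sum // addnC gap_sumD ?tick_mono //.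
apply: (@leq_trans (\sum_(i < n) cyc (fun=> 1%N) i om)).
  by apply: leq_sum => i _; rewrite geq_minl.
rewrite cyc_sum // sum_nat_const_nat muln1 (leq_trans (leq_subr _ _)) //.
apply: leq_trans (Rpos_len _ g); apply: ltnW; exact: len_Rpos.
Qed.

Lemma tick_avg : exists2 l : R, 0 < l & asure [set om | (tick n om)%:R / n%:R @[n --> \oo] --> l].
Proof.
have [B hB] := mean_index_finite; have [l hl] := tail_lim hB; have [g1 ig1] := iidc (fun=> 1%N).
exists l.
  have [om [g h]] := asure_ex (asureI asure_good (slln ig1 hl)).
  apply: (@lt_le_trans _ _ 1) => //; apply: (cvgn_ge h); exists 1%N => // n /= n1.
  rewrite ler_pdivlMr ?ltr0n // mul1r -natr_sum ler_nat cyc_sum // sum_nat_const_nat muln1.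
  elim: n {n1} => // n IH; apply: leq_ltn_trans IH _.
  by rewrite ltn_sub2r ?tick_lt // (leq_ltn_trans (tick_mono g (leq0n n))) // tick_lt.
apply: asure_mono (asureI asure_good (slln ig1 hl)) => om [g h] /=.
have h2 : (\sum_(i < n) (cyc (fun=> 1%N) i om)%:R) / n%:R + (tick 0 om)%:R * n%:R^-1 @[n --> \oo] -->
    l + (tick 0 om)%:R * 0.
  by apply: cvgD => //; apply: cvgMr; exact: cvgn_inv.
rewrite mulr0 addr0 in h2; apply: cvg_trans h2; apply: near_eq_cvg; exists 0%N => // n _ /=.
rewrite -mulrDl -natr_sum -natrD cyc_sum // sum_nat_const_nat muln1 subnK //.
exact: tick_mono.
Qed.

Definition mean F : R := limn (tail_sum P (cyc F)).

Lemma mean_cvg F : (forall n, (F n <= n)%N) -> tail_sum P (cyc F) M @[M --> \oo] --> mean F.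
Proof.
move=> h; have [B hB] := mean_finite.
have [mu hmu] : exists mu : R, tail_sum P (cyc F) M @[M --> \oo] --> mu.
  by apply: (@tail_lim F B) => M; apply: le_trans (hB M); apply: tail_le.
by apply: cvgP hmu.
Qed.

Lemma gap_avg F (l : R) : (forall n, (F n <= n)%N) -> 0 < l ->
  asure [set om | (tick n om)%:R / n%:R @[n --> \oo] --> l] ->
  asure [set om | (\sum_(j < k) (gap F j om)%:R) / k%:R @[k --> \oo] --> mean F / l].
Proof.
move=> hF l0 al; have [g1 ig1] := iidc F.
apply: asure_mono (asureI (asureI asure_good al) (slln ig1 (mean_cvg hF))) => om [[g h1] h2] /=.
apply: (@ratio_cvg _ (fun n => tick n om) (fun n => tick_lt n g) (fun k => \sum_(j < k) (gap F j om)%:R) _ _ l0) => //.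
- by move=> k; apply: sumr_ge0.
- move=> k j /subnKC <-; rewrite big_split_ord /= lerDl; exact: sumr_ge0.
have h3 : (\sum_(i < n) (cyc F i om)%:R) / n%:R + (\sum_(j < tick 0 om) (gap F j om)%:R) * n%:R^-1 @[n --> \oo] -->
    mean F + (\sum_(j < tick 0 om) (gap F j om)%:R) * 0.
  by apply: cvgD => //; apply: cvgMr; exact: cvgn_inv.
rewrite mulr0 addr0 in h3; apply: cvg_trans h3; apply: near_eq_cvg; exists 0%N => // n _ /=.
rewrite -mulrDl -!natr_sum -natrD cyc_sum // addnC; congr (_%:R / _).
rewrite -(big_mkord xpredT (fun j => gap F j om)) -(big_mkord xpredT (fun j => gap F j om)).
by rewrite -(@big_cat_nat _ _ _ (tick 0 om)) //=; apply: tick_mono.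
Qed.

(** [mean id / l], the mean duration of a cycle over its mean number of levels, is the constant
    [kappa] of the overview. *)
Lemma etime_avg (l : R) : 0 < l -> asure [set om | (tick n om)%:R / n%:R @[n --> \oo] --> l] ->
  asure [set om | (etime k om)%:R / k%:R @[k --> \oo] --> mean id / l].
Proof.
move=> l0 al; apply: asure_mono (asureI asure_good (gap_avg (fun n => leqnn n) l0 al)) => om [g h] /=.
have h3 : (\sum_(j < k) (gap id j om)%:R) / k%:R + (etime 0 om)%:R * k%:R^-1 @[k --> \oo] -->
    mean id / l + (etime 0 om)%:R * 0.
  by apply: cvgD => //; apply: cvgMr; exact: cvgn_inv.
rewrite mulr0 addr0 in h3; apply: cvg_trans h3; apply: near_eq_cvg; exists 0%N => // k _ /=.
rewrite -mulrDl -natr_sum -natrD addnC -(big_mkord xpredT (fun j => gap id j om)).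
by rewrite gap_sumD.
Qed.

Lemma speed_pos (l : R) : 0 < l -> asure [set om | (tick n om)%:R / n%:R @[n --> \oo] --> l] ->
  0 < mean id / l.
Proof.
move=> l0 al; have [om [g h]] := asure_ex (asureI asure_good (etime_avg l0 al)).
have L00 : (0 < L0)%N.
  have := leq_trans (len_Rpos 0 g) (Rpos_len 0 g); by case: (L0).
apply: (@lt_le_trans _ _ L0%:R^-1); first by rewrite invr_gt0 ltr0n.
apply: (cvgn_ge h); exists 1%N => // k /= k1.
rewrite ler_pdivlMr ?ltr0n // mulrC ler_pdivrMr ?ltr0n // -natrM ler_nat mulnC.
by rewrite (leq_trans (ltnW (len_Rpos k g))) // Rpos_len.
Qed.

(** Within a cycle the offset is bounded by [len u0] plus [L0] times the duration of the cycle, and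
    a single cycle is negligible against their number because the averages converge. *)
Lemma offset_small (l : R) : 0 < l -> asure [set om | (tick n om)%:R / n%:R @[n --> \oo] --> l] ->
  asure [set om | (dist (Rpos k om) (Xb (etime k om) om))%:R / k%:R @[k --> \oo] --> (0 : R)].
Proof.
move=> l0 al; have [g1 ig1] := iidc id.
apply: asure_mono (asureI (asureI asure_good al) (slln ig1 (mean_cvg (fun n => leqnn n)))) => om [[g h1] h2] /=.
have sj : short_jumps s L0 Xb om by case: g => -[].
pose bd n := (len u0 + L0 * cyc id n om)%:R : R.
apply: (@small_cvg _ (fun n => tick n om) (fun n => tick_lt n g)
  (fun k => (dist (Rpos k om) (Xb (etime k om) om))%:R) bd _ l0) => //; last first.
  have h3 : (len u0)%:R * n%:R^-1 + L0%:R * ((\sum_(i < n.+1) (cyc id i om)%:R) / n%:R - (\sum_(i < n) (cyc id i om)%:R) / n%:R)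
      @[n --> \oo] --> (len u0)%:R * 0 + L0%:R * (mean id - mean id).
    apply: cvgD; first by apply: cvgMr; exact: cvgn_inv.
    apply: cvgMr; apply: cvgB => //; exact: (cvgn_shiftl h2).
  rewrite subrr !mulr0 addr0 in h3; apply: cvg_trans h3; apply: near_eq_cvg; exists 0%N => // n _ /=.
  rewrite big_ord_recr /= mulrDl addrAC subrr add0r /bd natrD natrM; ring.
move=> n k k1 k2; rewrite /bd ler_nat.
have [_ /= st _] := tickP n g.
have [_ [h3 _] _] := goodP k g.
have kE := subnKC k1.
have cc : cone (Rpos (tick n om) om) (Rpos k om) by rewrite -kE; apply: good_cone.
have cX : cone (Rpos k om) (Xb (etime k om) om) by apply: intr_sub h3.
have d1 : (dist (Rpos k om) (Xb (etime k om) om) <= dist (Rpos (tick n om) om) (Xb (etime k om) om))%N.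
  have cX' : cone (Rpos (tick n om) om) (Xb (etime k om) om) by apply: cone_trans cX.
  rewrite -(leq_add2l (len (Rpos (tick n om) om))) -(cone_dist cX').
  by rewrite (cone_dist cX) leq_add2r; apply: (cone_len cc).
apply: leq_trans d1 _; apply: leq_trans (dist_triangle (Xb (etime (tick n om) om) om) _ _) _.
have eE := subnKC (et_mono g k1).
apply: leq_add.
  have := congr1 snd st; rewrite /= /theta addn0 => e.
  by rewrite -[leqLHS]/(len ((Rpos (tick n om) om)^-1 * Xb (etime (tick n om) om) om)%g) e.
rewrite -eE; apply: leq_trans (short_jumps_dist _ _ sj) _; rewrite leq_mul2l; apply/orP; right.
rewrite leq_subLR /cyc gap_sumD; last 2 first.
- exact: g.
- by apply: tick_mono.
by apply: et_mono => //; apply: ltnW.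
Qed.

(** Up to a fixed tail level [J] the truncated cycles increase to the full ones, and the remaining
    tails are small because the mean is finite. *)
Lemma mean_trunc (e : R) : 0 < e -> exists M, mean id - e <= mean (minn^~ M).
Proof.
move=> e0; have e2 : 0 < e / 2 by rewrite divr_gt0.
have /cvgrPdist_lt /(_ _ e2) [J _ hJ] := mean_cvg (fun n => leqnn n).
have {}hJ := hJ J (leqnn J).
have cv : tail_sum P (cyc (minn^~ M)) J @[M --> \oo] --> tail_sum P (cyc id) J.
  rewrite /tail_sum; elim: {hJ} J => [|J IH].
    by under eq_fun do rewrite big_ord0; rewrite big_ord0; apply: cvg_cst.
  under eq_fun do rewrite big_ord_recr /=; rewrite big_ord_recr /=; apply: cvgD => // {IH}.
  move: J => j.
  rewrite [X in _ --> Pr X](_ : _ = \bigcup_M [set om | (j < cyc (minn^~ M) 0 om)%N]).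
    apply: Pr_bigcup_cvg => M; first exact: Pr_cyc_meas.
    move=> om /= /leq_trans; apply; apply: cyc_le => n.
    by rewrite leq_min geq_minl (leq_trans (geq_minr _ _)).
  apply/seteqP; split=> om /=; last first.
    by move=> [M _ /leq_trans]; apply; apply: cyc_le => n; rewrite geq_minl.
  move=> h; exists (cyc id 0 om) => //=; rewrite (_ : cyc _ 0 om = cyc id 0 om) //.
  apply: eq_big_nat => i /andP[i1 i2]; rewrite /gap /=; apply/minn_idPl.
  rewrite /cyc (@big_cat_nat _ _ _ i) ?(ltnW i2) //= [X in (_ <= _ + X)%N]big_ltn //.
  by apply: leq_trans (leq_addl _ _); rewrite /gap /=; apply: leq_addr.
have /cvgrPdist_lt /(_ _ e2) [M _ hM] := cv.
have {}hM := hM M (leqnn M); exists M.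
have le : tail_sum P (cyc (minn^~ M)) J <= mean (minn^~ M).
  apply: (cvgn_ge (mean_cvg (fun n => geq_minl n M))); exists J => // j /= /subnKC <-.
  rewrite /tail_sum big_split_ord /= lerDl; apply: sumr_ge0 => i _; exact: Pr_ge0.
move: hJ hM; rewrite /= !ltr_norml => /andP[a1 a2] /andP[a3 a4].
lra.
Qed.

(** * The chain [Wproc] under its stationary law *)

Local Notation Wp := (Wproc s star edge L1 K Cov Xb).
Local Notation att := (attainable s star edge L1 K Cov P Xb).
Local Notation kx := (attain_time s star edge L1 K Cov P Xb).

Lemma Wp_state k x om : Wp k om = x -> state k om = (x.1.1, x.2).
Proof. by move=> <-; rewrite /state /theta addn0. Qed.

Lemma countable_VWW : countable [set: V * W * W].
Proof.
by apply: countable_prod => //; apply: countable_prod => //; apply: finite_set_countable; exact: finite_finset.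
Qed.

Lemma Wp_meas k : dmeas (Wp k).
Proof.
have h := dmeas_pair (dmeas_pair (state_meas k) (Rpos_meas k)) (Rpos_meas k.-1).
have cst : countable [set: V * W].
  by apply: countable_prod => //; apply: finite_set_countable; exact: finite_finset.
have := dmeas_comp (fun p : V * W * W * W => (p.1.1.1, (p.2^-1 * p.1.2)%g, p.1.1.2))
  (countable_prod (countable_prod cst cW) cW) h.
congr (dmeas _); apply/funext => om; by rewrite /Wproc /state /theta addn0.
Qed.

Lemma Wp_record k j om om' : good om -> good om' -> record k om = record k om' -> (j <= k)%N ->
  Wp j om = Wp j om'.
Proof.
move=> g g' r jk; have [e1 e2 e3] := record_le g g' r jk.
have [_ e4 _] := record_le g g' r (leq_trans (leq_pred j) jk).
by move: e3; rewrite /state /theta /Wproc !addn0 e2 e4 => /(congr1 snd) /= ->.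
Qed.

Lemma Wp_past j k x : (j <= k)%N -> kpast k [set om | Wp j om = x].
Proof.
move=> jk; split; first exact: Wp_meas.
by move=> om om' g g' r /= <-; apply/esym/(Wp_record g g' r).
Qed.

Lemma kpastI k B B' : kpast k B -> kpast k B' -> kpast k (B `&` B').
Proof.
move=> [m1 h1] [m2 h2]; split; first exact: measurableI.
by move=> om om' g g' r [b1 b2]; split; [apply: h1 b1|apply: h2 b2].
Qed.

Definition next_is (t : V) (y : V * W * W) : set (nat -> W) := [set th | exists nv : nat * W,
  FS t 1 nv.1 nv.2 th /\ (ctype (ref t * nv.2)%g, nv.2, (nv.2^-1 * th nv.1)%g) = y].
Definition next_gt (t : V) (i : nat) : set (nat -> W) := [set th | exists nv : nat * W,
  FS t 1 nv.1 nv.2 th /\ (i < nv.1)%N].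

Let cnW : countable [set: nat * W].
Proof. by apply: countable_prod => //; exact: countable_nat. Qed.

Lemma next_is_seqm t y : seqm 1%g (next_is t y).
Proof.
apply: (seqm_count cnW) => -[n v] /=; apply: seqmI; first exact: FS_seqm.
exact: (seqm_pred (x0 := 1%g) cW n (fun x => (ctype (ref t * v)%g, v, (v^-1 * x)%g) = y)).
Qed.

Lemma next_gt_seqm t i : seqm 1%g (next_gt t i).
Proof.
by apply: (seqm_count cnW) => -[n v] /=; apply: seqmI; [exact: FS_seqm|exact: seqm_cst].
Qed.

Lemma next_isP k y om : good om ->
  next_is (ctype (Rpos k om)) y (theta k om) <-> Wp k.+1 om = y.
Proof.
move=> g; have [rd re] : (K < len (ref (ctype (Rpos k om))))%N /\ ctype (ref (ctype (Rpos k om))) = ctype (Rpos k om).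
  by apply: refP; apply: good_deep.
have st n v : etime (k + 1) om = (etime k om + n)%N -> Rpos (k + 1) om = (Rpos k om * v)%g ->
   (ctype (ref (ctype (Rpos k om)) * v)%g, v, (v^-1 * theta k om n)%g) = Wp k.+1 om.
  rewrite (addn1 k) => e1 e2; rewrite /Wproc succnK e1 e2 /theta invMg mulKg -mulgA; congr (_, _, _).
  by apply/esym; apply: ctype_tr; rewrite ?re // -e2 -(addn1 k); apply: good_cone.
split=> [[[n v] /= [/(FSP _ _ _ _ g) [e1 e2] <-]]|<-]; first by rewrite (st _ _ e1 e2).
exists ((etime k.+1 om - etime k om)%N, ((Rpos k om)^-1 * Rpos k.+1 om)%g) => /=.
have e1 : etime (k + 1) om = (etime k om + (etime k.+1 om - etime k om))%N.
  by rewrite addn1 subnKC // -[X in (_ <= etime X _)%N]addn1; apply: good_le.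
have e2 : Rpos (k + 1) om = (Rpos k om * ((Rpos k om)^-1 * Rpos k.+1 om))%g.
  by rewrite mulVKg addn1.
by split; [apply/FSP|apply: st].
Qed.

Lemma next_gtP k i om : good om ->
  next_gt (ctype (Rpos k om)) i (theta k om) <-> (i < gap id k om)%N.
Proof.
move=> g; split=> [[[n v] /= [/(FSP _ _ _ _ g) [e1 _]]]|h].
  by rewrite /gap -(addn1 k) e1 addKn.
exists ((etime k.+1 om - etime k om)%N, ((Rpos k om)^-1 * Rpos k.+1 om)%g) => /=.
split=> //; apply/FSP => //; rewrite addn1 mulVKg subnKC //.
by rewrite -[X in (_ <= etime X _)%N]addn1; apply: good_le.
Qed.

Definition trp (x y : V * W * W) : R := law (x.1.1, x.2) (next_is x.1.1 y).
Definition gtp (x : V * W * W) (i : nat) : R := law (x.1.1, x.2) (next_gt x.1.1 i).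

Lemma trp_ge0 x y : 0 <= trp x y. Proof. by rewrite divr_ge0 ?Pr_ge0. Qed.
Lemma gtp_ge0 x i : 0 <= gtp x i. Proof. by rewrite divr_ge0 ?Pr_ge0. Qed.

Lemma gap_gt_meas k i : measurable [set om | (i < gap id k om)%N].
Proof.
have mg : dmeas (gap id k) by apply: gap_meas.
exact: (dmeas_preimage countable_nat (fun n => (i < n)%N) mg).
Qed.

Lemma step_law k B x E (Q : set Om) : (0 < k)%N -> kpast k B -> seqm 1%g (E x.1.1) ->
  measurable Q -> (forall om, good om -> E (ctype (Rpos k om)) (theta k om) <-> Q om) ->
  Pr (B `&` [set om | Wp k om = x] `&` Q) =
  Pr (B `&` [set om | Wp k om = x]) * law (x.1.1, x.2) (E x.1.1).
Proof.
move=> k0 pB hE mQ EQ; have pBx := kpastI pB (Wp_past x (leqnn k)).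
have h := regen_law (x.1.1, x.2) pBx hE.
have eqB : B `&` [set om | Wp k om = x] `&` [set om | state k om = (x.1.1, x.2)] = B `&` [set om | Wp k om = x].
  by apply/seteqP; split=> om => [[]//|h1]; split=> //; apply: Wp_state h1.2.
rewrite eqB in h; rewrite -h; have [mB _] := pBx.
apply: (@eq_Pr_as _ _ _ _ _ _ good) => //; first exact: measurableI.
  by apply: measurableI => //; exact: (seqm_preimage (theta_meas k) hE).
move=> om g; split=> -[[b1 b2] b3]; split=> //; have b2' := congr1 fst (Wp_state b2); rewrite /= in b2'.
  by move/(EQ om g): b3; rewrite b2'.
by apply/(EQ om g); rewrite b2'.
Qed.

Lemma step_trp k B x y : (0 < k)%N -> kpast k B ->
  Pr (B `&` [set om | Wp k om = x] `&` [set om | Wp k.+1 om = y]) =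
  Pr (B `&` [set om | Wp k om = x]) * trp x y.
Proof.
move=> k0 pB; apply: (@step_law k B x (next_is^~ y)) => //.
- exact: next_is_seqm.
- exact: Wp_meas.
- by move=> om g; apply: next_isP.
Qed.

Lemma step_gtp k B x i : (0 < k)%N -> kpast k B ->
  Pr (B `&` [set om | Wp k om = x] `&` [set om | (i < gap id k om)%N]) =
  Pr (B `&` [set om | Wp k om = x]) * gtp x i.
Proof.
move=> k0 pB; apply: (@step_law k B x (next_gt^~ i)) => //.
- exact: next_gt_seqm.
- exact: gap_gt_meas.
- by move=> om g; apply: next_gtP.
Qed.

Lemma attP x : att x -> (0 < kx x)%N /\ 0 < Pr [set om | Wp (kx x) om = x].
Proof.
move=> [k hk]; rewrite /attain_time; case: xgetP => [k' _ [h1 h2]|/(_ k)//].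
by split=> //; move: h2; rewrite PrE ?lte_fin //; apply: Wp_meas.
Qed.

Lemma not_att k x : (0 < k)%N -> ~ att x -> Pr [set om | Wp k om = x] = 0.
Proof.
move=> k0 no; apply/eqP; apply: contrapT => /negP h; apply: no; exists k; split=> //.
by rewrite PrE ?lte_fin ?lt_def ?h ?Pr_ge0 //; apply: Wp_meas.
Qed.

Lemma kpastT k : kpast k setT. Proof. by split. Qed.

Lemma Wtrans_trp x y : att x -> Wtrans s star edge L1 K Cov P Xb x y = (trp x y)%:E.
Proof.
move=> /attP [k0 p0]; rewrite /Wtrans -/(kx x).
have := step_trp x y k0 (kpastT _); rewrite !setTI => h.
have mx := Wp_meas (kx x) x; have my := Wp_meas (kx x).+1 y.
rewrite (_ : [set om | _ /\ _] = [set om | Wp (kx x) om = x] `&` [set om | Wp (kx x).+1 om = y]) //.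
rewrite PrE ?h; last exact: measurableI.
by rewrite PrE // inver gt_eqF // -EFinM mulrC mulKf // gt_eqF.
Qed.

(** The [n]-step transition from [x], taken from the process itself after a time when [x] is
    attained rather than as a matrix power; [wstepS] is then the Chapman-Kolmogorov relation. *)
Definition wstep n x z : R := Pr ([set om | Wp (kx x) om = x] `&` [set om | Wp (kx x + n) om = z]) /
  Pr [set om | Wp (kx x) om = x].

Lemma wstep_ge0 n x z : 0 <= wstep n x z. Proof. by rewrite divr_ge0 ?Pr_ge0. Qed.

Lemma null_and k z (B : set Om) : (0 < k)%N -> measurable B -> ~ att z ->
  Pr (B `&` [set om | Wp k om = z]) = 0.
Proof.
move=> k0 mB nz; apply: (@Pr0_sub _ _ _ _ _ [set om | Wp k om = z]).
- by apply: measurableI => //; apply: Wp_meas.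
- exact: Wp_meas.
- by move=> om [].
- exact: not_att.
Qed.

Lemma wstepS n x z : att x -> ((wstep n.+1 x z)%:E = \esum_(y in att) (wstep n x y * trp y z)%:E)%E.
Proof.
move=> ax; have [k0 p0] := attP ax; have kn0 : (0 < kx x + n)%N by rewrite addn_gt0 k0.
have mB : measurable [set om | Wp (kx x) om = x] by exact: Wp_meas.
have mC : measurable [set om | Wp (kx x + n.+1) om = z] by exact: Wp_meas.
rewrite /wstep mulrC EFinM (total_probability_on countable_VWW (f := Wp (kx x + n)) (Q := att)).
- rewrite -esumZl ?invr_ge0 ?Pr_ge0 //; last by move=> y; rewrite lee_fin Pr_ge0.
  apply: eq_esum => y _; rewrite -EFinM; congr _%:E.
  rewrite setIAC addnS step_trp //; last by apply: Wp_past; rewrite leq_addr.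
  by rewrite mulrA [_^-1 * _]mulrC.
- exact: Wp_meas.
- exact: measurableI.
- by move=> y ny; apply: null_and => //; apply: measurableI.
Qed.

Section StationaryMeasure.
Variable nu : V * W * W -> R.
Hypothesis nuS : is_stationary_probability s star edge L1 K Cov P Xb nu.
Let nu0 x : 0 <= nu x. Proof. exact: (stat_ge0 nuS). Qed.

Lemma wstep_stationary n z : att z -> (\esum_(x in att) (nu x * wstep n.+1 x z)%:E = (nu z)%:E)%E.
Proof.
elim: n z => [|n IH] z az.
  rewrite -(stat_inv nuS az); apply: eq_esum => x ax.
  rewrite Wtrans_trp // -EFinM /wstep addn1; congr (_ * _)%:E; have [k0 p0] := attP ax.
  have := step_trp x z k0 (kpastT _); rewrite !setTI => ->.
  by rewrite mulrC mulKf // gt_eqF.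
transitivity (\esum_(x in att) \esum_(y in att) (nu x * wstep n.+1 x y * trp y z)%:E)%E.
  apply: eq_esum => x ax; rewrite EFinM wstepS // -esumZl //; last first.
    by move=> y; rewrite lee_fin mulr_ge0 ?wstep_ge0 ?trp_ge0.
  by apply: eq_esum => y _; rewrite -EFinM mulrA.
rewrite (@esum_swap _ _ _ att att (fun x y => (nu x * wstep n.+1 x y * trp y z)%:E)); last first.
  move=> x y; rewrite lee_fin; apply: mulr_ge0; last exact: trp_ge0.
  by apply: mulr_ge0; [exact: nu0|exact: wstep_ge0].
rewrite -(stat_inv nuS az); apply: eq_esum => y ay.
rewrite Wtrans_trp // -(IH y ay) muleC -esumZl ?trp_ge0 //; last first.
  by move=> x; rewrite lee_fin mulr_ge0 ?wstep_ge0.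
by apply: eq_esum => x _; rewrite -EFinM mulrC.
Qed.

Definition gapp n x i : R := Pr ([set om | Wp (kx x) om = x] `&` [set om | (i < gap id (kx x + n.+1) om)%N]) /
  Pr [set om | Wp (kx x) om = x].

Lemma gapp_ge0 n x i : 0 <= gapp n x i. Proof. by rewrite divr_ge0 ?Pr_ge0. Qed.
Lemma gapp_le1 n x i : gapp n x i <= 1.
Proof.
have [p0|p0] := eqVneq (Pr [set om | Wp (kx x) om = x]) 0; first by rewrite /gapp p0 invr0 mulr0.
rewrite ler_pdivrMr; last by rewrite lt_def p0 Pr_ge0.
have mB : measurable [set om | Wp (kx x) om = x] by exact: Wp_meas.
have mC := gap_gt_meas (kx x + n.+1) i.
by rewrite mul1r; apply: le_Pr => //; exact: measurableI.
Qed.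

Lemma gapp_sum n x i : att x -> ((gapp n x i)%:E = \esum_(z in att) (wstep n.+1 x z * gtp z i)%:E)%E.
Proof.
move=> ax; have [k0 p0] := attP ax; have kn0 : (0 < kx x + n.+1)%N by rewrite addn_gt0 k0.
have mB : measurable [set om | Wp (kx x) om = x] by exact: Wp_meas.
have mC := gap_gt_meas (kx x + n.+1) i.
rewrite /gapp /wstep mulrC EFinM (total_probability_on countable_VWW (f := Wp (kx x + n.+1)) (Q := att)).
- rewrite -esumZl ?invr_ge0 ?Pr_ge0 //; last by move=> y; rewrite lee_fin Pr_ge0.
  apply: eq_esum => y _; rewrite -EFinM; congr _%:E.
  rewrite setIAC step_gtp //; last by apply: Wp_past; rewrite leq_addr.
  by rewrite mulrA [_^-1 * _]mulrC.
- exact: Wp_meas.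
- exact: measurableI.
- by move=> y ny; apply: null_and => //; apply: measurableI.
Qed.

Lemma gapp_stationary n i :
  (\esum_(x in att) (nu x * gapp n x i)%:E = \esum_(z in att) (nu z * gtp z i)%:E)%E.
Proof.
transitivity (\esum_(x in att) \esum_(z in att) (nu x * wstep n.+1 x z * gtp z i)%:E)%E.
  apply: eq_esum => x ax; rewrite EFinM gapp_sum // -esumZl //; last first.
    by move=> y; rewrite lee_fin mulr_ge0 ?wstep_ge0 ?gtp_ge0.
  by apply: eq_esum => y _; rewrite -EFinM mulrA.
rewrite (@esum_swap _ _ _ att att (fun x y => (nu x * wstep n.+1 x y * gtp y i)%:E)); last first.
  move=> x y; rewrite lee_fin; apply: mulr_ge0; last exact: gtp_ge0.
  by apply: mulr_ge0; [exact: nu0|exact: wstep_ge0].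
apply: eq_esum => z az; rewrite [in RHS]mulrC EFinM -(wstep_stationary n az) -esumZl ?gtp_ge0 //.
  by apply: eq_esum => x _; rewrite -EFinM mulrC.
by move=> x; rewrite lee_fin mulr_ge0 ?wstep_ge0.
Qed.

(** The stationary probability that an increment exceeds [i]; summed over [i], it gives the
    stationary mean. *)
Definition gap_tail i : R := fine (\esum_(z in att) (nu z * gtp z i)%:E).

Lemma gap_tailE i : (\esum_(z in att) (nu z * gtp z i)%:E = (gap_tail i)%:E)%E.
Proof.
rewrite /gap_tail fineK // ge0_fin_numE; last by apply: esum_ge0 => z _; rewrite lee_fin mulr_ge0 ?gtp_ge0.
rewrite -(gapp_stationary 0); apply: le_lt_trans (ltry 1); rewrite -(stat_mass nuS).
by apply: le_esum => x _; rewrite lee_fin ler_piMr ?gapp_le1.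
Qed.

Lemma gap_tail_ge0 i : 0 <= gap_tail i.
Proof. by rewrite -lee_fin -gap_tailE; apply: esum_ge0 => z _; rewrite lee_fin mulr_ge0 ?gtp_ge0. Qed.

Lemma cesaro_shift (g : nat -> R) (a : R) k : (\sum_(j < n) g j) / n%:R @[n --> \oo] --> a ->
  (\sum_(j < n) g (k + j)%N) / n%:R @[n --> \oo] --> a.
Proof.
elim: k => [|k IH] // h; have {IH h} h := IH h.
have h1 := cvgn_shiftl h.
have h2 : (\sum_(j < n.+1) g (k + j)%N) / n%:R - g k * n%:R^-1 @[n --> \oo] --> a - g k * 0.
  by apply: cvgB => //; apply: cvgMr; exact: cvgn_inv.
rewrite mulr0 subr0 in h2; apply: cvg_trans h2; apply: near_eq_cvg; apply: nearW => n /=.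
rewrite big_ord_recl /= addn0 -mulrBl addrC addKr; congr (_ / _).
by apply: eq_bigr => j _; rewrite /bump leq0n add1n addSnnS.
Qed.

Definition grid n M : seq (nat * nat) := [seq (j, i) | j <- iota 0 n, i <- iota 0 M].

Lemma grid_sum n M (F : nat -> nat -> R) :
  \sum_(ji <- grid n M) F ji.1 ji.2 = \sum_(j < n) \sum_(i < M) F j i.
Proof.
rewrite big_allpairs /= -(big_mkord xpredT (fun j => \sum_(i < M) F j i)) /index_iota subn0.
by apply: eq_bigr => j _; rewrite -(big_mkord xpredT (fun i => F j i)) /index_iota subn0.
Qed.

Lemma sum_lt_minn g M : \sum_(i < M) (i < g)%N%:R = (minn g M)%:R :> R.
Proof.
elim: M => [|M IH]; first by rewrite big_ord0 minn0.
rewrite big_ord_recr /= IH -natrD; congr _%:R.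
by have [h|h] := ltnP M g; lia.
Qed.

Section Limit.
Variable l : R.
Hypothesis l0 : 0 < l.
Hypothesis al : asure [set om | (tick n om)%:R / n%:R @[n --> \oo] --> l].

(** Restricting to one value of [Wproc] does not disturb the almost sure average of the truncated
    gaps, and truncation makes them bounded, so conditional expectations converge. *)
Lemma gapp_cvg M x : att x ->
  n%:R^-1 * \sum_(j < n) \sum_(i < M) gapp j x i @[n --> \oo] --> mean (minn^~ M) / l.
Proof.
move=> ax; have [k0 p0] := attP ax.
have bcv := @bounded_cvg _ _ _ P (nat * nat)%type (grid^~ M) (fun n _ => n%:R^-1)
  (fun n ji => [set om | (ji.2 < gap id (kx x + ji.1.+1) om)%N]) [set om | Wp (kx x) om = x]
  M%:R (mean (minn^~ M) / l).
have sE n om : \sum_(i <- grid n M) n%:R^-1 * \1_[set om0 | (i.2 < gap id (kx x + i.1.+1) om0)%N] om =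
    (\sum_(j < n) (gap (minn^~ M) ((kx x).+1 + j) om)%:R) / n%:R :> R.
  rewrite -big_distrr /= mulrC; congr (_ * _).
  rewrite (grid_sum n M (fun j i => \1_[set om0 | (i < gap id (kx x + j.+1) om0)%N] om)).
  apply: eq_bigr => j _; rewrite /gap addSnnS -sum_lt_minn; apply: eq_bigr => i _.
  by rewrite indicE; congr (_%:R); congr nat_of_bool; apply/idP/idP; rewrite inE.
have : \sum_(i <- grid n M) n%:R^-1 * Pr ([set om | Wp (kx x) om = x] `&` [set om | (i.2 < gap id (kx x + i.1.+1) om)%N])
  @[n --> \oo] --> mean (minn^~ M) / l * Pr [set om | Wp (kx x) om = x].
apply: bcv.
- by move=> n _; rewrite invr_ge0.
- by move=> n i; apply: gap_gt_meas.
- exact: Wp_meas.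
- move=> n om; rewrite sE; case: n => [|n]; first by rewrite big_ord0 mul0r.
  rewrite ler_pdivrMr // -natr_sum -natrM ler_nat.
  apply: (@leq_trans (\sum_(j < n.+1) M)); last by rewrite sum_nat_const card_ord mulnC.
  by apply: leq_sum => j _; apply: geq_minr.
- apply: asure_mono (gap_avg (F := minn^~ M) _ l0 al) => [om /= h|n]; last exact: geq_minl.
  by under eq_fun do rewrite sE; apply: (cesaro_shift (g := fun j => (gap (minn^~ M) j om)%:R)).
move=> h; have h1 : (Pr [set om | Wp (kx x) om = x])^-1 *
    (\sum_(i <- grid n M) n%:R^-1 * Pr ([set om | Wp (kx x) om = x] `&` [set om | (i.2 < gap id (kx x + i.1.+1) om)%N]))
    @[n --> \oo] --> (Pr [set om | Wp (kx x) om = x])^-1 * (mean (minn^~ M) / l * Pr [set om | Wp (kx x) om = x]).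
  by apply: cvgMr; apply: h.
rewrite mulrC mulfK ?gt_eqF // in h1; apply: cvg_trans h1; apply: near_eq_cvg; apply: nearW => n /=.
rewrite -big_distrr /= (grid_sum n M (fun j i => Pr ([set om | Wp (kx x) om = x] `&` [set om | (i < gap id (kx x + j.+1) om)%N]))).
rewrite mulrCA; congr (_ * _); rewrite big_distrr /=; apply: eq_bigr => j _.
by rewrite big_distrr /=; apply: eq_bigr => i _; rewrite mulrC.
Qed.

(** By invariance the [nu]-average of [B n] is the same for all positive [n], whereas [B n x] tends
    to the same limit for every attainable [x]. Fatou's lemma for [B] and for [M%:R - B] identifies
    the two. *)
Lemma gap_tail_sum M : \sum_(i < M) gap_tail i = mean (minn^~ M) / l.
Proof.
pose B n x : R := n%:R^-1 * \sum_(j < n) \sum_(i < M) gapp j x i.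
have B0 n x : 0 <= B n x.
  by rewrite mulr_ge0 ?invr_ge0 // sumr_ge0 // => j _; apply: sumr_ge0 => i _; apply: gapp_ge0.
have BM n x : B n x <= M%:R.
  case: n => [|n]; first by rewrite /B invr0 mul0r.
  rewrite /B mulrC ler_pdivrMr // -natrM mulnC.
  apply: (@le_trans _ _ (\sum_(j < n.+1) \sum_(i < M) 1)); last first.
    by rewrite !sumr_const !card_ord -mulrnA mulnC.
  by apply: ler_sum => j _; apply: ler_sum => i _; apply: gapp_le1.
have BS n : (0 < n)%N -> (\esum_(x in att) (nu x * B n x)%:E = (\sum_(i < M) gap_tail i)%:E)%E.
  move=> n0; transitivity ((n%:R^-1)%:E * \sum_(j < n) \sum_(i < M) \esum_(x in att) (nu x * gapp j x i)%:E)%E.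
    transitivity ((n%:R^-1)%:E * \esum_(x in att) \sum_(j < n) \sum_(i < M) (nu x * gapp j x i)%:E)%E.
      rewrite -esumZl ?invr_ge0 //; last first.
        by move=> x; apply: sume_ge0 => j _; apply: sume_ge0 => i _; rewrite lee_fin mulr_ge0 ?gapp_ge0.
      apply: eq_esum => x _; under eq_bigr do rewrite sumEFin; rewrite sumEFin -EFinM; congr _%:E.
      rewrite /B mulrCA; congr (_ * _); rewrite big_distrr /=; apply: eq_bigr => j _.
      by rewrite big_distrr.
    congr (_ * _)%E; rewrite esum_sum; last first.
      by move=> x j _ _; apply: sume_ge0 => i _; rewrite lee_fin mulr_ge0 ?gapp_ge0.
    by apply: eq_bigr => j _; rewrite esum_sum // => x i _ _; rewrite lee_fin mulr_ge0 ?gapp_ge0.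
  have E j : (\sum_(i < M) \esum_(x in att) (nu x * gapp j x i)%:E = (\sum_(i < M) gap_tail i)%:E)%E.
    by rewrite -sumEFin; apply: eq_bigr => i _; rewrite gapp_stationary gap_tailE.
  rewrite (eq_bigr _ (fun (j : 'I_n) _ => E j)) sumEFin -EFinM; congr _%:E.
  by rewrite sumr_const card_ord -[X in _ * X]mulr_natl mulKf // pnatr_eq0 -lt0n.
have [x0 ax0] : exists x, att x.
  apply: contrapT => no; have := stat_mass nuS; rewrite esum1 => [/eqP|x ax]; last by case: no; exists x.
  by rewrite eqe eq_sym oner_eq0.
have m0 : 0 <= mean (minn^~ M) / l.
  by apply: (cvgn_ge (u := B^~ x0)); [exact: gapp_cvg|apply: nearW => n; apply: B0].
have mM : mean (minn^~ M) / l <= M%:R.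
  by apply: (cvgn_le (u := B^~ x0)); [exact: gapp_cvg|apply: nearW => n; apply: BM].
apply/eqP; rewrite eq_le; apply/andP; split; last first.
  apply: (esum_fatou (v := nu) (B := B) (I := att)) => //.
  - exact: (stat_mass nuS).
  - by move=> n n0; rewrite BS.
  - by move=> x ax; apply: gapp_cvg.
have h : M%:R - mean (minn^~ M) / l <= M%:R - \sum_(i < M) gap_tail i.
  apply: (esum_fatou (v := nu) (B := fun n x => M%:R - B n x) (I := att)) => //.
  - exact: (stat_mass nuS).
  - by rewrite subr_ge0.
  - by move=> n x; rewrite subr_ge0.
  - move=> n n0; rewrite EFinB -(BS n n0).
    have h : (\esum_(x in att) (nu x * (M%:R - B n x))%:E + \esum_(x in att) (nu x * B n x)%:E = M%:R%:E)%E.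
      rewrite -esumD; last 2 first.
      - by move=> x _; rewrite lee_fin mulr_ge0 // subr_ge0.
      - by move=> x _; rewrite lee_fin mulr_ge0.
      transitivity (M%:R%:E * \esum_(x in att) (nu x)%:E)%E; last by rewrite (stat_mass nuS) mule1.
      rewrite -esumZl //; apply: eq_esum => x _; rewrite -!EFinD -EFinM; congr _%:E.
      by rewrite -mulrDr subrK mulrC.
    by rewrite -h BS // addeK.
  - by move=> x ax; apply: cvgB; [exact: cvg_cst|exact: gapp_cvg].
lra.
Qed.

Lemma mean_incrementE x : att x ->
  (mean_increment s star edge L1 K Cov P Xb x = \esum_(i in [set: nat]) (gtp x i)%:E)%E.
Proof.
move=> ax; have [k0 p0] := attP ax; rewrite /mean_increment -/(kx x).
have mB : measurable [set om | Wp (kx x) om = x] by exact: Wp_meas.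
have mg : dmeas (gap id (kx x)) by apply: gap_meas.
have md (f : Om -> nat) : dmeas f -> measurable_fun setT (fun om => (f om)%:R : R).
  move=> mf _ Y mY; rewrite setTI.
  exact: (dmeas_preimage countable_nat (fun n => Y n%:R) mf).
have -> : (\int[P]_(om in [set om | Wp (kx x) om = x]) ((etime (kx x).+1 om)%:R - (etime (kx x) om)%:R)%:E =
    \int[P]_(om in [set om | Wp (kx x) om = x]) ((gap id (kx x) om)%:R)%:E)%E.
  apply: ae_eq_integral => //.
  - apply/measurable_EFinP; apply: measurable_funTS; apply: measurable_funB; exact: md.
  - apply/measurable_EFinP; apply: measurable_funTS; exact: md.
  - exists (~` good); split; [exact: measurableC| |].
      by apply: etrans (PrE P (measurableC good_meas)) _; rewrite good_as.
    move=> om h g; apply: h => _; congr _%:E; rewrite /gap natrB //.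
    by rewrite -[X in (_ <= etime X _)%N]addn1; apply: good_le.
rewrite nat_integral // PrE // inver gt_eqF // muleC -esumZl ?invr_ge0 ?Pr_ge0 //; last first.
  by move=> i; rewrite lee_fin Pr_ge0.
apply: eq_esum => i _; have := step_gtp x i k0 (kpastT _); rewrite !setTI => ->.
by rewrite -EFinM mulKf // gt_eqF.
Qed.

Lemma Enu_increment_mean : (Enu_increment s star edge L1 K Cov P Xb nu = (mean id / l)%:E)%E.
Proof.
transitivity (\esum_(x in att) \esum_(i in [set: nat]) (nu x * gtp x i)%:E)%E.
  apply: eq_esum => x ax; rewrite mean_incrementE // -esumZl //; last by move=> i; rewrite lee_fin gtp_ge0.

rewrite (@esum_swap _ _ _ att setT (fun x i => (nu x * gtp x i)%:E)); last first.
  by move=> x i; rewrite lee_fin mulr_ge0 ?gtp_ge0.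
under eq_esum do rewrite gap_tailE.
rewrite -nneseries_esumT; last by move=> i; rewrite lee_fin gap_tail_ge0.
have cv : \sum_(i < n) gap_tail i @[n --> \oo] --> mean id / l.
  apply/cvgrPdist_le => e'; move: (e' : R) => e {e'} e0.
  have [M hM] := mean_trunc (mulr_gt0 e0 l0).
  have le n : \sum_(i < n) gap_tail i <= mean id / l.
    rewrite gap_tail_sum ler_pM2r ?invr_gt0 //.
    have c1 : tail_sum P (cyc (minn^~ n)) M @[M --> \oo] --> mean (minn^~ n).
      by apply: mean_cvg => j; exact: geq_minl.
    have c2 : tail_sum P (cyc id) M @[M --> \oo] --> mean id.
      exact: mean_cvg.
    apply: (ler_lim (cvgP _ c1) (cvgP _ c2)).
    by apply: nearW => j; apply: tail_le => i; exact: geq_minl.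
  exists M => // n /= Mn; have h1 := le n.
  have h2 : mean id / l - e <= \sum_(i < M) gap_tail i.
    by rewrite gap_tail_sum -(ler_pM2r l0) mulrBl !divfK ?gt_eqF.
  have h3 : \sum_(i < M) gap_tail i <= \sum_(i < n) gap_tail i.
    by rewrite -(subnKC Mn) big_split_ord /= lerDl; apply: sumr_ge0 => i _; apply: gap_tail_ge0.
  rewrite ger0_norm; lra.
apply/cvg_lim => //; rewrite (_ : (fun n => _) = EFin \o (fun n => \sum_(i < n) gap_tail i)).
  by apply: cvg_EFin; [exact: nearW|].
by apply/funext => n; rewrite /= big_mkord sumEFin.
Qed.

End Limit.

End StationaryMeasure.

(** * The law of the covering process and the Green function *)

Let mdist k : dmeas (fun om => dist (Rpos k om) (Xb (etime k om) om)).
Proof.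
have h := dmeas_pair (Rpos_meas k) (state_meas k).
have cst : countable [set: V * W].
  by apply: countable_prod => //; apply: finite_set_countable; exact: finite_finset.
have := dmeas_comp (fun p : W * (V * W) => len p.2.2) (countable_prod cW cst) h.
by congr (dmeas _); apply/funext => om; rewrite /state /theta addn0.
Qed.

Lemma not_I1_root r : (K < len r)%N -> ~ I1 r r.
Proof.
move=> rd /intrP [_ h]; have [i hi] := exists_descent (G := G) (leq_ltn_trans (leq0n _) rd).
have := h (r * s i)%g; rewrite (dist_gen (G := G)) => /(_ (L1_ge1 (S := S))) /(cone_len (G := G)).
by rewrite hi ltnn.
Qed.

(** For each [n] let the walk be at [r] at time [n], follow a fixed reduced word to depth [3 * L1]
    and stay. Almost surely each of these events forces [R_k = r]; its probability is at least a
    constant times that of being at [r] at time [n], and the events are disjoint, since neither the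
    reduced word nor the interior comes back to [r]. Summing over [n] gives the Green function. *)
Lemma Rpos_lower : exists2 c' : R, 0 < c' & forall k r, covn k r ->
  c' * grn r <= Pr [set om | Rpos k om = r].
Proof.
have [umax hu] := descend (S := S).
have [e /andP[e0 e1] he] := markov_follows (D := D) (C := C).
have [c1 c10 hc1] := stay_lower.
exists (e ^+ umax * c1) => [|k r kr]; first by rewrite mulr_gt0 ?exprn_gt0.
have rd : (K < len r)%N by apply: (covn_deep (S := S)) kr.
have [z [rz _ dz /(_ isT) I3z]] := hu 1%N r rd; rewrite muln1 in dz.
have [l [lz sl _]] := cone_path rz.
pose An n := follows s Xb n r l `&` stays_inf Xb (I1 r) (n + size l).
have mF n : measurable (follows s Xb n r l).
  by apply: (past_meas (C := C) (n := n + size l)); apply: follows_past.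
have mA n : measurable (An n) by apply: measurableI => //; exact: (stays_inf_meas (C := C)).
have low n : e ^+ umax * c1 * pn n r 1%g <= Pr (An n).
  have pT : past Xb n setT by [].
  have := he n setT r l pT; rewrite !setTI => h1.
  have h2 : Pr (follows s Xb n r l `&` [set om | Xb (n + size l)%N om = z] `&` stays_inf Xb (I1 r) (n + size l)) =
     Pr (follows s Xb n r l `&` [set om | Xb (n + size l)%N om = z]) * stay_inf (I1 r) z.
    by apply: (markov_stays_inf (D := D) (C := C)); apply: follows_past.
  have eqF : follows s Xb n r l `&` [set om | Xb (n + size l)%N om = z] = follows s Xb n r l.
    by apply/seteqP; split=> om => [[]//|h]; split=> //=; rewrite h // take_size.
  rewrite eqF in h2; rewrite /An h2 (pn_Pr).
  apply: (@le_trans _ _ (e ^+ size l * Pr [set om | Xb n om = r] * c1)).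
    rewrite mulrAC ler_wpM2r ?(ltW c10) // ler_wpM2r ?Pr_ge0 //.
    by rewrite ler_wiXn2l ?(ltW e0) // sl.
  apply: ler_pM => //; last exact: hc1.
  by rewrite mulr_ge0 ?Pr_ge0 ?exprn_ge0 // ltW.
  exact: ltW.
pose B := [set om | Rpos k om = r] `|` ~` good.
have mB : measurable B by apply: measurableU; [exact: Rpos_meas|exact: measurableC].
have PB : Pr B <= Pr [set om | Rpos k om = r].
  apply: le_trans (PrU_le P (Rpos_meas k r) (measurableC good_meas)) _.
  by rewrite good_as addr0.
apply: le_trans PB.
apply: (@cvgn_le _ (fun n => e ^+ umax * c1 * \sum_(i < n) pn i r 1%g)).
  by apply: cvgMr; apply: grn_cvg.
apply: nearW => M; rewrite big_distrr /=.
apply: (@le_trans _ _ (\sum_(i < M) 1 * Pr (An i))).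
  by apply: ler_sum => i _; rewrite mul1r; apply: low.
have := @Pr_indic_le _ _ _ P _ _ (index_enum 'I_M) [:: tt] (fun=> 1) (fun=> 1) (fun i : 'I_M => An i) (fun=> B).
rewrite big_seq1 mul1r; apply=> // om; rewrite big_seq1 mul1r.
under eq_bigr do rewrite mul1r.
have [[i Ai]|no] := pselect (exists i : 'I_M, An i om); last first.
  by rewrite big1 // => i _; rewrite indicE memNset // => Ai; apply: no; exists i.
have uniqA n n' : (n < n')%N -> An n om -> An n' om -> False.
  move=> nn' [f1 s1] [f2 _]; have Xr : Xb n' om = r by have := f2 0%N (leq0n _); rewrite addn0 take0 mulg1.
  have [le|lt] := leqP n' (n + size l); last first.
    by have := s1 n' (ltnW lt); rewrite Xr; apply: not_I1_root.
  have := f1 (n' - n)%N; rewrite subnKC ?(ltnW nn') // Xr leq_subLR => /(_ le) /eqP.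
  rewrite -[X in X == _]mulg1 (inj_eq (mulgI r)) eq_sym => /eqP w1.
  have rl : reduced s l by rewrite /reduced sl -lz /Defs.dist mulKg.
  have [rt _] : reduced s (take (n' - n) l) /\ reduced s (drop (n' - n) l).
    by apply: (reduced_cat (G := G)); rewrite cat_take_drop.
  move: rt; rewrite /reduced w1 (len1 (s := s)) size_takel ?leq_subLR // => h.
  by move: nn'; rewrite -subn_gt0 -h.
rewrite (bigD1 i) //= big1 ?addr0 => [|j ji]; last first.
  rewrite indicE memNset // => Aj; case: (ltngtP i j) => // h; first exact: uniqA h Ai Aj.
    exact: uniqA h Aj Ai.
  by move: ji; rewrite -(inj_eq val_inj) /= h eqxx.
rewrite !indicE mem_set // mem_set // /B.
have [g|ng] := pselect (good om); [left|by right].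
have [ck st _] := goodP k g; have [f1 s1] := Ai.
apply: (settled_uniq ck kr st (n' := (i + size l)%N)).
by split=> //; rewrite f1 // take_size lz.
Qed.

(** The walk visits some point within [a] of [r], and the probability of ever visiting a point is at
    most its Green function. The Harnack inequality brings this back to [r], and the number of
    points is at most exponential in [a]. *)
Lemma Rpos_upper : exists2 C' : R, 1 <= C' & forall k r a,
  Pr ([set om | Rpos k om = r] `&` [set om | (dist (Rpos k om) (Xb (etime k om) om) <= a)%N])
  <= C' ^+ a * grn r.
Proof.
have [e /andP[e0 e1] he] := grn_dist.
exists (N.+1%:R / e) => [|k r a].
  by rewrite ler_pdivlMr // mul1r (le_trans e1) // ler1n.
pose l := bseq_at s r a.
pose U y := \bigcup_n [set om | Xb n om = y].
have mU y : measurable (U y) by apply: bigcupT_measurable => n; exact: (Xb_meas (C := C)).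
have hU y : Pr (U y) <= grn y.
  apply: (Pr_bigcup_le (a := fun n => pn n y 1%g)) => [n|n|n]; first exact: (Xb_meas (C := C)).
    by rewrite (pn_Pr).
  exact: grn_ge.
have md : measurable [set om | (dist (Rpos k om) (Xb (etime k om) om) <= a)%N].
  exact: (dmeas_preimage countable_nat (fun n => (n <= a)%N) (mdist k)).
apply: le_trans (@Pr_le_sum _ _ _ P 'I_(size l) xpredT (fun i => U (nth 1%g l i)) _ _ _ _) _.
- by apply: measurableI => //; exact: Rpos_meas.
- by [].
- move=> om [/= rE h]; have yl : Xb (etime k om) om \in l.
    by rewrite (mem_bseq_at (G := G)) -rE.
  have il : (index (Xb (etime k om) om) l < size l)%N by rewrite index_mem.
  by exists (Ordinal il) => //=; exists (etime k om) => //=; rewrite nth_index.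
apply: (@le_trans _ _ (\sum_(i < size l) e^-1 ^+ a * grn r)).
  apply: ler_sum => i _; apply: le_trans (hU _) _.
  have : nth 1%g l i \in l by rewrite mem_nth.
  rewrite (mem_bseq_at (G := G)) => dl; have := he (nth 1%g l i) r.
  rewrite (distC (G := G)) => h; rewrite exprVn ler_pdivlMl ?exprn_gt0 //; apply: le_trans h.
  by apply: ler_wpM2r; [exact: ltW|apply: ler_wiXn2l => //; exact: ltW].
rewrite sumr_const card_ord -[leLHS]mulr_natl mulrA; rewrite ler_wpM2r ?(ltW (grn_pos _)) // expr_div_n exprVn.
rewrite ler_wpM2r ?invr_ge0 ?exprn_ge0 ?(ltW e0) // -natrX ler_nat.
exact: size_bseq_at.
Qed.

(** * Entropy of the covering process as a Green speed *)

Section Speed.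
Variable l : R.
Hypothesis l0 : 0 < l.
Hypothesis al : asure [set om | (tick n om)%:R / n%:R @[n --> \oo] --> l].

(** Summed over the [r] for which [Pr [R_k = r]] exceeds [expR (de * k) * grn r], the bound of
    [Rpos_upper] with offset at most [k / t.+1] is at most [expR (- (de / 2) * k)]. Borel-Cantelli
    applies, and the offset condition holds eventually by [offset_small]. *)
Lemma Rpos_prob_le (de : R) : 0 < de -> asure [set om | exists k0, forall k, (k0 <= k)%N ->
  Pr [set om' | Rpos k om' = Rpos k om] <= expR (de * k%:R) * grn (Rpos k om)].
Proof.
move=> de0; have [C' C1 hC] := Rpos_upper.
(* [t] is chosen so that the factor [C' ^+ (k %/ t.+1)] uses up at most half of the exponent. *)
have [t ht] := nat_above (ln C' / (de / 2)).
have C0 : 0 < C' by apply: lt_le_trans C1.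
have Ct : C' <= expR (t.+1%:R * (de / 2)).
  rewrite -[leLHS]lnK ?posrE // ler_expR -ler_pdivrMr ?divr_gt0 //; apply: (le_trans ht).
  by rewrite ler_nat.
have Ca k : C' ^+ (k %/ t.+1) <= expR (de / 2 * k%:R).
  apply: (@le_trans _ _ (expR (t.+1%:R * (de / 2)) ^+ (k %/ t.+1))).
    by rewrite lerXn2r ?nnegrE ?expR_ge0 // ltW.
  rewrite -expRM_natl ler_expR [t.+1%:R * _]mulrC mulrCA ler_wpM2l ?divr_ge0 ?(ltW de0) //.
  by rewrite -natrM ler_nat leq_divM.
pose bad k := [set om | expR (de * k%:R) * grn (Rpos k om) < Pr [set om' | Rpos k om' = Rpos k om]] `&`
  [set om | (dist (Rpos k om) (Xb (etime k om) om) <= k %/ t.+1)%N].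
have mbad k : measurable (bad k).
  apply: measurableI.
    exact: (dmeas_preimage cW (fun r => expR (de * k%:R) * grn r < Pr [set om' | Rpos k om' = r]) (Rpos_meas k)).
  exact: (dmeas_preimage countable_nat (fun n => (n <= k %/ t.+1)%N) (mdist k)).
have hb k : Pr (bad k) <= 1 * expR (- (de / 2)) ^+ k.
  rewrite mul1r -lee_fin -PrE // (total_probability P cW (Rpos_meas k)) //.
  apply: (@le_trans _ _ (\esum_(r in [set: W]) ((expR (- (de / 2)) ^+ k)%:E * P [set om | Rpos k om = r]))%E).
    apply: le_esum => r _; rewrite PrE; last by apply: measurableI => //; exact: Rpos_meas.
    rewrite PrE -?EFinM ?lee_fin; last exact: Rpos_meas.
    have [lt|ge] := ltP (expR (de * k%:R) * grn r) (Pr [set om' | Rpos k om' = r]); last first.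
      rewrite (_ : _ `&` _ = set0) ?Pr0 ?mulr_ge0 ?Pr_ge0 ?exprn_ge0 ?expR_ge0 //.
        by rewrite Pr_set0 mulr_ge0 ?exprn_ge0 ?expR_ge0 ?Pr_ge0.
      by apply/seteqP; split=> om //= [[b1 _] b2]; move: b1; rewrite /= b2 ltNge ge.
    apply: (@le_trans _ _ (expR (de / 2 * k%:R) * grn r)).
      apply: (@le_trans _ _ (Pr ([set om | Rpos k om = r] `&` [set om | (dist (Rpos k om) (Xb (etime k om) om) <= k %/ t.+1)%N]))).
        apply: le_Pr; first by apply: measurableI => //; exact: Rpos_meas.
          apply: measurableI; first exact: Rpos_meas.
          exact: (dmeas_preimage countable_nat (fun n => (n <= k %/ t.+1)%N) (mdist k)).
        by move=> om [[_ b] c'].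
      by apply: (le_trans (hC _ _ _)); apply: ler_wpM2r => //; exact: ltW.
    rewrite -expRM_natl -[leLHS]mul1r; have -> : expR (de / 2 * k%:R) = expR (k%:R * - (de / 2)) * expR (de * k%:R).
      by rewrite -expRD; congr expR; lra.
    by rewrite mul1r -mulrA ler_wpM2l ?expR_ge0 // ltW.
  rewrite esumZl ?exprn_ge0 ?expR_ge0 //.
  rewrite (_ : (\esum_(r in [set: W]) P [set om | Rpos k om = r])%E = 1%E) ?mule1 //.
  rewrite -(probability_setT P) (total_probability P cW (Rpos_meas k)) //.
  by apply: eq_esum => r _; rewrite setTI.
have bc : asure [set om | exists n0, forall n, (n0 <= n)%N -> ~ bad n om].
  apply: (borel_cantelli ler01 _ mbad hb); rewrite expR_ge0 /= expR_lt1 oppr_lt0 divr_gt0 //.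
apply: asure_mono (asureI bc (offset_small l0 al)) => om [[n0 h1] /= h2].
have t10 : 0 < (t.+1%:R)^-1 :> R by rewrite invr_gt0.
have /cvgrPdist_lt /(_ _ t10) [n1 _ h3] := h2.
exists (maxn n0 n1.+1) => k; rewrite geq_max => /andP[k0 k1]; rewrite leNgt; apply/negP => lt.
apply: (h1 k k0); split=> //=.
have kp : (0 : R) < k%:R by rewrite ltr0n (leq_ltn_trans _ k1).
have := h3 k (ltnW k1); rewrite /= sub0r normrN ger0_norm ?divr_ge0 //.
rewrite ltr_pdivrMr // mulrC ltr_pdivlMr // -natrM ltr_nat => lt'.
by rewrite leq_divRL // ltnW.
Qed.

(** By the two bounds on [Pr [R_k = r]], its logarithm differs from that of [grn] by [o(k)]. This
    also shows that [H] is finite: [- ln grn] grows at most linearly in the length, hence in [k]. *)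
Lemma green_entropy (H : \bar R) :
  asure [set om | (- ln (Pr [set om' | Rpos n om' = Rpos n om]) / n%:R)%:E @[n --> \oo] --> H] ->
  exists2 h : R, H = h%:E & asure [set om | - ln (grn (Rpos n om)) / n%:R @[n --> \oo] --> h].
Proof.
move=> aH; have [c' c'0 hc'] := Rpos_lower.
have aprob : asure [set om | forall p, exists k0, forall k, (k0 <= k)%N ->
    Pr [set om' | Rpos k om' = Rpos k om] <= expR (p.+1%:R^-1 * k%:R) * grn (Rpos k om)].
  by apply: (asure_all (Q := fun p => [set om | exists k0, forall k, (k0 <= k)%N ->
    Pr [set om' | Rpos k om' = Rpos k om] <= expR (p.+1%:R^-1 * k%:R) * grn (Rpos k om)])) => p;
    apply: Rpos_prob_le; rewrite invr_gt0.
pose x n om : R := - ln (Pr [set om' | Rpos n om' = Rpos n om]) / n%:R.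
pose y n om : R := - ln (grn (Rpos n om)) / n%:R.
have ppos k om : good om -> 0 < Pr [set om' | Rpos k om' = Rpos k om].
  move=> g; have [ck _ _] := goodP k g; apply: lt_le_trans (hc' k _ ck).
  by rewrite mulr_gt0.
have close om : good om -> (forall p, exists k0, forall k, (k0 <= k)%N ->
    Pr [set om' | Rpos k om' = Rpos k om] <= expR (p.+1%:R^-1 * k%:R) * grn (Rpos k om)) ->
    y n om - x n om @[n --> \oo] --> (0 : R).
  move=> g h; apply/cvgrPdist_le => e'; move: (e' : R) => e {e'} e0.
  have [p hp] := nat_above e^-1.
  have pe : p.+1%:R^-1 <= e.
    rewrite invf_ple ?posrE //; apply: (le_trans hp); by rewrite ler_nat.
  have [k0 hk] := h p; have [k1 hk1] := nat_above (`|ln c'| / e).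
  exists (maxn k0 k1).+1 => // k /= kk.
  have kp : (0 : R) < k%:R by rewrite ltr0n (leq_ltn_trans _ kk).
  have [ck _ _] := goodP k g; have l1 := hc' k _ ck.
  have {}hk := hk k (leq_trans (leq_maxl k0 k1) (ltnW kk)).
  rewrite -ler_ln ?posrE ?mulr_gt0 ?expR_gt0 ?ppos // lnM ?posrE ?expR_gt0 // expRK in hk.
  rewrite -ler_ln ?posrE ?mulr_gt0 ?ppos // lnM ?posrE // in l1.
  rewrite sub0r normrN /y /x -mulrBl normrM normfV (ger0_norm (ltW kp)) ler_pdivrMr //.
  have pk : p.+1%:R^-1 * k%:R <= e * k%:R by rewrite ler_wpM2r // ltW.
  have ek : `|ln c'| <= e * k%:R.
    rewrite mulrC -ler_pdivrMr //; apply: (le_trans hk1); rewrite ler_nat.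
    by rewrite (leq_trans (leq_maxr k0 k1)) // ltnW.
  move: hk l1 ek pk; move: (ln (Pr _)) (ln (grn _)) (ln c') (_ * k%:R) (e * k%:R) => lp lg lc z z'.
  rewrite !ler_norml => hk l1 /andP[e1 e2] pk; apply/andP; split; lra.
have aet := etime_avg l0 al.
have [h hH] : exists h : R, H = h%:E.
  have [om [[[g h1] h2] h3]] := asure_ex (asureI (asureI (asureI asure_good aprob) aH) aet).
  have cv := close om g h1; rewrite /= in h2 h3.
  have [cc cc0 hl] := ln_grn_lip.
  have xb : \forall n \near \oo, x n om <= `|ln (grn 1%g)| + cc * L0%:R * (mean id / l + 1) + 1.
    have /cvgrPdist_lt /(_ _ ltr01) [k0 _ hk0] := cv; have /cvgrPdist_lt /(_ _ ltr01) [k1 _ hk1] := h3.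
    exists (maxn k0 k1).+1 => // k /= kk.
    have kp : (1 : R) <= k%:R by rewrite ler1n (leq_ltn_trans _ kk).
    have kp0 : (0 : R) < k%:R by apply: lt_le_trans kp.
    have := hk0 k (leq_trans (leq_maxl k0 k1) (ltnW kk)); rewrite /= sub0r normrN ltr_norml => /andP[a1 a2].
    have := hk1 k (leq_trans (leq_maxr k0 k1) (ltnW kk)); rewrite /= ltr_norml => /andP[a3 a4].
    have yk : y k om <= `|ln (grn 1%g)| + cc * L0%:R * (mean id / l + 1).
      rewrite /y ler_pdivrMr //; have := hl 1%g (Rpos k om); rewrite dist1 ler_norml => /andP[b1 b2].
      have b3 : (len (Rpos k om))%:R <= L0%:R * ((mean id / l + 1) * k%:R).
        apply: (@le_trans _ _ (L0%:R * (etime k om)%:R)).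
          by rewrite -natrM ler_nat; apply: Rpos_len.
        rewrite ler_wpM2l // -ler_pdivrMr //; lra.
      have b4 := ler_norm (- ln (grn 1%g)); rewrite normrN in b4.
      have b5 : `|ln (grn 1%g)| <= `|ln (grn 1%g)| * k%:R by rewrite ler_peMr.
      have b6 := ler_wpM2l cc0 b3; rewrite mulrDl -mulrA -mulrA; lra.
    lra.
  have x0 : \forall n \near \oo, 0 <= x n om.
    apply: nearW => n; rewrite /x divr_ge0 // oppr_ge0 ln_le0 // Pr_le1 //; exact: Rpos_meas.
  have lE := cvg_lim (@ereal_hausdorff R) h2.
  have le1 : (H <= (`|ln (grn 1%g)| + cc * L0%:R * (mean id / l + 1) + 1)%:E)%E.
    rewrite -lE; apply: lime_le; first exact: cvgP h2.
    by apply: filterS xb => n; rewrite lee_fin.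
  have le2 : (0 <= H)%E.
    rewrite -lE; apply: lime_ge; first exact: cvgP h2.
    by apply: filterS x0 => n; rewrite lee_fin.
  case: (H) le1 le2 => [h _ _|//|//]; first by exists h.
exists h => //; rewrite hH in aH.
apply: asure_mono (asureI (asureI asure_good aprob) aH) => om [[g h1] /= h2].
have cv := close om g h1.
have cx : x n om @[n --> \oo] --> h by move/fine_cvgP: h2 => [_].
have h3 : x n om + (y n om - x n om) @[n --> \oo] --> h + 0 by apply: cvgD.
by move: h3; rewrite addr0; under eq_fun do rewrite addrC subrK.
Qed.

Lemma green_speed (h : R) :
  asure [set om | - ln (grn (Rpos n om)) / n%:R @[n --> \oo] --> h] ->
  asure [set om | - ln (grn (Xb n om)) / n%:R @[n --> \oo] --> h / (mean id / l)].
Proof.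
move=> ah; have aet := etime_avg l0 al; have aof := offset_small l0 al.
have k0 : 0 < mean id / l by apply: speed_pos.
have [cc cc0 hl] := ln_grn_lip.
apply: asure_mono (asureI (asureI (asureI asure_good aof) ah) aet) => om [[[g h1] h2] h3] /=.
apply: (@interpolation _ (fun k => etime k om) _ _ (fun k => - ln (grn (Rpos k om)))
  (fun k => cc * ((dist (Rpos k om) (Xb (etime k om) om))%:R + L0%:R * ((etime k.+1 om)%:R - (etime k om)%:R)))) => //.
  have h4 : cc * ((dist (Rpos k om) (Xb (etime k om) om))%:R / k%:R + L0%:R * ((etime k.+1 om)%:R / k%:R - (etime k om)%:R / k%:R))
      @[k --> \oo] --> cc * (0 + L0%:R * (mean id / l - mean id / l)).
    apply: cvgMr; apply: cvgD; first exact: h1.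
    by apply: cvgMr; apply: cvgB; [exact: (cvgn_shiftl h3)|exact: h3].
  rewrite subrr mulr0 addr0 mulr0 in h4; apply: cvg_trans h4; apply: near_eq_cvg; apply: nearW => k /=.
  by rewrite -mulrBl [L0%:R * (_ / _)]mulrA -mulrDl mulrA.
move=> k n kn nk; rewrite -opprD normrN.
have [[_ sj] _] := g.
apply: (le_trans (hl _ _)); rewrite ler_wpM2l // -natrB ?(leq_trans kn (ltnW nk)) //.
rewrite -natrM -natrD ler_nat (distC (G := G)).
apply: leq_trans (dist_triangle (G := G) (Xb (etime k om) om) _ _) _; rewrite leq_add2l.
have h5 : (dist (Xb (etime k om) om) (Xb (etime k om + (n - etime k om))%N om) <= L0 * (n - etime k om))%N.
  by apply: short_jumps_dist.
rewrite subnKC // in h5; apply: (leq_trans h5).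
by rewrite leq_mul2l leq_sub2r ?orbT // ltnW.
Qed.

End Speed.

(** The covering cones of lower level containing [R_n] are determined by [R_n], so it fixes the
    whole word [Y_0, ..., Y_n]; conversely the increments in [Y] rebuild [R_n] step by step. *)
Lemma Ycylinder_Pr n om : good om ->
  fine (P (Ycylinder s star edge L1 K Cov Xb n om)) = Pr [set om' | Rpos n om' = Rpos n om].
Proof.
move=> g; pose Rl om := mkseq (Rpos ^~ om) n.+1.
pose Yl (l : seq W) j : W + V * V * W := if j is i.+1 then
    inr (ctype (nth 1%g l i), ctype (nth 1%g l i.+1), ((nth 1%g l i)^-1 * nth 1%g l i.+1)%g)
  else inl (nth 1%g l 0).
have YE j om' : (j <= n)%N -> Yproc s star edge L1 K Cov Xb j om' = Yl (Rl om') j.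
  case: j => [|j] jn; rewrite /Yproc /Yl /Rl !nth_mkseq //.
  exact: leq_trans jn (leqnSn n).
have mY : measurable (Ycylinder s star edge L1 K Cov Xb n om).
  rewrite (_ : Ycylinder _ _ _ _ _ _ _ _ _ = [set om' | [set l | forall j, (j <= n)%N -> Yl l j = Yl (Rl om) j] (Rl om')]).
    by apply: dmeas_preimage; [exact: countable_seq|apply: dmeas_mkseq].
  apply/seteqP; split=> om' /= h j jn; first by rewrite -!YE // h.
  by rewrite !YE // h.
apply: (@eq_Pr_as _ _ _ _ _ _ good) => //; first exact: Rpos_meas.
move=> om' g'; split=> [h|/= h].
  have e j : (j <= n)%N -> Rpos j om' = Rpos j om.
    elim: j => [|j IH] jn; first by have [] := h 0%N (leq0n _).
    have [_ _ e] := h j.+1 jn; move: e; rewrite (IH (ltnW jn)); exact: mulgI.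
  exact: e.
have e j : (j <= n)%N -> Rpos j om' = Rpos j om.
  move=> jn; have [c1 _ _] := goodP j g; have [c2 _ _] := goodP j g'.
  apply: (covn_uniq (S := S) c2 c1 (z := Rpos n om)).
    by rewrite -h -(subnKC jn); apply: good_cone.
  by rewrite -(subnKC jn); apply: good_cone.
by case=> [|j] jn; rewrite /= ?e // ltnW.
Qed.

End Regenerated.

(** * Entropy of the retracted walk *)

Section EntropyRate.

Let pi n x : R := Pr [set om | Xb n om = x].
Let Bn n := bseq s (L0 * n).

Lemma asure_ball : asure [set om | forall n, Xb n om \in Bn n].
Proof.
have a1 : asure (short_jumps s L0 Xb).
  by apply: asure_meas; [apply: short_jumps_meas|apply: short_jumps_as].
have a2 : asure [set om | Xb 0%N om = 1%g].
  by apply: asure_meas => //; rewrite Pr_setC // (start_pos) subrr.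
apply: asure_mono (asureI a1 a2) => om [h1 h2] n /=.
have h : (dist (Xb 0 om) (Xb (0 + n) om) <= L0 * n)%N by apply: short_jumps_dist.
by rewrite add0n (h2 : Xb 0 om = 1%g) dist1 in h; rewrite /Bn mem_bseq.
Qed.

Lemma indic_ball n (f : W -> R) om : Xb n om \in Bn n ->
  \sum_(x <- Bn n) f x * \1_[set om | Xb n om = x] om = f (Xb n om).
Proof.
move=> h; rewrite (bigD1_seq (Xb n om)) ?bseq_uniq //= big1 ?addr0; last first.
  by move=> x /eqP ne; rewrite indicE memNset ?mulr0 // => /= e; apply: ne.
by rewrite indicE mem_set // mulr1.
Qed.

Lemma expectation_ball n (f : W -> R) : (forall x, 0 <= f x) ->
  (\int[P]_om (f (Xb n om))%:E = (\sum_(x <- Bn n) f x * pi n x)%:E)%E.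
Proof.
move=> f0; rewrite -integral_indics //.
have [E [mE PE EQ]] := asure_ball.
apply: ae_eq_integral => //.
- apply/measurable_EFinP => _ Y mY; rewrite setTI.
  exact: (dmeas_preimage (countable_W (G := G)) (fun x => Y (f x)) (Xb_meas (C := C) n)).
- apply/measurable_EFinP; elim: (Bn n) => [|a l IH].
    by under eq_fun do rewrite big_nil; exact: measurable_cst.
  under eq_fun do rewrite big_cons; apply: measurable_funD => //.
  by apply: measurable_funM => //; exact: measurable_indic.
- exists (~` E); split; [exact: measurableC| |].
    by apply: etrans (PrE P (measurableC mE)) _; rewrite PE.
  by move=> om h /EQ hB; apply: h => _; rewrite indic_ball //; apply: hB.
Qed.

Lemma pi_sum n : \sum_(x <- Bn n) pi n x = 1.
Proof.
have := @expectation_ball n (fun=> 1) (fun=> ler01).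
have -> : (\int[P]_om (1 : R)%:E = 1)%E.
  by rewrite integral_cst // mul1e; exact: probability_setT.
by move=> /(congr1 fine) /= h; rewrite [RHS]h; apply: eq_bigr => x _; rewrite mul1r.
Qed.

Lemma pi_pn n x : pi n x = pn n x 1%g. Proof. by rewrite (pn_Pr). Qed.

Lemma pi_le_grn n x : pi n x <= grn x.
Proof.
rewrite pi_pn; apply: le_trans (grn_ge n.+1 x); rewrite big_ord_recr /= lerDr.
by apply: sumr_ge0 => i _; apply: (pn_ge0 (D := D)).
Qed.

(** Each time up to [t * n] contributes mass at most [1]. After it the decay [rho] beats the number
    of points of the ball and the ratio of masses, which together contribute at most [a ^+ n], so
    that the rest is a geometric series. *)
Lemma grn_ball : exists2 c : R, 0 < c & forall n, \sum_(x <- Bn n) grn x <= c * n.+1%:R.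
Proof.
have [rho /andP[r0 r1] hr] := pn_decay (D := D) (cs_rec (covering_system := S)) (cs_inf (covering_system := S)).
pose a : R := (N.+1%:R * (qmax q)%:R) ^+ L0.
have qm1 : 1 <= (qmax q)%:R :> R by rewrite ler1n.
have a1 : 1 <= a by rewrite exprn_ege1 // -natrM ler1n muln_gt0.
have m1 := wd_m0 (walk_data := D) 1%g.
have ple k n x : x \in Bn n -> pn k x 1%g <= rho ^+ k * ((qmax q)%:R ^+ L0) ^+ n.
  rewrite /Bn mem_bseq => xl.
  have p0 : 0 <= pn k x 1%g by apply: (pn_ge0 (D := D)).
  have b0 : 0 <= rho ^+ k * ((qmax q)%:R ^+ L0) ^+ n by rewrite mulr_ge0 ?exprn_ge0 // ltW.
  rewrite -ler_sqr ?nnegrE // -(ler_pM2l m1); apply: (le_trans (hr _ _ _)).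
  have e2 : (rho ^+ k) ^+ 2 = rho ^+ (2 * k) by rewrite -exprM mulnC.
  rewrite [in leRHS]exprMn e2 mulrCA ler_wpM2l ?exprn_ge0 ?(ltW r0) //.
  have h : m x <= (qmax q)%:R ^+ dist 1%g x * m 1%g by apply: (m_dist_le (D := D)).
  rewrite dist1 in h; apply: (le_trans h).
  rewrite mulrC ler_wpM2l ?(ltW m1) // -!exprM; apply: ler_weXn2l => //.
  by apply: (leq_trans xl); rewrite leq_pmulr.
have [t ht] : exists t, rho ^+ t <= a^-1.
  have [t ht] := expr_small (introT andP (conj r0 r1)) (ltac:(by rewrite invr_gt0 (lt_le_trans ltr01)) : 0 < a^-1).
  by exists t; exact: ltW.
have d0 : 0 < 1 - rho by lra.
exists (t%:R + 1 / (1 - rho)) => [|n]; first by rewrite ltr_wpDl // divr_gt0.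
have tot k : \sum_(x <- Bn n) pn k x 1%g <= 1.
  have := @Pr_indic_le _ _ _ P _ _ (Bn n) [:: tt] (fun=> 1) (fun=> 1) (fun x => [set om | Xb k om = x]) (fun=> setT).
  rewrite big_seq1 mul1r; rewrite Pr_setT.
  move=> h; rewrite (eq_bigr (fun x => 1 * pi k x)); last by move=> x _; rewrite mul1r pi_pn.
  apply: h => // om; rewrite big_seq1 mul1r indicT.
  have [hin|nin] := boolP (Xb k om \in Bn n).
    rewrite (bigD1_seq (Xb k om)) ?bseq_uniq //= big1 ?addr0; last first.
      by move=> x /eqP ne; rewrite indicE memNset ?mulr0 // => /= e; apply: ne.
    by rewrite indicE mem_set // mulr1.
  rewrite big_seq big1 // => x xB; rewrite indicE memNset ?mulr0 //= => e.
  by move: nin; rewrite e xB.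
have late k : \sum_(x <- Bn n) pn (t * n + k) x 1%g <= rho ^+ k.
  apply: (@le_trans _ _ (\sum_(x <- Bn n) rho ^+ (t * n + k) * ((qmax q)%:R ^+ L0) ^+ n)).
    by rewrite big_seq [leRHS]big_seq; apply: ler_sum => x xB; apply: ple.
  rewrite big_const_seq count_predT iter_addr_0 -[leLHS]mulr_natl.
  have sz : (size (Bn n))%:R <= (N.+1%:R ^+ L0) ^+ n :> R.
    by rewrite -exprM -natrX ler_nat; apply: size_bseq.
  have -> : (size (Bn n))%:R * (rho ^+ (t * n + k) * (qmax q)%:R ^+ L0 ^+ n) =
      rho ^+ k * ((size (Bn n))%:R * (rho ^+ t) ^+ n * (qmax q)%:R ^+ L0 ^+ n).
    by rewrite exprD exprM; ring.
  have a0 : 0 < a by apply: lt_le_trans a1.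
  apply: ler_piMr; first by rewrite exprn_ge0 // ltW.
  apply: (@le_trans _ _ ((N.+1%:R ^+ L0) ^+ n * (a^-1) ^+ n * (qmax q)%:R ^+ L0 ^+ n)).
    apply: ler_wpM2r; first by rewrite !exprn_ge0.
    apply: ler_pM => //; first by rewrite !exprn_ge0 // ltW.
    by apply: lerXn2r; rewrite ?nnegrE ?exprn_ge0 ?invr_ge0 // ltW.
  by rewrite mulrAC -!exprMn -/a divff ?expr1n // gt_eqF.
apply: (@cvgn_le _ (fun M => \sum_(x <- Bn n) \sum_(k < M) pn k x 1%g)).
  elim: (Bn n) => [|x l IH].
    by rewrite big_nil; under eq_fun do rewrite big_nil; exact: cvg_cst.
  rewrite big_cons; under eq_fun do rewrite big_cons.
  by apply: cvgD => //; apply: grn_cvg.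
exists (t * n)%N => // M /= /subnKC <-; rewrite exchange_big big_split_ord /=.
apply: (@le_trans _ _ ((t * n)%:R + \sum_(k < M - t * n) rho ^+ k)).
  apply: lerD; last by apply: ler_sum => k _; apply: late.
  rewrite -[(t * n)%:R]mulr1 mulr_natl -[X in _ *+ X]card_ord -sumr_const.
  by apply: ler_sum => k _; apply: tot.
have geo j : \sum_(k < j) rho ^+ k <= 1 / (1 - rho).
  rewrite ler_pdivlMr // mulrC; have := subrX1 rho j.
  have p0 : 0 <= rho ^+ j by rewrite exprn_ge0 // ltW.
  move=> h; have {}h : (1 - rho) * (\sum_(i < j) rho ^+ i) = 1 - rho ^+ j by rewrite -opprB mulNr -h opprB.
  by rewrite h; lra.
rewrite mulrDl natrM; apply: lerD; first by rewrite ler_wpM2l // ler_nat.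
by apply: (le_trans (geo _)); rewrite ler_peMr ?ler1n // divr_ge0 // ltW.
Qed.

Let hn n : R := \sum_(x <- Bn n) - ln (pi n x) * pi n x.
Let gn n : R := \sum_(x <- Bn n) - ln (grn x) * pi n x.

Lemma entropy_ge_green n : gn n <= hn n.
Proof.
apply: ler_sum => x _; have [p0|p0] := eqVneq (pi n x) 0; first by rewrite p0 !mulr0.
have pp : 0 < pi n x by rewrite lt_def p0 Pr_ge0.
by rewrite ler_wpM2r ?Pr_ge0 // lerN2 ler_ln ?posrE // pi_le_grn.
Qed.

(* Gibbs' inequality against the Green function restricted to the ball. *)
Lemma entropy_le_green n : hn n <= gn n + ln (\sum_(x <- Bn n) grn x).
Proof.
set Z := \sum_(x <- Bn n) grn x.
have Z0 : 0 < Z.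
  rewrite /Z (bigD1_seq 1%g) ?bseq_uniq //=; last by rewrite /Bn mem_bseq len1.
  by rewrite ltr_wpDr // sumr_ge0 // => x _; exact: ltW.
have -> : gn n + ln Z = \sum_(x <- Bn n) (- ln (grn x) + ln Z) * pi n x.
  under eq_bigr do rewrite mulrDl.
  by rewrite big_split /= -big_distrr /= pi_sum mulr1.
rewrite -subr_ge0 -sumrB.
apply: (@le_trans _ _ (\sum_(x <- Bn n) (pi n x - grn x / Z))).
  by rewrite sumrB pi_sum -big_distrl /= divff ?subrr // gt_eqF.
apply: ler_sum => x _; have [p0|p0] := eqVneq (pi n x) 0.
  by rewrite p0 !mulr0 subrr sub0r oppr_le0 divr_ge0 // ltW.
have pp : 0 < pi n x by rewrite lt_def p0 Pr_ge0.
pose r := grn x / Z / pi n x.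
have r0 : 0 < r by rewrite !divr_gt0.
have := le_ln1Dx (x := r - 1).
rewrite [1 + _]addrC subrK => /(_ (ltac:(lra))).
rewrite /r ln_div ?posrE ?divr_gt0 // ln_div ?posrE // => h.
have := ler_wpM2r (ltW pp) h; rewrite [leRHS]mulrBl divfK // mul1r; lra.
Qed.

(** On the ball, which contains [Xb n] almost surely, [- ln grn / n] is bounded by [B] thanks to the
    Lipschitz bound, so the almost sure limit passes to the mean; adding [B] makes the integrand
    nonnegative. *)
Lemma green_rate (h : R) : asure [set om | - ln (grn (Xb n om)) / n%:R @[n --> \oo] --> h] ->
  gn n / n%:R @[n --> \oo] --> h.
Proof.
move=> ah; have [cc cc0 hl] := ln_grn_lip.
pose B := `|ln (grn 1%g)| + cc * L0%:R.
have B0 : 0 <= B by rewrite addr_ge0 // mulr_ge0.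
have bnd n x : (0 < n)%N -> (len x <= L0 * n)%N -> `|- ln (grn x) / n%:R| <= B.
  move=> n0 xl; have np : (0 : R) < n%:R by rewrite ltr0n.
  rewrite normrM normfV normrN (ger0_norm (ltW np)) ler_pdivrMr //.
  have h1 := hl 1%g x; rewrite dist1 in h1.
  have h2 : cc * (len x)%:R <= cc * L0%:R * n%:R by rewrite -mulrA ler_wpM2l // -natrM ler_nat.
  have h3 : `|ln (grn 1%g)| <= `|ln (grn 1%g)| * n%:R by rewrite ler_peMr // ler1n.
  have h4 := ler_normB (ln (grn 1%g)) (ln (grn 1%g) - ln (grn x)); rewrite subKr in h4.
  by rewrite mulrDl; lra.
pose w n x : R := if (0 < n)%N && (len x <= L0 * n)%N then - ln (grn x) / n%:R + B else 0.
have w0 n x : 0 <= w n x.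
  rewrite /w; case: ifP => // /andP[n0 xl]; have := bnd n x n0 xl; rewrite ler_norml => /andP[h1 _]; lra.
have wB n x : w n x <= 2 * B.
  rewrite /w; case: ifP => [/andP[n0 xl]|_]; last by rewrite mulr_ge0.
  by have := bnd n x n0 xl; rewrite ler_norml => /andP[_ h1]; lra.
have := @bounded_cvg _ _ _ P W Bn w (fun n x => [set om | Xb n om = x]) setT (2 * B) (h + B) w0 (fun n x => meas_at n x) measurableT.
have P1 : Pr setT = 1 by exact: Pr_setT.
rewrite P1 mulr1 => hh; have {}hh : \sum_(x <- Bn n) w n x * Pr (setT `&` [set om | Xb n om = x]) @[n --> \oo] --> h + B.
  apply: hh.
  - move=> n om; have [hin|nin] := boolP (Xb n om \in Bn n); first by rewrite indic_ball.
    rewrite big_seq big1 ?mulr_ge0 // => x xB; rewrite indicE memNset ?mulr0 //= => e.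
    by move: nin; rewrite e xB.
  - apply: asure_mono (asureI asure_ball ah) => om [h1 h2] /=.
    have h3 : - ln (grn (Xb n om)) / n%:R + B @[n --> \oo] --> h + B.
      by apply: cvgD; [exact: h2|exact: cvg_cst].
    apply: cvg_trans h3; apply: near_eq_cvg; exists 1%N => // n /= n0.
    rewrite indic_ball // /w n0 /=; have := h1 n; rewrite /Bn mem_bseq => -> //.
have h3 : \sum_(x <- Bn n) w n x * Pr (setT `&` [set om | Xb n om = x]) - B @[n --> \oo] --> h + B - B.
  by apply: cvgB => //; exact: cvg_cst.
rewrite addrK in h3; apply: cvg_trans h3; apply: near_eq_cvg; exists 1%N => // n /= n0.
rewrite big_seq (eq_bigr (fun x => - ln (grn x) * pi n x / n%:R + B * pi n x)); last first.
  move=> x; rewrite /Bn mem_bseq => xl; rewrite /w n0 xl /= setTI mulrDl; congr (_ + _).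
  by rewrite mulrAC.
by rewrite -big_seq big_split /= -big_distrl /= -big_distrr /= pi_sum mulr1 addrK.
Qed.

Lemma ln_linear_small (c : R) : 0 < c -> ln (c * n.+1%:R) / n%:R @[n --> \oo] --> (0 : R).
Proof.
move=> c0; apply/cvgrPdist_le => e'; move: (e' : R) => e {e'} e0.
pose ep := e / (4 * c); have ep0 : 0 < ep by rewrite divr_gt0 // mulr_gt0.
have [k1 hk1] := nat_above ((`|ln ep| + 1) / (e / 2)).
have [k2 hk2] := nat_above (`|ln c| / e).
exists (maxn k1 k2).+1 => // n /= nn.
have np : (0 : R) < n%:R by rewrite ltr0n (leq_ltn_trans _ nn).
have n1 : (1 : R) <= n%:R by rewrite ler1n (leq_ltn_trans _ nn).
have y0 : 0 < c * n.+1%:R by rewrite mulr_gt0.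
have up : ln (c * n.+1%:R) <= ep * (c * n.+1%:R) - ln ep.
  have pp : 0 < ep * (c * n.+1%:R) by rewrite mulr_gt0.
  have := le_ln1Dx (x := ep * (c * n.+1%:R) - 1); rewrite [1 + _]addrC subrK => /(_ (ltac:(lra))).
  by rewrite lnM ?posrE // => h; lra.
have epE : ep * (c * n.+1%:R) = e / 4 * n.+1%:R by rewrite /ep; field; rewrite gt_eqF.
have lo : ln c <= ln (c * n.+1%:R) by rewrite ler_ln ?posrE // ler_peMr ?ler1n // ltW.
have b1 : `|ln ep| + 1 <= e / 2 * n%:R.
  rewrite mulrC -ler_pdivrMr ?divr_gt0 //; apply: (le_trans hk1); rewrite ler_nat.
  by rewrite (leq_trans (leq_maxl k1 k2)) // ltnW.
have b2 : `|ln c| <= e * n%:R.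
  rewrite mulrC -ler_pdivrMr //; apply: (le_trans hk2); rewrite ler_nat.
  by rewrite (leq_trans (leq_maxr k1 k2)) // ltnW.
rewrite sub0r normrN normrM normfV (ger0_norm (ltW np)) ler_pdivrMr //.
rewrite epE in up; move: b1 b2 up lo; move: (ln ep) (ln c) (ln (c * _)) => l1 l2 l3.
have nn1 : n.+1%:R = n%:R + 1 :> R by rewrite natr1.
rewrite nn1.
have en : e <= e * n%:R by rewrite ler_peMr // ltW.
rewrite [e / 4 * (_ + _)]mulrDr mulr1 => b1; have a1 := ler_norm l1; have := ler_norm (- l1); rewrite normrN => a2.
have := ler_norm (- l2); rewrite normrN => a3 b2 up lo.
have h4 : e / 4 * n%:R = e * n%:R / 4 by field.
have h2 : e / 2 * n%:R = e * n%:R / 2 by field.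
rewrite h4 in up; rewrite h2 in b1.
rewrite ler_norml; apply/andP; split; lra.
Qed.

Theorem entropy_rate (h : R) : asure [set om | - ln (grn (Xb n om)) / n%:R @[n --> \oo] --> h] ->
  (- (n%:R^-1)%:E * 'E_P[fun om => ln (Pr [set om' | Xb n om' = Xb n om])])%E @[n --> \oo] --> h%:E.
Proof.
move=> /green_rate hg; have [c c0 hc] := grn_ball.
have hh : hn n / n%:R @[n --> \oo] --> h.
  apply: (@squeeze_cvgr _ _ _ _ (fun n => gn n / n%:R) (fun n => gn n / n%:R + ln (c * n.+1%:R) / n%:R)) => //.
    exists 1%N => // n /= n0; have np : (0 : R) < n%:R by rewrite ltr0n.
    rewrite -mulrDl !ler_pM2r ?invr_gt0 // entropy_ge_green /=.
    apply: (le_trans (entropy_le_green n)); rewrite lerD2l ler_ln ?posrE ?mulr_gt0 //.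
    rewrite (bigD1_seq 1%g) ?bseq_uniq //=; last by rewrite /Bn mem_bseq len1.
    by rewrite ltr_wpDr // sumr_ge0 // => x _; exact: ltW.
  by rewrite -[X in _ --> X]addr0; apply: cvgD => //; exact: ln_linear_small.
rewrite (_ : (fun n => _) = EFin \o (fun n => hn n / n%:R)).
  by apply: cvg_EFin; [exact: nearW|exact: hh].
apply/funext => n /=; rewrite unlock.
have -> : (\int[P]_om (ln (Pr [set om' | Xb n om' = Xb n om]))%:E = - (hn n)%:E)%E.
  have -> : (hn n)%:E = (\int[P]_om (- ln (pi n (Xb n om)))%:E)%E.
    rewrite (@expectation_ball n (fun x => - ln (pi n x))) // => x.
    by rewrite oppr_ge0 ln_le0 // Pr_le1.
  rewrite -integral_ge0N /=; last by move=> om _; rewrite lee_fin oppr_ge0 ln_le0 // Pr_le1.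
  by apply: eq_integral => om _; rewrite opprK.
by rewrite -!EFinN -EFinM mulNr mulrN opprK mulrC.
Qed.

End EntropyRate.

Lemma entropy_identity nu H :
  is_stationary_probability s star edge L1 K Cov P Xb nu ->
  is_entropy_Y s star edge L1 K Cov P Xb H ->
  exists h : R, [/\
    (- (n%:R^-1)%:E * 'E_P[fun om => ln (Pr [set om' | Xb n om' = Xb n om])])%E @[n --> \oo] --> h%:E,
    h%:E = (H / Enu_increment s star edge L1 K Cov P Xb nu)%E &
    asure [set om | - ln (grn (Xb n om)) / n%:R @[n --> \oo] --> h]].
Proof.
move=> nuS /asureP HY.
have [t0 [u0 [c [T Rg]]]] : exists t0 u0 c T, regeneration t0 u0 c T.
  exact: regeneration_exists.
have [l l0 al] := tick_avg (Rg := Rg).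
have asg := asure_good (Rg := Rg).
have HR : asure [set om | (- ln (Pr [set om' | Rpos n om' =
    Rpos n om]) / n%:R)%:E @[n --> \oo] --> H].
  apply: asure_mono (asureI HY asg) => om [/= h g].
  apply: cvg_trans h; apply: near_eq_cvg; near=> n.
  by rewrite (Ycylinder_Pr (Rg := Rg)).
have [h HE hR] := green_entropy (Rg := Rg) l0 al HR.
have hX := green_speed (Rg := Rg) l0 al hR.
have k0 := speed_pos (Rg := Rg) l0 al.
eexists; split; [exact: entropy_rate hX| |exact: hX].
rewrite HE (Enu_increment_mean (Rg := Rg) nuS l0 al).
by rewrite inver gt_eqF.
Unshelve. all: by end_near. Qed.

Lemma green_grn (pb : W -> W -> \bar R) w :
  (forall n u v, nstep pb n u v = (pn n v u)%:E) -> green pb 1%g w = (grn w)%:E.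
Proof.
move=> h; rewrite /green; apply: cvg_lim => //.
have e : (fun n => \sum_(0 <= i < n) nstep pb i 1%g w)%E = (fun n => (\sum_(i < n) pn i w 1%g)%:E).
  by apply/funext => n; rewrite big_mkord -sumEFin; apply: eq_bigr => i _; rewrite h.
rewrite e; apply: cvg_EFin; first exact: nearW.
have h' : \sum_(i < n) pn i w 1%g @[n --> \oo] --> grn w by apply: grn_cvg.
exact: h'.
Qed.

End Process.

(** * Retraction of the walk from the building *)

Section Building.
Context {R : realType} {N : nat} {W : groupType} (s : 'I_N -> W).
Context {G : involutive_generators s}.
Variables (Delta : choiceType) (delta : Delta -> Delta -> W) (q : 'I_N -> nat).
Hypotheses (bld : is_building s delta) (reg : is_regular s delta q) (thk : thick q).
Local Notation len := (len s).
Local Notation letter_op := (letter_op (R := R) s q).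
Local Notation word_op := (word_op (R := R) s q).

Lemma gen_neq1 i : s i <> 1%g.
Proof. by move=> h; have := len_gen (G := G) i; rewrite h len1. Qed.

Lemma deltaxx x : delta x x = 1%g. Proof. exact/(building_B1 bld). Qed.

Lemma delta_gen_sym x y i : delta x y = s i -> delta y x = s i.
Proof.
move=> h; have [[e|e] _] := building_B2 bld y h.
  by move: e; rewrite deltaxx => /esym/(building_B1 bld) e; rewrite -e deltaxx in h; case: (gen_neq1 (esym h)).
have /esym := e; rewrite deltaxx => e'.
by rewrite -[delta y x](mulgK (s i)) e' mul1g (gen_invV (G := G)).
Qed.

Definition nbrs i x : seq Delta := enum_fset (fset_set [set y | delta x y = s i]).

Lemma mem_nbrs i x y : (y \in nbrs i x) = `[< delta x y = s i >].
Proof.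
have fin : finite_set [set y | delta x y = s i] by exists (q i); apply: reg.
by rewrite /nbrs -[LHS]/(y \in fset_set _) in_fset_set.
Qed.

Lemma nbrs_uniq i x : uniq (nbrs i x). Proof. exact: fset_uniq. Qed.

Lemma size_nbrs i x : size (nbrs i x) = q i.
Proof.
have fin : finite_set [set y | delta x y = s i] by exists (q i); apply: reg.
have h := reg x i.
rewrite -[LHS]/(#|` fset_set [set y | delta x y = s i]|)%fset.
exact: card_fset_set.
Qed.

(** The chamber [z] given by (B3) is the one closer to [o]. Any other chamber of the panel of [x] is
    adjacent to [z] as well, and stepping to it from [z] is an ascent, so (B2) puts it at the same
    distance as [x]. *)
Lemma projection o x i : ~~ ascent s (delta o x) i -> exists z,
  [/\ z \in nbrs i x, delta o z = (delta o x * s i)%g &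
   forall y, y \in nbrs i x -> y != z -> delta o y = delta o x].
Proof.
move=> da; have [z [h1 h2]] := building_B3 bld o x i; exists z; split=> //.
  by rewrite mem_nbrs; apply/asboolP.
move=> y; rewrite mem_nbrs => /asboolP hy /eqP ne.
have [[e|e] _] := building_B2 bld o hy; first exact: e.
have zx := delta_gen_sym h1.
have [[e'|e'] _] := building_B2 bld z hy.
  rewrite zx in e'; have [_ h3] := building_B2 bld o e'.
  have la : len (delta o z * s i)%g = (len (delta o z)).+1.
    by rewrite h2 mulgss // -(descentE (G := G) da).
  by rewrite h3 // h2 mulgss.
rewrite zx (gen_inv (involutive_generators := G)) in e'.
by case: ne; apply/esym/(building_B1 bld).
Qed.

(** The origin of [letter_op]: either all [q i] neighbours lie further from [o], or one lies closer
    and the other [q i - 1] at the same distance. *)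
Lemma sum_nbrs o i (F : W -> R) x :
  \sum_(y <- nbrs i x) F (delta o y) = (q i)%:R * letter_op i F (delta o x).
Proof.
have q0 : (q i)%:R != 0 :> R by rewrite pnatr_eq0 -lt0n (leq_trans _ (thk i)).
rewrite letter_opE; case: ifPn => [a|da].
  rewrite big_seq (eq_bigr (fun=> F (delta o x * s i)%g)) => [|y]; last first.
    rewrite mem_nbrs => /asboolP hy; have [_ h] := building_B2 bld o hy.
    by rewrite h //; apply: ascentE.
  by rewrite -big_seq big_const_seq count_predT iter_addr_0 size_nbrs mulr_natl.
have [z [h1 h2 h3]] := projection da.
rewrite (bigD1_seq z) ?nbrs_uniq //= h2 big_seq_cond.
rewrite (eq_bigr (fun=> F (delta o x))) => [|y /andP[hy ne]]; last by rewrite h3.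
rewrite -big_seq_cond big_const_seq iter_addr_0.
have -> : count (fun y => y != z) (nbrs i x) = (q i).-1.
  have := count_predC (pred1 z) (nbrs i x); rewrite size_nbrs count_uniq_mem ?nbrs_uniq // h1.
  by rewrite add1n => <-.
rewrite mulrDr mulrA divff // mul1r mulrA mulrBr divff // mulr1 -[X in _ + X = _]mulr_natl.
by congr (_ + _ * _); rewrite -subn1 natrB //; exact: leq_trans (thk i).
Qed.

(* End points, with multiplicity, of the galleries of type [l] starting at [x]. *)
Definition galleries (l : seq 'I_N) x : seq Delta :=
  foldl (fun Y i => flatten [seq nbrs i z | z <- Y]) [:: x] l.

Lemma galleries_rcons l i x : galleries (rcons l i) x = flatten [seq nbrs i z | z <- galleries l x].
Proof. by rewrite /galleries -cats1 foldl_cat. Qed.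

Definition qprod (l : seq 'I_N) : nat := \prod_(i <- l) q i.

Lemma word_op_rcons l i (F : W -> R) u : word_op (rcons l i) F u = word_op l (letter_op i F) u.
Proof.
elim: l u => [|j l IH] u //=; rewrite letter_opE !IH //.
Qed.

Lemma sum_galleries o l (F : W -> R) x :
  \sum_(y <- galleries l x) F (delta o y) = (qprod l)%:R * word_op l F (delta o x).
Proof.
elim/last_ind: l F => [|l i IH] F.
  by rewrite big_seq1 /qprod big_nil mul1r.
rewrite galleries_rcons big_flatten /= big_map.
rewrite (eq_bigr (fun z => (q i)%:R * letter_op i F (delta o z))); last by move=> z _; apply: sum_nbrs.
rewrite -big_distrr /= IH word_op_rcons mulrA; congr (_ * _).
by rewrite /qprod -cats1 big_cat big_seq1 natrM mulrC.
Qed.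

Lemma size_galleries l x : size (galleries l x) = qprod l.
Proof.
elim/last_ind: l => [|l i IH]; first by rewrite /qprod big_nil.
rewrite galleries_rcons size_flatten /shape -map_comp.
have -> : map (size \o nbrs i) (galleries l x) = nseq (size (galleries l x)) (q i).
  by elim: (galleries l x) => //= z Y ->; rewrite size_nbrs.
by rewrite sumn_nseq IH /qprod -cats1 big_cat big_seq1 mulnC.
Qed.

Lemma qprod_gt0 l : (0 < qprod l)%N.
Proof. by rewrite /qprod big_seq prodn_gt0 // => i; exact: leq_trans (thk i). Qed.

Lemma uniq_flatten_map (A B : eqType) (f : A -> seq B) (r : seq A) : uniq r ->
  (forall a, a \in r -> uniq (f a)) ->
  (forall a a' b, a \in r -> a' \in r -> b \in f a -> b \in f a' -> a = a') ->
  uniq (flatten [seq f a | a <- r]).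
Proof.
elim: r => [|a r IH] //= /andP[ar ur] hu hd; rewrite cat_uniq hu ?mem_head // IH //=; last 2 first.
- by move=> x xr; apply: hu; rewrite inE xr orbT.
- by move=> x x' b xr xr'; apply: hd; rewrite inE ?xr ?xr' orbT.
rewrite andbT; apply/hasPn => b /flatten_mapP[a' a'r ba']; apply/negP => ba.
have e : a = a' by apply: (hd a a' b) => //; rewrite inE ?eqxx // a'r orbT.
by rewrite e a'r in ar.
Qed.

(** Along a reduced word distances multiply by (B2). Two galleries of this type with the same end
    pass through the same previous chamber: otherwise their previous chambers would be adjacent, and
    (B2) would put them at different distances from [x]. So galleries correspond to chambers. *)
Lemma mem_galleries l x : reduced s l ->
  uniq (galleries l x) /\ forall y, (y \in galleries l x) = `[< delta x y = wprod s l >].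
Proof.
elim/last_ind: l => [|l i IH] rl.
  split=> // y; rewrite inE; apply/eqP/asboolP => [->|/(building_B1 bld) -> //]; exact: deltaxx.
have [rl' _] : reduced s l /\ reduced s [:: i] by apply: (reduced_cat (G := G)); rewrite cats1.
have [u h] := IH rl'.
have asc : len (wprod s l * s i)%g = (len (wprod s l)).+1.
  by rewrite -wprod_rcons (rl : len _ = _) size_rcons rl'.
rewrite galleries_rcons; split.
  apply: uniq_flatten_map => // [z _|z z' y]; first exact: nbrs_uniq.
  rewrite !h !mem_nbrs => /asboolP hz /asboolP hz' /asboolP zy /asboolP zy'.
  have yz' := delta_gen_sym zy'; have [[e|e] _] := building_B2 bld z yz'.
    have [_ h3] := building_B2 bld x (etrans e zy).
    move: (h3 (etrans (congr1 (fun u => len (u * s i)%g) hz) (etrans asc (congr1 (fun u => (len u).+1) (esym hz))))).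
    by rewrite hz hz' => e'; move: asc; rewrite -e' => /eqP; rewrite -[X in X == _]addn0 -addn1 eqn_add2l.
  by apply/(building_B1 bld); rewrite e zy (gen_inv (involutive_generators := G)).
move=> y; apply/flatten_mapP/asboolP => [[z]|hy].
  rewrite h mem_nbrs => /asboolP hz /asboolP zy; have [_ h3] := building_B2 bld x zy.
  by rewrite wprod_rcons -hz h3 // hz.
have [z [h1 h2]] := building_B3 bld x y i; exists z.
  by rewrite h; apply/asboolP; rewrite h2 hy wprod_rcons mulgss.
by rewrite mem_nbrs; apply/asboolP; apply: delta_gen_sym.
Qed.

Definition rword (w : W) : seq 'I_N := sval (cid2 (reducedP (G := G) w)).
Lemma rword_reduced w : reduced s (rword w). Proof. by rewrite /rword; case: cid2. Qed.
Lemma rwordK w : wprod s (rword w) = w. Proof. by rewrite /rword; case: cid2. Qed.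
Lemma size_rword w : size (rword w) = len w.
Proof. by rewrite -(rword_reduced w) rwordK. Qed.

Definition sphere (w : W) x : seq Delta := galleries (rword w) x.

Lemma sphere_uniq w x : uniq (sphere w x).
Proof. by have [] := mem_galleries x (rword_reduced w). Qed.

Lemma mem_sphere w x y : (y \in sphere w x) = `[< delta x y = w >].
Proof. by have [_ ->] := mem_galleries x (rword_reduced w); rewrite rwordK. Qed.

Lemma chamber_at x w : exists y, delta x y = w.
Proof.
have : (0 < size (sphere w x))%N by rewrite size_galleries qprod_gt0.
case e: (sphere w x) => [|y l] // _; exists y; apply/asboolP; rewrite -mem_sphere e inE eqxx //.
Qed.

Definition sphere_size (w : W) : R := (qprod (rword w))%:R.

(** [sphere_size] is computed from a chosen reduced word, but it counts the chambers at distance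
    [w], and these can be counted along any other reduced word of the same element. *)
Lemma sphere_size_gen (o : Delta) w i : ascent s w i -> sphere_size (w * s i)%g = (q i)%:R * sphere_size w.
Proof.
move=> a; have rl : reduced s (rcons (rword w) i).
  by rewrite /reduced wprod_rcons rwordK size_rcons size_rword ascentE.
have [u h] := mem_galleries o rl.
have pe : perm_eq (sphere (w * s i)%g o) (galleries (rcons (rword w) i) o).
  by apply: uniq_perm => // [|y]; [exact: sphere_uniq|rewrite mem_sphere h wprod_rcons rwordK].
have := perm_size pe; rewrite !size_galleries => e.
by rewrite /sphere_size e /qprod -cats1 big_cat big_seq1 natrM mulrC.
Qed.

Lemma countable_chambers (o : Delta) : countable [set: Delta].
Proof.
have cs : countable [set: seq 'I_N].
  by apply: countable_seq; apply: finite_set_countable; exact: finite_finset.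
have -> : [set: Delta] = \bigcup_(l in [set: seq 'I_N]) [set` galleries l o].
  apply/seteqP; split=> // y _; exists (rword (delta o y)) => //=.
  by rewrite -[_ \in _]/(y \in sphere (delta o y) o) mem_sphere; apply/asboolP.
apply: bigcup_countable => // l _; apply: finite_set_countable; exact: finite_seq.
Qed.

End Building.

(** * Identification of the retracted walk *)

Section RetractedWalk.
Context {R : realType} {N : nat} {W : groupType} (s : 'I_N -> W).
Context {G : involutive_generators s}.
Hypothesis s_inj : injective s.
Variables (Delta : choiceType) (delta : Delta -> Delta -> W) (q : 'I_N -> nat).
Hypotheses (bld : is_building s delta) (reg : is_regular s delta q) (thk : thick q).
Variables (o : Delta) (p : Delta -> Delta -> R) (L0 : nat).
Hypotheses (p_stoch : is_stochastic p) (p_isotropic : isotropic delta p).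
Hypothesis p_range : range_bound s delta p L0.
Hypothesis p_nn : forall x y i, delta x y = s i -> 0 < p x y.
Hypothesis N0 : (0 < N)%N.
Local Notation len := (len s).
Local Notation sphere := (sphere (G := G) delta).

Let p_ge0 x y : 0 <= p x y. Proof. by have [] := p_stoch. Qed.
Let cD : countable [set: Delta]. Proof. exact: (countable_chambers (G := G) bld reg o). Qed.

Definition rep (w : W) : Delta := xget o [set y | delta o y = w].
Lemma repP w : delta o (rep w) = w.
Proof.
rewrite /rep; case: xgetP => [y _ //|no]; have [y hy] := chamber_at (G := G) bld reg thk o w.
by case: (no y).
Qed.

Definition weight_at (w : W) : R := p o (rep w).
Lemma weight_atE x y : p x y = weight_at (delta x y).
Proof. by apply: p_isotropic; rewrite repP. Qed.

Lemma weight_far w : (L0 < len w)%N -> weight_at w = 0.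
Proof.
move=> h; apply/eqP; rewrite eq_le p_ge0 andbT leNgt; apply/negP => /p_range.
by rewrite repP leqNgt h.
Qed.

(** A uniform gallery of reduced type [rword w] ends uniformly on the sphere of [w], each chamber of
    which has probability [weight_at w]; hence the factor [sphere_size]. *)
Definition words_of : seq (R * seq 'I_N) :=
  [seq (weight_at w * sphere_size (G := G) q w, rword (G := G) w) | w <- bseq s L0].

Lemma ball_uniq x : uniq (flatten [seq sphere w x | w <- bseq s L0]).
Proof.
apply: uniq_flatten_map => [|w _|w w' y _ _]; first exact: bseq_uniq.
  exact: (sphere_uniq bld reg).
by rewrite !(mem_sphere bld reg) => /asboolP <- /asboolP.
Qed.

Lemma step_expectation (F : W -> R) x : (forall u, 0 <= F u) ->
  (\esum_(y in [set: Delta]) (p x y * F (delta o y))%:E = (walk_op s q words_of F (delta o x))%:E)%E.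
Proof.
move=> F0; rewrite (esum_seq (ball_uniq x)); last 2 first.
- by move=> y; rewrite lee_fin mulr_ge0.
- move=> y hy; rewrite weight_atE weight_far ?mul0r // ltnNge; apply/negP => le.
  move/negP: hy; apply; apply/flatten_mapP; exists (delta x y); first by rewrite mem_bseq.
  by rewrite (mem_sphere bld reg); apply/asboolP.
rewrite sumEFin big_flatten /= big_map /walk_op /words_of big_map; congr _%:E; apply: eq_bigr => w _ /=.
rewrite big_seq (eq_bigr (fun y => weight_at w * F (delta o y))) => [|y]; last first.
  by rewrite (mem_sphere bld reg) => /asboolP <-; rewrite weight_atE.
by rewrite -big_seq -big_distrr /= (sum_galleries (G := G) bld reg thk) mulrA.
Qed.

Lemma p_nn_range : (0 < L0)%N.
Proof.
pose i := Ordinal N0; have [y hy] := chamber_at (G := G) bld reg thk o (s i).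
by have := p_range (p_nn hy); rewrite hy (len_gen (G := G)).
Qed.

Lemma building_walk_data : walk_data s q (sphere_size (G := G) q) words_of L0.
Proof.
have m0 w : 0 < sphere_size (G := G) q w :> R by rewrite ltr0n (qprod_gt0 thk).
split.
- exact: thk.
- exact: m0.
- by move=> w i a; rewrite (sphere_size_gen (G := G) bld reg o a).
- by move=> c /mapP[w _ ->] /=; apply: mulr_ge0; [exact: p_ge0|exact: ltW].
- have := @step_expectation (fun=> 1) o (fun=> ler01).
  have -> : (\esum_(y in [set: Delta]) (p o y * 1)%:E = 1)%E.
    by have [_ h] := p_stoch; rewrite -(h o); apply: eq_esum => y _; rewrite mulr1.
  by move=> /(congr1 fine) /= h; rewrite [RHS]h; apply: eq_bigr => c _; rewrite word_op_cst mulr1.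
- by move=> c /mapP[w]; rewrite mem_bseq => h -> /=; rewrite size_rword.
- have gen i : exists2 b', 0 < b' & (b', [:: i]) \in words_of.
    exists (weight_at (s i) * sphere_size (G := G) q (s i)).
      by rewrite mulr_gt0 //; apply: (p_nn (i := i)); exact: repP.
    apply/mapP; exists (s i); first by rewrite mem_bseq (len_gen (G := G)) p_nn_range.
    (* The reduced word of [s i] has one letter, which is [i] because the generators are
       distinct. *)
    congr (_, _); have := size_rword (G := G) (s i); rewrite (len_gen (G := G)).
    have := rwordK (G := G) (s i); case: (rword _) => [|j [|j' l]] //=.
    by rewrite mulg1 => /s_inj ->.
  pose b i := sval (cid2 (gen i)).
  have b0 i : 0 < b i by rewrite /b; case: cid2.
  exists (\big[Num.min/b (Ordinal N0)]_(i < N) b i) => [|i].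
    by elim/big_ind: _ => // x y x0 y0; rewrite lt_min x0.
  exists (b i); first exact: bigmin_le_cond.
  by rewrite /b; case: cid2.
Qed.

Let D := building_walk_data.
Local Notation pstep := (pstep s q words_of).

Lemma pbarE u v : pbar delta o p u v = (pstep u v)%:E.
Proof.
rewrite /pbar -/(rep u) esum_mkcond -[in RHS](repP u) -step_expectation; last by move=> w; rewrite ler0n.
apply: eq_esum => y _; rewrite /dirac1; case: ifPn => h.
  by move: h; rewrite inE /= => ->; rewrite eqxx mulr1.
by rewrite notin_setE /= in h; move/eqP/negPf: h => ->; rewrite mulr0.
Qed.

Lemma nstep_pbar n u v : nstep (pbar delta o p) n u v = (pn s q words_of n v u)%:E.
Proof.
have p0 k w x : 0 <= pn s q words_of k w x by apply: (pn_ge0 (D := D)).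
elim: n u => [|n IH] u /=; first by rewrite /pn /= /dirac1; case: eqP.
rewrite (eq_esum (b := fun z => (pstep u z * pn s q words_of n v z)%:E)); last first.
  by move=> z _; rewrite pbarE IH -EFinM.
rewrite (esum_seq (bseq_at_uniq s u L0)); last 2 first.
- by move=> z; rewrite lee_fin mulr_ge0 // (pstep_ge0 (D := D)).
- move=> z; rewrite (mem_bseq_at (G := G)) -ltnNge => h.
  by rewrite (pstep_far (D := D)) // mul0r.
by rewrite sumEFin -(walk_opE (D := D)).
Qed.

Section Chain.
Context {d : measure_display} {Om : measurableType d} (P : probability Om R) (X : nat -> Om -> Delta).
Hypothesis X_chain : is_markov_chain P X p o.
Local Notation Pr := (Pr P).
Local Notation Xb := (Xbar delta o X).

Let mX n : dmeas (X n). Proof. by move=> x; have [h _] := X_chain; apply: h. Qed.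
Let mXb n : dmeas (Xb n).
Proof. exact: (dmeas_comp (fun y => delta o y) cD (mX n)). Qed.

Lemma chain_start : Pr [set om | X 0%N om = o] = 1.
Proof.
have [_ h] := X_chain; have := h 0%N (fun=> o); rewrite eqxx big_ord0 => h1.
rewrite -fine_Pr (_ : [set om | X 0%N om = o] = [set om | forall i, (i <= 0)%N -> X i om = o]) ?h1 //.
by apply/seteqP; split=> om /= e; [case|apply: e].
Qed.

Let Bx n (x : nat -> W) := [set om | forall i, (i <= n)%N -> Xb i om = x i].

Let past_Bx n x : past X n (Bx n x).
Proof. by move=> om om' h b i i_n; rewrite /Xbar -h //; apply: b. Qed.

Let mBx n x : measurable (Bx n x).
Proof. exact: (measurable_past cD mX (@past_Bx n x)). Qed.

(** Lumping: the law of the next distance depends on the current chamber only through its distance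
    from [o], so summing over chambers preserves the Markov property. *)
Lemma retracted_step n x : Pr (Bx n.+1 x) = Pr (Bx n x) * pstep (x n) (x n.+1).
Proof.
have [_ hl] := X_chain.
apply: (Pr_total_eq cD (f := X n) (f' := X n)) => // [|y]; first exact: (pstep_ge0 (D := D)).
have [e|ne] := eqVneq (delta o y) (x n); last first.
  rewrite [X in Pr X = _](_ : _ = set0); last first.
    apply/seteqP; split=> om //= [h e]; move/eqP: ne; apply; rewrite -e; exact: h.
  rewrite [X in _ = Pr X * _](_ : _ = set0); last first.
    apply/seteqP; split=> om //= [h e]; move/eqP: ne; apply; rewrite -e; exact: h.
  by rewrite Pr_set0 mul0r.
apply: EFin_inj; rewrite -PrE; last by apply: measurableI => //; exact: mX.
rewrite (total_probability P cD (mX n.+1)); last by apply: measurableI => //; exact: mX.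
rewrite EFinM -e !pstepE -step_expectation; last by move=> w; rewrite ler0n.
rewrite -esumZl ?Pr_ge0 //; last by move=> z; rewrite lee_fin mulr_ge0.
apply: eq_esum => z _; rewrite -EFinM mulrA -(markov_step cD mX p_ge0 hl); last exact: past_Bx.
rewrite PrE; last by do 2 (apply: measurableI; last exact: mX).
congr _%:E; rewrite /dirac1; case: eqP => [ez|nz].
  rewrite mulr1; congr Pr; apply/seteqP; split=> om /=.
    by move=> [[h h1] h2]; split=> //; split=> // i i_n; apply: h; apply: leqW.
  move=> [[h h1] h2]; split=> //; split=> // i; rewrite leq_eqVlt => /orP[/eqP ->|]; last exact: h.
  by rewrite /Xbar h2.
rewrite mulr0 (_ : _ `&` _ = set0) ?Pr_set0 //.
apply/seteqP; split=> om //= [[h h1] h2]; apply: nz; rewrite -h2; exact: h.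
Qed.

Lemma building_walk_chain : walk_chain s q words_of P Xb.
Proof.
split=> [n|n x]; first exact: mXb.
elim: n => [|n IH]; last first.
  rewrite -/(Bx n.+1 x) retracted_step /Bx IH; case: ifP => _; last by rewrite mul0r.
  by rewrite big_ord_recr.
rewrite big_ord0.
have as0 : Pr (~` [set om | X 0%N om = o]) = 0.
  by rewrite Pr_setC ?chain_start ?subrr //; exact: mX.
case: ifP => [/eqP e|/eqP ne].
  rewrite -chain_start; apply: (@eq_Pr_as _ _ _ _ _ _ [set om | X 0%N om = o]) => //.
  - exact: mBx.
  - exact: mX.
  - exact: mX.
  - move=> om /= h; split=> // _ [|i] // _; rewrite /Xbar h e; exact: (deltaxx bld).
apply: (@Pr0_sub _ _ _ _ _ (~` [set om | X 0%N om = o])) => //.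
- exact: mBx.
- by apply: measurableC; exact: mX.
- move=> om /= h e; apply: ne; rewrite -(h 0%N) // /Xbar e; exact: (deltaxx bld).
Qed.

End Chain.

End RetractedWalk.

(** The universal property of [W] speaks of group types, so invertible matrices are packaged as one
    to receive the reflection representation. *)
Record gl (R : realType) (n : nat) := Gl { glval :> 'M[R]_n; glP : glval \in unitmx }.
HB.instance Definition _ R n := [isSub for @glval R n].
HB.instance Definition _ R n := [Choice of gl R n by <:].

(** * Infinity of Fuchsian Coxeter groups *)

Section GeneralLinear.
Context {R : realType} {n : nat}.

Lemma gl_mulP (a b : gl R n) : glval a *m glval b \in unitmx.
Proof. by rewrite unitmx_mul !glP. Qed.
Definition gl_mul a b : gl R n := Gl (gl_mulP a b).
Definition gl_one : gl R n := Gl (unitmx1 R n).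
Lemma gl_invP (a : gl R n) : invmx (glval a) \in unitmx. Proof. by rewrite unitmx_inv glP. Qed.
Definition gl_inv a : gl R n := Gl (gl_invP a).

Lemma gl_mulA : associative gl_mul.
Proof. by move=> a b c; apply: val_inj; rewrite /= mulmxA. Qed.
Lemma gl_mul1 : left_id gl_one gl_mul.
Proof. by move=> a; apply: val_inj; rewrite /= mul1mx. Qed.
Lemma gl_mulr1 : right_id gl_one gl_mul.
Proof. by move=> a; apply: val_inj; rewrite /= mulmx1. Qed.
Lemma gl_mulV : left_inverse gl_one gl_inv gl_mul.
Proof. by move=> a; apply: val_inj; rewrite /= mulVmx // glP. Qed.
Lemma gl_mulrV : right_inverse gl_one gl_inv gl_mul.
Proof. by move=> a; apply: val_inj; rewrite /= mulmxV // glP. Qed.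
End GeneralLinear.

HB.instance Definition _ (R : realType) (n : nat) :=
  isGroup.Build (gl R n) gl_mulA gl_mul1 gl_mulr1 gl_mulV gl_mulrV.

(** * The reflection representation *)

Section Reflections.
Context {R : realType} {N : nat}.
Variable (k : 'I_N -> nat).
Hypothesis N3 : (3 <= N)%N.
Hypothesis k2 : forall i, (2 <= k i)%N.

Lemma ordS_neq (i : 'I_N) : ordS i != i.
Proof.
rewrite -(inj_eq val_inj) /= /ordS /=; have := ltn_ord i; rewrite leq_eqVlt => /orP[/eqP e|lt].
  by rewrite e modnn; apply/eqP => i0; have := N3; rewrite -e -i0.
by rewrite modn_small // eqn_leq ltnn.
Qed.

Lemma ordS2_neq (i : 'I_N) : ordS (ordS i) != i.
Proof.
rewrite -(inj_eq val_inj) /= -addn1 modnDml -addn1 -addnA.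
have := ltn_ord i; have [lt|ge] := ltnP (i + 2) N.
  by rewrite modn_small // -[X in _ != X]addn0 eqn_add2l.
move=> iN; have -> : ((i + 2) %% N = i + 2 - N)%N.
  rewrite -{1}(subnK ge) modnDr modn_small //; lia.
apply/eqP; lia.
Qed.

(** The canonical bilinear form of the Coxeter system: [- cos (pi / k)] for consecutive generators,
    and [- 1], the value for infinite order, for pairs without a relation. *)
Definition form (i j : 'I_N) : R :=
  if i == j then 1 else if j == ordS i then - cos (pi / (k i)%:R)
  else if i == ordS j then - cos (pi / (k j)%:R) else - 1.

Lemma form_sym i j : form i j = form j i.
Proof.
rewrite /form eq_sym; case: eqVneq => // ne; case: (eqVneq j (ordS i)) => [ej|nj].
  by case: eqVneq => // ei; have := ordS2_neq i; rewrite -ej -ei eqxx.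
by case: ifP.
Qed.

Lemma formxx i : form i i = 1. Proof. by rewrite /form eqxx. Qed.

Lemma formS i : form i (ordS i) = - cos (pi / (k i)%:R).
Proof. by rewrite /form eqxx eq_sym (negPf (ordS_neq i)). Qed.

Definition gram : 'M[R]_N := \matrix_(i, j) form i j.
Definition refl_mx (i : 'I_N) : 'M[R]_N := 1%:M - 2 *: (col i gram *m delta_mx 0 i).

Definition pair_with (v : 'rV[R]_N) i : R := (v *m gram) 0 i.

Lemma reflE v i : v *m refl_mx i = v - (2 * pair_with v i) *: delta_mx 0 i.
Proof.
rewrite /refl_mx mulmxBr mulmx1 -scalemxAr mulmxA -[in RHS]scalerA; congr (_ - _ *: _).
apply/rowP => j; rewrite !mxE /= big_ord1 /pair_with !mxE; congr (_ * _).
by apply: eq_bigr => l _; rewrite !mxE.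
Qed.

Lemma pair_withD u v i : pair_with (u + v) i = pair_with u i + pair_with v i.
Proof. by rewrite /pair_with mulmxDl mxE. Qed.
Lemma pair_withZ a v i : pair_with (a *: v) i = a * pair_with v i.
Proof. by rewrite /pair_with -scalemxAl mxE. Qed.
Lemma pair_withN v i : pair_with (- v) i = - pair_with v i.
Proof. by rewrite -scaleN1r pair_withZ mulN1r. Qed.
Lemma pair_delta i j : pair_with (delta_mx 0 i) j = form i j.
Proof. by rewrite /pair_with -rowE !mxE. Qed.

Lemma refl_mxK i : refl_mx i *m refl_mx i = 1%:M.
Proof.
apply/row_matrixP => j; rewrite row_mul [in RHS]rowE mulmx1.
have -> : row j (refl_mx i) = delta_mx 0 j - (2 * form j i) *: delta_mx 0 i.
  by rewrite rowE reflE pair_delta.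
rewrite reflE.
rewrite -!scaleNr pair_withD pair_withZ !pair_delta formxx -addrA -scalerDl.
rewrite [X in 'e_j + X *: _](_ : _ = 0) ?scale0r ?addr0 //.
by rewrite /GRing.scale /=; ring.
Qed.

Lemma refl_unit i : refl_mx i \in unitmx.
Proof. by have [] := mulmx1_unit (refl_mxK i). Qed.
Definition refl i : gl R N := Gl (refl_unit i).

Lemma glXE (a : gl R N) n (v : 'rV[R]_N) : v *m glval (a ^+ n)%g = iter n (fun v => v *m glval a) v.
Proof.
elim: n v => [|n IH] v; first by rewrite expg0 mulmx1.
by rewrite expgS -[glval _]/(glval a *m glval (a ^+ n)%g) mulmxA IH -iterSr.
Qed.

Lemma sin_reflect (t th : R) : sin t - 2 * (sin t - cos th * sin (t + th)) = sin (t + th + th).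
Proof.
rewrite (sinD (t + th) th) (sinD t th) (cosD t th).
have := cos2Dsin2 th; move: (cos th) (sin th) (sin t) (cos t) => c' s' x y h.
apply/eqP; rewrite -subr_eq0; apply/eqP; transitivity (x * (c' ^+ 2 + s' ^+ 2 - 1)); first by ring.
by rewrite h subrr mulr0.
Qed.

Lemma solve_gram2 (p q c : R) : 1 - c ^+ 2 != 0 ->
  p - (p + c * q) / (1 - c ^+ 2) + c * ((q + c * p) / (1 - c ^+ 2)) = 0.
Proof. by move=> h; field. Qed.

(** In the plane of the two roots the product of the reflections shifts the parameter of [E t] by
    [th *+ 2], so its [k i]-th power is a full turn. Vectors orthogonal to the plane are fixed, and
    they complement it because [sin th] is not zero. *)
Lemma refl_braid i : ((refl i * refl (ordS i)) ^+ k i = 1)%g.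
Proof.
set j := ordS i; set th : R := pi / (k i)%:R; set a := (refl i * refl j)%g.
have k0 : (0 : R) < (k i)%:R by rewrite ltr0n (leq_trans _ (k2 i)).
have thk : th *+ 2 *+ k i = pi *+ 2.
  by rewrite -mulrnA mulnC mulrnA -[X in X *+ 2]mulr_natr /th divfK // gt_eqF.
have aE v : v *m glval a = v *m refl_mx i *m refl_mx j by rewrite -[glval a]/(refl_mx i *m refl_mx j) mulmxA.
have ij : form i j = - cos th by apply: formS.
have ji : form j i = - cos th by rewrite form_sym.
have s0 : 0 < sin th.
  apply: sin_gt0_pi; rewrite divr_gt0 ?pi_gt0 //= ltr_pdivrMr // ltr_pMr ?pi_gt0 // ltr1n.
  exact: k2.
pose E t : 'rV[R]_N := sin t *: delta_mx 0 i + sin (t + th) *: delta_mx 0 j.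
have rE t : E t *m glval a = E (t + th *+ 2).
  have r1 : E t *m refl_mx i = sin (t + th + th) *: delta_mx 0 i + sin (t + th) *: delta_mx 0 j.
    rewrite reflE /E pair_withD !pair_withZ !pair_delta formxx ji addrAC -scalerBl; congr (_ *: _ + _).
    by rewrite -sin_reflect; ring.
  rewrite aE r1 reflE pair_withD !pair_withZ !pair_delta formxx ij -addrA -scalerBl /E mulr2n !addrA.
  by congr (_ + _ *: _); rewrite -(sin_reflect (t + th)); ring.
have rEn n t : E t *m glval (a ^+ n)%g = E (t + th *+ 2 *+ n).
  rewrite glXE; elim: n t => [|n IH] t; first by rewrite mulr0n addr0.
  by rewrite iterSr -[X in iter n _ X]/(E t *m glval a) rE IH [th *+ 2 *+ n.+1]mulrS -addrA.
have rEk t : E t *m glval (a ^+ k i)%g = E t.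
  rewrite rEn thk /E; congr (_ *: _ + _ *: _); first exact: sinD2pi.
  by rewrite addrAC; exact: sinD2pi.
have fixed v : pair_with v i = 0 -> pair_with v j = 0 -> v *m glval (a ^+ k i)%g = v.
  move=> h1 h2; have e : v *m glval a = v.
    have e1 : v *m refl_mx i = v by rewrite reflE h1 mulr0 scale0r subr0.
    by rewrite aE e1 reflE h2 mulr0 scale0r subr0.
  by rewrite glXE; elim: (k i) => //= n ->.
have ei : sin th *: delta_mx 0 i = E th - (cos th *+ 2) *: E 0.
  rewrite /E sin0 scale0r !add0r scalerA -addrA -scalerBl sinD.
  by rewrite (_ : _ - _ = 0) ?scale0r ?addr0 //; ring.
have fi : (delta_mx 0 i : 'rV[R]_N) *m glval (a ^+ k i)%g = delta_mx 0 i.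
  apply: (scalerI (lt0r_neq0 s0)); rewrite scalemxAl ei mulmxBl -scalemxAl !rEk //.
have fj : (delta_mx 0 j : 'rV[R]_N) *m glval (a ^+ k i)%g = delta_mx 0 j.
  apply: (scalerI (lt0r_neq0 s0)); rewrite scalemxAl.
  have -> : sin th *: delta_mx 0 j = E 0 by rewrite /E sin0 scale0r !add0r.
  exact: rEk.
apply: val_inj => /=; apply/row_matrixP => l; rewrite rowE [in RHS]rowE mulmx1.
move: (delta_mx 0 l : 'rV[R]_N) => v.
have s2 : 1 - cos th ^+ 2 != 0 by rewrite -sin2cos2 expf_neq0 // gt_eqF.
(* [x] and [y] are the coordinates of the orthogonal projection of [v] onto the plane. *)
pose x := (pair_with v i + cos th * pair_with v j) / (1 - cos th ^+ 2).
pose y := (pair_with v j + cos th * pair_with v i) / (1 - cos th ^+ 2).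
have vE : v = (v - x *: delta_mx 0 i - y *: delta_mx 0 j) + (x *: delta_mx 0 i + y *: delta_mx 0 j).
  by rewrite -[v - _ - _]addrA -opprD subrK.
rewrite vE mulmxDl fixed.
- by rewrite mulmxDl -!scalemxAl fi fj.
- rewrite !pair_withD !pair_withN !pair_withZ !pair_delta formxx ji -[RHS](solve_gram2 (pair_with v i) (pair_with v j) s2).
  by rewrite /x /y; ring.
- rewrite !pair_withD !pair_withN !pair_withZ !pair_delta formxx ij -[RHS](solve_gram2 (pair_with v j) (pair_with v i) s2).
  by rewrite /x /y; ring.
Qed.

End Reflections.

Lemma multiplicative1 (G H : groupType) (phi : {multiplicative G -> H}) : phi 1%g = 1%g.
Proof. by apply: (mulgI (phi 1%g)); rewrite mulg1 -gmulfM mulg1. Qed.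

Lemma sum_pick (R : realType) (I : finType) (a : I) (F : I -> R) : \sum_j (j == a)%:R * F j = F a.
Proof. by rewrite (bigD1 a) //= eqxx mul1r big1 ?addr0 // => j /negPf ->; rewrite mul0r. Qed.

(* The angles of a hyperbolic triangle make the Gram determinant nonpositive. *)
Lemma triangle_det (R : realType) (al be ga : R) : 0 < al -> 0 < be -> 0 < ga -> al + be + ga <= pi ->
  1 <= cos al ^+ 2 + cos be ^+ 2 + cos ga ^+ 2 + 2 * (cos al * cos be * cos ga).
Proof.
move=> a0 b0 g0 le.
have h : cos (pi - (al + be)) <= cos ga.
  have [->|ne] := eqVneq ga (pi - (al + be)); first by [].
  apply: ltW; rewrite ltr_cos ?in_itv /=; last 2 first.
  - by apply/andP; split; lra.
  - by apply/andP; split; lra.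
  by rewrite lt_def eq_sym ne /=; lra.
have e : cos (pi - (al + be)) = sin al * sin be - cos al * cos be.
  by rewrite cosB cospi sinpi mul0r addr0 cosD; ring.
have sa : 0 <= sin al by apply: sin_ge0_pi; apply/andP; split; lra.
have sb : 0 <= sin be by apply: sin_ge0_pi; apply/andP; split; lra.
rewrite e in h; have {}h : sin al * sin be <= cos ga + cos al * cos be by lra.
have sab : 0 <= sin al * sin be by apply: mulr_ge0.
have h2 : (sin al * sin be) ^+ 2 <= (cos ga + cos al * cos be) ^+ 2.
  by rewrite ler_sqr ?nnegrE // (le_trans sab).
rewrite exprMn !sin2cos2 in h2; move: h2; move: (cos al) (cos be) (cos ga) => x z y h2.
have e2 : (1 - x ^+ 2) * (1 - z ^+ 2) = 1 - x ^+ 2 - z ^+ 2 + (x * z) ^+ 2 by ring.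
have e3 : (y + x * z) ^+ 2 = y ^+ 2 + 2 * (x * z * y) + (x * z) ^+ 2 by ring.
by rewrite e2 e3 in h2; lra.
Qed.

(** For [N = 3] the vector is a row of the adjugate of the Gram matrix, on which the form is a
    positive minor times the determinant, nonpositive by the angle condition. For larger [N] the
    generators [0] and [2] satisfy no relation, and the sum of their basis vectors is isotropic. *)
Lemma form_nonpos (R : realType) (N : nat) (k : 'I_N -> nat) : (3 <= N)%N -> (forall i, (2 <= k i)%N) ->
  \sum_(i < N) ((k i)%:R)^-1 < N%:R - 2 :> rat ->
  exists2 u : 'I_N -> R, (exists i, u i != 0) & \sum_i \sum_j u i * u j * form k i j <= 0.
Proof.
move=> N3 k2; rewrite leq_eqVlt in N3; case/orP: N3 => [/eqP e|N4].
  subst N => hyp; have N3 : (3 <= 3)%N by [].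
  have hR : \sum_(i < 3) ((k i)%:R)^-1 < 1 :> R.
    have := hyp; rewrite -(ltr_rat R) rmorph_sum /= rmorphB /= !ratr_nat.
    rewrite (eq_bigr (fun i => ((k i)%:R)^-1 : R)) => [|i _]; last by rewrite fmorphV /= ratr_nat.
    by move=> h; lra.
  pose i0 : 'I_3 := ord0; pose i1 := ordS i0; pose i2 := ordS i1.
  have i20 : ordS i2 = i0 by apply: val_inj.
  have S3 (F : 'I_3 -> R) : \sum_i F i = F i0 + F i1 + F i2.
    rewrite !big_ord_recl big_ord0 addr0 addrA.
    by congr (_ + F _ + F _); apply: val_inj.
  pose th i : R := pi / (k i)%:R.
  have k0 i : (0 : R) < (k i)%:R by rewrite ltr0n (leq_trans _ (k2 i)).
  have th0 i : 0 < th i by rewrite divr_gt0 // pi_gt0.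
  have thpi : th i0 + th i1 + th i2 <= pi.
    rewrite S3 in hR; rewrite /th -!mulrDr -[leRHS]mulr1 ler_wpM2l ?pi_ge0 //; exact: ltW.
  have := triangle_det (th0 i0) (th0 i1) (th0 i2) thpi.
  have f01 : form k i0 i1 = - cos (th i0) by apply: formS.
  have f12 : form k i1 i2 = - cos (th i1) by apply: formS.
  have f20 : form k i2 i0 = - cos (th i2) by rewrite -i20; apply: formS.
  have f10 : form k i1 i0 = - cos (th i0) by rewrite form_sym.
  have f21 : form k i2 i1 = - cos (th i1) by rewrite form_sym.
  have f02 : form k i0 i2 = - cos (th i2) by rewrite form_sym.
  have s0 : 0 < sin (th i0) by apply: sin_gt0_pi; rewrite th0 /=; have := th0 i1; have := th0 i2; lra.
  have n0 : 0 < 1 - cos (th i0) ^+ 2 by rewrite -sin2cos2 exprn_gt0.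
  set x := cos (th i0) in f01 f10 n0 *; set z := cos (th i1) in f12 f21 *.
  set y := cos (th i2) in f20 f02 *; move=> det.
  pose u (i : 'I_3) : R := if i == i0 then y + x * z else if i == i1 then z + x * y else 1 - x ^+ 2.
  exists u; first by exists i2; rewrite /u /= gt_eqF.
  rewrite !S3 f01 f12 f20 f10 f21 f02 !formxx /u /=.
  have -> : forall a b c : R, a * a * 1 + a * b * - x + a * c * - y +
     (b * a * - x + b * b * 1 + b * c * - z) + (c * a * - y + c * b * - z + c * c * 1) =
     a * (a - x * b - y * c) + b * (b - x * a - z * c) + c * (c - y * a - z * b) by move=> *; ring.
  rewrite [leLHS](_ : _ = (1 - x ^+ 2) * (1 - (x ^+ 2 + z ^+ 2 + y ^+ 2 + 2 * (x * z * y)))); last by ring.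
  by rewrite mulr_ge0_le0 // ?subr_le0 // ltW.
move=> _; have N4' := N4; pose i0 : 'I_N := Ordinal (leq_trans (isT : (0 < 3)%N) (ltnW N4)).
pose i2 : 'I_N := Ordinal (ltnW N4).
have f02 : form k i0 i2 = - 1 :> R.
  rewrite /form; have -> : (i0 == i2) = false by [].
  have -> : (i2 == ordS i0) = false.
    by apply/eqP => /(congr1 val) /=; rewrite modn_small //; apply: leq_trans N4'.
  have -> : (i0 == ordS i2) = false by apply/eqP => /(congr1 val) /=; rewrite modn_small.
  by [].
pose u (i : 'I_N) : R := (i == i0)%:R + (i == i2)%:R.
exists u; first by exists i0; rewrite /u eqxx addr0 oner_neq0.
have inner i : \sum_j u i * u j * form k i j = u i * (form k i i0 + form k i i2).
  under eq_bigr do rewrite -mulrA; rewrite -big_distrr /=; congr (_ * _).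
  under eq_bigr do rewrite mulrDl; rewrite big_split /= !sum_pick //.
rewrite (eq_bigr _ (fun i _ => inner i)).
under eq_bigr do rewrite mulrDl; rewrite big_split /= !sum_pick !formxx f02 form_sym ?f02; last exact: ltnW.
by lra.
Qed.

Section FuchsianCoxeter.
Context {R : realType} {N : nat} {W : groupType} (s : 'I_N -> W) (k : 'I_N -> nat).
Hypothesis cox : fuchsian_coxeter_system s k.
Local Notation len := (len s).

Let N3 : (3 <= N)%N. Proof. by have [] := cox. Qed.
Let k2 i : (2 <= k i)%N. Proof. by have [] := cox. Qed.

(** All relators have even length, so sending every generator to the transposition of two points
    defines a homomorphism; it detects the parity of the length, which multiplication by a generator
    changes. *)
Lemma fuchsian_involutive : involutive_generators s.
Proof.
have [_ _ _ [s2 _] [gen univ]] := cox; split=> [i|w|w i e]; [exact: s2|exact: gen|].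
pose t : {perm bool} := tperm true false.
have tt1 : (t * t = 1)%g by rewrite tperm2.
have [phi hphi] : exists phi : {multiplicative W -> {perm bool}}, forall i, phi (s i) = t.
  by apply: univ; split=> j; rewrite tt1 // expg1n.
have phiE l : phi (wprod s l) = (t ^+ size l)%g.
  elim: l => [|j l IH] /=; first by rewrite multiplicative1 expg0.
  by rewrite gmulfM hphi IH expgS.
have lenE u : exists2 l, size l = len u & wprod s l = u.
  rewrite /Defs.len; case: xgetP => [n _ [] //|].
  have ex : exists n, `[< exists2 l, size l = n & wprod s l = u >].
    by have [l lu] := gen u; exists (size l); apply/asboolP; exists l.
  case: (ex_minnP ex) => n /asboolP nw nmin /(_ n) []; split=> // l' l'w.
  by apply: nmin; apply/asboolP; exists l'.
have [l sl lw] := lenE w; have [l' sl' lw'] := lenE (w * s i)%g.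
have := phiE l'; rewrite lw' gmulfM hphi -lw phiE sl' e -sl.
move=> /(congr1 (fun p => (t ^+ size l)^-1 * p)%g); rewrite mulKg mulVg => /permP /(_ true).
by rewrite perm1 tpermL.
Qed.

Lemma reflection_representation : exists phi : {multiplicative W -> gl R N},
  forall i, glval (phi (s i)) = refl_mx (R := R) k i.
Proof.
have [_ _ _ _ [_ univ]] := cox.
have [phi h] : exists phi : {multiplicative W -> gl R N}, forall i, phi (s i) = refl k i.
  apply: univ; split=> i; last exact: refl_braid.
  by apply: val_inj; exact: refl_mxK.
by exists phi => i; rewrite h.
Qed.

(** The reflection [i] negates the [i]-th coordinate of the basis vector [i], while any other
    reflection keeps it. *)
Lemma fuchsian_gen_inj : injective s.
Proof.
move=> i j e; have [phi h] := reflection_representation.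
have := h i; rewrite e h => /(congr1 (fun M => (delta_mx 0 i *m M : 'rV[R]_N) 0 i)).
rewrite !reflE !pair_delta formxx !mxE !eqxx /=; case: eqVneq => //= ne.
rewrite mulr0 subr0 !mulr1 -[X in X = _]addr0 => /addrI /eqP.
by rewrite eq_sym oppr_eq0 pnatr_eq0.
Qed.

Let G := fuchsian_involutive.

(* If [W] is finite, the averaged Gram matrix [Sm] of its reflection
   representation is positive definite and agrees with the Coxeter form up to
   scaling, which is impossible when that form is not positive definite. *)
Section Finite.
Variable n : nat.
Hypothesis fin : forall w, (len w <= n)%N.

(** The averaged form is invariant under the reflection [i]; comparing the entries at [(i, j)] on
    both sides of this invariance gives the last property. *)
Lemma invariant_gram : exists Sm : 'M[R]_N,
  [/\ forall i j, Sm i j = Sm j i,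
      forall v : 'rV[R]_N, v != 0 -> 0 < (v *m Sm *m v^T) 0 0 &
      forall i j, Sm i j = form k i j * Sm i i].
Proof.
have [phi h] := reflection_representation.
pose M w := glval (phi w).
have MM u v : M (u * v)%g = M u *m M v by rewrite /M gmulfM.
pose Sm := \sum_(w <- bseq s n) M w *m (M w)^T.
have sym : Sm^T = Sm.
  by rewrite /Sm linear_sum /=; apply: eq_bigr => w _; rewrite trmx_mul trmxK.
have inv i : refl_mx k i *m Sm *m (refl_mx k i)^T = Sm.
  have pe : perm_eq (bseq s n) (map (fun w => (s i * w)%g) (bseq s n)).
    apply: uniq_perm; rewrite ?bseq_uniq // ?map_inj_uniq ?bseq_uniq //; first by move=> u v /mulgI.
    move=> w; rewrite (mem_bseq (G := G)) fin; apply/esym/mapP; exists (s i * w)%g.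
      by rewrite (mem_bseq (G := G)) fin.
    by rewrite mulgA (gen_inv (involutive_generators := G)) mul1g.
  rewrite [in RHS]/Sm (perm_big _ pe) big_map /Sm mulmx_sumr mulmx_suml; apply: eq_bigr => w _.
  have Ms : M (s i) = refl_mx k i := h i.
  by rewrite !MM !Ms trmx_mul !mulmxA.
exists Sm; split.
- by move=> i j; rewrite -[in LHS]sym mxE.
- move=> v v0; rewrite /Sm mulmx_sumr mulmx_suml summxE.
  have sq w : (v *m (M w *m (M w)^T) *m v^T) 0 0 = \sum_j (v *m M w) 0 j ^+ 2.
    rewrite !mulmxA -(mulmxA (v *m M w)) -trmx_mul mxE; apply: eq_bigr => j _.
    by rewrite [in X in _ * X]mxE expr2.
  rewrite (bigD1_seq 1%g) ?bseq_uniq //=; last by rewrite (mem_bseq (G := G)) (len1 (G := G)).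
  rewrite ltr_wpDr //; first by apply: sumr_ge0 => w _; rewrite sq; apply: sumr_ge0 => j _; exact: sqr_ge0.
  have -> : M 1%g = 1%:M by rewrite /M multiplicative1.
  rewrite trmx1 !mulmx1.
  have -> : (v *m v^T) 0 0 = \sum_j v 0 j ^+ 2 by rewrite mxE; apply: eq_bigr => j _; rewrite mxE expr2.
  have [j hj] : exists j, v 0 j != 0.
    apply: contrapT => no; move/eqP: v0; apply; apply/rowP => j; rewrite mxE; apply/eqP.
    by apply: contrapT => /negP hj; apply: no; exists j.
  rewrite (bigD1 j) //= ltr_wpDr ?sumr_ge0 // => [l _|]; first exact: sqr_ge0.
  by rewrite lt_def sqrf_eq0 hj sqr_ge0.
- move=> i j; have e1 : refl_mx k i *m Sm = Sm *m (refl_mx k i)^T.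
    by rewrite -{2}(inv i) -!mulmxA -trmx_mul refl_mxK trmx1 mulmx1.
  have := congr1 (fun A : 'M[R]_N => (delta_mx 0 i *m A : 'rV[R]_N) 0 j) e1.
  rewrite /= mulmxA reflE pair_delta formxx mulr1 -rowE.
  have -> : (delta_mx 0 i - 2 *: delta_mx 0 i : 'rV[R]_N) = - delta_mx 0 i.
    by rewrite scaler_nat mulr2n opprD addrA subrr sub0r.
  rewrite mulNmx -rowE mxE [row i Sm 0 j]mxE.
  rewrite [row i (_ *m _) 0 j]mxE.
  have -> : (Sm *m (refl_mx k i)^T) i j = Sm i j - 2 * (form k j i * Sm i i).
    rewrite -[Sm in LHS]sym -trmx_mul mxE -[(refl_mx k i *m Sm) j i]/((refl_mx k i *m Sm) j i).
    have <- : (delta_mx 0 j *m (refl_mx k i *m Sm) : 'rV[R]_N) 0 i = (refl_mx k i *m Sm) j i.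
      by rewrite -rowE mxE.
    rewrite mulmxA reflE pair_delta mulmxBl -scalemxAl -!rowE !mxE -[Sm j i in LHS]/(Sm j i) mulrA.
    by congr (_ - _); rewrite -[in LHS]sym mxE.
  by rewrite [form k j i]form_sym // => h'; lra.
Qed.

(** Where the Coxeter form does not vanish the two diagonal entries of [Sm] agree, so [Sm] is the
    Coxeter form rescaled by the square roots [dd] of its diagonal, and positivity carries over. *)
Lemma finite_form_pos (u : 'I_N -> R) : (exists i, u i != 0) ->
  0 < \sum_i \sum_j u i * u j * form k i j.
Proof.
move=> [l ul]; have [Sm [sym pos SE]] := invariant_gram.
have dpos i : 0 < Sm i i.
  have d0 : (delta_mx 0 i : 'rV[R]_N) != 0.
    apply/eqP => /rowP /(_ i) /eqP; rewrite !mxE !eqxx; exact/negP/oner_neq0.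
  have := pos _ d0; rewrite -rowE trmx_delta -colE !mxE //.
pose dd i := Num.sqrt (Sm i i).
have dd0 i : 0 < dd i by rewrite sqrtr_gt0.
have ddE i j : Sm i j = form k i j * (dd i * dd j).
  have [f0|f0] := eqVneq (form k i j) (0 : R); first by rewrite SE f0 !mul0r.
  have e : Sm i i = Sm j j.
    by apply: (mulfI f0); rewrite -SE sym SE form_sym.
  by rewrite SE /dd -e -expr2 sqr_sqrtr // ltW.
pose v : 'rV[R]_N := \row_i (u i / dd i).
have v0 : v != 0.
  apply/eqP => /rowP /(_ l) /eqP; rewrite !mxE mulf_eq0 (negPf ul) invr_eq0 gt_eqF //.
have := pos v v0; rewrite -mulmxA mxE; congr (_ < _); apply: eq_bigr => i _.
rewrite !mxE big_distrr /=; apply: eq_bigr => j _; rewrite !mxE ddE.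
by field; rewrite !gt_eqF.
Qed.

End Finite.

Theorem fuchsian_infinite n : exists w, (n < len w)%N.
Proof.
apply: contrapT => no; have fin w : (len w <= n)%N.
  by rewrite leqNgt; apply/negP => h; apply: no; exists w.
have [_ _ hyp _ _] := cox.
have [u u0 le] := form_nonpos R N3 k2 hyp.
by have := finite_form_pos fin u0; rewrite ltNge le.
Qed.

End FuchsianCoxeter.

Theorem theorem3p16
    (R : realType)
    (* the irreducible Fuchsian Coxeter system *)
    (N : nat) (W : groupType) (s : 'I_N -> W) (k : 'I_N -> nat)
    (cox : fuchsian_coxeter_system s k) (cox_irr : coxeter_irreducible s)
    (* the thick regular building *)
    (Delta : choiceType) (delta : Delta -> Delta -> W) (q : 'I_N -> nat)
    (bld : is_building s delta) (reg : is_regular s delta q) (thk : thick q)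
    (o : Delta)
    (* the isotropic random walk *)
    (p : Delta -> Delta -> R) (p_stoch : is_stochastic p)
    (p_isotropic : isotropic delta p) (p_irr : is_irreducible p)
    (L0 : nat) (p_range : is_range s delta p L0)
    (p_nn : forall x y i, delta x y = s i -> 0 < p x y)
    (d : measure_display) (Om : measurableType d) (P : probability Om R)
    (X : nat -> Om -> Delta) (X_chain : is_markov_chain P X p o)
    (* the automatic structure *)
    (V : finType) (star : V) (edge : V -> 'I_N -> V -> bool)
    (aut : strongly_automatic s star edge)
    (aut_rec : recurrent_connected edge)
    (K : nat) (aut_K : recurrent_outside s star edge K)
    (* the hyperbolicity constants and the coverings *)
    (dhyp : R) (dhyp_thin : thin_triangles s dhyp)
    (div : nat -> R) (div_exp : exponential_divergence s div)
    (Cov : V -> set W)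
    (Cov_covering : forall t, recurrent edge t ->
       is_covering s star edge (L1_const (div 0%N) L0 dhyp) t (Cov t))
    (* the stationary measure and the entropy of the covering process *)
    (nu : V * W * W -> R)
    (nu_stat : is_stationary_probability s star edge
       (L1_const (div 0%N) L0 dhyp) K Cov P (Xbar delta o X) nu)
    (H : \bar R)
    (H_entropy : is_entropy_Y s star edge
       (L1_const (div 0%N) L0 dhyp) K Cov P (Xbar delta o X) H) :
  let hG : \bar R := (H / Enu_increment s star edge
       (L1_const (div 0%N) L0 dhyp) K Cov P (Xbar delta o X) nu)%E in
  exists hbar : R,
    [/\ (fun n : nat =>
           (- (n%:R^-1)%:E *
            'E_P[fun om => ln (pibar delta o P X n (Xbar delta o X n om))])%E)
          @ \oo --> hbar%:E,
        hbar%:E = hG &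
        {ae P, forall om,
          (fun n : nat => ellG delta o p (Xbar delta o X n om) / n%:R)
            @ \oo --> hbar}].
Proof.
have G := fuchsian_involutive cox.
have s_inj : injective s := fuchsian_gen_inj (R := R) cox.
have N0 : (0 < N)%N by have [N3 _ _ _ _] := cox; apply: leq_trans N3.
have [rng _] := p_range.
set L1 := L1_const (div 0%N) L0 dhyp in nu_stat H_entropy Cov_covering *.
have D := building_walk_data (G := G) s_inj bld reg thk o p_stoch p_isotropic rng p_nn N0.
have C := building_walk_chain (G := G) s_inj bld reg thk p_stoch p_isotropic rng p_nn N0 X_chain.
have S : covering_system s star edge dhyp L1 L0 K Cov.
  split=> //.
  - exact: (fuchsian_infinite (R := R) cox).
  - by rewrite lerD2r !le_max lexx orbT.
  - by rewrite lerD2r !le_max lexx !orbT.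
have [h [h1 h2 h3]] := entropy_identity (D := D) (C := C) (A := aut) (S := S) nu_stat H_entropy.
exists h; split=> //; apply/asureP; apply: asure_mono h3 => om /= h3.
have gE w : fine (green (pbar delta o p) 1%g w) = grn s q (words_of (G := G) delta q o p L0) w.
  rewrite (green_grn (D := D) (S := S)) // => n u v.
  exact: (nstep_pbar (G := G) s_inj bld reg thk o p_stoch p_isotropic rng p_nn N0).
(* The normalisation by [G(e, e)] adds a constant to [ellG], which disappears after division by
   [n]. *)
have ln0 : ln (grn s q (words_of (G := G) delta q o p L0) 1%g) / n%:R @[n --> \oo] --> (0 : R).
  by rewrite -[in X in _ --> X](mulr0 (ln (grn s q (words_of (G := G) delta q o p L0) 1%g))); apply: cvgMr; exact: cvgn_inv.
rewrite -[h]addr0; apply: cvg_trans (cvgD h3 ln0); apply: near_eq_cvg; apply: nearW => n.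
rewrite /ellG !gE ln_div ?posrE ?(grn_pos (D := D) (S := S)) //.
by rewrite opprB addrC mulrDl.
Qed.
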